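(* Let $W:\mathbb{R}^2\to\mathbb{R}_+$ be continuous and $a\in\mathbb{R}$ such that $W$ vanishes at two points $u^\pm=(a,u_2^\pm)$. Assume that $W\ge\frac12w^2$ on $\mathbb{R}^2$, and that $W=\frac12w^2$ and $w>0$ on the open segment $(u^-,u^+)$, where $w\in\mathcal{C}^2(\mathbb{R}^2,\mathbb{R})$ solves the wave equation $\partial_{11}w-\partial_{22}w=0$ in $\mathbb{R}^2$. If $u$ is a global minimizer of problem $(\mathcal P)$ such that either $u\in L^\infty$ or there exist $C,\beta>0$ with $|w(z)|\le Ce^{\beta|z|^2}$ for all $z$, then $u(x)=g(x_1)$ a.e., where $g:\mathbb{R}\to\mathbb{R}^2_a$ is, up to translation, the unique minimizer of $\inf\{\int_\mathbb{R}\frac12|\dot\gamma|^2+W(\gamma)\,dt:\gamma\in\dot H^1(\mathbb{R},\mathbb{R}^2_a),\ \gamma(\pm\infty)=u^\pm\}$.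
   Context: $\mathbb{T}=\mathbb{R}/\mathbb{Z}$, $\Omega=\mathbb{R}\times\mathbb{T}$, $x=(x_1,x_2)$. $\dot H^1_{div}(\Omega,\mathbb{R}^2)=\{u\in H^1_{loc}:\nabla u\in L^2,\ \nabla\cdot u=0\}$, $E(u)=\int_\Omega\frac12|\nabla u|^2+W(u)dx$, $\overline{u}(x_1)=\int_\mathbb{T}u(x_1,x_2)dx_2$. Problem $(\mathcal P)$: minimize $E$ over $u\in\dot H^1_{div}(\Omega,\mathbb{R}^2)$ with $\lim_{x_1\to\pm\infty}\overline{u}(x_1)=u^\pm$; a global minimizer attains this infimum. $\mathbb{R}^2_a=\{z:z_1=a\}$. *)

(* Defs.v *)
From HB Require Import structures.
From mathcomp Require Import all_boot all_order all_algebra.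
From mathcomp Require Import all_classical all_reals all_analysis.
Set Implicit Arguments. Unset Strict Implicit. Unset Printing Implicit Defensive.
Import Order.TTheory GRing.Theory Num.Theory numFieldNormedType.Exports.
Local Open Scope classical_set_scope.
Local Open Scope ring_scope.

Section Defs.
Variable R : realType.

Definition leb := (@lebesgue_measure R).
Definition mu2 := (leb \x leb)%E.

Definition e1 : R * R := (1, 0).
Definition e2 : R * R := (0, 1).

Definition sq2 (p : R * R) : R := p.1 ^+ 2 + p.2 ^+ 2.

Definition Dseq (s : seq (R * R)) (f : R * R -> R) : R * R -> R :=
  foldr (fun v g => 'D_v g) f s.

Definition testfun2 (phi : R * R -> R) : Prop :=
  (forall s v x, derivable (Dseq s phi) x v) /\
  (forall s, continuous (Dseq s phi)) /\
  exists M : R, forall x : R * R, M < `|x.1| \/ M < `|x.2| -> phi x = 0.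

Definition L1loc2 (f : R * R -> R) : Prop :=
  forall M : R, mu2.-integrable [set x : R * R | `|x.1| <= M /\ `|x.2| <= M]
                               (fun x => (f x)%:E).

Definition weak_partial2 (v : R * R) (f g : R * R -> R) : Prop :=
  L1loc2 f /\ L1loc2 g /\
  forall phi, testfun2 phi ->
    (\int[mu2]_x (f x * 'D_v phi x)%:E = - \int[mu2]_x (g x * phi x)%:E)%E.

(* fundamental cell of Omega = R x T, T = R/Z *)
Definition cell : set (R * R) := [set x | 0 <= x.2 < 1].

(* functions on Omega are 1-periodic functions in x2 *)
Definition periodic2 (u : R * R -> R * R) : Prop :=
  forall x1 x2, u (x1, x2 + 1) = u (x1, x2).

Definition Hdiv (u du1 du2 : R * R -> R * R) : Prop :=
  periodic2 u /\
  L1loc2 (fun x => (u x).1 ^+ 2) /\ L1loc2 (fun x => (u x).2 ^+ 2) /\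
  weak_partial2 e1 (fun x => (u x).1) (fun x => (du1 x).1) /\
  weak_partial2 e1 (fun x => (u x).2) (fun x => (du1 x).2) /\
  weak_partial2 e2 (fun x => (u x).1) (fun x => (du2 x).1) /\
  weak_partial2 e2 (fun x => (u x).2) (fun x => (du2 x).2) /\
  (\int[mu2]_(x in cell) (sq2 (du1 x) + sq2 (du2 x))%:E < +oo)%E /\
  {ae mu2, forall x, (du1 x).1 + (du2 x).2 = 0}.

Definition ubar (u : R * R -> R * R) (x1 : R) : R * R :=
  (Rintegral leb `[0, 1] (fun t => (u (x1, t)).1),
   Rintegral leb `[0, 1] (fun t => (u (x1, t)).2)).

Definition bc (u : R * R -> R * R) (um up : R * R) : Prop :=
  exists ub : R -> R * R,
    {ae leb, forall x1, ub x1 = ubar u x1} /\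
    ub x1 @[x1 --> +oo] --> up /\ ub x1 @[x1 --> -oo] --> um.

Definition energy (W : R * R -> R) (u du1 du2 : R * R -> R * R) : \bar R :=
  \int[mu2]_(x in cell) ((sq2 (du1 x) + sq2 (du2 x)) / 2 + W (u x))%:E.

Definition admissible (um up : R * R) (u du1 du2 : R * R -> R * R) : Prop :=
  Hdiv u du1 du2 /\ bc u um up.

Definition global_min (W : R * R -> R) (um up : R * R)
    (u du1 du2 : R * R -> R * R) : Prop :=
  admissible um up u du1 du2 /\
  forall v dv1 dv2, admissible um up v dv1 dv2 ->
    (energy W u du1 du2 <= energy W v dv1 dv2)%E.

Definition testfun1 (phi : R -> R) : Prop :=
  (forall n x, derivable (iter n (@derive1 R R) phi) x 1) /\
  exists M : R, forall t : R, M < `|t| -> phi t = 0.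

Definition L1loc1 (f : R -> R) : Prop :=
  forall M : R, leb.-integrable `[- M, M] (fun t => (f t)%:E).

Definition weak_deriv1 (f g : R -> R) : Prop :=
  L1loc1 f /\ L1loc1 g /\
  forall phi, testfun1 phi ->
    (\int[leb]_t (f t * derive1 phi t)%:E = - \int[leb]_t (g t * phi t)%:E)%E.

(* gamma in \dot H^1(R, R^2_a) (continuous representative), with weak
   derivative dgamma *)
Definition H1dot_a (a : R) (gam dgam : R -> R * R) : Prop :=
  continuous gam /\ (forall t, (gam t).1 = a) /\
  weak_deriv1 (fun t => (gam t).1) (fun t => (dgam t).1) /\
  weak_deriv1 (fun t => (gam t).2) (fun t => (dgam t).2) /\
  (\int[leb]_t (sq2 (dgam t))%:E < +oo)%E.

Definition admissible1 (a : R) (um up : R * R) (gam dgam : R -> R * R) : Prop :=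
  H1dot_a a gam dgam /\
  gam t @[t --> +oo] --> up /\ gam t @[t --> -oo] --> um.

Definition energy1 (W : R * R -> R) (gam dgam : R -> R * R) : \bar R :=
  \int[leb]_t (sq2 (dgam t) / 2 + W (gam t))%:E.

Definition min1 (W : R * R -> R) (a : R) (um up : R * R)
    (gam dgam : R -> R * R) : Prop :=
  admissible1 a um up gam dgam /\
  forall g dg, admissible1 a um up g dg ->
    (energy1 W gam dgam <= energy1 W g dg)%E.

Definition C2 (w : R * R -> R) : Prop :=
  (forall s v x, (size s <= 1)%N -> derivable (Dseq s w) x v) /\
  (forall s, (size s <= 2)%N -> continuous (Dseq s w)).

End Defs.

(* Main.v *)
(* Calibration.  By d'Alembert's formula w(z) is a function of z1 + z2 plus a
   function of z1 - z2.  Put S = d1 u2 + d2 u1.  Since div u = 0,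
   (d1 + d2)(u1 + u2) = S and (d1 - d2)(u1 - u2) = - S, so S w(u) is a
   divergence, and its integral over the cell is the integral m of w over
   (u^-, u^+).  The Jacobian being a null Lagrangian, |Du|^2 may be replaced
   by S^2 + (d1 u1 - d2 u2)^2, and therefore
     E(u) >= m + int [ (S - w(u))^2 / 2 + (d1 u1 - d2 u2)^2 / 2 + (W - w^2/2)(u) ].
   For unbounded u the profiles of w are truncated.  The error is controlled by
   the growth of w because, for a finite energy map with limits, the measure of
   {|u1 + u2| > M} decays faster than every Gaussian.

   Running through the segment with speed max(w, delta) shows E(u) <= m, so
   the squares vanish: all derivatives of u but d1 u2 are zero and
   d1 u2 = w(u).  Hence u = (a, Y(x1)) with Y' = w(a, Y).  One-dimensional
   minimizers extend to competitors on the strip, hence solve the same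
   equation, and uniqueness for it gives uniqueness up to translation. *)
Require Import Defs.
From HB Require Import structures.
From mathcomp Require Import all_boot all_order all_algebra.
From mathcomp Require Import all_classical all_reals all_analysis.
From mathcomp Require Import measurable_realfun unstable ring lra.
Import Order.TTheory GRing.Theory Num.Theory numFieldNormedType.Exports.
Local Open Scope classical_set_scope.
Local Open Scope ring_scope.
Set Implicit Arguments. Unset Strict Implicit. Unset Printing Implicit Defensive.

(** As [u] has only weak first derivatives, the chain rule and the divergence theorem are applied
    line by line: each component has one representative absolutely continuous on almost every
    horizontal line and another on almost every vertical line, and fluxes are computed on boxes
    [[s, t]] x [[0, 1]]. The ends are times at which the vertical trace is uniformly close to its
    limit; they exist because the vertical energy is integrable over a half-line of infinite length.
    Integrating the Jacobian by parts would need second derivatives. Symmetric difference quotients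
    in the periodic variable make it exact; their limit gives only an inequality, in the direction
    that a lower bound for the energy needs. The floor [delta] on the speed is there because [w]
    vanishes at both endpoints: the true profile takes infinite time, while the floored competitor
    arrives in finite time at an extra cost proportional to [delta]. The one-dimensional minimizer
    is not constructed separately: it is read off from [u], and it is minimal because every
    one-dimensional curve extends to the strip with the same energy. *)

Section integrableR.
Context d (T : measurableType d) (R : realType) (m : {measure set T -> \bar R}).
Variables (D : set T) (mD : measurable D).
Implicit Types f g : T -> R.

Lemma integrableDR f g : m.-integrable D (EFin \o f) ->
  m.-integrable D (EFin \o g) -> m.-integrable D (EFin \o (fun x => f x + g x)).
Proof. by move=> i j; have := integrableD mD i j. Qed.

Lemma integrableNR f : m.-integrable D (EFin \o f) ->
  m.-integrable D (EFin \o (fun x => - f x)).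
Proof. by move=> i; have := integrableN i. Qed.

Lemma integrableBR f g : m.-integrable D (EFin \o f) ->
  m.-integrable D (EFin \o g) -> m.-integrable D (EFin \o (fun x => f x - g x)).
Proof. by move=> i j; apply: integrableDR => //; apply: integrableNR. Qed.

Lemma integrableZR k f : m.-integrable D (EFin \o f) ->
  m.-integrable D (EFin \o (fun x => k * f x)).
Proof. by move=> i; have := integrableZl mD k i. Qed.

End integrableR.

Section almost_everywhere.
Context d (T : measurableType d) (R : realType) (m : {measure set T -> \bar R}).
Implicit Types P Q : T -> Prop.

Lemma aeS P Q : (forall x, P x -> Q x) ->
  {ae m, forall x, P x} -> {ae m, forall x, Q x}.
Proof. by move=> h; apply: (@filterS _ _ (ae_filter_ringOfSetsType m)). Qed.

Lemma aeT P : (forall x, P x) -> {ae m, forall x, P x}.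
Proof. by move=> h; apply: aeW. Qed.

Lemma ae_and P Q : {ae m, forall x, P x} -> {ae m, forall x, Q x} ->
  {ae m, forall x, P x /\ Q x}.
Proof. by move=> h1 h2; apply: (@filterI _ _ (ae_filter_ringOfSetsType m)). Qed.

Lemma ae_nat (P : nat -> T -> Prop) : (forall n, {ae m, forall x, P n x}) ->
  {ae m, forall x, forall n, P n x}.
Proof. by move=> h; apply/ae_foralln. Qed.

End almost_everywhere.

(** * Absolutely continuous functions of one variable *)

Section AC.
Context {R : realType}.
Notation mu := (@lebesgue_measure R).
Implicit Types (y g F f : R -> R).

(* Gives the chain rule for absolutely continuous functions without a.e. differentiation. *)
Lemma local_increment_bound (D G : R -> R) (a b : R) : a <= b ->
  (forall x, a <= x <= b -> exists2 d, 0 < d & forall s t, a <= s -> s <= t ->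
     t <= b -> `|s - x| < d -> `|t - x| < d -> `|D t - D s| <= G t - G s) ->
  `|D b - D a| <= G b - G a.
Proof.
move=> ab H.
(* Continuous induction: near the supremum [c] of [S] the hypothesis at [c] carries the bound up to
   [c] and beyond it, so [c] cannot be smaller than [b]. *)
pose S := [set x | a <= x <= b /\ `|D x - D a| <= G x - G a].
have Sa : S a by split; rewrite ?lexx ?ab// !subrr normr0.
have supS : has_sup S.
  by split; [exists a|exists b => x [/andP[]]].
pose c := sup S.
have ac : a <= c by apply: sup_upper_bound.
have cb : c <= b by apply: sup_le_ub; [exists a|move=> x [/andP[]]].
have [d d0 Hd] : exists2 d, 0 < d & forall s t, a <= s -> s <= t ->
     t <= b -> `|s - c| < d -> `|t - c| < d -> `|D t - D s| <= G t - G s.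
  by apply: H; rewrite ac cb.
have [x [/andP[ax xb] Sx] cx] := sup_adherent d0 supS.
have xc : x <= c by apply: sup_upper_bound => //; split => //; rewrite ax xb.
have step t : x <= t -> t <= b -> `|t - c| < d -> S t.
  move=> xt tb tc; split; first by rewrite (le_trans ax xt) tb.
  have xd : `|x - c| < d.
    by rewrite ler0_norm ?subr_le0// opprB ltrBlDr -ltrBlDl.
  have := Hd _ _ ax xt tb xd tc.
  have -> : D t - D a = (D t - D x) + (D x - D a) by ring.
  move=> h; apply: le_trans (ler_normD _ _) _.
  by apply: le_trans (lerD h Sx) _; rewrite le_eqVlt; apply/orP; left; apply/eqP; ring.
have [cb'|bc] := ltP c b; last first.
  have -> : b = c by apply/eqP; rewrite eq_le cb bc.
  by have [] := step c xc cb; rewrite ?subrr ?normr0.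
pose t := Num.min b (c + d / 2).
have tb : t <= b by rewrite /t ge_min lexx.
have ct : c < t by rewrite /t lt_min cb'/= ltrDl divr_gt0.
have tc : t <= c + d / 2 by rewrite /t ge_min lexx orbT.
have St : S t.
  apply: step => //; first by rewrite (le_trans xc)// ltW.
  rewrite gtr0_norm ?subr_gt0//; lra.
have : t <= c by apply: sup_upper_bound.
by rewrite leNgt ct.
Qed.

(** Absolute continuity, encoded by the integral identity rather than by differentiability almost
    everywhere: the identity is what a weak derivative yields on lines and what the fluxes
    consume. *)
Definition prim y g := forall s t, s <= t ->
  mu.-integrable `[s, t] (EFin \o g) /\
  y t - y s = \int[mu]_(x in `[s, t]) g x.

Lemma Rintegral_itv_split g (s r t : R) : s <= r -> r <= t ->
  mu.-integrable `[s, t] (EFin \o g) ->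
  \int[mu]_(x in `[s, t]) g x =
  \int[mu]_(x in `[s, r]) g x + \int[mu]_(x in `[r, t]) g x.
Proof.
move=> sr rt ig.
have := @Rintegral_itvB _ g (BLeft s) (BRight t) r ig.
rewrite !bnd_simp => /(_ sr rt) h.
rewrite -(@Rintegral_itv_obnd_cbnd _ r (BRight t)).
  by rewrite -h addrC subrK.
apply: integrableS ig => //; apply: subset_itvr; by rewrite bnd_simp.
Qed.

Lemma integrable_subitv g (s t s' t' : R) : s <= s' -> t' <= t ->
  mu.-integrable `[s, t] (EFin \o g) -> mu.-integrable `[s', t'] (EFin \o g).
Proof.
move=> ss tt; apply: integrableS => //.
by apply: subset_itv; rewrite bnd_simp.
Qed.

Lemma near_subr1 (x : R) : \forall z \near x, x - 1 <= z.
Proof. by exists 1 => //= z; rewrite /ball_/= ltr_norml; lra. Qed.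

Lemma prim_continuous y g : prim y g -> continuous y.
Proof.
move=> H x.
have ab : x - 1 < x + 1 by lra.
have [ig _] := H _ _ (ltW ab).
have := parameterized_integral_continuous (ltW ab) ig.
move=> /(continuous_within_itvP _ ab)[+ _ _] => /(_ x).
have xin : x \in `]x - 1, x + 1[ by rewrite in_itv/=; apply/andP; split; lra.
move=> /(_ xin) cx.
have : continuous_at x (fun z => y (x - 1) + parameterized_integral mu (x - 1) z g).
  by apply: cvgD; [exact: cvg_cst|exact: cx].
have -> : y = fun z => y z by [].
rewrite /continuous_at.
have yx : y (x - 1) + parameterized_integral mu (x - 1) x g = y x.
  rewrite /parameterized_integral; have [_ <-] := H (x - 1) x ltac:(lra).
  by rewrite addrC subrK.
rewrite /prop_for /continuous_at yx.
apply: cvg_trans.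
apply: near_eq_cvg; near=> z.
rewrite /parameterized_integral.
have xz : x - 1 <= z by near: z; exact: near_subr1.
have [_ <-] := H (x - 1) z xz.
by rewrite addrC subrK.
Unshelve. all: by end_near. Qed.

Lemma prim_norm y g s t : prim y g -> s <= t ->
  `|y t - y s| <= \int[mu]_(x in `[s, t]) `|g x|.
Proof.
by move=> H st; have [ig ->] := H _ _ st; apply: le_normr_Rintegral.
Qed.

Lemma is_derive_continuous F f : (forall x : R, is_derive x (1 : R) F (f x)) ->
  continuous F.
Proof.
move=> dF x; apply: differentiable_continuous; apply/derivable1_diffP.
by case: (dF x).
Qed.

Lemma continuous_itv_integrable f (s t : R) : continuous f ->
  mu.-integrable `[s, t] (EFin \o f).
Proof.
move=> cf; apply: continuous_compact_integrable; first exact: segment_compact.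
by apply: continuous_subspaceT.
Qed.

Lemma continuous_itv_bounded f (s t : R) : continuous f ->
  [bounded f x | x in `[s, t]%classic].
Proof.
move=> cf.
have := @compact_bounded _ _ (f @` `[s, t]).
have : compact (f @` `[s, t]).
  apply: continuous_compact; last exact: segment_compact.
  exact: continuous_subspaceT.
move=> h /(_ h) [M [Mr HM]].
exists M; split => // z Mz x /= xst.
by apply: (HM z Mz); exists x.
Qed.

Lemma continuous_mul_integrable f g (s t : R) : continuous f ->
  mu.-integrable `[s, t] (EFin \o g) ->
  mu.-integrable `[s, t] (EFin \o (fun x => f x * g x)).
Proof.
move=> cf ig.
apply: (@integrableMr _ _ _ mu `[s, t]%classic _ f (EFin \o g)) => //.
- apply: measurable_funTS; exact: continuous_measurable_fun.
- exact: continuous_itv_bounded.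
Qed.

(** Near [x] the factor [f (y _)] is almost equal to [f (y x)], so the increments of [F (y _)] and
    of the integral of [f (y _) * g] both differ from [f (y x)] times the increment of [y] by a
    small multiple of the integral of [|g|]. [local_increment_bound] turns these local estimates
    into a global one. *)
Lemma prim_comp y g F f : prim y g -> (forall x : R, is_derive x (1 : R) F (f x)) ->
  continuous f -> prim (fun x => F (y x)) (fun x => f (y x) * g x).
Proof.
move=> H dF cf s t st.
have cy := prim_continuous H.
have [ig _] := H _ _ st.
have cfy : continuous (fun x => f (y x)).
  by move=> x; apply: continuous_comp; [exact: cy|exact: cf].
have ifg := continuous_mul_integrable cfy ig.
split => //.
apply/eqP; rewrite -subr_eq0 -normr_le0; apply/ler_addgt0Pl => e e0; rewrite addr0.
pose I := \int[mu]_(x in `[s, t]) `|g x|.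
have I0 : 0 <= I by apply: Rintegral_ge0.
(* Two local errors of [e'] times the integral of [|g|] add up to [2 * e' * I <= e]; the [+ 1]
   covers [I = 0]. *)
pose e' := e / (2 * (I + 1)).
have e'0 : 0 < e' by rewrite divr_gt0// mulr_gt0// ltr_pwDr.
pose D z := F (y z) - \int[mu]_(x in `[s, z]) (f (y x) * g x).
pose G z := 2 * e' * \int[mu]_(x in `[s, z]) `|g x|.
have iabs : mu.-integrable `[s, t] (EFin \o (fun x => `|g x|)).
  exact: (integrable_norm ig).
have loc : `|D t - D s| <= G t - G s.
  apply: local_increment_bound => // x _.
  have /cvgrPdist_lt /(_ _ e'0) : {for y x, continuous f} by exact: cf.
  move=> [d1 /= d10 H1].
  have /cvgrPdist_lt /(_ _ d10) : {for x, continuous y} by exact: cy.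
  move=> [d /= d0 H2].
  exists d => // p q sp pq qt px qx.
  have ffx z : `|z - y x| < d1 -> `|f z - f (y x)| <= e'.
    move=> h; rewrite distrC; apply: ltW; apply: H1 => /=.
    by rewrite /ball_/= distrC.
  have yd z : `|z - x| < d -> `|y z - y x| < d1.
    by move=> h; rewrite distrC; apply: H2; rewrite /ball_/= distrC.
  have ipq : mu.-integrable `[p, q] (EFin \o g).
    exact: (integrable_subitv sp qt ig).
  have ipqa : mu.-integrable `[p, q] (EFin \o (fun x => `|g x|)).
    exact: (integrable_norm ipq).
  have ipqf : mu.-integrable `[p, q] (EFin \o (fun x => f (y x) * g x)).
    exact: (integrable_subitv sp qt ifg).
  have isq : forall h, mu.-integrable `[s, t] (EFin \o h) -> mu.-integrable `[s, q] (EFin \o h).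
    by move=> h; apply: integrable_subitv.
  rewrite /D /G -mulrBr !(Rintegral_itv_split sp pq); try exact: isq.
  have -> : forall A B C E : R, A - (B + C) - (E - B) = A - E - C by move=> *; ring.
  have -> : forall A B C : R, A * (B + C - B) = A * C by move=> *; ring.
  have E1 : `|F (y q) - F (y p) - f (y x) * (y q - y p)| <= e' * `|y q - y p|.
    have mvt : forall u v, u <= v -> `|u - y x| < d1 -> `|v - y x| < d1 ->
        `|F v - F u - f (y x) * (v - u)| <= e' * `|v - u|.
      move=> u v uv ud vd.
      have cFw : {within `[u, v], continuous F}.
        by apply: continuous_subspaceT; exact: is_derive_continuous dF.
      have [z zuv ->] := MVT_segment uv (fun z _ => dF z) cFw.
      rewrite -mulrBl normrM ler_wpM2r//; apply: ffx.
      move: zuv; rewrite in_itv/= => /andP[uz zv].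
      by move: ud vd uz zv; rewrite !ltr_norml; clear; lra.
    have [pq'|qp] := leP (y p) (y q); first exact: mvt (yd _ px) (yd _ qx).
    have := mvt _ _ (ltW qp) (yd _ qx) (yd _ px).
    by rewrite -normrN (distrC (y p)); congr (`|_| <= _); ring.
  have E2 : `|\int[mu]_(x0 in `[p, q]) (f (y x0) * g x0) - f (y x) * (y q - y p)|
     <= e' * \int[mu]_(x in `[p, q]) `|g x|.
    have [_ ->] := H _ _ pq.
    rewrite -RintegralZl// -RintegralB//; last first.
      exact: integrableZR.
    apply: le_trans (le_normr_Rintegral _ _) _ => //.
      by apply: integrableBR => //; exact: integrableZR.
    rewrite -RintegralZl//; apply: le_Rintegral => //.
    - apply: (@integrable_norm _ _ _ _ _ (fun x0 => _ - _)) => //.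
      by apply: integrableBR => //; exact: integrableZR.
    - exact: integrableZR.
    move=> z /=; rewrite in_itv/= => /andP[pz zq].
    rewrite -mulrBl normrM ler_wpM2r//; apply/ffx/yd.
    by move: px qx pz zq; rewrite !ltr_norml; clear; lra.
  have E3 := prim_norm H pq.
  have -> : F (y q) - F (y p) - \int[mu]_(x0 in `[p, q]) (f (y x0) * g x0)
    = (F (y q) - F (y p) - f (y x) * (y q - y p)) - (\int[mu]_(x0 in `[p, q]) (f (y x0) * g x0) - f (y x) * (y q - y p)) by ring.
  apply: le_trans (ler_normB _ _) _.
  have := lerD E1 E2; move=> /le_trans; apply.
  by have := ler_wpM2l (ltW e'0) E3; clear; lra.
have := loc; rewrite /D /G set_itv1 !Rintegral_set1 subr0 mulr0 subr0.
rewrite -/I => h.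
have -> : F (y t) - F (y s) - \int[mu]_(x in `[s, t]) (f (y x) * g x) =
   F (y t) - \int[mu]_(x in `[s, t]) (f (y x) * g x) - F (y s) by ring.
apply: le_trans h _.
have -> : 2 * e' * I = e * (I / (I + 1)).
  by rewrite /e'; field; lra.
rewrite ger_pMr// ler_pdivrMr; lra.
Qed.

Lemma prim_ext y y' g g' : y =1 y' -> g =1 g' -> prim y g -> prim y' g'.
Proof. by move=> /funext -> /funext ->. Qed.

Lemma primD y1 y2 g1 g2 : prim y1 g1 -> prim y2 g2 ->
  prim (fun x => y1 x + y2 x) (fun x => g1 x + g2 x).
Proof.
move=> H1 H2 s t st; have [i1 e1] := H1 _ _ st; have [i2 e2] := H2 _ _ st.
split; first exact: integrableDR.
by rewrite RintegralD// -e1 -e2; ring.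
Qed.

Lemma primZ k y g : prim y g -> prim (fun x => k * y x) (fun x => k * g x).
Proof.
move=> H s t st; have [i e] := H _ _ st.
split; first exact: integrableZR.
by rewrite RintegralZl// -e; ring.
Qed.

Lemma primB y1 y2 g1 g2 : prim y1 g1 -> prim y2 g2 ->
  prim (fun x => y1 x - y2 x) (fun x => g1 x - g2 x).
Proof.
move=> H1 /(primZ (-1)) H2; apply: prim_ext (primD H1 H2) => x /=;
  by rewrite mulN1r.
Qed.

Lemma prim_cst (c : R) : prim (fun=> c) (fun=> 0).
Proof.
move=> s t st; split; first by apply: continuous_itv_integrable => x; exact: cvg_cst.
by rewrite subrr /Rintegral integral0.
Qed.

Lemma prim_id : prim id (fun=> 1).
Proof.
move=> s t st; split; first by apply: continuous_itv_integrable => x; exact: cvg_cst.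
rewrite Rintegral_cst// mul1r.
have -> : fine (mu `[s, t]) = t - s.
  rewrite lebesgue_measure_itv/= lte_fin.
  by case: ltP st => // ts st; rewrite (_ : t = s) ?subrr//; apply/eqP; rewrite eq_le ts.
by [].
Qed.

Lemma prim_is_derive F f : (forall x : R, is_derive x (1 : R) F (f x)) ->
  continuous f -> prim F f.
Proof.
move=> dF cf; apply: prim_ext (prim_comp prim_id dF cf) => x //.
by rewrite mulr1.
Qed.

Lemma is_derive_sqr (x : R) : is_derive x (1 : R) (fun z : R => z * z : R) (2 * x).
Proof.
have := is_deriveM (is_derive_id x (1 : R)) (is_derive_id x (1 : R)).
have -> : x%:A + x%:A = 2 * x :> R by rewrite /GRing.scale/=; ring.
exact.
Qed.

(** Polarisation: the product is a quarter of a difference of two squares, and squares are covered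
    by the chain rule. *)
Lemma prim_mul y1 y2 g1 g2 : prim y1 g1 -> prim y2 g2 ->
  prim (fun x => y1 x * y2 x) (fun x => y1 x * g2 x + y2 x * g1 x).
Proof.
move=> H1 H2.
have csq : continuous (fun x : R => 2 * x) by move=> x; apply: mulrl_continuous.
apply: prim_ext (primZ (4^-1) (primB (prim_comp (primD H1 H2) is_derive_sqr csq) (prim_comp (primB H1 H2) is_derive_sqr csq))) => x /=; by field.
Qed.

(* For [t != 0] one of the two intervals is empty, so this is the signed integral from 0 to t. *)
Definition sint g (t : R) :=
  \int[mu]_(x in `[0, t]) g x - \int[mu]_(x in `[t, 0]) g x.

Lemma prim_sint g : (forall s t, mu.-integrable `[s, t] (EFin \o g)) ->
  prim (sint g) g.
Proof.
move=> H s t st; split => //.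
have E r : r <= 0 -> sint g r = - \int[mu]_(x in `[r, 0]) g x.
  move=> r0; rewrite /sint; have [-> |r0'] := eqVneq r 0.
    by rewrite set_itv1 Rintegral_set1 subr0 oppr0.
  by rewrite set_itv_ge ?Rintegral_set0 ?sub0r// bnd_simp -ltNge lt_neqAle r0'.
have E' r : 0 <= r -> sint g r = \int[mu]_(x in `[0, r]) g x.
  move=> r0; rewrite /sint; have [-> |r0'] := eqVneq r 0.
    by rewrite set_itv1 Rintegral_set1 subr0.
  by rewrite (@set_itv_ge _ _ _ (BRight 0)) ?Rintegral_set0 ?subr0// bnd_simp -ltNge lt_neqAle eq_sym r0'.
have [t0|t0] := leP t 0; first by rewrite !E// ?(le_trans st)// (@Rintegral_itv_split g s t 0)//; ring.
have [s0|s0] := leP s 0.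
  by rewrite (E s)// (E' t) ?ltW// (@Rintegral_itv_split g s 0 t)//; [ring|exact: ltW].
rewrite !E'//; [|exact: ltW..].
by rewrite (@Rintegral_itv_split g 0 s t)//; [ring|exact: ltW].
Qed.

Lemma continuous_antiderivative f : continuous f ->
  forall x : R, is_derive x (1 : R) (sint f) (f x).
Proof.
move=> cf x.
have H : prim (sint f) f by apply: prim_sint => s t; exact: continuous_itv_integrable.
have [dF F'] := @continuous_FTC1_closed _ f (x - 1) x (x + 1) ltac:(lra)
  (continuous_itv_integrable (x - 1) (x + 1) cf) ltac:(lra) (cf x).
rewrite derive1E in F'.
have D := is_deriveD (is_derive_cst (sint f (x - 1)) x (1 : R)) (derivableP dF).
rewrite F' add0r in D.
apply: near_eq_is_derive D.
near=> z.
have xz : x - 1 <= z by near: z; exact: near_subr1.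
rewrite /= [LHS]/GRing.add/=.
by have [_ <-] := H _ _ xz; rewrite /cst addrC subrK.
Unshelve. all: by end_near. Qed.

(** The Lebesgue points of [g] are such points. This serves to pass to the limit in difference
    quotients and to see that a constant function has density zero. *)
Lemma prim_derive_ae y g : measurable_fun setT g -> prim y g ->
  {ae mu, forall x : R, is_derive x (1 : R) y (g x)}.
Proof.
move=> mg H.
have lg : locally_integrable setT g.
  split => // ; first exact: openT.
  move=> K _ cK.
  have [M [_ HM]] := compact_bounded cK.
  pose N := `|M| + 1.
  have KN : K `<=` `[- N, N].
    move=> x Kx; have /= := HM N; rewrite /N.
    have MN : M < `|M| + 1 by have := ler_norm M; lra.
    move=> /(_ MN x Kx) /=; rewrite ler_norml in_itv/=; lra.
  have [/integrableP[_ ig] _] := H (- N) N ltac:(rewrite /N; have := normr_ge0 M; lra).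
  apply: le_lt_trans ig; apply: ge0_subset_integral => //.
  - exact: compact_measurable.
  - by apply: measurable_funTS; apply/measurable_EFinP; apply: measurableT_comp.
have aux (x : R) : ((x - 1)%:E < x%:E)%E by rewrite lte_fin; lra.
have := lebesgue_differentiation lg.
apply: aeS => x lx.
have [ig _] := H (x - 1) (x + 1) ltac:(lra).
have [dF F'] := @FTC1_lebesgue_pt _ g (BLeft (x - 1)) x (x + 1) ltac:(lra) ig (aux x) lx.
rewrite derive1E in F'.
have D := is_deriveD (is_derive_cst (y (x - 1)) x (1 : R)) (derivableP dF).
rewrite F' add0r in D.
apply: near_eq_is_derive D.
near=> z.
have xz : x - 1 <= z by near: z; exact: near_subr1.
rewrite /= [LHS]/GRing.add/=.
by have [_ <-] := H _ _ xz; rewrite /cst addrC subrK.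
Unshelve. all: by end_near. Qed.

Lemma is_derive_le F f (k l u v : R) : (forall x : R, is_derive x (1 : R) F (f x)) ->
  u <= v -> (forall x, u <= x <= v -> k <= f x <= l) ->
  k * (v - u) <= F v - F u <= l * (v - u).
Proof.
move=> dF uv H.
have cFw : {within `[u, v], continuous F}.
  by apply: continuous_subspaceT; exact: is_derive_continuous dF.
have [z zuv ->] := MVT_segment uv (fun z _ => dF z) cFw.
move: zuv; rewrite in_itv/= => /H /andP[k1 k2].
by rewrite !ler_wpM2r// subr_ge0.
Qed.

Lemma Rintegral_supp g (D : set R) : (forall x, ~ D x -> g x = 0) ->
  \int[mu]_(x in D) g x = \int[mu]_x g x.
Proof.
move=> h; rewrite Rintegral_mkcond; apply: eq_Rintegral => x _.
by rewrite patchE; case: ifPn => // /negP; rewrite inE => /h ->.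
Qed.

Lemma integrable_supp g (D : set R) : measurable D -> (forall x, ~ D x -> g x = 0) ->
  mu.-integrable D (EFin \o g) -> mu.-integrable setT (EFin \o g).
Proof.
move=> mD h /integrable_mkcond => /(_ mD); apply: eq_integrable => // x _.
by rewrite patchE; case: ifPn => // /negP; rewrite inE => /h /= ->.
Qed.

Definition shell (s h z : R) : R := if s < `|z| < s + h then 1 else 0.

Lemma measurable_shell s h : measurable_fun setT (shell s h).
Proof.
have cny : measurable_fun setT (fun x : R => `|x| : R) by apply: measurableT_comp.
apply: measurable_fun_ifT => //.
by apply: measurable_and; apply: measurable_fun_ltr.
Qed.

(** Compose [y] with the primitive [F] of the tent [tau] supported on the shell. The tent is at
    least [h / 4] on the middle half of the shell, of length [h / 2], so [F] changes by at least
    [h / 4 * (h / 2)] across it, while the density of [F (y _)] is at most [h / 2] times [|g|] and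
    lives on the shell. A tent replaces the indicator because the chain rule asks for a continuous
    derivative. *)
Lemma prim_crossing y g (s h t0 t1 : R) : 0 <= s -> 0 < h -> prim y g ->
  t0 <= t1 ->
  (`|y t0| <= s /\ s + h <= `|y t1|) \/ (`|y t1| <= s /\ s + h <= `|y t0|) ->
  h / 4 <= \int[mu]_(x in `[t0, t1]) (`|g x| * shell s h (y x)).
Proof.
move=> s0 h0 H t01 hy.
pose tau (z : R) := Num.max 0 (Num.min (`|z| - s) (s + h - `|z|)).
have ctau : continuous tau.
  move=> z.
  have c0 : {for z, continuous (fun=> 0 : R^o)} by exact: cvg_cst.
  have c1 : {for z, continuous (fun x : R => `|x| - s : R^o)}.
    by apply: cvgB; [exact: norm_continuous|exact: cvg_cst].
  have c2 : {for z, continuous (fun x : R => s + h - `|x| : R^o)}.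
    by apply: cvgB; [exact: cvg_cst|exact: norm_continuous].
  exact: (continuous_max c0 (continuous_min c1 c2)).
have tau0 z : 0 <= tau z by rewrite le_max lexx.
have tauh z : tau z <= h / 2.
  rewrite ge_max; apply/andP; split; first by apply: divr_ge0; [exact: ltW|].
  rewrite ge_min; apply/orP; have [?|?] := leP (`|z|) (s + h / 2); [left|right]; lra.
have taus z : `|z| <= s -> tau z = 0.
  move=> zs; apply/eqP; rewrite eq_le tau0 andbT ge_max lexx/= ge_min subr_le0 zs//.
have tausup z : ~~ (s < `|z| < s + h) -> tau z = 0.
  rewrite negb_and -!leNgt => /orP[/taus //|zs].
  apply/eqP; rewrite eq_le tau0 andbT ge_max lexx/= ge_min [X in _ || X]subr_le0 zs orbT//.
have dF := continuous_antiderivative ctau.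
set F := sint tau in dF.
have mono u v : u <= v -> F u <= F v.
  move=> uv; have := @is_derive_le F tau 0 (h / 2) u v dF uv.
  rewrite mul0r => /(_ _)/andP[|+ _]; last lra.
  by move=> x _; rewrite tau0 tauh.
have cst u v : u <= v -> - s <= u -> v <= s -> F u = F v.
  move=> uv su vs; have := @is_derive_le F tau 0 0 u v dF uv.
  rewrite mul0r => h'; apply/eqP; rewrite eq_sym -subr_eq0 eq_le andbC; apply: h'.
  by move=> x xuv; rewrite taus ?lexx// ler_norml; lra.
have big1 z : s + h <= z -> h / 4 * (h / 2) <= F z - F s.
  move=> sz; have := @is_derive_le F tau (h / 4) (h / 2) (s + h / 4) (s + 3 * h / 4) dF ltac:(lra).
  have H1 := mono s (s + h / 4) ltac:(lra).
  have H2 := mono (s + 3 * h / 4) z ltac:(lra).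
  move=> /(_ _)/andP[|+ _].
    move=> x xs; rewrite tauh andbT le_max; apply/orP; right.
    by clear -xs s0 h0; rewrite ger0_norm ?le_min; lra.
  have -> : s + 3 * h / 4 - (s + h / 4) = h / 2 by field.
  by clear -H1 H2; lra.
have big2 z : z <= - (s + h) -> h / 4 * (h / 2) <= F (- s) - F z.
  move=> sz; have := @is_derive_le F tau (h / 4) (h / 2) (- (s + 3 * h / 4)) (- (s + h / 4)) dF ltac:(lra).
  have H1 := mono (- (s + h / 4)) (- s) ltac:(lra).
  have H2 := mono z (- (s + 3 * h / 4)) ltac:(lra).
  move=> /(_ _)/andP[|+ _].
    move=> x xs; rewrite tauh andbT le_max; apply/orP; right.
    by clear -xs s0 h0; rewrite ler0_norm ?le_min; lra.
  have -> : - (s + h / 4) - - (s + 3 * h / 4) = h / 2 by field.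
  by clear -H1 H2; lra.
have key u v : `|u| <= s -> s + h <= `|v| -> h / 4 * (h / 2) <= `|F u - F v|.
  rewrite ler_norml => /andP[us1 us2] hv.
  have Fu : F u = F s by apply: cst => //; lra.
  have Fs : F (- s) = F s by apply: cst => //; lra.
  move: hv; rewrite ler_normr => /orP[/big1 h'|hv].
    by rewrite distrC Fu; apply: le_trans (ler_norm _).
  have /big2 h' : v <= - (s + h) by lra.
  by rewrite Fu -Fs; apply: le_trans (ler_norm _).
have K : h / 4 * (h / 2) <= `|F (y t1) - F (y t0)|.
  by case: hy => -[h1 h2]; [rewrite distrC|]; exact: key.
have HF := prim_comp H dF ctau.
have := le_trans K (prim_norm HF t01).
have [ig _] := H _ _ t01.
have [iFg _] := HF _ _ t01.
have cy := prim_continuous H.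
have mind : measurable_fun setT (fun x => shell s h (y x)).
  apply: (measurableT_comp (measurable_shell s h)).
  exact: continuous_measurable_fun.
have ii : mu.-integrable `[t0, t1] (EFin \o (fun x => `|g x| * shell s h (y x))).
  apply: (le_integrable _ _ _ (integrable_norm ig)) => //.
    apply/measurable_EFinP; apply: measurable_funM; last exact: measurable_funTS.
    by move/integrable_norm: ig => /integrableP[/measurable_EFinP].
  move=> x _ /=; rewrite lee_fin normrM normr_id ler_piMr//.
  by rewrite /shell; case: ifP; rewrite ?normr1 ?normr0.
have : \int[mu]_(x in `[t0, t1]) `|tau (y x) * g x| <=
  \int[mu]_(x in `[t0, t1]) (h / 2 * (`|g x| * shell s h (y x))).
  apply: le_Rintegral => //; [exact: (integrable_norm iFg)|exact: integrableZR|].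
  move=> x _; rewrite normrM (ger0_norm (tau0 _)).
  rewrite /shell; case: ifPn => [_|/tausup ->]; last by rewrite mul0r mulr0 mulr0.
  by rewrite mulr1 ler_wpM2r.
rewrite RintegralZl// => h1 h2; have := le_trans h2 h1.
by rewrite [h / 4 * _]mulrC ler_pM2l// divr_gt0.
Qed.

End AC.

(** * Test functions *)

Section smooth.
Context {R : realType}.
Implicit Types (f g : R -> R).

Lemma is_derive_lineP (V W : normedModType R) (f : V -> W) (x v : V) (l : W) :
  is_derive x v f l <-> is_derive (0 : R) (1 : R) (fun h : R => f (h *: v + x)) l.
Proof.
have E : (fun h : R => h^-1 *: ((f \o shift x) (h *: v) - f x)) =
  (fun h : R => h^-1 *: (((fun h : R => f (h *: v + x)) \o shift (0 : R)) (h *: (1 : R)) - f ((0 : R) *: v + x))).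
  by apply/funext => h /=; rewrite addr0 scale0r add0r [h *: 1]mulr1.
split=> -[dv <-]; constructor.
- by rewrite /derivable -E.
- by rewrite /derive -E.
- by rewrite /derivable E.
- by rewrite /derive E.
Qed.

Lemma derive1_is_derive f g : (forall x : R, is_derive x (1 : R) f (g x)) ->
  f^`()%classic = g.
Proof. by move=> h; apply/funext => x; rewrite derive1E; case: (h x). Qed.

Lemma derivable_is_derive f (x : R) : derivable f x 1 ->
  is_derive x (1 : R) f (f^`()%classic x).
Proof. by move=> /derivableP; rewrite derive1E. Qed.

(** The index is shifted by one: the iterated derivatives of orders [0] to [n] are themselves
    differentiable, so [Ck 0] is plain differentiability, and continuity of the derivatives up to
    order [n] is automatic. *)
Definition Ck n f := forall k (x : R), (k <= n)%N -> derivable (iter k (@derive1 R R) f) x 1.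

Lemma CkW n f : Ck n.+1 f -> Ck n f.
Proof. by move=> h k x kn; apply: h; rewrite (leq_trans kn). Qed.

Lemma Ck_derivable n f (x : R) : Ck n f -> is_derive x (1 : R) f (f^`()%classic x).
Proof. by move=> h; apply: derivable_is_derive; exact: (h 0%N). Qed.

Lemma Ck_derive1 n f : Ck n.+1 f -> Ck n f^`()%classic.
Proof. by move=> h k x kn; rewrite -iterSr; apply: h. Qed.

Lemma CkS n f g : (forall x : R, is_derive x (1 : R) f (g x)) -> Ck n g -> Ck n.+1 f.
Proof.
move=> h hg [|k] x kn; first by case: (h x).
by rewrite iterSr (derive1_is_derive h); exact: hg.
Qed.

Lemma Ck0 f g : (forall x : R, is_derive x (1 : R) f (g x)) -> Ck 0 f.
Proof. by move=> h [|k] x //= _; case: (h x). Qed.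

Lemma CkD n f g : Ck n f -> Ck n g -> Ck n (fun x => f x + g x).
Proof.
elim: n f g => [|n IH] f g hf hg.
  by apply: Ck0 => x; exact: is_deriveD (Ck_derivable x hf) (Ck_derivable x hg).
apply: CkS; first by move=> x; exact: is_deriveD (Ck_derivable x hf) (Ck_derivable x hg).
by apply: IH; exact: Ck_derive1.
Qed.

Lemma CkM n f g : Ck n f -> Ck n g -> Ck n (fun x => f x * g x).
Proof.
elim: n f g => [|n IH] f g hf hg.
  by apply: Ck0 => x; exact: is_deriveM (Ck_derivable x hf) (Ck_derivable x hg).
apply: CkS; first by move=> x; exact: is_deriveM (Ck_derivable x hf) (Ck_derivable x hg).
exact: CkD (IH _ _ (CkW hf) (Ck_derive1 hg)) (IH _ _ (CkW hg) (Ck_derive1 hf)).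
Qed.

Lemma Ck_cst n (c : R) : Ck n (fun=> c).
Proof.
elim: n c => [|n IH] c; first by apply: Ck0 => x; exact: is_derive_cst.
by apply: CkS (IH 0) => x; exact: is_derive_cst.
Qed.

Lemma is_derive_affine f (l a b x : R) : is_derive (a * x + b) (1 : R) f l ->
  is_derive x (1 : R) (fun x => f (a * x + b)) (a * l).
Proof.
move=> /(@is_derive1_comp _ f (fun x => a * x + b)) h.
have : is_derive x (1 : R) (fun x : R => a * x + b : R) a.
  have := is_deriveD (is_deriveZ a (is_derive_id x (1 : R))) (is_derive_cst b x (1 : R)).
  by rewrite addr0 /GRing.scale/= mulr1.
by move=> /h; rewrite mulrC.
Qed.

Lemma Ck_affine n f (a b : R) : Ck n f -> Ck n (fun x => f (a * x + b)).
Proof.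
elim: n f => [|n IH] f hf.
  by apply: Ck0 => x; apply: is_derive_affine; exact: Ck_derivable hf.
apply: CkS; first by move=> x; apply: is_derive_affine; exact: Ck_derivable hf.
by apply: CkM; [exact: Ck_cst|apply: IH; exact: Ck_derive1].
Qed.

(* With the factors [x^-1 ^+ k], the derivative of a bump is a linear combination
   of bumps, which gives smoothness. *)
Definition bump k (x : R) : R := if 0 < x then x^-1 ^+ k * expR (- x^-1) else 0.

Lemma bump_ge0 k x : 0 <= bump k x.
Proof.
rewrite /bump; case: ifP => // x0; rewrite mulr_ge0 ?expR_ge0// exprn_ge0//.
by rewrite invr_ge0 ltW.
Qed.

(** With [y = x^-1], the term of order [k.+1] of the exponential series is at most [expR y]; the one
    power of [y] that [bump k] does not use becomes the factor [x]. This is what makes the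
    derivative at the origin zero. *)
Lemma bump_le k (x : R) : 0 <= x -> bump k x <= k.+1`!%:R * x.
Proof.
rewrite le_eqVlt => /predU1P[<-|x0]; first by rewrite /bump ltxx mulr0.
rewrite /bump x0 expRN.
have y0 : 0 < x^-1 by rewrite invr_gt0.
have := @expR_ge1Dxn _ x^-1 k (ltW y0).
move=> h.
rewrite ler_pdivrMr ?expR_gt0//.
have f0 : 0 < k.+1`!%:R :> R by rewrite ltr0n fact_gt0.
have : x^-1 ^+ k.+1 <= k.+1`!%:R * expR x^-1.
  have : x^-1 ^+ k.+1 / k.+1`!%:R <= expR x^-1 by lra.
  by rewrite ler_pdivrMr// mulrC.
move=> /(ler_wpM2r (ltW x0)); rewrite exprS mulrAC mulVf ?gt_eqF// mul1r.
by rewrite mulrAC.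
Qed.

Lemma is_derive_bump k (x : R) :
  is_derive x (1 : R) (bump k) (bump k.+2 x - k%:R * bump k.+1 x).
Proof.
have [x0|x0|->] := ltgtP x 0.
- have -> : bump k.+2 x - k%:R * bump k.+1 x = 0.
    by rewrite /bump ltNge ltW//= mulr0 subr0.
  have D := is_derive_cst (0 : R) x (1 : R).
  apply: near_eq_is_derive D.
  near=> z; rewrite /cst /bump ltNge ltW//.
  by near: z; exact: (lt_nbhsl x0).
- have xn0 : x != 0 by rewrite gt_eqF.
  have dinv := is_deriveV xn0 (is_derive_id x (1 : R)).
  have d1 := is_deriveX k dinv.
  have d2 := is_derive1_comp (is_derive_expR _) (is_deriveN dinv).
  have D := is_deriveM d1 d2.
  have E : forall z : R, ((fun y : R => y^-1) ^+ k : R -> R) z = z^-1 ^+ k.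
    by move=> z; elim: (k) => [|m IH]; rewrite ?expr0// !exprS -IH.
  have -> : bump k.+2 x - k%:R * bump k.+1 x = ((fun y : R => y^-1) ^+ k : R -> R) x *:
   (expR (- x^-1) * - (- x ^- 2 *: (1 : R))) +
   expR (- x^-1) *: ((k%:R * x^-1 ^+ k.-1) *: (- x ^- 2 *: (1 : R))).
    rewrite E /bump x0 /GRing.scale/= !mulr1 -!exprVn; case: (k) => [|m] /=.
      by rewrite !mul0r; ring.
    by rewrite !exprS; ring.
  apply: near_eq_is_derive D.
  near=> z; rewrite /bump ifT.
    by rewrite [LHS]/GRing.mul/= E.
  by near: z; exact: (lt_nbhsr x0).
- have -> : bump k.+2 (0 : R) - k%:R * bump k.+1 (0 : R) = 0.
    by rewrite /bump ltxx mulr0 subr0.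
  have : h^-1 *: ((bump k \o shift 0) (h *: (1 : R)) - bump k 0) @[h --> (0:R)^'] --> (0 : R).
    apply/cvgrPdist_le => e e0; near=> h.
    have -> : (bump k \o shift 0) (h *: (1 : R)) = bump k h by rewrite /= addr0 [_ *: _]mulr1.
    have -> : h^-1 *: (bump k h - bump k 0) = h^-1 * bump k h.
      by rewrite [bump k 0]/bump ltxx subr0.
    rewrite sub0r normrN.
    have [h0|h0] := ltP 0 h; last by rewrite /bump ltNge h0/= mulr0 normr0 ltW.
    have -> : h^-1 * bump k h = bump k.+1 h by rewrite /bump h0 exprS mulrA.
    rewrite ger0_norm ?bump_ge0//.
    apply: le_trans (bump_le _ (ltW h0)) _.
    have f0 : 0 < k.+2`!%:R :> R by rewrite ltr0n fact_gt0.
    rewrite mulrC -ler_pdivlMr//; apply: le_trans (ler_norm _) _.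
    near: h; apply: dnbhs0_le; exact: divr_gt0.
  move=> h; constructor; first by apply: cvgP h.
  exact/cvg_lim.
Unshelve. all: by end_near. Qed.

Lemma bump_Ck n k : Ck n (bump k).
Proof.
elim: n k => [|n IH] k; first by apply: Ck0 => x; exact: is_derive_bump.
apply: CkS; first by move=> x; exact: is_derive_bump.
rewrite (_ : (fun x => _) = (fun x => bump k.+2 x + (- k%:R) * bump k.+1 x)).
  by apply: CkD => //; apply: CkM => //; exact: Ck_cst.
by apply/funext => x; rewrite mulNr.
Qed.

Lemma testfun1P f : (forall n, Ck n f) ->
  (exists M : R, forall t : R, M < `|t| -> f t = 0) -> testfun1 f.
Proof. by move=> h1 h2; split => // n x; exact: (h1 n). Qed.

Lemma testfun1_Ck n f : testfun1 f -> Ck n f.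
Proof. by move=> [h _] k x _; exact: h. Qed.

Lemma derive1_supp f (M : R) : (forall t : R, M < `|t| -> f t = 0) ->
  forall t : R, M < `|t| -> f^`()%classic t = 0.
Proof.
move=> h t Mt.
have D := is_derive_cst (0 : R) t (1 : R).
have : is_derive t (1 : R) f 0.
  apply: near_eq_is_derive D; near=> z; rewrite h//.
  near: z; exact: (cvgr_gt _ (@norm_continuous _ _ t)).
by rewrite derive1E => -[].
Unshelve. all: by end_near. Qed.

Lemma testfun1_derive1 f : testfun1 f -> testfun1 f^`()%classic.
Proof.
move=> tf; apply: testfun1P.
  by move=> n; apply: Ck_derive1; exact: testfun1_Ck.
by have [_ [M HM]] := tf; exists M; exact: derive1_supp.
Qed.

Lemma testfun1_is_derive f (x : R) : testfun1 f ->
  is_derive x (1 : R) f (f^`()%classic x).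
Proof. by move=> tf; apply: (@Ck_derivable 0); exact: testfun1_Ck. Qed.

Lemma testfun1_continuous f : testfun1 f -> continuous f.
Proof. move=> tf; apply: is_derive_continuous => x; exact: testfun1_is_derive. Qed.

Lemma testfun1D f g : testfun1 f -> testfun1 g -> testfun1 (fun x => f x + g x).
Proof.
move=> tf tg; apply: testfun1P; first by move=> n; apply: CkD; exact: testfun1_Ck.
have [_ [M HM]] := tf; have [_ [N HN]] := tg.
exists (Num.max M N) => t; rewrite gt_max => /andP[/HM -> /HN ->].
by rewrite addr0.
Qed.

Lemma testfun1Z (c : R) f : testfun1 f -> testfun1 (fun x => c * f x).
Proof.
move=> tf; apply: testfun1P.
  by move=> n; apply: CkM; [exact: Ck_cst|exact: testfun1_Ck].
by have [_ [M HM]] := tf; exists M => t /HM ->; rewrite mulr0.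
Qed.

Lemma testfun1_shift (c : R) f : testfun1 f -> testfun1 (fun x => f (x + c)).
Proof.
move=> tf; apply: testfun1P.
  move=> n; have := Ck_affine (a := 1) (b := c) (testfun1_Ck (n := n) tf).
  by rewrite (_ : (fun x => f (1 * x + c)) = (fun x => f (x + c)))//; apply/funext => x; rewrite mul1r.
have [_ [M HM]] := tf; exists (M + `|c|) => t Mt; apply: HM.
have := ler_normB (t + c) c; rewrite addrK; lra.
Qed.

(** Smooth substitutes for the indicator of []a, b[]: [bump 0] at [n.+1%:R * y] is the exponential
    of [- (n.+1%:R * y)^-1] and tends to 1 for every [y > 0]. The arguments are written as affine
    functions of [x] to fit [Ck_affine]. *)
Definition step (a b : R) n (x : R) : R :=
  bump 0 (n.+1%:R * x + - n.+1%:R * a) * bump 0 (- n.+1%:R * x + n.+1%:R * b).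

Lemma bump0_le1 (x : R) : bump 0 x <= 1.
Proof.
rewrite /bump; case: ifP => // x0; rewrite expr0 mul1r.
by rewrite -[leRHS]expR0 ler_expR oppr_le0 invr_ge0 ltW.
Qed.

Lemma bump0_gt0 (x : R) : 0 < x -> 0 < bump 0 x.
Proof. by move=> x0; rewrite /bump x0 expr0 mul1r expR_gt0. Qed.

Lemma step_ge0 a b n x : 0 <= step a b n x.
Proof. by rewrite mulr_ge0// bump_ge0. Qed.

Lemma step_le1 a b n x : step a b n x <= 1.
Proof. by rewrite mulr_ile1// ?bump_ge0// bump0_le1. Qed.

Lemma step_supp a b n x : ~~ (a < x < b) -> step a b n x = 0.
Proof.
have n0 : 0 <= n.+1%:R :> R by exact: ler0n.
rewrite /step negb_and -!leNgt => /orP[xa|bx].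
  rewrite {1}/bump ltNge mulNr -mulrBr mulr_ge0_le0 ?mul0r//; lra.
have -> : - n.+1%:R * x + n.+1%:R * b = n.+1%:R * (b - x) by ring.
by rewrite {2}/bump ltNge mulr_ge0_le0 ?mulr0//; lra.
Qed.

Lemma testfun1_step a b n : testfun1 (step a b n).
Proof.
apply: testfun1P.
  by move=> k; apply: CkM; apply: Ck_affine; exact: bump_Ck.
exists (`|a| + `|b|) => t Mt; apply: step_supp.
apply/negP => /andP[at_ tb]; move: Mt; apply/negP; rewrite -leNgt ler_norml.
have := ler_norm b; have := ler_norm (- a); rewrite normrN.
have := normr_ge0 a; have := normr_ge0 b; lra.
Qed.

Lemma step_cvg a b x : step a b n x @[n --> \oo] --> (if a < x < b then 1 else 0 : R).
Proof.
case: ifPn => [/andP[ax xb]|h]; last first.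
  by under eq_fun do rewrite (step_supp _ h); exact: cvg_cst.
have key (y : R) : 0 < y -> bump 0 (n.+1%:R * y) @[n --> \oo] --> (1 : R).
  move=> y0.
  have -> : (fun n => bump 0 (n.+1%:R * y)) = (fun n => expR (- (harmonic n * y^-1))).
    by apply/funext => n; rewrite /bump expr0 mul1r mulr_gt0// invfM.
  have -> : 1 = expR (- (0 * y^-1)) :> R by rewrite mul0r oppr0 expR0.
  apply: (@cvg_comp _ _ _ (fun n : nat => - (harmonic n * y^-1)) expR); last exact: continuous_expR.
  by apply: cvgN; apply: cvgM; [exact: cvg_harmonic|exact: cvg_cst].
rewrite -[X in _ --> X]mul1r; apply: cvgM.
  by under eq_fun do rewrite mulNr -mulrBr; apply: key; lra.
by under eq_fun do rewrite mulNr addrC -mulrBr; apply: key; lra.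
Qed.

Lemma is_derive_slice1 (p : R * R -> R) (t y l : R) :
  is_derive (t, y) (@e1 R) p l <-> is_derive t (1 : R) (fun s => p (s, y)) l.
Proof.
rewrite is_derive_lineP [X in _ <-> X]is_derive_lineP.
rewrite (_ : (fun h : R => p (h *: (@e1 R) + (t, y))) = (fun h : R => p (h *: (1 : R) + t, y)))//.
apply/funext => h; congr p; congr pair.
by rewrite /e1/= [h *: 0]mulr0 add0r.
Qed.

Lemma is_derive_swap (p : R * R -> R) (x v : R * R) (l : R) :
  is_derive x v (p \o @swap R R) l <-> is_derive (swap x) (swap v) p l.
Proof. by rewrite is_derive_lineP [X in _ <-> X]is_derive_lineP. Qed.

Lemma derive_is_derive (p : R * R -> R) (x v : R * R) : derivable p x v ->
  is_derive x v p ('D_v p x).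
Proof. exact: derivableP. Qed.

Lemma is_deriveE (p : R * R -> R) v q : (forall x, is_derive x v p (q x)) ->
  'D_v p = q.
Proof. by move=> h; apply/funext => x; case: (h x). Qed.

Lemma testfun2_swap (p : R * R -> R) : testfun2 p -> testfun2 (p \o @swap R R).
Proof.
move=> [d1 [c1 [M HM]]].
have E s : Dseq s (p \o @swap R R) = Dseq (map (@swap R R) s) p \o @swap R R.
  elim: s => //= v s ->; apply: is_deriveE => x.
  by apply/is_derive_swap/derive_is_derive/d1.
split; [|split].
- move=> s v x; rewrite E.
  by have [] := (is_derive_swap _ x v _).2 (derive_is_derive (d1 (map (@swap R R) s) (swap v) (swap x))).
- by move=> s; rewrite E => x; apply: continuous_comp; [exact: swap_continuous|exact: c1].
- by exists M => x h; apply: HM; case: h; [right|left].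
Qed.

Lemma testfun2_slice (p : R * R -> R) (y : R) : testfun2 p ->
  testfun1 (fun t => p (t, y)) /\
  forall t, (fun t => p (t, y))^`()%classic t = 'D_(@e1 R) p (t, y).
Proof.
move=> [d1 [c1 [M HM]]].
have D n (x : R) : is_derive x (1 : R) (fun t => Dseq (nseq n (@e1 R)) p (t, y))
  (Dseq (nseq n.+1 (@e1 R)) p (x, y)).
  by apply/is_derive_slice1; apply: derive_is_derive; exact: d1.
have E n : iter n (@derive1 R R) (fun t => p (t, y)) = (fun t => Dseq (nseq n (@e1 R)) p (t, y)).
  by elim: n => // n IH; rewrite iterS IH; apply: derive1_is_derive => x; exact: D.
split; last by move=> t; rewrite (derive1_is_derive (D 0%N)).
split; first by move=> n x; rewrite E; case: (D n x).
by exists M => t Mt; apply: HM; left.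
Qed.

Section tensor.
Variables (f g : R -> R) (tf : testfun1 f) (tg : testfun1 g).

Lemma is_derive_tensor (x v : R * R) : is_derive x v (fun x : R * R => f x.1 * g x.2 : R)
  (v.1 * f^`()%classic x.1 * g x.2 + v.2 * f x.1 * g^`()%classic x.2).
Proof.
apply/is_derive_lineP.
have A (a b : R) (k : R -> R) : testfun1 k ->
    is_derive (0 : R) (1 : R) (fun h : R => k (h * a + b)) (a * k^`()%classic b).
  move=> tk.
  have -> : (fun h : R => k (h * a + b)) = (fun h => k (a * h + b)).
    by apply/funext => h; rewrite mulrC.
  have := @is_derive_affine k (k^`()%classic b) a b 0.
  by rewrite mulr0 add0r; apply; exact: testfun1_is_derive.
have D := is_deriveM (A v.1 x.1 f tf) (A v.2 x.2 g tg).
apply: is_derive_eq D _.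
by rewrite !mul0r !add0r /GRing.scale/=; ring.
Qed.

End tensor.

(** A directional derivative of a tensor product of iterated derivatives is again a finite
    combination of such products. A list of triples (coefficient, order in [f], order in [g])
    records a combination, and this form is stable under differentiation. *)
Lemma testfun2_tensor f g : testfun1 f -> testfun1 g ->
  testfun2 (fun x : R * R => f x.1 * g x.2).
Proof.
move=> tf tg.
have fi i : testfun1 (iter i (@derive1 R R) f).
  by elim: i => //= i; exact: testfun1_derive1.
have gi i : testfun1 (iter i (@derive1 R R) g).
  by elim: i => //= i; exact: testfun1_derive1.
pose tens (L : seq (R * nat * nat)) (x : R * R) : R :=
  \sum_(c <- L) c.1.1 * (iter c.1.2 (@derive1 R R) f x.1 * iter c.2 (@derive1 R R) g x.2).
have D L v : exists L', forall x, is_derive x v (tens L) (tens L' x).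
  elim: L => [|[[c i] j] L [L' IH]].
    exists [::] => x; rewrite /tens.
    under eq_fun do rewrite big_nil.
    by rewrite big_nil; exact: is_derive_cst.
  exists [:: (c * v.1, i.+1, j), (c * v.2, i, j.+1) & L'] => x; rewrite /tens.
  have -> : (fun x : R * R => \sum_(c <- (c, i, j) :: L)
      c.1.1 * (iter c.1.2 (@derive1 R R) f x.1 * iter c.2 (@derive1 R R) g x.2)) =
    (fun x => c * (iter i (@derive1 R R) f x.1 * iter j (@derive1 R R) g x.2)  + tens L x).
    by apply/funext => z; rewrite big_cons.
  have D := is_deriveD (is_deriveZ c (is_derive_tensor (fi i) (gi j) x v)) (IH x).
  apply: is_derive_eq D _.
  by rewrite !big_cons /= /GRing.scale/=; rewrite /tens; ring.
have E s : exists L, Dseq s (fun x : R * R => f x.1 * g x.2) = tens L.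
  elim: s => [|v s [L IH]].
    exists [:: (1, 0%N, 0%N)]; apply/funext => x.
    by rewrite /tens big_cons big_nil addr0/= mul1r.
  have [L' HL] := D L v; exists L' => /=; rewrite IH; exact: is_deriveE.
split; [|split].
- move=> s v x; have [L ->] := E s; have [L' HL] := D L v; by case: (HL x).
- move=> s; have [L ->] := E s; elim: L => [|[[c i] j] L IH] x.
    by rewrite /tens; under eq_fun do rewrite big_nil; exact: cvg_cst.
  rewrite /tens; under eq_fun do rewrite big_cons.
  apply: cvgD; last exact: IH.
  apply: cvgM; first exact: cvg_cst.
  apply: cvgM.
    by apply: (@continuous_comp _ _ _ fst); [exact: cvg_fst|exact: testfun1_continuous].
  by apply: (@continuous_comp _ _ _ snd); [exact: cvg_snd|exact: testfun1_continuous].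
- have [_ [M HM]] := tf; have [_ [N HN]] := tg.
  exists (Num.max M N) => x; rewrite !gt_max => -[/andP[/HM -> _]|/andP[_ /HN ->]];
    by rewrite ?mul0r ?mulr0.
Qed.

Lemma derive_tensor1 f g (x : R * R) : testfun1 f -> testfun1 g ->
  'D_(@e1 R) (fun x : R * R => f x.1 * g x.2) x = f^`()%classic x.1 * g x.2.
Proof.
move=> tf tg; have [_ ->] := is_derive_tensor tf tg x (@e1 R).
by rewrite /e1/= mul1r mul0r mul0r addr0.
Qed.

Notation mu := (@lebesgue_measure R).

Lemma prim_ibp y g f : prim y g -> testfun1 f ->
  [/\ mu.-integrable setT (EFin \o (fun t => y t * f^`()%classic t)),
   mu.-integrable setT (EFin \o (fun t => g t * f t)) &
  \int[mu]_t (y t * f^`()%classic t) = - \int[mu]_t (g t * f t)].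
Proof.
move=> H tf.
have [_ [M HM]] := tf.
have cf := testfun1_continuous tf.
have cf' := testfun1_continuous (testfun1_derive1 tf).
have HM' := derive1_supp HM.
(* [N] exceeds [M] strictly, so [f] vanishes at both ends of [[- N, N]] and the product rule leaves
   no boundary term; the absolute value makes [N] positive even for negative [M]. *)
pose N := `|M| + 1.
have MN : M < N by have := ler_norm M; rewrite /N; lra.
have N0 : 0 < N by have := normr_ge0 M; rewrite /N; lra.
have nin t : ~ `[- N, N]%classic t -> M < `|t|.
  rewrite /= in_itv/= -ler_norml => /negP; rewrite -ltNge; exact: lt_trans.
have K := prim_mul H (prim_is_derive (fun x => testfun1_is_derive x tf) cf').
have [_ e] := K (- N) N ltac:(lra).
have [ig _] := H (- N) N ltac:(lra).
have i1 : mu.-integrable `[-N, N] (EFin \o (fun t => y t * f^`()%classic t)).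
  apply: continuous_itv_integrable => x; apply: continuousM; first exact: prim_continuous H x.
  exact: cf'.
have i2 : mu.-integrable `[-N, N] (EFin \o (fun t => g t * f t)).
  have -> : (fun t => g t * f t) = (fun t => f t * g t) by apply/funext => t; rewrite mulrC.
  exact: continuous_mul_integrable.
have s1 t : ~ `[- N, N]%classic t -> y t * f^`()%classic t = 0.
  by move=> /nin /HM' ->; rewrite mulr0.
have s2 t : ~ `[- N, N]%classic t -> g t * f t = 0.
  by move=> /nin /HM ->; rewrite mulr0.
split; [exact: integrable_supp i1|exact: integrable_supp i2|].
rewrite -(Rintegral_supp s1) -(Rintegral_supp s2).
move: e; rewrite (HM N) ?(HM (- N)) ?normrN ?gtr0_norm// !mulr0 subr0.
under eq_Rintegral do rewrite [f _ * _]mulrC.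
by rewrite RintegralD// => /esym/eqP; rewrite addr_eq0 => /eqP.
Qed.

End smooth.

(** * Fubini and Tonelli for real-valued functions, and properties of almost every slice *)

Section product_measure_tools.
Context {R : realType}.
Notation mu := (@lebesgue_measure R).
Notation mu2 := (@mu2 R).
Implicit Types (f g h : R * R -> R) (A B : set R).

Lemma measurable_slice1 f (y : R) : measurable_fun setT f ->
  measurable_fun setT (fun x => f (x, y)).
Proof. by move=> mf; apply: (measurableT_comp mf); exact: pair2_measurable. Qed.

Lemma measurable_slice2 f (x : R) : measurable_fun setT f ->
  measurable_fun setT (fun y => f (x, y)).
Proof. by move=> mf; apply: (measurableT_comp mf); exact: pair1_measurable. Qed.

Lemma ae_integral_eq0 d (T : measurableType d) (m : {measure set T -> \bar R})
  (F : T -> \bar R) : measurable_fun setT F -> (forall x, 0 <= F x)%E ->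
  (\int[m]_x F x = 0)%E -> {ae m, forall x, F x = 0%E}.
Proof.
move=> mF F0 h.
have : ae_eq m setT F (cst 0%E).
  apply/ae_eq_integral_abs => //.
  by rewrite -h; apply: eq_integral => x _; rewrite gee0_abs.
by apply: aeS => x; exact.
Qed.

Lemma integral_ae_eq0 d (T : measurableType d) (m : {measure set T -> \bar R})
  (F : T -> \bar R) : measurable_fun setT F -> 
  {ae m, forall x, F x = 0%E} -> (\int[m]_x F x = 0)%E.
Proof.
move=> mF h; rewrite (@ae_eq_integral _ _ _ m setT (cst 0%E))//.
  by rewrite integral0.
by apply: aeS h.
Qed.

(** Tonelli applied to the indicator of a null set that contains the exceptional points. *)
Lemma ae_slices (P : R * R -> Prop) : {ae mu2, forall x, P x} ->
  {ae mu, forall x, {ae mu, forall y, P (x, y)}} /\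
  {ae mu, forall y, {ae mu, forall x, P (x, y)}}.
Proof.
move=> [N [mN N0 PN]].
pose F (x : R * R) : \bar R := (\1_N x)%:E.
have mF : measurable_fun setT F by apply/measurable_EFinP; exact: measurable_indic.
have F0 x : (0 <= F x)%E by rewrite lee_fin.
have iF : (\int[mu2]_x F x = 0)%E by rewrite integral_indic// setIT.
have NP x : F x = 0%E -> P x.
  rewrite /F indicE; case: (boolP (x \in N)) => [_ [] /eqP|xN _].
    by rewrite oner_eq0.
  apply: contrapT => nP; move/negP: xN; apply; rewrite inE; exact: PN.
split.
- have := fubini_tonelli1 (m1 := mu) (m2 := mu) F mF F0.
  rewrite [LHS]iF => /esym h.
  have := @ae_integral_eq0 _ _ mu _ (measurable_fun_fubini_tonelli_F (m2 := mu) F mF F0) _ h.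
  have FF x : (0 <= fubini_F mu F x)%E by apply: integral_ge0 => y _; exact: F0.
  move=> /(_ FF)/aeS; apply => x hx; apply: aeS (@ae_integral_eq0 _ _ mu _ _ _ hx) => //.
  by move=> y; exact: NP.
  exact: (measurableT_comp mF (pair1_measurable x)).
- have := fubini_tonelli2 (m1 := mu) (m2 := mu) F mF F0.
  rewrite [LHS]iF => /esym h.
  have := @ae_integral_eq0 _ _ mu _ (measurable_fun_fubini_tonelli_G (m1 := mu) F mF F0) _ h.
  have FF y : (0 <= fubini_G mu F y)%E by apply: integral_ge0 => x _; exact: F0.
  move=> /(_ FF)/aeS; apply => y hy; apply: aeS (@ae_integral_eq0 _ _ mu _ _ _ hy) => //.
  by move=> x; exact: NP.
  exact: (measurableT_comp mF (pair2_measurable y)).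
Qed.

Lemma ae_slices1 (P : R * R -> Prop) : {ae mu2, forall x, P x} ->
  {ae mu, forall x, {ae mu, forall y, P (x, y)}}.
Proof. by case/ae_slices. Qed.

Lemma ae_slices2 (P : R * R -> Prop) : {ae mu2, forall x, P x} ->
  {ae mu, forall y, {ae mu, forall x, P (x, y)}}.
Proof. by case/ae_slices. Qed.

(** Restricted to equalities of measurable functions, so that Tonelli applies to [|f - g|]; a set
    that is merely null on slices would not be known to be measurable. *)
Lemma ae_of_slices1 f g : measurable_fun setT f -> measurable_fun setT g ->
  {ae mu, forall x, {ae mu, forall y, f (x, y) = g (x, y)}} ->
  {ae mu2, forall x, f x = g x}.
Proof.
move=> mf mg h.
pose F (x : R * R) : \bar R := (`|f x - g x|)%:E.
have mF : measurable_fun setT F.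
  by apply/measurable_EFinP; apply: measurableT_comp => //; exact: measurable_funB.
have F0 x : (0 <= F x)%E by rewrite lee_fin.
have : (\int[mu2]_x F x = 0)%E.
  rewrite [LHS](fubini_tonelli1 (m1 := mu) (m2 := mu) F mF F0).
  apply: integral_ae_eq0; first exact: (measurable_fun_fubini_tonelli_F (m2 := mu) F mF F0).
  apply: aeS h => x hx; apply: integral_ae_eq0.
    exact: (measurableT_comp mF (pair1_measurable x)).
  by apply: aeS hx => y; rewrite /F => ->; rewrite subrr normr0.
move=> h0; apply: aeS (@ae_integral_eq0 _ _ mu2 _ mF F0 h0) => x [] /eqP.
by rewrite normr_eq0 subr_eq0 => /eqP.
Qed.

Lemma integrable_patch d (T : measurableType d) (m : {measure set T -> \bar R})
  (D : set T) (F : T -> R) : measurable D -> m.-integrable D (EFin \o F) <->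
  m.-integrable setT (EFin \o (F \_ D)).
Proof. by move=> mD; rewrite -restrict_EFin; exact: integrable_mkcond. Qed.

Lemma measurable_patch d (T : measurableType d) 
  (D : set T) (F : T -> R) : measurable D -> measurable_fun D F <->
  measurable_fun setT (F \_ D).
Proof. by move=> mD; exact: measurable_restrictT. Qed.

Lemma patch_setX f A B x y :
  (f \_ (A `*` B)) (x, y) = if x \in A then ((fun y => f (x, y)) \_ B) y else 0.
Proof.
rewrite !patchE in_setX/=; by case: (x \in A); case: (y \in B).
Qed.

Lemma ae_eq_integrable d (T : measurableType d) (m : {measure set T -> \bar R})
  (F G : T -> \bar R) : measurable_fun setT G -> {ae m, forall x, F x = G x} ->
  m.-integrable setT F -> m.-integrable setT G.
Proof.
move=> mG h /integrableP[mF iF]; apply/integrableP; split => //.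
rewrite (@ae_eq_integral _ _ _ m setT (abse \o F))//.
- exact: measurableT_comp.
- exact: measurableT_comp.
- by apply: aeS h => x /= ->.
Qed.

Lemma RFubiniT f : mu2.-integrable setT (EFin \o f) ->
  [/\ {ae mu, forall x, mu.-integrable setT (EFin \o (fun y => f (x, y)))},
   mu.-integrable setT (EFin \o (fun x => \int[mu]_y f (x, y))) &
   \int[mu2]_x f x = \int[mu]_x \int[mu]_y f (x, y)].
Proof.
move=> iF.
have h1 := ae_integrable1 (m1 := mu) (m2 := mu) iF.
have h2 := integrable_fubini_F (m1 := mu) (m2 := mu) iF.
have h3 := integral12_prod_meas1 (m1 := mu) (m2 := mu) iF.
have e : {ae mu, forall x, fubini_F mu (EFin \o f) x = (\int[mu]_y f (x, y))%:E}.
  apply: aeS h1 => x ix; rewrite /Rintegral fineK//; exact: integrable_fin_num ix.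
have me := measurable_int _ h2.
have E (x : R) : (\int[mu]_y f (x, y))%:E = (fine (fubini_F mu (EFin \o f) x))%:E by [].
have mm : measurable_fun setT (EFin \o (fun x => \int[mu]_y f (x, y))).
  by apply/measurable_EFinP; exact: measurableT_comp.
split => //.
- exact: ae_eq_integrable e h2.
- rewrite /Rintegral -[in LHS]h3; congr fine.
  apply: ae_eq_integral => //; by apply: aeS e.
Qed.

Lemma integrable_swapT f : mu2.-integrable setT (EFin \o f) ->
  mu2.-integrable setT (EFin \o (f \o @swap R R)).
Proof.
move=> iF; have mF := measurable_int _ iF.
have mG : measurable_fun setT (EFin \o (f \o @swap R R)).
  exact: (measurableT_comp mF (@measurable_swap _ _ _ _)).
apply/(integrable12ltyP mu mu mG).
by have /(integrable21ltyP mu mu mF) := iF.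
Qed.

Lemma Rintegral_swapT f : mu2.-integrable setT (EFin \o f) ->
  \int[mu2]_x f (swap x) = \int[mu2]_x f x.
Proof.
move=> iF; have iG := integrable_swapT iF.
have e1 := integral12_prod_meas1 (m1 := mu) (m2 := mu) iG.
have e2 := integral21_prod_meas1 (m1 := mu) (m2 := mu) iF.
by rewrite /Rintegral; congr fine; rewrite -[LHS]e1 -[RHS]e2.
Qed.

Lemma patch_swap f A B : (f \o @swap R R) \_ (B `*` A) = (f \_ (A `*` B)) \o @swap R R.
Proof. by apply/funext => -[x y] /=; rewrite !patchE !in_setX/= andbC. Qed.

Lemma RFubini f A B : measurable A -> measurable B ->
  mu2.-integrable (A `*` B) (EFin \o f) ->
  [/\ {ae mu, forall x, A x -> mu.-integrable B (EFin \o (fun y => f (x, y)))},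
   mu.-integrable A (EFin \o (fun x => \int[mu]_(y in B) f (x, y))) &
   \int[mu2]_(x in A `*` B) f x = \int[mu]_(x in A) \int[mu]_(y in B) f (x, y)].
Proof.
move=> mA mB /integrable_patch => /(_ (measurableX mA mB)) iF.
have [h1 h2 h3] := RFubiniT iF.
have E x : \int[mu]_y (f \_ (A `*` B)) (x, y) = ((fun x => \int[mu]_(y in B) f (x, y)) \_ A) x.
  under eq_Rintegral do rewrite patch_setX.
  rewrite patchE; case: ifP => _; first by rewrite -Rintegral_mkcond.
  by rewrite /Rintegral integral0.
split.
- apply: aeS h1 => x + Ax.
  under eq_fun do rewrite /= patch_setX mem_set//=.
  by move=> h; apply/integrable_patch.
- apply/integrable_patch => //; move: h2.
  by congr (_.-integrable _ _); apply/funext => x /=; rewrite E.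
- rewrite Rintegral_mkcond h3 [RHS]Rintegral_mkcond.
  by apply: eq_Rintegral => x _; rewrite E.
Qed.

Lemma RFubini' f A B : measurable A -> measurable B ->
  mu2.-integrable (A `*` B) (EFin \o f) ->
  [/\ {ae mu, forall y, B y -> mu.-integrable A (EFin \o (fun x => f (x, y)))},
   mu.-integrable B (EFin \o (fun y => \int[mu]_(x in A) f (x, y))) &
   \int[mu2]_(x in A `*` B) f x = \int[mu]_(y in B) \int[mu]_(x in A) f (x, y)].
Proof.
move=> mA mB iF0.
have iF : mu2.-integrable setT (EFin \o (f \_ (A `*` B))).
  exact: (@integrable_patch _ _ mu2 _ f (measurableX mA mB)).1 iF0.
have iG : mu2.-integrable (B `*` A) (EFin \o (f \o @swap R R)).
  apply: (@integrable_patch _ _ mu2 _ _ (measurableX mB mA)).2.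
  by rewrite patch_swap; exact: integrable_swapT.
have [h1 h2 h3] := RFubini mB mA iG.
split => //.
rewrite -[RHS]h3 Rintegral_mkcond [RHS]Rintegral_mkcond patch_swap.
by rewrite -[LHS]Rintegral_swapT.
Qed.

(** Positive and negative parts are integrated separately by Tonelli. Slices with a divergent
    integral are thereby covered, [fine] sending infinite values to 0. *)
Lemma measurable_Rintegral_param d (T : measurableType d) (k : T * R -> R) :
  measurable_fun setT k -> measurable_fun setT (fun x => \int[mu]_y k (x, y)).
Proof.
move=> mk; rewrite /Rintegral.
apply: (measurableT_comp (fine_measurable _)) => //.
under eq_fun do rewrite integralE.
have mk' : measurable_fun setT (EFin \o k) by exact/measurable_EFinP.
apply: emeasurable_funB.
- have mp := measurable_funepos mk'.
  have := measurable_fun_fubini_tonelli_F (m2 := mu) _ mp (fun x => funepos_ge0 _ x).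
  congr measurable_fun; apply/funext => x; apply: eq_integral => y _.
  by rewrite ?funeposE ?funenegE.
- have mn := measurable_funeneg mk'.
  have := measurable_fun_fubini_tonelli_F (m2 := mu) _ mn (fun x => funeneg_ge0 _ x).
  congr measurable_fun; apply/funext => x; apply: eq_integral => y _.
  by rewrite ?funeposE ?funenegE.
Qed.

Lemma prim_cst_ae0 (c : R) (g : R -> R) : measurable_fun setT g ->
  prim (fun=> c) g -> {ae mu, forall x, g x = 0}.
Proof.
move=> mg H; apply: aeS (prim_derive_ae mg H) => x [_ <-].
by have [] := is_derive_cst c x (1 : R).
Qed.

Lemma Rintegral_oo (g : R -> R) (s t : R) : mu.-integrable `[s, t] (EFin \o g) ->
  \int[mu]_(x in `]s, t[) g x = \int[mu]_(x in `[s, t]) g x.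
Proof.
move=> ig.
rewrite (@Rintegral_itv_bndo_bndc _ (BRight s)); last first.
  by apply: integrableS ig => //; apply: subset_itv; rewrite bnd_simp.
by rewrite Rintegral_itv_obnd_cbnd//; apply: integrableS ig => //; apply: subset_itv; rewrite bnd_simp.
Qed.

(** The primitive vanishes at the rationals, hence everywhere by continuity, so its density is zero.
    Rational endpoints keep the number of conditions countable, which matters when each of them
    holds only almost everywhere in a parameter. *)
Lemma integrals_eq0_ae0 (g : R -> R) : measurable_fun setT g ->
  (forall s t, mu.-integrable `[s, t] (EFin \o g)) ->
  (forall q q' : rat, \int[mu]_(x in `[ratr q, ratr q']) g x = 0) ->
  {ae mu, forall x, g x = 0}.
Proof.
move=> mg ig h; have H := prim_sint ig.
apply: (@prim_cst_ae0 0) => //; apply: (prim_ext _ _ H) => // x.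
have cs := prim_continuous H.
have sq q : sint g (ratr q) = 0.
  by rewrite /sint; have := h 0 q; have := h q 0; rewrite rmorph0 => -> ->; rewrite subrr.
apply/eqP; rewrite -normr_le0; apply/ler_addgt0Pl => e e0; rewrite addr0.
have /cvgrPdist_lt /(_ _ e0)[d /= d0 Hd] := cs x.
have : x < x + d by rewrite ltrDl.
move=> /rat_in_itvoo[q]; rewrite in_itv/= => /andP[xq qx].
have := Hd (ratr q); rewrite /ball_/= sq subr0 => h'; apply/ltW/h'.
by rewrite ltr0_norm ?subr_lt0// opprB ltrBlDl.
Qed.

End product_measure_tools.

(** * Weak derivatives along lines *)

Section weak_lines.
Context {R : realType}.
Notation mu := (@lebesgue_measure R).
Notation mu2 := (@mu2 R).
Implicit Types (f g h : R * R -> R) (A B : set R).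

Lemma ae_count (I : countType) d (T : measurableType d) (m : {measure set T -> \bar R})
  (P : I -> T -> Prop) : (forall i, {ae m, forall x, P i x}) ->
  {ae m, forall x, forall i, P i x}.
Proof.
move=> h.
have : {ae m, forall x, forall n, if unpickle n is Some i then P i x else True}.
  by apply: ae_nat => n; case: (unpickle n) => [i|]; [exact: h|exact: aeT].
by apply: aeS => x hx i; have := hx (pickle i); rewrite pickleK.
Qed.

Lemma Rdominated_cvg d (T : measurableType d) (m : {measure set T -> \bar R})
  (D : set T) (fn : nat -> T -> R) (f g : T -> R) : measurable D ->
  (forall n, measurable_fun D (fn n)) -> measurable_fun D f ->
  (forall x, D x -> fn n x @[n --> \oo] --> f x) ->
  m.-integrable D (EFin \o g) ->
  (forall n x, D x -> `|fn n x| <= g x) ->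
  m.-integrable D (EFin \o f) /\
  \int[m]_(x in D) fn n x @[n --> \oo] --> \int[m]_(x in D) f x.
Proof.
move=> mD mfn mf cv ig dom.
have iF : m.-integrable D (EFin \o f).
  apply: le_integrable ig => //; first exact/measurable_EFinP.
  move=> x Dx /=; rewrite lee_fin (le_trans _ (ler_norm _))//.
  apply: (ler_cvg_to (cvg_norm (cv x Dx)) (cvg_cst (g x))).
  by apply: nearW => n /=; exact: dom.
split => //.
apply: fine_cvg; rewrite fineK; last exact: integrable_fin_num iF.
apply: (@dominated_cvg _ _ _ m D mD (fun n => EFin \o fn n) (EFin \o f) (EFin \o g)) => //.
- by move=> n; exact/measurable_EFinP.
- by move=> x Dx; apply: cvg_EFin; [exact: nearW|exact: cv].
Qed.

Lemma subsetX (A A' B B' : set R) : A `<=` A' -> B `<=` B' -> A `*` B `<=` A' `*` B'.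
Proof. by move=> h1 h2 [x y] [/= /h1 ? /h2 ?]. Qed.

Lemma boxE (M : R) : [set x : R * R | `|x.1| <= M /\ `|x.2| <= M] =
  `[- M, M]%classic `*` `[- M, M]%classic.
Proof.
by apply/seteqP; split => -[x y] /=; rewrite !in_itv/= -!ler_norml.
Qed.

Lemma measurable_itvX (a b c d : R) : measurable (`[a, b]%classic `*` `[c, d]%classic : set (R * R)).
Proof. exact: measurableX. Qed.

Lemma L1loc2_box f (a b c d : R) : L1loc2 f ->
  mu2.-integrable (`[a, b] `*` `[c, d]) (EFin \o f).
Proof.
move=> h.
pose M := `|a| + `|b| + (`|c| + `|d|).
have := h M; rewrite boxE; apply: integrableS; [exact: measurable_itvX..|].
move=> [x y] /= []; rewrite !in_itv/= => /andP[ax xb] /andP[cy yd].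
have := ler_norm (- a); have := ler_norm b; have := ler_norm (- c); have := ler_norm d.
rewrite !normrN /M => *.
have := normr_ge0 a; have := normr_ge0 b; have := normr_ge0 c; have := normr_ge0 d => *.
by split; apply/andP; split; lra.
Qed.

Lemma L1loc2P f : (forall M : R, mu2.-integrable (`[- M, M] `*` `[- M, M]) (EFin \o f)) ->
  L1loc2 f.
Proof. by move=> h M; rewrite boxE. Qed.

Lemma bigcup_box : \bigcup_n (`[- n%:R, n%:R]%classic `*` `[- n%:R, n%:R]%classic) = [set: R * R].
Proof.
apply/seteqP; split => // -[x y] _.
have [n hn] : exists n : nat, `|x| + `|y| < n%:R.
  exists (Num.truncn (`|x| + `|y|)).+1.
  by apply: truncnS_gt.
exists n => //=; rewrite !in_itv/= -!ler_norml.
by have := normr_ge0 x; have := normr_ge0 y; split; lra.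
Qed.

Lemma measurable_L1loc2 f : L1loc2 f -> measurable_fun setT f.
Proof.
move=> h; rewrite -bigcup_box.
apply/measurable_fun_bigcup => [n|n]; first exact: measurable_itvX.
by have /integrableP[/measurable_EFinP] := L1loc2_box (- n%:R) n%:R (- n%:R) n%:R h.
Qed.

Lemma itv_nat (s t : R) : exists n : nat, - n%:R <= s /\ t <= n%:R.
Proof.
exists (Num.truncn (`|s| + `|t|)).+1.
have h : `|s| + `|t| < (Num.truncn (`|s| + `|t|)).+1%:R by apply: truncnS_gt.
have := normr_ge0 s; have := normr_ge0 t.
have := ler_norm (- s); have := ler_norm t; rewrite normrN; split; lra.
Qed.

(** One null set serves all intervals because only the countably many boxes of half-width [n] have
    to be treated; the half-width [n1 + n2] contains both the interval and the slice. *)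
Lemma L1loc2_slices1 f : L1loc2 f ->
  {ae mu, forall x, forall s t, mu.-integrable `[s, t] (EFin \o (fun y => f (x, y)))}.
Proof.
move=> h.
have := ae_nat (fun n => (let: And3 a _ _ := RFubini (measurable_itv `[- n%:R, n%:R]) (measurable_itv `[- n%:R, n%:R]) (L1loc2_box (- n%:R) n%:R (- n%:R) n%:R h) in a)).
apply: aeS => x hx s t.
have [n1 [s1 t1]] := itv_nat s t; have [n2 [s2 t2]] := itv_nat x x.
have := hx (n1 + n2)%N; rewrite natrD => /(_ _)/integrable_subitv; apply.
- by have := ler0n R n2; lra.
- by have := ler0n R n2; lra.
- by rewrite /= in_itv/=; have := ler0n R n1; have := ler0n R n2; lra.
Qed.

Lemma L1loc2_slices2 f : L1loc2 f ->
  {ae mu, forall y, forall s t, mu.-integrable `[s, t] (EFin \o (fun x => f (x, y)))}.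
Proof.
move=> h.
have := ae_nat (fun n => (let: And3 a _ _ := RFubini' (measurable_itv `[- n%:R, n%:R]) (measurable_itv `[- n%:R, n%:R]) (L1loc2_box (- n%:R) n%:R (- n%:R) n%:R h) in a)).
apply: aeS => x hx s t.
have [n1 [s1 t1]] := itv_nat s t; have [n2 [s2 t2]] := itv_nat x x.
have := hx (n1 + n2)%N; rewrite natrD => /(_ _)/integrable_subitv; apply.
- by have := ler0n R n2; lra.
- by have := ler0n R n2; lra.
- by rewrite /= in_itv/=; have := ler0n R n1; have := ler0n R n2; lra.
Qed.

(** Products of [step] functions tend to the indicator of the open rectangle and are dominated by
    that of the closed one. *)
Lemma rect_eq0 h (a b c d : R) : L1loc2 h ->
  (forall p q, testfun1 p -> testfun1 q ->
    (\int[mu2]_x (h x * (p x.1 * q x.2))%:E = 0)%E) ->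
  \int[mu2]_(x in `]a, b[ `*` `]c, d[) h x = 0.
Proof.
move=> L H.
have mh := measurable_L1loc2 L.
have mD : measurable (`]a, b[%classic `*` `]c, d[%classic : set (R * R)) by apply: measurableX.
pose D := `[a, b]%classic `*` `[c, d]%classic.
have mbox : measurable (D : set (R * R)) by exact: measurable_itvX.
pose fn n (x : R * R) : R := h x * (step a b n x.1 * step c d n x.2).
have mst (s t : R) n : measurable_fun setT (step s t n).
  by apply: continuous_measurable_fun; apply: testfun1_continuous; exact: testfun1_step.
have mfn n : measurable_fun setT (fn n).
  apply: measurable_funM => //; apply: measurable_funM.
    by apply: (measurableT_comp (mst _ _ _)); exact: measurable_fst.
  by apply: (measurableT_comp (mst _ _ _)); exact: measurable_snd.
have ig : mu2.-integrable setT (EFin \o (fun x => `|(h \_ D) x|)).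
  have i1 := (@integrable_patch _ _ _ mu2 D h mbox).1 (L1loc2_box a b c d L).
  exact: (integrable_norm i1).
have cv x : fn n x @[n --> \oo] --> (h \_ (`]a, b[%classic `*` `]c, d[%classic)) x.
  have -> : (h \_ (`]a, b[%classic `*` `]c, d[%classic)) x = h x * ((if a < x.1 < b then 1 else 0) * (if c < x.2 < d then 1 else 0)).
    case: x => x y; rewrite patchE in_setX/= !mem_setE !in_itv/=.
    by case: (a < x < b); case: (c < y < d); rewrite ?mulr1 ?mulr0.
  by apply: cvgM; [exact: cvg_cst|apply: cvgM; exact: step_cvg].
have dom n x : `|fn n x| <= `|(h \_ D) x|.
  rewrite /fn patchE; case: ifPn => [_|].
    rewrite normrM ler_piMr// ger0_norm; last by apply: mulr_ge0; exact: step_ge0.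
    by apply: mulr_ile1; [exact: step_ge0|exact: step_ge0|exact: step_le1|exact: step_le1].
  case: x => x y; rewrite /D in_setX/= !mem_setE !in_itv/= negb_and => hn.
  suff -> : step a b n x * step c d n y = 0 by rewrite mulr0 normr0.
  case/orP: hn => hn.
    rewrite step_supp ?mul0r//; apply: contra hn => /andP[]; lra.
  rewrite [X in _ * X]step_supp ?mulr0//; apply: contra hn => /andP[]; lra.
have mlim : measurable_fun setT (h \_ (`]a, b[%classic `*` `]c, d[%classic)).
  by apply: (@measurable_patch _ _ _ _ _ mD).1; exact: measurable_funTS.
have [_ cvI] := @Rdominated_cvg _ _ mu2 setT _ _ _ measurableT mfn mlim (fun x _ => cv x) ig (fun n x _ => dom n x).
rewrite Rintegral_mkcond.
have E n : \int[mu2]_x fn n x = 0 by rewrite /Rintegral H//; exact: testfun1_step.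
move: cvI; rewrite (_ : (fun n => _) = fun=> 0); last by apply/funext => n; exact: E.
by move=> /(cvg_lim (@Rhausdorff R)) <-; exact: lim_cst.
Qed.

(** Two passes of the one-variable criterion. For fixed rational [c] and [d] the integral of
    [h (x, _)] over []c, d[] vanishes for almost every [x], since its integrals over rational
    intervals are integrals of [h] over rectangles; then, for almost every [x], this holds for all
    rational [c] and [d] at once, and the slice vanishes. *)
Lemma dBR2 h : L1loc2 h ->
  (forall p q, testfun1 p -> testfun1 q ->
    (\int[mu2]_x (h x * (p x.1 * q x.2))%:E = 0)%E) ->
  {ae mu2, forall x, h x = 0}.
Proof.
move=> L H.
have mh := measurable_L1loc2 L.
apply: (@ae_of_slices1 _ h (fun=> 0)) => //.
have h1 : {ae mu, forall x, forall qq : rat * rat,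
    \int[mu]_(y in `]ratr qq.1, ratr qq.2[) h (x, y) = 0}.
  apply: ae_count => -[c d] /=.
  have mco : measurable (`]ratr c, ratr d[%classic : set R) by [].
  have I s t : mu2.-integrable (`[s, t] `*` `]ratr c, ratr d[) (EFin \o h).
    apply: integrableS (L1loc2_box s t (ratr c) (ratr d) L).
    - exact: measurable_itvX.
    - exact: measurableX.
    - by apply: subsetX => //; apply: subset_itv; rewrite bnd_simp.
  apply: integrals_eq0_ae0.
  - under eq_fun do rewrite Rintegral_mkcond.
    apply: (@measurable_Rintegral_param _ _ _ (fun z => ((fun y => h (z.1, y)) \_ `]ratr c, ratr d[) z.2)).
    rewrite (_ : (fun z => _) = h \_ (setT `*` `]ratr c, ratr d[)).
      by apply: (@measurable_patch _ _ _ _ _ _).1; [exact: measurableX|exact: measurable_funTS].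
    by apply/funext => -[x y]; rewrite patch_setX in_setT.
  - by move=> s t; have [_ + _] := RFubini (measurable_itv `[s, t]) mco (I s t).
  - move=> q q'.
    have [_ i _] := RFubini (measurable_itv `[ratr q, ratr q']) mco (I (ratr q) (ratr q')).
    rewrite -Rintegral_oo//.
    have mqq : measurable (`]ratr q, ratr q'[%classic : set R) by [].
    have I' : mu2.-integrable (`]ratr q, ratr q'[ `*` `]ratr c, ratr d[) (EFin \o h).
      apply: integrableS (I (ratr q) (ratr q')).
      - exact: measurableX.
      - exact: measurableX.
      - by apply: subsetX => //; apply: subset_itv; rewrite bnd_simp.
    have [_ _ <-] := RFubini mqq mco I'.
    exact: rect_eq0.
apply: aeS (ae_and h1 (L1loc2_slices1 L)) => x [h0 ix].
apply: integrals_eq0_ae0 => //; first exact: measurable_slice2.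
by move=> q q'; rewrite -Rintegral_oo//; exact: h0 (q, q').
Qed.

Lemma testfun1_antiderivative (k : R -> R) : testfun1 k -> \int[mu]_t k t = 0 ->
  exists2 p, testfun1 p & p^`()%classic = k.
Proof.
move=> tk ik; have [_ [M HM]] := tk.
have ck := testfun1_continuous tk.
have dk := continuous_antiderivative ck.
pose N := `|M| + 1.
have MN : M < N by have := ler_norm M; rewrite /N; lra.
have N0 : 0 < N by have := normr_ge0 M; rewrite /N; lra.
have H : prim (sint k) k by apply: prim_sint => s t; exact: continuous_itv_integrable.
(* Normalised to vanish to the left of the support; the zero mean makes it vanish to the right as
   well. *)
pose p t := sint k t - sint k (- N).
have dp (x : R) : is_derive x (1 : R) p (k x).
  have := is_deriveB (dk x) (is_derive_cst (sint k (- N)) x (1 : R)).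
  by rewrite subr0.
exists p; last exact: derive1_is_derive.
apply: testfun1P.
  case=> [|n]; first exact: Ck0 dp.
  by apply: CkS dp _; exact: testfun1_Ck.
exists N => t; rewrite ltr_normr => /orP[Nt|tN]; rewrite /p.
  have [_ ->] := H (- N) t ltac:(lra).
  rewrite Rintegral_supp//= => x /negP; rewrite in_itv/= negb_and -!ltNge => hx.
  apply: HM; case/orP: hx => hx.
    by rewrite ltr_normr; apply/orP; right; lra.
  by rewrite ltr_normr; apply/orP; left; lra.
have [_ e] := H t (- N) ltac:(lra).
rewrite -opprB e /Rintegral (eq_integral (fun=> 0%E)) ?integral0 ?oppr0// => x.
rewrite inE/= in_itv/= => /andP[tx xN]; congr EFin; apply: HM.
by rewrite ltr_normr; apply/orP; right; lra.
Qed.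

Lemma ae_le_integrable d (T : measurableType d) (m : {measure set T -> \bar R})
  (D : set T) (f g : T -> R) : measurable D -> measurable_fun D f ->
  {ae m, forall x, D x -> `|f x| <= `|g x|} ->
  m.-integrable D (EFin \o g) -> m.-integrable D (EFin \o f).
Proof.
move=> mD mf h /integrableP[mg ig]; apply/integrableP; split; first exact/measurable_EFinP.
apply: le_lt_trans ig; apply: ae_ge0_le_integral => //.
- by apply: measurableT_comp => //; exact/measurable_EFinP.
- by apply: measurableT_comp => //.
Qed.

Lemma le_integrableR d (T : measurableType d) (m : {measure set T -> \bar R})
  (D : set T) (f g : T -> R) : measurable D -> measurable_fun D f ->
  (forall x, D x -> `|f x| <= `|g x|) ->
  m.-integrable D (EFin \o g) -> m.-integrable D (EFin \o f).
Proof. by move=> mD mf h; apply: ae_le_integrable => //; exact: aeT. Qed.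

Lemma integrable_bounded_mul d (T : measurableType d) (m : {measure set T -> \bar R})
  (D : set T) (f k : T -> R) (C : R) : measurable D -> measurable_fun D k ->
  (forall x, D x -> `|k x| <= C) ->
  m.-integrable D (EFin \o f) -> m.-integrable D (EFin \o (fun x => f x * k x)).
Proof.
move=> mD mk h i1; apply: le_integrableR (integrableZR mD C i1) => //.
  by apply: measurable_funM => //; have /integrableP[/measurable_EFinP] := i1.
by move=> x Dx; rewrite mulrC !normrM ler_wpM2r// (le_trans (h x Dx))// ler_norm.
Qed.

Lemma integrable_snd (k : R -> R) (a b c d : R) : mu.-integrable `[c, d] (EFin \o k) ->
  mu2.-integrable (`[a, b] `*` `[c, d]) (EFin \o (fun x => k x.2)).
Proof.
move=> ik; apply: (@integrable_patch _ _ _ mu2 _ _ (measurable_itvX a b c d)).2.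
have /integrableP[mk lk] := ik.
have mk' := (@measurable_patch _ _ _ _ _ (measurable_itv `[c, d])).1 ((measurable_EFinP _ _).1 mk).
have -> : (fun x : R * R => k x.2) \_ (`[a, b] `*` `[c, d]) =
   fun x => \1_(`[a, b]%classic) x.1 * (k \_ `[c, d]) x.2.
  apply/funext => -[x y]; rewrite patch_setX /= indicE; case: (x \in _); by rewrite ?mul1r ?mul0r.
have mF : measurable_fun setT (EFin \o (fun x : R * R => \1_(`[a, b]%classic) x.1 * (k \_ `[c, d]) x.2 : R)).
  apply/measurable_EFinP; apply: measurable_funM.
    by apply: (measurableT_comp (measurable_indic _)) => //; exact: measurable_fst.
  by apply: (measurableT_comp mk'); exact: measurable_snd.
apply/(integrable21ltyP mu mu mF).
pose kk y : \bar R := (`|(k \_ `[c, d]) y|)%:E.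
have E y : (\int[mu]_x `|(EFin \o (fun x0 : R * R => (\1_(`[a, b]%classic) x0.1 * (k \_ `[c, d]) x0.2)%R)) (x, y)| =
   (\int[mu]_x (\1_(`[a, b]%classic) x)%:E) * kk y)%E.
  rewrite -ge0_integralZr//.
  - by apply: eq_integral => x _; rewrite /= normrM EFinM (ger0_norm (_ : 0 <= \1__ x)).
  - by apply/measurable_EFinP; exact: measurable_indic.
  - by rewrite /kk lee_fin.
under eq_integral do rewrite E.
rewrite ge0_integralZl//; last 3 first.
- by apply/measurable_EFinP; exact: measurableT_comp.
- by move=> y _; rewrite lee_fin.
- by apply: integral_ge0 => x _; rewrite lee_fin.
rewrite integral_indic// setIT; apply: lte_mul_pinfty => //.
  by rewrite ge0_fin_numE//; have := lebesgue_measure_itv `[a, b] => /= ->; case: ifP => _; rewrite ?ltry.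
have /integrableP[_] := (@integrable_patch _ _ _ mu _ _ (measurable_itv `[c, d])).1 (integrable_norm ik).
apply: le_lt_trans; rewrite le_eqVlt; apply/orP; left; apply/eqP; apply: eq_integral => y _ /=.
by rewrite /kk !patchE; case: ifP => _; rewrite ?normr_id// normr0.
Qed.

Lemma L1loc2D f g : L1loc2 f -> L1loc2 g -> L1loc2 (fun x => f x + g x).
Proof.
by move=> hf hg; apply: L1loc2P => M; apply: integrableDR; [exact: measurable_itvX|exact: L1loc2_box..].
Qed.

Lemma L1loc2B f g : L1loc2 f -> L1loc2 g -> L1loc2 (fun x => f x - g x).
Proof.
by move=> hf hg; apply: L1loc2P => M; apply: integrableBR; [exact: measurable_itvX|exact: L1loc2_box..].
Qed.

Lemma testfun1_bounded (p : R -> R) : testfun1 p -> exists C, forall t, `|p t| <= C.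
Proof.
move=> tp; have [_ [M HM]] := tp.
have [C [Cr HC]] := continuous_itv_bounded (- `|M|) `|M| (testfun1_continuous tp).
exists (`|C| + 1) => t.
have [Mt|tM] := ltP M `|t|; first by rewrite HM// normr0 addr_ge0.
apply: HC => /=; first by rewrite ltr_pwDr// ler_norm.
by rewrite in_itv/= -ler_norml; apply: le_trans tM _; exact: ler_norm.
Qed.

Lemma L1loc2_test f (p q : R -> R) : L1loc2 f -> testfun1 p -> testfun1 q ->
  mu2.-integrable setT (EFin \o (fun x => f x * (p x.1 * q x.2))).
Proof.
move=> L tp tq; have [_ [M HM]] := tp; have [_ [N HN]] := tq.
have [C HC] := testfun1_bounded tp; have [D HD] := testfun1_bounded tq.
pose K := Num.max M N.
have i1 := (@integrable_patch _ _ _ mu2 _ _ (measurable_itvX (- K) K (- K) K)).1 (L1loc2_box (- K) K (- K) K L).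
apply: le_integrable (integrableZR measurableT (C * D) i1) => //.
  apply/measurable_EFinP; apply: measurable_funM; first exact: measurable_L1loc2.
  apply: measurable_funM.
    by apply: (measurableT_comp (continuous_measurable_fun (testfun1_continuous tp))); exact: measurable_fst.
  by apply: (measurableT_comp (continuous_measurable_fun (testfun1_continuous tq))); exact: measurable_snd.
move=> [x y] _ /=; rewrite lee_fin patchE in_setX/= !mem_setE !in_itv/= -!ler_norml.
have C0 := le_trans (normr_ge0 _) (HC 0); have D0 := le_trans (normr_ge0 _) (HD 0).
case: ifPn => [_|].
  rewrite mulrC !normrM ler_wpM2r//; apply: ler_pM => //.
    exact: le_trans (HC x) (ler_norm _).
  exact: le_trans (HD y) (ler_norm _).
rewrite negb_and -!ltNge !gt_max => /orP[/andP[/HM -> _]|/andP[_ /HN ->]];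
  by rewrite ?mul0r ?mulr0 ?normr0 ?mulr0.
Qed.

Lemma ae_snd (P : R -> Prop) : {ae mu, forall y, P y} -> {ae mu2, forall x, P x.2}.
Proof.
move=> [N [mN N0 hN]]; exists (setT `*` N); split; first exact: measurableX.
  have e : (mu \x mu)%E (setT `*` N) = (mu setT * mu N)%E by apply: product_measure1E.
  by rewrite N0 mule0 in e.
by move=> [x y] h; split => //=; exact: hN.
Qed.

Lemma ae_fst (P : R -> Prop) : {ae mu, forall y, P y} -> {ae mu2, forall x, P x.1}.
Proof.
move=> [N [mN N0 hN]]; exists (N `*` setT); split; first exact: measurableX.
  have e : (mu \x mu)%E (N `*` setT) = (mu N * mu setT)%E by apply: product_measure1E.
  by rewrite N0 mul0e in e.
by move=> [x y] h; split => //=; exact: hN.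
Qed.

Lemma measurable_sint_param g : measurable_fun setT g ->
  measurable_fun setT (fun x : R * R => sint (fun s => g (s, x.2)) x.1).
Proof.
move=> mg.
have m1 : measurable_fun setT (fun z : (R * R) * R => g (z.2, z.1.2)).
  apply: (measurableT_comp mg); apply: measurable_fun_pair => /=; first exact: measurable_snd.
  by apply: (measurableT_comp measurable_snd); exact: measurable_fst.
have mt : measurable_fun setT (fun z : (R * R) * R => z.1.1).
  by apply: (measurableT_comp measurable_fst); exact: measurable_fst.
have ms : measurable_fun setT (fun z : (R * R) * R => z.2) by exact: measurable_snd.
apply: measurable_funB; under eq_fun do rewrite Rintegral_mkcond.
- apply: (@measurable_Rintegral_param _ _ _ (fun z : (R * R) * R => ((fun s => g (s, z.1.2)) \_ `[0, z.1.1]) z.2)).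
  have -> : (fun z : (R * R) * R => ((fun s => g (s, z.1.2)) \_ `[0, z.1.1]) z.2) =
    (fun z => if (0 <= z.2) && (z.2 <= z.1.1) then g (z.2, z.1.2) else 0).
    by apply/funext => z; rewrite patchE mem_setE in_itv.
  apply: measurable_fun_ifT => //.
  by apply: measurable_and; apply: measurable_fun_ler.
- apply: (@measurable_Rintegral_param _ _ _ (fun z : (R * R) * R => ((fun s => g (s, z.1.2)) \_ `[z.1.1, 0]) z.2)).
  have -> : (fun z : (R * R) * R => ((fun s => g (s, z.1.2)) \_ `[z.1.1, 0]) z.2) =
    (fun z => if (z.1.1 <= z.2) && (z.2 <= 0) then g (z.2, z.1.2) else 0).
    by apply/funext => z; rewrite patchE mem_setE in_itv.
  apply: measurable_fun_ifT => //.
  by apply: measurable_and; apply: measurable_fun_ler.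
Qed.

(** On a box the primitive is dominated by [K y], the integral of [|g (_, y)|] over a fixed
    interval, which is integrable in [y] by Fubini. *)
Lemma L1loc2_sint g : L1loc2 g -> L1loc2 (fun x : R * R => sint (fun s => g (s, x.2)) x.1).
Proof.
move=> L; apply: L1loc2P => M.
have mg := measurable_L1loc2 L.
have ms := measurable_sint_param mg.
pose N := `|M|.
have N0 : 0 <= N by exact: normr_ge0.
have MN : M <= N by exact: ler_norm.
pose K y := \int[mu]_(s in `[- N, N]) `|g (s, y)|.
have iabs : mu2.-integrable (`[- N, N] `*` `[- M, M]) (EFin \o (fun x => `|g x|)).
  by apply: integrable_norm; exact: L1loc2_box.
have [_ iK _] := RFubini' (measurable_itv _) (measurable_itv _) iabs.
have := integrable_snd (- M) M iK.
apply: ae_le_integrable; [exact: measurable_itvX|exact: measurable_funTS|].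
apply: aeS (ae_snd (L1loc2_slices2 L)) => -[t y] /= ig [].
rewrite !in_itv/= => /andP[tM Mt] _.
rewrite [leRHS]ger0_norm; last by apply: Rintegral_ge0.
have iN : mu.-integrable `[- N, N] (EFin \o (fun s => `|g (s, y)|)).
  exact: (integrable_norm (ig _ _)).
have sub s t' : - N <= s -> t' <= N -> \int[mu]_(x in `[s, t']) `|g (x, y)| <= K y.
  move=> Ns tN; rewrite /K Rintegral_mkcond [leRHS]Rintegral_mkcond.
  apply: le_Rintegral => //.
  - by apply: (@integrable_patch _ _ _ mu _ _ (measurable_itv _)).1; apply: integrable_subitv iN.
  - exact: (@integrable_patch _ _ _ mu _ _ (measurable_itv _)).1.
  - move=> x _; rewrite !patchE; case: ifPn => [|_]; last by case: ifP => _; rewrite ?normr_ge0.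
    rewrite mem_setE in_itv/= => /andP[sx xt].
    by rewrite mem_setE in_itv/= ifT//; apply/andP; split; lra.
rewrite /sint; have [t0|t0] := leP t 0.
  have -> : \int[mu]_(x in `[0, t]) g (x, y) = 0.
    have [->|tn0] := eqVneq t 0; first by rewrite set_itv1 Rintegral_set1.
    by rewrite set_itv_ge ?Rintegral_set0// bnd_simp -ltNge lt_neqAle tn0.
  rewrite sub0r normrN; apply: le_trans (le_normr_Rintegral _ (ig _ _)) _ => //.
  by apply: sub; lra.
rewrite (@set_itv_ge _ _ _ (BRight 0)) ?Rintegral_set0 ?subr0; last by rewrite bnd_simp -ltNge.
apply: le_trans (le_normr_Rintegral _ (ig _ _)) _ => //.
by apply: sub; lra.
Qed.

Lemma is_derive_unique (k : R -> R) (x l l' : R) :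
  is_derive x (1 : R) k l -> is_derive x (1 : R) k l' -> l = l'.
Proof. by move=> [_ <-] [_ <-]. Qed.

Lemma testfun1_unit : exists2 p : R -> R, testfun1 p &
  [/\ \int[mu]_t p t = 1, forall t, ~ `[0, 1]%classic t -> p t = 0 & mu.-integrable setT (EFin \o p)].
Proof.
have ts := @testfun1_step R 0 1 0.
pose s := step (0 : R) 1 0.
have supp t : ~ `[0, 1]%classic t -> s t = 0.
  by move=> h; apply: step_supp; apply/negP => /andP[t0 t1]; apply: h; rewrite /= in_itv/= !ltW.
have cs := testfun1_continuous ts.
have i01 := @continuous_itv_integrable _ _ 0 1 cs.
have iT := integrable_supp (measurable_itv `[0, 1]) supp i01.
(* If the integral were zero, the primitive of [s], being nondecreasing, would be constant on
   [[0, 1]], contradicting [s > 0] at the midpoint. *)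
have pos : 0 < \int[mu]_t s t.
  rewrite lt_neqAle Rintegral_ge0 ?andbT; last by move=> *; exact: step_ge0.
  apply/negP => /eqP h.
  have H : prim (sint s) s by apply: prim_sint => *; exact: continuous_itv_integrable.
  have e01 : sint s 0 = sint s 1.
    by have [_] := H 0 1 ler01; rewrite (Rintegral_supp supp) -h => /eqP; rewrite subr_eq0 => /eqP.
  have mono u v : u <= v -> sint s u <= sint s v.
    by move=> uv; rewrite -subr_ge0; have [_ ->] := H _ _ uv; apply: Rintegral_ge0 => *; exact: step_ge0.
  have D := continuous_antiderivative cs (2^-1).
  have D0 := is_derive_cst (sint s 0) (2^-1 : R) (1 : R).
  have D1 : is_derive (2^-1 : R) (1 : R) (sint s) 0.
    apply: near_eq_is_derive D0; near=> z; apply/eqP; rewrite eq_le mono/=.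
      by rewrite /cst e01 mono//; near: z; apply: filterS (@lt_nbhsl _ (2^-1) 1 _) => [z /ltW//|]; lra.
    by near: z; apply: filterS (@lt_nbhsr _ 0 (2^-1) _) => [z /ltW//|]; lra.
  have : s 2^-1 = 0 by exact: is_derive_unique D D1.
  have s2 : 0 < s 2^-1 by apply: mulr_gt0; apply: bump0_gt0; lra.
  by move=> e; rewrite e ltxx in s2.
exists (fun t => (\int[mu]_t s t)^-1 * s t); first exact: testfun1Z.
split.
- by rewrite RintegralZl// mulVf// gt_eqF.
- by move=> t /supp ->; rewrite mulr0.
- exact: integrableZR.
Unshelve. all: by end_near. Qed.

Lemma Rintegral_ae_eq d (T : measurableType d) (m : {measure set T -> \bar R})
  (D : set T) (F G : T -> R) : measurable D ->
  m.-integrable D (EFin \o F) -> m.-integrable D (EFin \o G) ->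
  {ae m, forall x, D x -> F x = G x} ->
  \int[m]_(x in D) F x = \int[m]_(x in D) G x.
Proof.
move=> mD /integrableP[mF _] /integrableP[mG _] h.
by rewrite /Rintegral; congr fine; apply: ae_eq_integral => //; apply: aeS h => x hx Dx; rewrite hx.
Qed.

(* For the representation on lines it is enough to test against tensor products. *)
Definition weak_tensor1 f g := L1loc2 f /\ L1loc2 g /\
  forall p q : R -> R, testfun1 p -> testfun1 q ->
    \int[mu2]_x (f x * (p^`()%classic x.1 * q x.2)) =
    - \int[mu2]_x (g x * (p x.1 * q x.2)).

(* By the du Bois-Reymond lemma, [f] minus the primitive of [g] in the first variable depends
   on the second variable only; integrating against a test function of unit mass reads it off. *)
Lemma weak_line1 f g : weak_tensor1 f g ->
  exists U : R * R -> R, [/\ measurable_fun setT U,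
    {ae mu2, forall x, f x = U x} &
    {ae mu, forall y, prim (fun t => U (t, y)) (fun t => g (t, y))}].
Proof.
move=> [Lf [Lg W]].
have mf := measurable_L1loc2 Lf; have mg := measurable_L1loc2 Lg.
have [p0 tp0 [ip0 sp0 _]] := testfun1_unit.
pose V (x : R * R) := sint (fun s => g (s, x.2)) x.1.
have LV : L1loc2 V by exact: L1loc2_sint.
have mV := measurable_L1loc2 LV.
pose H y := \int[mu]_s ((f (s, y) - V (s, y)) * p0 s).
pose U (x : R * R) := V x + H x.2.
have cp0 := testfun1_continuous tp0.
have mH : measurable_fun setT H.
  apply: (@measurable_Rintegral_param _ _ _ (fun z : R * R => (f (z.2, z.1) - V (z.2, z.1)) * p0 z.2)).
  apply: measurable_funM; last first.
    by apply: (measurableT_comp (continuous_measurable_fun cp0)); exact: measurable_snd.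
  apply: measurable_funB.
    by apply: (measurableT_comp mf); exact: measurable_swap.
  by apply: (measurableT_comp mV); exact: measurable_swap.
have LU : L1loc2 U.
  apply: L1loc2D => //; apply: L1loc2P => M; apply: integrable_snd.
  have i1 : mu2.-integrable (`[0, 1] `*` `[- M, M]) (EFin \o (fun x => (f x - V x) * p0 x.1)).
    have := L1loc2B Lf LV; move=> /(@L1loc2_box _ 0 1 (- M) M) i1.
    have [C HC] := testfun1_bounded tp0.
    apply: (@integrable_bounded_mul _ _ mu2 _ (fun x => f x - V x) (fun x => p0 x.1) C) => //.
    - exact: measurable_itvX.
    - apply: measurable_funTS.
      by apply: (measurableT_comp (continuous_measurable_fun cp0)); exact: measurable_fst.
  have [_ + _] := RFubini' (measurable_itv _) (measurable_itv _) i1.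
  congr (_.-integrable _ _); apply/funext => y /=; congr EFin.
  by apply: Rintegral_supp => t /sp0 ->; rewrite mulr0.
have mU := measurable_L1loc2 LU.
have hprim : {ae mu, forall y, prim (fun t => U (t, y)) (fun t => g (t, y))}.
  apply: aeS (L1loc2_slices2 Lg) => y ig.
  apply: prim_ext (primD (prim_sint ig) (prim_cst (H y))) => t //=.
  by rewrite addr0.
exists U; split => //.
have LfU := L1loc2B Lf LU.
suff : {ae mu2, forall x, f x - U x = 0}.
  by apply: aeS => x /eqP; rewrite subr_eq0 => /eqP.
apply: dBR2 => // p q tp tq.
have ifpq := L1loc2_test Lf tp tq.
have iUpq := L1loc2_test LU tp tq.
have ifp0q := L1loc2_test Lf tp0 tq.
have e0 : \int[mu2]_x (f x * (p x.1 * q x.2)) - \int[mu2]_x (U x * (p x.1 * q x.2)) = 0.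
  pose c := \int[mu]_t p t.
  have ipT (r : R -> R) : testfun1 r -> mu.-integrable setT (EFin \o r).
    move=> tr; have [_ [M HM]] := tr.
    have hs t : ~ `[- M, M]%classic t -> r t = 0.
      by rewrite /= in_itv/= -ler_norml => /negP; rewrite -ltNge => /HM.
    by apply: integrable_supp hs _; [exact: measurable_itv|apply: continuous_itv_integrable; exact: testfun1_continuous].
  (* [p - c * p0] has zero mean, hence is the derivative of a test function [th]. The weak equation
     tested with [th] then reduces testing with [p] to testing with [p0]. *)
  have tk : testfun1 (fun t => p t - c * p0 t).
    have := testfun1D tp (testfun1Z (- c) tp0).
    by congr testfun1; apply/funext => t; rewrite mulNr.
  have ik : \int[mu]_t (p t - c * p0 t) = 0.
    rewrite RintegralB//; [|exact: ipT|by apply: integrableZR => //; exact: ipT].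
    by rewrite RintegralZl//; [rewrite ip0 mulr1 subrr|exact: ipT].
  have [th tth dth] := testfun1_antiderivative tk ik.
  have igthq := L1loc2_test Lg tth tq.
  have ifthq := L1loc2_test Lf (testfun1_derive1 tth) tq.
  have wf : \int[mu2]_x (f x * (th^`()%classic x.1 * q x.2)) = - \int[mu2]_x (g x * (th x.1 * q x.2)).
    exact: W.
  have e1 : \int[mu2]_x (f x * (p x.1 * q x.2)) = \int[mu2]_x (c * (f x * (p0 x.1 * q x.2)) - g x * (th x.1 * q x.2)).
    have -> : (fun x => f x * (p x.1 * q x.2)) = (fun x => c * (f x * (p0 x.1 * q x.2)) + f x * (th^`()%classic x.1 * q x.2)).
      by apply/funext => x; rewrite dth; ring.
    rewrite RintegralD//; last exact: integrableZR.
    by rewrite RintegralB//; [rewrite wf|exact: integrableZR].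
  have i2 : mu2.-integrable setT (EFin \o (fun x => c * (f x * (p0 x.1 * q x.2)) - g x * (th x.1 * q x.2))).
    by apply: integrableBR => //; exact: integrableZR.
  rewrite e1; apply/eqP; rewrite subr_eq0; apply/eqP.
  have XT : [set: R * R] = setT `*` setT by rewrite setXTT.
  rewrite XT in i2 iUpq *.
  have [_ j1 ->] := RFubini' measurableT measurableT i2.
  have [_ j2 ->] := RFubini' measurableT measurableT iUpq.
  apply: Rintegral_ae_eq => //.
  apply: aeS (ae_and hprim (ae_and (L1loc2_slices2 Lf) (L1loc2_slices2 Lg))) => y [hy [ify igy]] _ /=.
  have [k1 k2 k3] := prim_ibp hy tth.
  have cUy := prim_continuous hy.
  have sup (r : R -> R) t : ~ `[0, 1]%classic t -> r t * p0 t = 0 by move=> /sp0 ->; rewrite mulr0.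
  have isup (r : R -> R) : mu.-integrable `[0, 1] (EFin \o r) -> mu.-integrable setT (EFin \o (fun t => r t * p0 t)).
    move=> ir; apply: (integrable_supp (measurable_itv `[0, 1]) (sup r)).
    have := continuous_mul_integrable cp0 ir.
    by congr (_.-integrable _ _); apply/funext => t /=; rewrite mulrC.
  have ifp0 := isup _ (ify 0 1).
  have iUp0 := isup _ (continuous_itv_integrable 0 1 cUy).
  have cVy : continuous (fun t => V (t, y)).
    by apply: prim_continuous; exact: prim_sint igy.
  have iVp0 := isup _ (continuous_itv_integrable 0 1 cVy).
  (* [H] was chosen for this: on almost every line [U] and [f] have the same integral against
     [p0]. *)
  have eU0 : \int[mu]_t (U (t, y) * p0 t) = \int[mu]_t (f (t, y) * p0 t).
    have -> : (fun t => U (t, y) * p0 t) = (fun t => V (t, y) * p0 t + H y * p0 t).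
      by apply/funext => t; rewrite /U mulrDl.
    rewrite RintegralD//; last by apply: integrableZR => //; exact: ipT.
    rewrite RintegralZl//; last exact: ipT.
    rewrite ip0 mulr1 /H.
    under [X in _ + X]eq_Rintegral do rewrite mulrBl.
    by rewrite RintegralB// addrC subrK.
  transitivity ((\int[mu]_t (c * (f (t, y) * p0 t) - g (t, y) * th t)) * q y).
    rewrite -RintegralZr//; last by apply: integrableBR => //; exact: integrableZR.
    by apply: eq_Rintegral => t _; ring.
  transitivity ((\int[mu]_t (U (t, y) * p t)) * q y); last first.
    rewrite -RintegralZr//; first by apply: eq_Rintegral => t _; ring.
    have -> : (fun t => U (t, y) * p t) = (fun t => U (t, y) * th^`()%classic t + c * (U (t, y) * p0 t)).
      by apply/funext => t; rewrite dth; ring.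
    by apply: integrableDR => //; exact: integrableZR.
  congr (_ * _).
  have -> : (fun t => U (t, y) * p t) = (fun t => U (t, y) * th^`()%classic t + c * (U (t, y) * p0 t)).
    by apply/funext => t; rewrite dth; ring.
  rewrite RintegralB//; last exact: integrableZR.
  rewrite RintegralD//; last exact: integrableZR.
  by rewrite !RintegralZl// eU0 k3 addrC.
rewrite (_ : (fun x => _) = EFin \o (fun x => f x * (p x.1 * q x.2) - U x * (p x.1 * q x.2))); last first.
  by apply/funext => x /=; rewrite mulrBl.
have iB := integrableBR measurableT ifpq iUpq.
rewrite -[LHS]fineK; last exact: (integrable_fin_num _ iB).
by congr EFin; rewrite -[RHS]e0 -RintegralB.
Qed.

Lemma weak_tensor1_of f g : weak_partial2 (@e1 R) f g -> weak_tensor1 f g.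
Proof.
move=> [Lf [Lg W]]; split => //; split => // p q tp tq.
have := W _ (testfun2_tensor tp tq).
under eq_integral do rewrite derive_tensor1//.
by rewrite /Rintegral => ->; rewrite fineN.
Qed.

Lemma derive_tensor2 (p q : R -> R) (x : R * R) : testfun1 p -> testfun1 q ->
  'D_(@e2 R) (fun x : R * R => p x.1 * q x.2) x = p x.1 * q^`()%classic x.2.
Proof.
move=> tf tg; have [_ ->] := is_derive_tensor tf tg x (@e2 R).
by rewrite /e2/= mul0r mul0r mul1r add0r.
Qed.

Lemma L1loc2_swap f : L1loc2 f -> L1loc2 (f \o @swap R R).
Proof.
move=> Lk; apply: L1loc2P => M.
apply: (@integrable_patch _ _ _ mu2 _ _ (measurable_itvX _ _ _ _)).2.
rewrite patch_swap; apply: integrable_swapT.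
by apply: (@integrable_patch _ _ _ mu2 _ _ (measurable_itvX _ _ _ _)).1; exact: L1loc2_box.
Qed.

Lemma weak_tensor1_of_swap f g : weak_partial2 (@e2 R) f g ->
  weak_tensor1 (f \o @swap R R) (g \o @swap R R).
Proof.
move=> [Lf [Lg W]]; split; [exact: L1loc2_swap|split; [exact: L1loc2_swap|]] => p q tp tq.
have := W _ (testfun2_tensor tq tp).
under eq_integral do rewrite derive_tensor2//.
move=> h.
have i1 := L1loc2_test Lf tq (testfun1_derive1 tp).
have i2 := L1loc2_test Lg tq tp.
transitivity (\int[mu2]_x (f x * (q x.1 * p^`()%classic x.2))).
  by rewrite -(Rintegral_swapT i1); apply: eq_Rintegral => x _ /=; congr (_ * _); rewrite mulrC.
rewrite /Rintegral h fineN; congr (- _); rewrite -/(Rintegral mu2 setT (fun x => g x * (q x.1 * p x.2))).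
by rewrite -(Rintegral_swapT i2); apply: eq_Rintegral => x _ /=; congr (_ * _); rewrite mulrC.
Qed.

Lemma swap_measurable_fun f : measurable_fun setT f -> measurable_fun setT (f \o @swap R R).
Proof. by move=> mf; apply: (measurableT_comp mf); exact: measurable_swap. Qed.

Lemma ae_swap (P : R * R -> Prop) : {ae mu2, forall x, P x} -> {ae mu2, forall x, P (swap x)}.
Proof.
move=> [N [mN N0 hN]]; exists ((@swap R R) @^-1` N); split.
- by rewrite -[X in measurable X]setTI; exact: measurable_swap.
- pose F (x : R * R) : \bar R := (\1_N x)%:E.
  have mF : measurable_fun setT F by apply/measurable_EFinP; exact: measurable_indic.
  have F0 x : (0 <= F x)%E by rewrite lee_fin.
  have mF' : measurable_fun setT (F \o @swap R R) by apply: (measurableT_comp mF); exact: measurable_swap.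
  have e1 : (\int[mu2]_x F x = mu2 N)%E by rewrite (integral_indic mu2 measurableT mN) setIT.
  have e2 : (\int[mu2]_x (F \o @swap R R) x = mu2 ((@swap R R) @^-1` N))%E.
    have mS : measurable ((@swap R R) @^-1` N).
      by rewrite -[X in measurable X]setTI; exact: measurable_swap.
    have -> : F \o @swap R R = fun x => (\1_((@swap R R) @^-1` N) x)%:E.
      by apply/funext => x; rewrite /F /= !indicE.
    by rewrite (integral_indic mu2 measurableT mS) setIT.
  rewrite -[LHS]e2 -[RHS]N0 -[RHS]e1.
  have F0' x : (0 <= (F \o @swap R R) x)%E by exact: F0.
  rewrite [LHS](fubini_tonelli1 (m1 := mu) (m2 := mu) _ mF' F0').
  by rewrite [RHS](fubini_tonelli2 (m1 := mu) (m2 := mu) _ mF F0).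
- by move=> x h /=; apply: hN.
Qed.

Lemma weak_line2 f g : weak_partial2 (@e2 R) f g ->
  exists U : R * R -> R, [/\ measurable_fun setT U,
    {ae mu2, forall x, f x = U x} &
    {ae mu, forall x, prim (fun t => U (x, t)) (fun t => g (x, t))}].
Proof.
move=> /weak_tensor1_of_swap/weak_line1[U [mU fU hU]].
exists (U \o @swap R R); split => //; first exact: swap_measurable_fun.
apply: aeS (ae_swap fU) => -[x y] //.
Qed.

End weak_lines.

(** * Translation invariance and periodicity *)

Section translation.
Context {R : realType}.
Notation mu := (@lebesgue_measure R).
Notation mu2 := (@mu2 R).

(** The plane carries the product of the two Borel structures, so an open set has to be exhibited as
    a countable union of rational rectangles. *)
Lemma open2_measurable (O : set (R * R)) : open O -> measurable O.
Proof.
move=> oO.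
pose rect (q : rat * rat * (rat * rat)) : set (R * R) :=
  `]ratr q.1.1, ratr q.1.2[%classic `*` `]ratr q.2.1, ratr q.2.2[%classic.
have -> : O = \bigcup_n (if unpickle n is Some q then
    (if `[< rect q `<=` O >] then rect q else set0) else set0).
  apply/seteqP; split => [[x y] Oxy|z [n _]]; last first.
    by case: (unpickle n) => [q|//]; case: asboolP => // h /h.
  have /nbhs_ballP[e /= e0 He] : nbhs (x, y) O by exact: open_nbhs_nbhs.
  have /rat_in_itvoo[a] : x - e < x by lra.
  have /rat_in_itvoo[b] : x < x + e by lra.
  have /rat_in_itvoo[c] : y - e < y by lra.
  have /rat_in_itvoo[d] : y < y + e by lra.
  rewrite !in_itv/= => /andP[yd dy] /andP[cy yc] /andP[xb bx] /andP[ax xa].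
  pose q := (a, b, (c, d)).
  have hq : rect q `<=` O.
    move=> [s t] [/=]; rewrite !in_itv/= => /andP[h1 h2] /andP[h3 h4].
    by apply: He; split => /=; rewrite /ball/= ltr_norml; lra.
  have [k kK] : exists k, @unpickle (rat * rat * (rat * rat))%type k = Some q.
    by exists (pickle q); exact: pickleK.
  exists k; first exact: I.
  rewrite kK; case: asboolP => [_|/(_ hq)//].
  by split => /=; rewrite in_itv/=; apply/andP.
apply: bigcupT_measurable => n; case: (unpickle n) => [q|//].
by case: asboolP => // _; exact: measurableX.
Qed.

Lemma continuous2_measurable (f : R * R -> R) : continuous f -> measurable_fun setT f.
Proof.
move=> /continuousP cf; apply: (measurability _ (RGenOpens.measurableE R)).
move=> _ [_ [a [b ->] <-]]; rewrite setTI; apply: open2_measurable.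
by apply: cf; exact: interval_open.
Qed.

Lemma measurable_shift (c : R) : measurable_fun setT (fun x : R => x + c).
Proof. exact: measurable_funD. Qed.

Lemma lebesgue_measure_shift (c : R) (A : set R) : measurable A ->
  mu ((fun x => x + c) @^-1` A) = mu A.
Proof.
move=> mA.
pose phi : R -> measurableTypeR R := fun x => x + c.
have mphi : measurable_fun setT phi by exact: measurable_shift.
have := @lebesgue_measure_unique R (pushforward mu phi).
move=> h; apply/esym; apply: h => // _ [[a b]] _ <-.
have e : phi @^-1` `]a, b]%classic = `]a - c, b - c]%classic.
  by apply/seteqP; split => x /=; rewrite /phi !in_itv/=; lra.
transitivity (mu `]a - c, b - c]%classic); last by rewrite -e.
rewrite !lebesgue_measure_itv/= !lte_fin ltrD2r.
by case: ifP => // _; rewrite -!EFinB; congr EFin; ring.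
Qed.

Lemma ge0_integral_shift (c : R) (F : R -> \bar R) : measurable_fun setT F ->
  (forall x, 0 <= F x)%E -> (\int[mu]_x F (x + c)%R = \int[mu]_x F x)%E.
Proof.
move=> mF F0.
pose phi : measurableTypeR R -> measurableTypeR R := fun x => x + c.
have mphi : measurable_fun setT phi by exact: measurable_shift.
transitivity (\int[pushforward mu phi]_x F x)%E.
  by rewrite (ge0_integral_pushforward mphi mu measurableT)// preimage_setT.
by apply: eq_measure_integral => A mA _; exact: lebesgue_measure_shift.
Qed.

Lemma integral_shift (c : R) (F : R -> \bar R) : measurable_fun setT F ->
  (\int[mu]_x F (x + c)%R = \int[mu]_x F x)%E.
Proof.
move=> mF; rewrite integralE [RHS]integralE; congr (_ - _)%E.
- rewrite -(ge0_integral_shift c (measurable_funepos mF))//.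
  by apply: eq_integral => x _; rewrite !funeposE.
- rewrite -(ge0_integral_shift c (measurable_funeneg mF))//.
  by apply: eq_integral => x _; rewrite !funenegE.
Qed.

Lemma Rintegral_shift (c : R) (f : R -> R) : measurable_fun setT f ->
  \int[mu]_x f (x + c) = \int[mu]_x f x.
Proof.
by move=> mf; rewrite /Rintegral (integral_shift c (F := EFin \o f))//; exact/measurable_EFinP.
Qed.

Lemma ae_shift (c : R) (P : R -> Prop) : {ae mu, forall x, P x} -> {ae mu, forall x, P (x + c)}.
Proof.
move=> [N [mN N0 hN]]; exists ((fun x => x + c) @^-1` N); split.
- by rewrite -[X in measurable X]setTI; exact: measurable_shift.
- by rewrite -[RHS]N0; exact: lebesgue_measure_shift.
- by move=> x h /=; apply: hN.
Qed.

Definition tau (c : R) (x : R * R) : R * R := (x.1, x.2 + c).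

Lemma measurable_tau (c : R) : measurable_fun setT (tau c).
Proof.
apply: measurable_fun_pair => /=; first exact: measurable_fst.
by apply: measurable_funD; [exact: measurable_snd|exact: measurable_cst].
Qed.

Lemma integrable_tau (c : R) (f : R * R -> R) : mu2.-integrable setT (EFin \o f) ->
  mu2.-integrable setT (EFin \o (f \o tau c)).
Proof.
move=> iF; have mF := measurable_int _ iF.
have mG : measurable_fun setT (EFin \o (f \o tau c)).
  by apply: (measurableT_comp mF); exact: measurable_tau.
apply/(integrable12ltyP mu mu mG).
have /(integrable12ltyP mu mu mF) := iF.
apply: le_lt_trans; rewrite le_eqVlt; apply/orP; left; apply/eqP.
apply: eq_integral => x _.
rewrite -[RHS](integral_shift c (F := fun y => `|(EFin \o f) (x, y)|%E))//.
apply: measurableT_comp => //; exact: (measurableT_comp mF (pair1_measurable x)).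
Qed.

Lemma Rintegral_tau (c : R) (f : R * R -> R) : mu2.-integrable setT (EFin \o f) ->
  \int[mu2]_x f (tau c x) = \int[mu2]_x f x.
Proof.
move=> iF; have iG := integrable_tau c iF.
have [_ _ ->] := RFubiniT iF; have [_ _ ->] := RFubiniT iG.
apply: eq_Rintegral => x _; rewrite -[RHS](Rintegral_shift c)//.
by apply: measurable_slice2; have /integrableP[/measurable_EFinP] := iF.
Qed.

Lemma ae_tau (c : R) (P : R * R -> Prop) : {ae mu2, forall x, P x} -> {ae mu2, forall x, P (tau c x)}.
Proof.
move=> [N [mN N0 hN]]; exists (tau c @^-1` N); split.
- by rewrite -[X in measurable X]setTI; exact: measurable_tau.
- have mS : measurable (tau c @^-1` N).
    by rewrite -[X in measurable X]setTI; exact: measurable_tau.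
  pose F (x : R * R) : \bar R := (\1_N x)%:E.
  have mF : measurable_fun setT F by apply/measurable_EFinP; exact: measurable_indic.
  have F0 x : (0 <= F x)%E by rewrite lee_fin.
  have mF' : measurable_fun setT (F \o tau c) by apply: (measurableT_comp mF); exact: measurable_tau.
  have F0' x : (0 <= (F \o tau c) x)%E by exact: F0.
  have e1 : (\int[mu2]_x F x = mu2 N)%E by rewrite (integral_indic mu2 measurableT mN) setIT.
  have e2 : (\int[mu2]_x (F \o tau c) x = mu2 (tau c @^-1` N))%E.
    have -> : F \o tau c = fun x => (\1_(tau c @^-1` N) x)%:E.
      by apply/funext => x; rewrite /F /= !indicE.
    by rewrite (integral_indic mu2 measurableT mS) setIT.
  rewrite -[LHS]e2 -[RHS]N0 -[RHS]e1.
  rewrite [LHS](fubini_tonelli1 (m1 := mu) (m2 := mu) _ mF' F0').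
  rewrite [RHS](fubini_tonelli1 (m1 := mu) (m2 := mu) _ mF F0).
  apply: eq_integral => x _; rewrite -[RHS](integral_shift c)//.
  exact: (measurableT_comp mF (pair1_measurable x)).
- by move=> x h /=; apply: hN.
Qed.

Lemma L1loc2_tau (c : R) (f : R * R -> R) : L1loc2 f -> L1loc2 (f \o tau c).
Proof.
move=> L; apply: L1loc2P => M.
apply: (@integrable_patch _ _ _ mu2 _ _ (measurable_itvX _ _ _ _)).2.
have -> : (f \o tau c) \_ (`[- M, M] `*` `[- M, M]) = (f \_ (`[- M, M] `*` `[- M + c, M + c])) \o tau c.
  apply/funext => -[x y] /=; rewrite !patchE !in_setX/= !mem_setE !in_itv/=.
  by rewrite lerD2r lerD2r.
apply: integrable_tau.
by apply: (@integrable_patch _ _ _ mu2 _ _ (measurable_itvX _ _ _ _)).1; exact: L1loc2_box.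
Qed.

Lemma shift_test (k : R * R -> R) (p r : R -> R) : L1loc2 k -> testfun1 p -> testfun1 r ->
  \int[mu2]_x (k (tau 1 x) * (p x.1 * r x.2)) =
  \int[mu2]_x (k x * (p x.1 * r (x.2 - 1))).
Proof.
move=> Lk tp tr.
have i1 := L1loc2_test Lk tp (testfun1_shift (- 1) tr).
rewrite -(Rintegral_tau 1 i1); apply: eq_Rintegral => -[x y] _.
by rewrite /tau/= addrK.
Qed.

Lemma derive1_shift (r : R -> R) (c : R) : testfun1 r ->
  (fun x => r (x + c))^`()%classic = (fun x => r^`()%classic (x + c)).
Proof.
move=> tr; apply: derive1_is_derive => x.
have := @is_derive_affine _ r (r^`()%classic (x + c)) 1 c x.
rewrite mul1r => /(_ (testfun1_is_derive _ tr)).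
by under eq_fun do rewrite mul1r; rewrite mul1r.
Qed.

(** Periodicity almost everywhere only: unlike [u] itself, its weak derivatives are determined up to
    null sets. *)
Definition yper (f : R * R -> R) := {ae mu2, forall x, f (tau 1 x) = f x}.

Lemma ae_periodic_of_test (g : R * R -> R) : L1loc2 g ->
  (forall p q, testfun1 p -> testfun1 q ->
    \int[mu2]_x (g (tau 1 x) * (p x.1 * q x.2)) = \int[mu2]_x (g x * (p x.1 * q x.2))) ->
  yper g.
Proof.
move=> L H.
have LB := L1loc2B (L1loc2_tau 1 L) L.
suff : {ae mu2, forall x, (g \o tau 1) x - g x = 0}.
  by apply: aeS => x /eqP; rewrite subr_eq0 => /eqP.
apply: dBR2 => // p q tp tq.
have i1 := L1loc2_test (L1loc2_tau 1 L) tp tq.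
have i2 := L1loc2_test L tp tq.
rewrite (_ : (fun x => _) = EFin \o (fun x => (g \o tau 1) x * (p x.1 * q x.2) - g x * (p x.1 * q x.2))); last first.
  by apply/funext => x /=; rewrite mulrBl.
have iB := integrableBR measurableT i1 i2.
rewrite -[LHS]fineK; last exact: (integrable_fin_num _ iB).
congr EFin; transitivity (\int[mu2]_x ((g \o tau 1) x * (p x.1 * q x.2) - g x * (p x.1 * q x.2))) => //.
by rewrite RintegralB// H// subrr.
Qed.

(** The shift is moved from [g] to the test function, then through the weak equation to [f], where
    periodicity absorbs it. *)
Lemma periodic_partial1 (f g : R * R -> R) : weak_partial2 (@e1 R) f g ->
  (forall x, f (tau 1 x) = f x) -> yper g.
Proof.
move=> /weak_tensor1_of[Lf [Lg W]] per; apply: ae_periodic_of_test => // p q tp tq.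
rewrite shift_test//.
have := W _ _ tp (testfun1_shift (- 1) tq).
rewrite -(shift_test Lf (testfun1_derive1 tp) tq).
under eq_Rintegral do rewrite per.
by rewrite W// => /oppr_inj.
Qed.

Lemma periodic_partial2 (f g : R * R -> R) : weak_partial2 (@e2 R) f g ->
  (forall x, f (tau 1 x) = f x) -> yper g.
Proof.
move=> [Lf [Lg W0]] per.
have W p q : testfun1 p -> testfun1 q ->
    \int[mu2]_x (f x * (p x.1 * q^`()%classic x.2)) = - \int[mu2]_x (g x * (p x.1 * q x.2)).
  move=> tp tq; have := W0 _ (testfun2_tensor tp tq).
  under eq_integral do rewrite derive_tensor2//.
  by rewrite /Rintegral => ->; rewrite fineN.
apply: ae_periodic_of_test => // p q tp tq.
rewrite shift_test//.
have := W _ _ tp (testfun1_shift (- 1) tq).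
rewrite derive1_shift// -(shift_test Lf tp (testfun1_derive1 tq)).
under eq_Rintegral do rewrite per.
by rewrite W// => /oppr_inj.
Qed.


Lemma integral_mksub (A : set R) (F : R -> \bar R) (c : R) : measurable A -> measurable_fun setT F ->
  (\int[mu]_(y in (fun x => x + c)%R @^-1` A) F (y + c)%R = \int[mu]_(y in A) F y)%E.
Proof.
move=> mA mF; rewrite [LHS]integral_mkcond [RHS]integral_mkcond.
rewrite -(integral_shift c (F := F \_ A)); last first.
  by apply/(measurable_restrictT _ mA); exact: measurable_funTS.
by apply: eq_integral => y _; rewrite !patchE.
Qed.

Lemma itv_shift (c a b : R) : (fun x => x + c) @^-1` `[a, b[%classic = `[a - c, b - c[%classic.
Proof. by apply/seteqP; split => x /=; rewrite !in_itv/=; lra. Qed.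

(** The shifted period is cut at 1, and the piece beyond 1 is moved back by one period to complete
    [[0, 1[]. *)
Lemma ge0_integral_period (F : R -> \bar R) (c : R) : 0 <= c <= 1 -> measurable_fun setT F ->
  (forall y, 0 <= F y)%E -> {ae mu, forall y, F (y + 1)%R = F y} ->
  (\int[mu]_(y in `[0%R, 1%R[) F (y + c)%R = \int[mu]_(y in `[0%R, 1%R[) F y)%E.
Proof.
move=> /andP[c0 c1] mF F0 per.
have e1 : `[0, 1[%classic = (fun x => x + c) @^-1` `[c, c + 1[%classic.
  by rewrite itv_shift subrr addrAC subrr add0r.
have e2 : `[0, c[%classic = (fun x => x + 1) @^-1` `[1, c + 1[%classic.
  by rewrite itv_shift subrr addrK.
rewrite {1}e1 integral_mksub//.
have -> : `[c, c + 1[%classic = `[c, 1[%classic `|` `[1, c + 1[%classic.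
  by apply/seteqP; split => x /=; rewrite !in_itv/=; [case: (ltP x 1); lra|case; lra].
rewrite (ge0_integral_setU mu)//; first last.
- apply/disj_setPS => x [] /=; rewrite !in_itv/=; lra.
- exact: measurable_funTS.
rewrite -[X in (_ + X)%E](integral_mksub 1)// -e2.
have -> : (\int[mu]_(y in `[0%R, c[) F (y + 1)%R = \int[mu]_(y in `[0%R, c[) F y)%E.
  apply: ae_eq_integral => //.
  - apply: measurable_funTS; apply: (measurableT_comp mF); exact: measurable_shift.
  - exact: measurable_funTS.
  - by apply: aeS per => y h _.
have -> : `[0, 1[%classic = `[c, 1[%classic `|` `[0, c[%classic.
  by apply/seteqP; split => x /=; rewrite !in_itv/=; [case: (ltP x c); lra|case; lra].
rewrite (ge0_integral_setU mu)//.
- exact: measurable_funTS.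
- apply/disj_setPS => x [] /=; rewrite !in_itv/=; lra.
Qed.

End translation.

(** * Functions on the strip and their fluxes *)

Section strip.
Context {R : realType}.
Notation mu := (@lebesgue_measure R).
Notation mu2 := (@mu2 R).
Notation I := (`[0%R, 1%R]%classic : set R).
Notation Q := (setT `*` I : set (R * R)).
Implicit Types f g : R * R -> R.

Lemma measurable_Q (A : set R) : measurable A -> measurable (A `*` I : set (R * R)).
Proof. by move=> mA; apply: measurableX => //; exact: measurable_itv. Qed.

Lemma measurable_cell : measurable (@cell R).
Proof.
have -> : @cell R = setT `*` `[0, 1[%classic.
  by apply/seteqP; split => x /=; rewrite in_itv/= => //; case.
by apply: measurableX => //; exact: measurable_itv.
Qed.

Lemma ae_neq (c : R) : {ae mu, forall x, x != c}.
Proof.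
exists [set c]; split => //; first exact: lebesgue_measure_set1.
by move=> x /= /negP; rewrite negbK => /eqP.
Qed.

(** The half-open cell and the closed strip [Q] differ by the null line where the second coordinate
    is 1. The closed version is the one that matches [ubar] and the primitives on [[0, 1]]. *)
Lemma patch_cellQ (F : R * R -> \bar R) : {ae mu2, forall x, (F \_ (@cell R)) x = (F \_ Q) x}.
Proof.
apply: aeS (ae_snd (ae_neq 1)) => x x1; rewrite !patchE.
have -> // : (x \in @cell R) = (x \in Q).
apply: asbool_equiv_eq; rewrite /cell/= in_itv/=; split => [/andP[x0 x1']|[_ /andP[x0 x1']]].
  by split => //; rewrite x0 ltW.
by rewrite x0 lt_neqAle x1 x1'.
Qed.

Lemma integral_cell (F : R * R -> \bar R) : measurable_fun setT F ->
  (\int[mu2]_(x in @cell R) F x = \int[mu2]_(x in Q) F x)%E.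
Proof.
move=> mF; rewrite integral_mkcond [RHS]integral_mkcond.
apply: ae_eq_integral => //.
- by apply/(measurable_restrictT _ measurable_cell); exact: measurable_funTS.
- by apply/(measurable_restrictT _ (measurable_Q measurableT)); exact: measurable_funTS.
- by apply: aeS (patch_cellQ F) => x.
Qed.

Lemma integral_patch_slice (A : set R) (F : R * R -> \bar R) x :
  (\int[mu]_y (F \_ (A `*` I)) (x, y) = ((fun x => \int[mu]_(y in I) F (x, y)) \_ A) x)%E.
Proof.
rewrite patchE; case: ifPn => xA.
  rewrite [RHS]integral_mkcond; apply: eq_integral => y _.
  by rewrite !patchE in_setX/= xA.
rewrite integral0_eq// => y _; rewrite patchE in_setX/= (negbTE xA)//.
Qed.

Lemma tonelli_strip (A : set R) (F : R * R -> \bar R) : measurable A ->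
  measurable_fun setT F -> (forall x, 0 <= F x)%E ->
  measurable_fun setT (fun x => \int[mu]_(y in I) F (x, y))%E /\
  (\int[mu2]_(x in A `*` I) F x = \int[mu]_(x in A) \int[mu]_(y in I) F (x, y))%E.
Proof.
move=> mA mF F0.
have mP (B : set R) : measurable B -> measurable_fun setT (F \_ (B `*` I)).
  by move=> mB; apply/(measurable_restrictT _ (measurable_Q mB)); exact: measurable_funTS.
have P0 (B : set R) x : (0 <= (F \_ (B `*` I)) x)%E by rewrite patchE; case: ifP.
split.
  have := measurable_fun_fubini_tonelli_F (m2 := mu) _ (mP _ measurableT) (P0 _).
  congr measurable_fun; apply/funext => x.
  by rewrite /fubini_F integral_patch_slice patchE in_setT.
rewrite integral_mkcond [RHS]integral_mkcond.
rewrite [LHS](fubini_tonelli1 (m1 := mu) (m2 := mu) _ (mP _ mA) (P0 _)).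
by apply: eq_integral => x _; rewrite /fubini_F integral_patch_slice.
Qed.

Lemma co_cc (F : R -> \bar R) : measurable_fun setT F ->
  (\int[mu]_(y in `[0%R, 1%R[) F y = \int[mu]_(y in I) F y)%E.
Proof. by move=> mF; rewrite integral_itv_bndo_bndc//; exact: measurable_funTS. Qed.

Lemma ge0_integral_period_cc (F : R -> \bar R) (c : R) : 0 <= c <= 1 -> measurable_fun setT F ->
  (forall y, 0 <= F y)%E -> {ae mu, forall y, F (y + 1)%R = F y} ->
  (\int[mu]_(y in I) F (y + c)%R = \int[mu]_(y in I) F y)%E.
Proof.
move=> hc mF F0 hF; rewrite -[RHS]co_cc// -[LHS]co_cc; first exact: ge0_integral_period.
by apply: (measurableT_comp mF); exact: measurable_shift.
Qed.

Lemma measurable_shiftf (f : R -> R) c : measurable_fun setT f ->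
  measurable_fun setT (fun x : R => f (x + c)).
Proof. by move=> mf; apply: (measurableT_comp mf); exact: measurable_shift. Qed.

Lemma ge0_integral_tau (A : set R) (F : R * R -> \bar R) c : 0 <= c <= 1 ->
  measurable A -> measurable_fun setT F -> (forall x, 0 <= F x)%E ->
  {ae mu2, forall x, F (tau 1 x) = F x} ->
  (\int[mu2]_(x in A `*` I) F (tau c x) = \int[mu2]_(x in A `*` I) F x)%E.
Proof.
move=> hc mA mF F0 hF.
have mF' : measurable_fun setT (F \o tau c) by apply: (measurableT_comp mF); exact: measurable_tau.
have [m1 ->] := tonelli_strip mA mF F0.
have [m2 ->] := tonelli_strip mA mF' (fun x => F0 _).
apply: ae_eq_integral => //; try exact: measurable_funTS.
apply: aeS (ae_slices1 hF) => x hx _.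
apply: (ge0_integral_period_cc (F := fun y => F (x, y))) => //.
exact: (measurableT_comp mF (pair1_measurable x)).
Qed.

Lemma integrable_tau_strip (A : set R) f c : -1 <= c <= 1 ->
  measurable A -> measurable_fun setT f -> yper f ->
  mu2.-integrable (A `*` I) (EFin \o f) ->
  mu2.-integrable (A `*` I) (EFin \o (fun x => f (tau c x))) /\
  \int[mu2]_(x in A `*` I) f (tau c x) = \int[mu2]_(x in A `*` I) f x.
Proof.
(* A negative shift [c] agrees almost everywhere with the shift [c + 1], which is nonnegative. *)
wlog c0 : c / 0 <= c.
  move=> H hc mA mf pf iF; have [c0|c0] := leP 0 c; first exact: H.
  have hc1 : -1 <= c + 1 <= 1 by lra.
  have [|i1 <-] := H (c + 1) _ hc1 mA mf pf iF; first by lra.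
  have mt k : measurable_fun setT (fun x => f (tau k x)).
    by apply: (measurableT_comp mf); exact: measurable_tau.
  have e : {ae mu2, forall x, f (tau (c + 1) x) = f (tau c x)}.
    by apply: aeS (ae_tau c pf) => x <-; rewrite /tau/= addrA.
  have i2 : mu2.-integrable (A `*` I) (EFin \o (fun x => f (tau c x))).
    apply: (@ae_le_integrable _ _ _ mu2 _ _ (fun x => f (tau (c + 1) x))) => //.
    - exact: measurable_Q.
    - exact: measurable_funTS (mt c).
    - by apply: aeS e => x ->.
  split => //; apply: (@Rintegral_ae_eq _ _ _ mu2) => //; first exact: measurable_Q.
  by apply: aeS e => x ->.
move=> /andP[_ c1] mA mf pf /integrableP[_ iF].
have hc : 0 <= c <= 1 by rewrite c0.
have mF : measurable_fun setT (EFin \o f) by exact/measurable_EFinP.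
have mt : measurable_fun setT (fun x => f (tau c x)).
  by apply: (measurableT_comp mf); exact: measurable_tau.
split.
  apply/integrableP; split; first by apply: measurable_funTS; exact/measurable_EFinP.
  rewrite (ge0_integral_tau (F := fun x => `|(f x)%:E|%E) hc)//; first exact: measurableT_comp.
  by apply: aeS pf => x ->.
rewrite /Rintegral integralE [in RHS]integralE.
rewrite -(ge0_integral_tau hc mA (measurable_funepos mF))//; last first.
  by apply: aeS pf => y h; rewrite !funeposE/= h.
rewrite -(ge0_integral_tau hc mA (measurable_funeneg mF))//; last first.
  by apply: aeS pf => y h; rewrite !funenegE/= h.
by congr (fine (_ - _)%E); apply: eq_integral => y _; rewrite ?funeposE ?funenegE.
Qed.

(* [U] and [V] are the representatives of [f] that are absolutely continuous on
   almost every horizontal, resp. vertical, line. *)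
Record strip (f fx fy U V : R * R -> R) : Prop := Strip {
  strip_per : forall x, f (tau 1 x) = f x;
  strip_mf : measurable_fun setT f;
  strip_mU : measurable_fun setT U;
  strip_mV : measurable_fun setT V;
  strip_L2 : L1loc2 (fun x => f x ^+ 2);
  strip_Lx : L1loc2 fx;
  strip_Ly : L1loc2 fy;
  strip_fU : {ae mu2, forall x, f x = U x};
  strip_fV : {ae mu2, forall x, f x = V x};
  strip_px : yper fx;
  strip_py : yper fy;
  strip_primU : {ae mu, forall y, prim (fun x => U (x, y)) (fun x => fx (x, y))};
  strip_primV : {ae mu, forall x, prim (fun y => V (x, y)) (fun y => fy (x, y))};
  strip_x2 : mu2.-integrable Q (EFin \o (fun x => fx x ^+ 2));
  strip_y2 : mu2.-integrable Q (EFin \o (fun x => fy x ^+ 2)) }.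

Lemma integrable_sqD d (T : measurableType d) (m : {measure set T -> \bar R}) (D : set T)
  (k l : T -> R) : measurable D -> measurable_fun D k -> measurable_fun D l ->
  m.-integrable D (EFin \o (fun x => k x ^+ 2)) ->
  m.-integrable D (EFin \o (fun x => l x ^+ 2)) ->
  m.-integrable D (EFin \o (fun x => (k x + l x) ^+ 2)).
Proof.
move=> mD mk ml ik il.
apply: (@le_integrableR _ _ _ _ _ _ (fun x => 2 * k x ^+ 2 + 2 * l x ^+ 2)) => //.
- by apply: measurable_funX; exact: measurable_funD.
- move=> x _; apply: le_trans (ler_norm _); rewrite ger0_norm ?sqr_ge0//.
  by have := sqr_ge0 (k x - l x); rewrite !expr2; nra.
- by apply: integrableDR => //; exact: integrableZR.
Qed.

Lemma integrable_sqB d (T : measurableType d) (m : {measure set T -> \bar R}) (D : set T)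
  (k l : T -> R) : measurable D -> measurable_fun D k -> measurable_fun D l ->
  m.-integrable D (EFin \o (fun x => k x ^+ 2)) ->
  m.-integrable D (EFin \o (fun x => l x ^+ 2)) ->
  m.-integrable D (EFin \o (fun x => (k x - l x) ^+ 2)).
Proof.
move=> mD mk ml ik il.
apply: (@integrable_sqD _ _ m D k (fun x => - l x)) => //; first exact: measurable_funN.
by move: il; congr (_.-integrable _ _); apply/funext => x /=; rewrite sqrrN.
Qed.

Lemma strip_mx f fx fy U V : strip f fx fy U V -> measurable_fun setT fx.
Proof. by case=> *; exact: measurable_L1loc2. Qed.

Lemma strip_my f fx fy U V : strip f fx fy U V -> measurable_fun setT fy.
Proof. by case=> *; exact: measurable_L1loc2. Qed.

Lemma stripD f fx fy U V g gx gy U' V' : strip f fx fy U V -> strip g gx gy U' V' ->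
  strip (fun x => f x + g x) (fun x => fx x + gx x) (fun x => fy x + gy x)
    (fun x => U x + U' x) (fun x => V x + V' x).
Proof.
move=> sf sg; have mfx := strip_mx sf; have mgx := strip_mx sg.
have mfy := strip_my sf; have mgy := strip_my sg.
case: sf sg => a1 a2 a3 a4 a0 a5 a6 a7 a8 a9 a10 a11 a12 a13 a14.
case=> b1 b2 b3 b4 b0 b5 b6 b7 b8 b9 b10 b11 b12 b13 b14.
split; try exact: measurable_funD; try exact: L1loc2D.
- by move=> x; rewrite a1 b1.
- move=> M; apply: integrable_sqD => //; try exact: measurable_funTS.
  by rewrite boxE; exact: measurable_itvX.
- by apply: aeS (ae_and a7 b7) => x [-> ->].
- by apply: aeS (ae_and a8 b8) => x [-> ->].
- by apply: aeS (ae_and a9 b9) => x [-> ->].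
- by apply: aeS (ae_and a10 b10) => x [-> ->].
- by apply: aeS (ae_and a11 b11) => x [p q]; exact: primD.
- by apply: aeS (ae_and a12 b12) => x [p q]; exact: primD.
- by apply: integrable_sqD => //; [exact: measurable_Q|exact: measurable_funTS..].
- by apply: integrable_sqD => //; [exact: measurable_Q|exact: measurable_funTS..].
Qed.

Lemma stripB f fx fy U V g gx gy U' V' : strip f fx fy U V -> strip g gx gy U' V' ->
  strip (fun x => f x - g x) (fun x => fx x - gx x) (fun x => fy x - gy x)
    (fun x => U x - U' x) (fun x => V x - V' x).
Proof.
move=> sf sg; have mfx := strip_mx sf; have mgx := strip_mx sg.
have mfy := strip_my sf; have mgy := strip_my sg.
case: sf sg => a1 a2 a3 a4 a0 a5 a6 a7 a8 a9 a10 a11 a12 a13 a14.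
case=> b1 b2 b3 b4 b0 b5 b6 b7 b8 b9 b10 b11 b12 b13 b14.
split; try exact: measurable_funB; try exact: L1loc2B.
- by move=> x; rewrite a1 b1.
- move=> M; apply: integrable_sqB => //; try exact: measurable_funTS.
  by rewrite boxE; exact: measurable_itvX.
- by apply: aeS (ae_and a7 b7) => x [-> ->].
- by apply: aeS (ae_and a8 b8) => x [-> ->].
- by apply: aeS (ae_and a9 b9) => x [-> ->].
- by apply: aeS (ae_and a10 b10) => x [-> ->].
- by apply: aeS (ae_and a11 b11) => x [p q]; exact: primB.
- by apply: aeS (ae_and a12 b12) => x [p q]; exact: primB.
- by apply: integrable_sqB => //; [exact: measurable_Q|exact: measurable_funTS..].
- by apply: integrable_sqB => //; [exact: measurable_Q|exact: measurable_funTS..].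
Qed.

Lemma continuous_ae_eq (k l : R -> R) : continuous k -> continuous l ->
  {ae mu, forall x, k x = l x} -> k =1 l.
Proof.
move=> ck cl h x.
have P := continuous_antiderivative ck x.
have P' := continuous_antiderivative cl x.
have e : sint k = sint l.
  apply/funext => t; rewrite /sint; congr (_ - _); apply: Rintegral_ae_eq; rewrite ?measurable_itv//.
  - exact: continuous_itv_integrable.
  - exact: continuous_itv_integrable.
  - by apply: aeS h => y ->.
  - exact: continuous_itv_integrable.
  - exact: continuous_itv_integrable.
  - by apply: aeS h => y ->.
by rewrite e in P; exact: is_derive_unique P P'.
Qed.

(** The vertical lines on which traces may be taken. Both representatives agree with [f] there, so a
    boundary value produced by horizontal integration, through [U], can be read on the continuous
    periodic [V]. *)
Definition good (f fy U V : R * R -> R) (t : R) : Prop :=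
  [/\ prim (fun y => V (t, y)) (fun y => fy (t, y)),
      {ae mu, forall y, f (t, y) = V (t, y)},
      {ae mu, forall y, f (t, y) = U (t, y)},
      (forall y, V (t, y + 1) = V (t, y)) &
      mu.-integrable I (EFin \o (fun y => fy (t, y) ^+ 2))].

Lemma strip_good f fx fy U V : strip f fx fy U V -> {ae mu, forall t, good f fy U V t}.
Proof.
move=> S; case: (S) => a1 a2 a3 a4 a0 a5 a6 a7 a8 a9 a10 a11 a12 a13 a14.
have [h1 _ _] := RFubini measurableT (measurable_itv `[0, 1]) a14.
apply: aeS (ae_and (ae_and a12 h1) (ae_and (ae_slices1 a7) (ae_slices1 a8))) => t [[p i] [q1 q2]].
split => //; last exact: i.
have cV := prim_continuous p.
apply: (@continuous_ae_eq (fun y => V (t, y + 1)) (fun y => V (t, y))) => //.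
  move=> y; apply: (@continuous_comp R R R (fun y : R => y + 1) (fun y : R => V (t, y))); last exact: cV.
  by apply: cvgD; [exact: cvg_id|exact: cvg_cst].
apply: aeS (ae_and q2 (ae_shift 1 q2)) => y [<- <-].
exact: (a1 (t, y)).
Qed.

Lemma Rintegral_cstI (c : R) : \int[mu]_(z in I) c = c.
Proof.
have mI : measurable I by exact: measurable_itv.
have h : mu I = 1%:E by rewrite lebesgue_measure_itv/= lte_fin ltr01 oppr0 adde0.
transitivity (c * fine (mu I)); first exact: Rintegral_cst.
by rewrite h mulr1.
Qed.

(** [|k| <= (d + k ^+ 2 / d) / 2], from the square of [|k| - d]. The weight [d] is free, to be
    matched with the size of the energy. *)
Lemma Rintegral_abs_le (k : R -> R) (d : R) : 0 < d -> measurable_fun setT k ->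
  mu.-integrable I (EFin \o (fun y => k y ^+ 2)) ->
  mu.-integrable I (EFin \o k) /\
  \int[mu]_(y in I) `|k y| <= (d + d^-1 * \int[mu]_(y in I) (k y ^+ 2)) / 2.
Proof.
move=> d0 mk ik.
have mI : measurable I by exact: measurable_itv.
have ic (c : R) : mu.-integrable I (EFin \o (fun=> c)).
  by apply: continuous_itv_integrable => x; exact: cvg_cst.
have iB : mu.-integrable I (EFin \o (fun y => (2^-1 * d) + (2^-1 * d^-1) * k y ^+ 2)).
  by apply: integrableDR => //; exact: integrableZR.
have le y : `|k y| <= (2^-1 * d) + (2^-1 * d^-1) * k y ^+ 2.
  have : 0 <= (2^-1 * d^-1) * (`|k y| - d) ^+ 2.
    by apply: mulr_ge0; [apply: mulr_ge0; rewrite ?invr_ge0 ltW|exact: sqr_ge0].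
  rewrite -[k y ^+ 2]real_normK ?num_real// => H; rewrite -subr_ge0.
  rewrite (_ : _ - `|k y| = 2^-1 * d^-1 * (`|k y| - d) ^+ 2)//.
  by field; rewrite gt_eqF.
have ia : mu.-integrable I (EFin \o k).
  apply: le_integrableR iB => //; first exact: measurable_funTS.
  by move=> y _; rewrite (le_trans (le y))// ler_norm.
split => //.
apply: le_trans (_ : \int[mu]_(y in I) ((2^-1 * d) + (2^-1 * d^-1) * k y ^+ 2) <= _).
  apply: le_Rintegral => //.
  exact: (integrable_norm ia).
rewrite RintegralD//; last exact: integrableZR.
rewrite Rintegral_cstI RintegralZl//.
by rewrite le_eqVlt; apply/orP; left; apply/eqP; field; rewrite gt_eqF.
Qed.

Definition mean f (t : R) : R := \int[mu]_(y in I) f (t, y).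

(** The left side is the average over [z] of [V (t, y) - V (t, z)], and each such increment is
    bounded by the total variation over one period. *)
Lemma good_mean f fx fy U V t y : strip f fx fy U V -> good f fy U V t -> I y ->
  `|V (t, y) - mean f t| <= \int[mu]_(z in I) `|fy (t, z)|.
Proof.
move=> S [pV fV _ _ i2] Iy.
have mI : measurable I by exact: measurable_itv.
have cV := prim_continuous pV.
have -> : mean f t = \int[mu]_(z in I) V (t, z).
  rewrite /mean /Rintegral; congr fine; apply: ae_eq_integral => //.
  - apply: measurable_funTS; apply/measurable_EFinP; apply: measurable_slice2; exact: strip_mf S.
  - apply: measurable_funTS; apply/measurable_EFinP; apply: measurable_slice2; exact: strip_mV S.
  - by apply: aeS fV => z ->.
have ic (c : R) : mu.-integrable I (EFin \o (fun=> c)).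
  by apply: continuous_itv_integrable => x; exact: cvg_cst.
have iV := @continuous_itv_integrable _ _ 0 1 cV.
have c1 (c : R) : \int[mu]_(z in I) c = c.
  exact: Rintegral_cstI.
rewrite -[X in `|X - _|](c1 (V (t, y))) -RintegralB//.
have iB := @integrableBR _ _ _ mu _ mI _ _ (ic (V (t, y))) iV.
apply: le_trans (@le_normr_Rintegral _ _ _ mu I _ mI iB) _.
set m := (X in _ <= X); rewrite -(c1 m).
have [ifI _] := pV 0 1 ler01.
have sub s r : 0 <= s -> s <= r -> r <= 1 -> `|V (t, r) - V (t, s)| <= m.
  move=> s0 sr r1; apply: le_trans (prim_norm pV sr) _.
  have ia : mu.-integrable I (EFin \o (fun z => `|fy (t, z)|)) by exact: (integrable_norm ifI).
  rewrite /m (Rintegral_itv_split (r := s) _ _ ia)//; last by lra.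
  rewrite (Rintegral_itv_split (s := s) (r := r) _ _ (integrable_subitv _ _ ia))//.
  rewrite addrCA lerDl addr_ge0//; exact: Rintegral_ge0.
apply: le_Rintegral => //; first exact: (integrable_norm iB).
move=> z; move: Iy; rewrite /= !in_itv/= => /andP[y0 y1] /andP[z0 z1].
have [yz|zy] := leP y z; first by rewrite distrC; exact: sub.
by apply: sub => //; exact: ltW.
Qed.

(** If [|k| >= e] held at almost every point of [D], the integral of [|k|] over [D] would be
    infinite. *)
Lemma small_time (D : set R) (k : R -> R) (G : R -> Prop) (e : R) : measurable D ->
  mu D = +oo%E -> mu.-integrable setT (EFin \o k) -> {ae mu, forall t, G t} -> 0 < e ->
  exists t, [/\ D t, G t & `|k t| < e].
Proof.
move=> mD Doo ik hG e0; apply: contrapT => H.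
have /integrableP[mk] := @integrableS _ _ _ mu _ _ _ measurableT mD (@subsetT _ _) ik.
apply/negP; rewrite -leNgt.
have -> : (+oo = \int[mu]_(x in D) (cst e%:E) x :> \bar R)%E.
  by rewrite integral_cst//= Doo gt0_muley// lte_fin.
apply: ae_ge0_le_integral => //.
- by move=> x _; rewrite lee_fin ltW.
- exact: measurableT_comp.
- apply: aeS hG => t Gt Dt; rewrite /= lee_fin leNgt; apply/negP => h.
  by apply: H; exists t.
Qed.

Lemma measure_itv_oy (T : R) : mu `]T, +oo[ = +oo%E.
Proof. by rewrite lebesgue_measure_itv/= ltry. Qed.

Lemma measure_itv_yo (T : R) : mu `]-oo, T[ = +oo%E.
Proof. by rewrite lebesgue_measure_itv/= ltNyr. Qed.

(* The range exceeds the period because of the translations by [h] and [- h], [h <= 1], in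
   difference quotients. *)
Definition vclose (V : R * R -> R) (t p e : R) := forall y, -1 <= y <= 2 -> `|V (t, y) - p| <= e.

Lemma strip_energy f fx fy U V : strip f fx fy U V ->
  mu.-integrable setT (EFin \o (fun t => \int[mu]_(y in I) (fy (t, y) ^+ 2))).
Proof. by move=> S; have [_ + _] := RFubini measurableT (measurable_itv `[0, 1]) (strip_y2 S). Qed.

Lemma good_close f fx fy U V t p e : strip f fx fy U V -> good f fy U V t -> 0 < e ->
  `|mean f t - p| <= e / 2 -> \int[mu]_(y in I) (fy (t, y) ^+ 2) < (e / 2) ^+ 2 ->
  vclose V t p e.
Proof.
move=> S g e0 hp hm; have [_ _ _ per i2] := g.
have e20 : 0 < e / 2 by lra.
(* With weight [e / 2] and energy below [(e / 2) ^+ 2], the distance to the mean is at most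
   [(e / 2 + e / 2) / 2 = e / 2]; the mean contributes the other half. Periodicity then extends the
   bound from [[0, 1]] to [[-1, 2]]. *)
have [_] := Rintegral_abs_le e20 (measurable_slice2 t (strip_my S)) i2.
have : (e / 2)^-1 * \int[mu]_(y in I) (fy (t, y) ^+ 2) <= e / 2.
  by rewrite ler_pdivrMl// -expr2 ltW.
move=> h1 h2.
have h y : I y -> `|V (t, y) - p| <= e.
  move=> Iy; have := good_mean S g Iy.
  have -> : V (t, y) - p = (V (t, y) - mean f t) + (mean f t - p) by ring.
  by have := ler_normD (V (t, y) - mean f t) (mean f t - p); lra.
move=> y hy; have [y0|y0] := ltP y 0.
  by rewrite -per; apply: h; rewrite /= in_itv/=; lra.
have [y1|y1] := leP y 1; first by apply: h; rewrite /= in_itv/=; lra.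
have -> : y = (y - 1) + 1 by ring.
by rewrite per; apply: h; rewrite /= in_itv/=; lra.
Qed.

(** A single time serves both components because the sum of their two vertical energies is
    integrable. The free condition [G] lets the caller impose further properties that hold at almost
    every time, such as [good] for sums and differences. *)
Lemma good_time f fx fy U V g gx gy U' V' (D : set R) (G : R -> Prop) (p q e : R) :
  strip f fx fy U V -> strip g gx gy U' V' -> measurable D -> mu D = +oo%E ->
  {ae mu, forall t, D t -> `|mean f t - p| <= e / 2} ->
  {ae mu, forall t, D t -> `|mean g t - q| <= e / 2} ->
  {ae mu, forall t, G t} -> 0 < e ->
  exists t, [/\ D t, G t, good f fy U V t, good g gy U' V' t & vclose V t p e /\ vclose V' t q e].
Proof.
move=> S S' mD Doo hp hq hG e0.
have i := @integrableDR _ _ _ mu _ measurableT _ _ (strip_energy S) (strip_energy S').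
have e1 : 0 < (e / 2) ^+ 2 by apply: exprn_gt0; lra.
have [t [Dt [Gt [g1 [g2 [h1 h2]]]]]] := small_time mD Doo i
  (ae_and hG (ae_and (strip_good S) (ae_and (strip_good S') (ae_and hp hq)))) e1.
have E0 (k : R * R -> R) : 0 <= \int[mu]_(y in I) (k (t, y) ^+ 2).
  by apply: Rintegral_ge0 => y _; exact: sqr_ge0.
rewrite ger0_norm ?addr_ge0// => hE.
exists t; split => //; split.
- by apply: (good_close S g1) => //; [exact: h1|apply: le_lt_trans hE; rewrite lerDl].
- by apply: (good_close S' g2) => //; [exact: h2|apply: le_lt_trans hE; rewrite lerDr].
Qed.

(** [m] is the limit at [-oo] and [p] the one at [+oo]. As in [bc], they are limits of a
    representative of the mean, which agrees with [mean f] at almost every time only. *)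
Definition tends f (m p : R) := exists ub : R -> R,
  [/\ {ae mu, forall t, ub t = mean f t},
    ub t @[t --> +oo] --> p & ub t @[t --> -oo] --> m].

Lemma good_time_p f fx fy U V g gx gy U' V' (G : R -> Prop) (mf pf mg pg T e : R) :
  strip f fx fy U V -> strip g gx gy U' V' -> tends f mf pf -> tends g mg pg ->
  {ae mu, forall t, G t} -> 0 < e ->
  exists t, [/\ T < t, G t, good f fy U V t, good g gy U' V' t & vclose V t pf e /\ vclose V' t pg e].
Proof.
move=> S S' [ub [ub1 ubp _]] [vb [vb1 vbp _]] hG e0.
have e20 : 0 < e / 2 by lra.
have /cvgrPdist_le/(_ _ e20) [A [_ hA]] := ubp.
have /cvgrPdist_le/(_ _ e20) [B [_ hB]] := vbp.
pose M := Num.max T (Num.max A B).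
have [||t [Mt Gt g1 g2 c]] := @good_time _ _ _ _ _ _ _ _ _ _ `]M, +oo[%classic G pf pg e S S'
  (measurable_itv _) (measure_itv_oy M) _ _ hG e0.
- apply: aeS ub1 => t <- /=; rewrite in_itv/= andbT !gt_max => /and3P[_ At _].
  by rewrite distrC; exact: hA.
- apply: aeS vb1 => t <- /=; rewrite in_itv/= andbT !gt_max => /and3P[_ _ Bt].
  by rewrite distrC; exact: hB.
by exists t; split => //; move: Mt; rewrite /= in_itv/= andbT !gt_max => /and3P[].
Qed.

Lemma good_time_m f fx fy U V g gx gy U' V' (G : R -> Prop) (mf pf mg pg T e : R) :
  strip f fx fy U V -> strip g gx gy U' V' -> tends f mf pf -> tends g mg pg ->
  {ae mu, forall t, G t} -> 0 < e ->
  exists t, [/\ t < T, G t, good f fy U V t, good g gy U' V' t & vclose V t mf e /\ vclose V' t mg e].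
Proof.
move=> S S' [ub [ub1 _ ubp]] [vb [vb1 _ vbp]] hG e0.
have e20 : 0 < e / 2 by lra.
have /cvgrPdist_le/(_ _ e20) [A [_ hA]] := ubp.
have /cvgrPdist_le/(_ _ e20) [B [_ hB]] := vbp.
pose M := Num.min T (Num.min A B).
have [||t [Mt Gt g1 g2 c]] := @good_time _ _ _ _ _ _ _ _ _ _ `]-oo, M[%classic G mf mg e S S'
  (measurable_itv _) (measure_itv_yo M) _ _ hG e0.
- apply: aeS ub1 => t <- /=; rewrite in_itv/= !lt_min => /and3P[_ At _].
  by rewrite distrC; exact: hA.
- apply: aeS vb1 => t <- /=; rewrite in_itv/= !lt_min => /and3P[_ _ Bt].
  by rewrite distrC; exact: hB.
by exists t; split => //; move: Mt; rewrite /= in_itv/= !lt_min => /and3P[].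
Qed.

Lemma Rintegral_ae_eqm d (T : measurableType d) (m : {measure set T -> \bar R})
  (D : set T) (F G : T -> R) : measurable D ->
  measurable_fun D F -> measurable_fun D G ->
  {ae m, forall x, D x -> F x = G x} ->
  \int[m]_(x in D) F x = \int[m]_(x in D) G x.
Proof.
move=> mD mF mG h; rewrite /Rintegral; congr fine; apply: ae_eq_integral => //.
- exact/measurable_EFinP.
- exact/measurable_EFinP.
- by apply: aeS h => x hx Dx; rewrite hx.
Qed.

Lemma measurable_box (s t : R) : measurable (`[s, t]%classic `*` I : set (R * R)).
Proof. by apply: measurable_Q; exact: measurable_itv. Qed.

Lemma hflux (Y g : R * R -> R) s t : s <= t -> measurable_fun setT Y ->
  {ae mu, forall y, prim (fun x => Y (x, y)) (fun x => g (x, y))} ->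
  mu2.-integrable (`[s, t] `*` I) (EFin \o g) ->
  \int[mu2]_(x in `[s, t] `*` I) g x = \int[mu]_(y in I) (Y (t, y) - Y (s, y)).
Proof.
move=> st mY hp ig.
have [_ i1 ->] := RFubini' (measurable_itv `[s, t]) (measurable_itv `[0, 1]) ig.
apply: Rintegral_ae_eqm.
- exact: measurable_itv.
- by have /integrableP[/measurable_EFinP] := i1.
- by apply: measurable_funTS; apply: measurable_funB; exact: measurable_slice2.
- by apply: aeS hp => y p _; have [_ ->] := p _ _ st.
Qed.

(** The chain rule holds on horizontal lines for [U] and is integrated over the height; at the good
    times [s] and [t] the boundary values pass from [U] to [V]. *)
Lemma flux_x f fx fy U V (F f0 : R -> R) (C s t : R) : strip f fx fy U V ->
  (forall x : R, is_derive x (1 : R) F (f0 x)) -> continuous f0 -> (forall x, `|f0 x| <= C) ->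
  s <= t -> good f fy U V s -> good f fy U V t ->
  mu2.-integrable (`[s, t] `*` I) (EFin \o (fun x => fx x * f0 (f x))) /\
  \int[mu2]_(x in `[s, t] `*` I) (fx x * f0 (f x)) =
    \int[mu]_(y in I) (F (V (t, y)) - F (V (s, y))).
Proof.
move=> S dF cf0 bf0 st gs gt.
have cF := is_derive_continuous dF.
have mf0 := continuous_measurable_fun cf0; have mF := continuous_measurable_fun cF.
have mB := measurable_box s t.
have mU := strip_mU S; have mf := strip_mf S; have mV := strip_mV S.
have ix : mu2.-integrable (`[s, t] `*` I) (EFin \o fx) by apply: L1loc2_box; exact: strip_Lx S.
have iG (k : R * R -> R) : measurable_fun setT k ->
    mu2.-integrable (`[s, t] `*` I) (EFin \o (fun x => fx x * f0 (k x))).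
  move=> mk; apply: (@integrable_bounded_mul _ _ _ mu2 _ fx (fun x => f0 (k x)) C) => //.
  by apply: measurable_funTS; exact: (measurableT_comp mf0).
split; first exact: iG.
transitivity (\int[mu2]_(x in `[s, t] `*` I) (fx x * f0 (U x))).
  apply: (@Rintegral_ae_eq _ _ _ mu2) => //; [exact: iG..|].
  by apply: aeS (strip_fU S) => x ->.
rewrite (hflux (Y := fun x => F (U x)))//; last first.
- exact: iG.
- apply: aeS (strip_primU S) => y p.
  by apply: prim_ext (prim_comp p dF cf0) => x //=; rewrite mulrC.
- exact: (measurableT_comp mF).
have mS (k : R * R -> R) r : measurable_fun setT k -> measurable_fun setT (fun y => F (k (r, y))).
  by move=> mk; apply: (measurableT_comp mF); exact: measurable_slice2.
apply: Rintegral_ae_eqm.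
- exact: measurable_itv.
- by apply: measurable_funTS; apply: measurable_funB; exact: mS.
- by apply: measurable_funTS; apply: measurable_funB; exact: mS.
- have [_ s1 s2 _ _] := gs; have [_ t1 t2 _ _] := gt.
  by apply: aeS (ae_and (ae_and s1 s2) (ae_and t1 t2)) => y [[<- ->] [<- ->]].
Qed.

(** On a good vertical line the integral is [F (V (x, 1)) - F (V (x, 0))], which is zero because [V]
    is periodic at every point of such a line. *)
Lemma flux_y f fx fy U V (F f0 : R -> R) (C s t : R) : strip f fx fy U V ->
  (forall x : R, is_derive x (1 : R) F (f0 x)) -> continuous f0 -> (forall x, `|f0 x| <= C) ->
  s <= t ->
  mu2.-integrable (`[s, t] `*` I) (EFin \o (fun x => fy x * f0 (f x))) /\
  \int[mu2]_(x in `[s, t] `*` I) (fy x * f0 (f x)) = 0.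
Proof.
move=> S dF cf0 bf0 st.
have mf0 := continuous_measurable_fun cf0.
have mB := measurable_box s t.
have mf := strip_mf S.
have ix : mu2.-integrable (`[s, t] `*` I) (EFin \o fy) by apply: L1loc2_box; exact: strip_Ly S.
have iG : mu2.-integrable (`[s, t] `*` I) (EFin \o (fun x => fy x * f0 (f x))).
  apply: (@integrable_bounded_mul _ _ _ mu2 _ fy (fun x => f0 (f x)) C) => //.
  by apply: measurable_funTS; exact: (measurableT_comp mf0).
split => //.
have [_ i1 ->] := RFubini (measurable_itv `[s, t]) (measurable_itv `[0, 1]) iG.
transitivity (\int[mu]_(x in `[s, t]) (0 : R)); last by rewrite /Rintegral integral0.
apply: Rintegral_ae_eqm.
- exact: measurable_itv.
- by have /integrableP[/measurable_EFinP] := i1.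
- exact: measurable_cst.
apply: aeS (strip_good S) => x [p fV _ per _] _.
have [i2 h2] := prim_comp p dF cf0 ler01.
transitivity (\int[mu]_(y in `[0, 1]) (f0 (V (x, y)) * fy (x, y))).
  apply: Rintegral_ae_eqm.
  - exact: measurable_itv.
  - apply: measurable_funTS; apply: measurable_funM.
      by apply: measurable_slice2; exact: strip_my S.
    by apply: (measurableT_comp mf0); exact: measurable_slice2.
  - by have /integrableP[/measurable_EFinP] := i2.
  - by apply: aeS fV => y -> _; rewrite mulrC.
by rewrite -h2 -[1]add0r per subrr.
Qed.

Lemma cell_tail (k : R * R -> R) (e : R) : mu2.-integrable Q (EFin \o k) -> 0 < e ->
  exists T, forall s t, s < - T -> T < t ->
    `|\int[mu2]_(x in Q) k x - \int[mu2]_(x in `[s, t] `*` I) k x| <= e.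
Proof.
move=> ik e0.
have mQ := measurable_Q measurableT.
have iP : mu2.-integrable setT (EFin \o (k \_ Q)) by exact: (@integrable_patch _ _ _ mu2 _ _ mQ).1.
have mP : measurable_fun setT (k \_ Q) by have /integrableP[/measurable_EFinP] := iP.
pose fn (n : nat) (x : R * R) : R := `|(k \_ Q) x| * (if n%:R < `|x.1| then 1 else 0).
have mfn n : measurable_fun setT (fn n).
  apply: measurable_funM; first exact: measurableT_comp.
  apply: measurable_fun_ifT => //; apply: measurable_fun_ltr => //.
  by apply: measurableT_comp => //; exact: measurable_fst.
have lefn n x : `|fn n x| <= `|(k \_ Q) x|.
  by rewrite /fn; case: ifP => _; rewrite ?mulr1 ?mulr0 ?normr_id ?normr0.
have cfn x : fn n x @[n --> \oo] --> (0 : R).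
  apply: cvg_near_cst; exists (Num.truncn `|x.1|).+1 => // n /= hn.
  rewrite /fn; case: ifPn => [h|]; last by rewrite mulr0.
  have := truncnS_gt `|x.1|; have : (Num.truncn `|x.1|).+1%:R <= n%:R :> R by rewrite ler_nat.
  lra.
have [_] := @Rdominated_cvg _ _ _ mu2 setT fn (fun=> 0) (fun x => `|(k \_ Q) x|) measurableT
  mfn (measurable_cst _) (fun x _ => cfn x) (integrable_norm iP) (fun n x _ => lefn n x).
have -> : \int[mu2]_(x in setT) (0 : R) = 0 by rewrite /Rintegral integral0.
move=> /cvgrPdist_le/(_ _ e0)[n _ /(_ _ (leqnn n))] /=; rewrite sub0r normrN => hn.
exists n%:R => s t sn tn.
apply: le_trans hn.
have mA := measurable_box s t.
have iA : mu2.-integrable (`[s, t] `*` I) (EFin \o k).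
  by apply: (@integrableS _ _ _ mu2 _ _ _ mQ mA) => //; apply: subsetX.
have iPA : mu2.-integrable setT (EFin \o (k \_ (`[s, t] `*` I))) by exact: (@integrable_patch _ _ _ mu2 _ _ mA).1.
rewrite Rintegral_mkcond [X in _ - X]Rintegral_mkcond -RintegralB//.
have iB := @integrableBR _ _ _ mu2 _ measurableT _ _ iP iPA.
apply: le_trans (le_normr_Rintegral measurableT iB) _.
apply: le_trans (ler_norm _).
apply: le_Rintegral => //.
- exact: (integrable_norm iB).
- exact: (@le_integrableR _ _ _ mu2 _ _ (k \_ Q) measurableT (mfn n) (fun x _ => lefn n x) iP).
move=> [x y] _; rewrite /fn/= !patchE !in_setX/= in_setT/=.
case: (boolP (y \in _)) => yI; last by rewrite andbF subr0 normr0 mul0r.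
rewrite andbT; case: ifPn => [_|]; first by rewrite subrr normr0; case: ifP; rewrite ?mulr1 ?mulr0.
rewrite mem_setE in_itv/= subr0 => h; case: ifPn; rewrite ?mulr1// -leNgt ler_norml => h'.
by exfalso; move: h; rewrite negb_and -!ltNge; lra.
Qed.

(** All sufficiently wide boxes approximate the integral over [Q], so it is enough to control boxes
    whose ends are chosen conveniently, provided they can be chosen arbitrarily far out. *)
Lemma cell_limit (k : R * R -> R) (c : R) : mu2.-integrable Q (EFin \o k) ->
  (forall e T, 0 < e -> exists s t, [/\ s < - T, T < t &
    `|\int[mu2]_(x in `[s, t] `*` I) k x - c| <= e]) ->
  \int[mu2]_(x in Q) k x = c.
Proof.
move=> ik H; apply/eqP; rewrite -subr_eq0 -normr_le0; apply/ler_addgt0Pl => e e0; rewrite addr0.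
have e20 : 0 < e / 2 by lra.
have [T hT] := cell_tail ik e20; have [s [t [sT Tt h]]] := H _ T e20.
have h1 := hT _ _ sT Tt.
set a := \int[mu2]_(x in Q) k x in h1 *; set b := \int[mu2]_(x in _) k x in h h1.
have -> : a - c = (a - b) + (b - c) by ring.
by have := ler_normD (a - b) (b - c); lra.
Qed.

End strip.

(** * The Jacobian is a null Lagrangian *)

Section determinant.
Context {R : realType}.
Notation mu := (@lebesgue_measure R).
Notation mu2 := (@mu2 R).
Notation I := (`[0%R, 1%R]%classic : set R).
Notation Q := (setT `*` I : set (R * R)).
Implicit Types f g : R * R -> R.

Lemma tonelli_AB (A B : set R) (F : R * R -> \bar R) : measurable A -> measurable B ->
  measurable_fun setT F -> (forall x, 0 <= F x)%E ->
  (\int[mu]_(x in A) \int[mu]_(y in B) F (x, y) = \int[mu]_(y in B) \int[mu]_(x in A) F (x, y))%E.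
Proof.
move=> mA mB mF F0.
have mP : measurable_fun setT (F \_ (A `*` B)).
  by apply/(measurable_restrictT _ (measurableX mA mB)); exact: measurable_funTS.
have P0 x : (0 <= (F \_ (A `*` B)) x)%E by rewrite patchE; case: ifP.
have := fubini_tonelli (m1 := mu) (m2 := mu) _ mP P0.
have -> : (fun x => \int[mu]_y (F \_ (A `*` B)) (x, y))%E = (fun x => \int[mu]_(y in B) F (x, y))%E \_ A.
  apply/funext => x; rewrite patchE; case: ifPn => xA.
    by rewrite [RHS]integral_mkcond; apply: eq_integral => y _; rewrite !patchE in_setX/= xA.
  by rewrite integral0_eq// => y _; rewrite patchE in_setX/= (negbTE xA).
have -> : (fun y => \int[mu]_x (F \_ (A `*` B)) (x, y))%E = (fun y => \int[mu]_(x in A) F (x, y))%E \_ B.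
  apply/funext => y; rewrite patchE; case: ifPn => yB.
    by rewrite [RHS]integral_mkcond; apply: eq_integral => x _; rewrite !patchE in_setX/= yB andbT.
  by rewrite integral0_eq// => x _; rewrite patchE in_setX/= (negbTE yB) andbF.
by rewrite -!integral_mkcond.
Qed.

(** The integral of [(g - k) ^+ 2] is nonnegative, taken at the mean value [k]. The right side is an
    extended real, so that lines of infinite energy are allowed. *)
Lemma sq_Rintegral_le (a b : R) (g : R -> R) : a < b -> measurable_fun setT g ->
  mu.-integrable `[a, b] (EFin \o g) ->
  (((\int[mu]_(x in `[a, b]) g x) ^+ 2)%:E <=
    (b - a)%:E * \int[mu]_(x in `[a, b]) (g x ^+ 2)%:E)%E.
Proof.
move=> ab mg ig; have L0 : 0 < b - a by lra.
have mA : measurable `[a, b]%classic by exact: measurable_itv.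
have [fin|] := ltP (\int[mu]_(x in `[a, b]) (g x ^+ 2)%:E)%E +oo%E; last first.
  by rewrite leye_eq => /eqP ->; rewrite gt0_muley ?lte_fin// leey.
have ig2 : mu.-integrable `[a, b] (EFin \o (fun x => g x ^+ 2)).
  apply/integrableP; split.
    by apply: measurable_funTS; apply/measurable_EFinP; exact: measurable_funX.
  apply: le_lt_trans fin; rewrite le_eqVlt; apply/orP; left; apply/eqP.
  by apply: eq_integral => x _ /=; rewrite ger0_norm// sqr_ge0.
have -> : (\int[mu]_(x in `[a, b]) (g x ^+ 2)%:E = (\int[mu]_(x in `[a, b]) (g x ^+ 2))%:E)%E.
  by rewrite /Rintegral fineK//; exact: (integrable_fin_num _ ig2).
rewrite -EFinM lee_fin.
set c := \int[mu]_(x in `[a, b]) g x; set k := c / (b - a).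
have ic (z : R) : mu.-integrable `[a, b] (EFin \o (fun=> z)).
  by apply: continuous_itv_integrable => x; exact: cvg_cst.
have := @Rintegral_ge0 _ _ _ mu `[a, b]%classic (fun x => g x ^+ 2 - 2 * k * g x + k ^+ 2).
have -> : \int[mu]_(x in `[a, b]) (g x ^+ 2 - 2 * k * g x + k ^+ 2) =
    \int[mu]_(x in `[a, b]) (g x ^+ 2) - 2 * k * c + k ^+ 2 * (b - a).
  have i1 := @integrableZR _ _ _ mu _ mA (2 * k) _ ig.
  rewrite RintegralD//; last exact: (@integrableBR _ _ _ mu _ mA _ _ ig2 i1).
  rewrite RintegralB// RintegralZl//; congr (_ + _).
  rewrite Rintegral_cst// (_ : fine _ = b - a)//.
  have : mu `[a, b]%classic = (b - a)%:E by rewrite lebesgue_measure_itv/= lte_fin ab.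
  by move=> h; transitivity (fine (mu `[a, b]%classic)) => //; rewrite h.
move=> H; have : 0 <= \int[mu]_(x in `[a, b]) (g x ^+ 2) - 2 * k * c + k ^+ 2 * (b - a).
  by apply: H => x _; rewrite (_ : _ + _ = (g x - k) ^+ 2) ?sqr_ge0//; ring.
have -> : \int[mu]_(x in `[a, b]) (g x ^+ 2) - 2 * k * c + k ^+ 2 * (b - a) =
   \int[mu]_(x in `[a, b]) (g x ^+ 2) - c ^+ 2 / (b - a).
  by rewrite /k; field; rewrite gt_eqF.
by rewrite subr_ge0 ler_pdivrMr// mulrC.
Qed.

Lemma ge0_integral_period_sym (F : R -> \bar R) (c : R) : -1 <= c <= 1 -> measurable_fun setT F ->
  (forall y, 0 <= F y)%E -> {ae mu, forall y, F (y + 1)%R = F y} ->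
  (\int[mu]_(y in I) F (y + c)%R = \int[mu]_(y in I) F y)%E.
Proof.
move=> /andP[c0 c1] mF F0 hF; have [c2|c2] := leP 0 c.
  by apply: ge0_integral_period_cc => //; rewrite c2.
rewrite -(ge0_integral_period_cc (c := c + 1) _ mF)//; last by lra.
have ms k : measurable_fun setT (fun y : R => F (y + k)).
  by apply: (measurableT_comp mF); exact: measurable_shift.
apply: ae_eq_integral => //; first exact: measurable_funTS (ms c).
  exact: measurable_funTS (ms (c + 1)).
by apply: aeS (ae_shift c hF) => y <- _; rewrite addrA.
Qed.

(* Jensen on each window and Tonelli: averaging a periodic derivative does not increase its L2 norm. *)
Lemma jensen_line (V k : R -> R) (h : R) : 0 < h -> h <= 1 -> prim V k -> measurable_fun setT k ->
  {ae mu, forall y, k (y + 1)%R = k y} ->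
  (\int[mu]_(y in I) (((V (y + h) - V (y - h)) / (2 * h)) ^+ 2)%:E <= \int[mu]_(y in I) (k y ^+ 2)%:E)%E.
Proof.
move=> h0 h1 pV mk per.
pose Ke (y : R) : \bar R := (k y ^+ 2)%:E.
have mKe : measurable_fun setT Ke by apply/measurable_EFinP; exact: measurable_funX.
have Ke0 y : (0 <= Ke y)%E by rewrite lee_fin sqr_ge0.
pose F (z : R * R) : \bar R := Ke (z.2 + z.1).
have mF : measurable_fun setT F.
  by apply: (measurableT_comp mKe); apply: measurable_funD; [exact: measurable_snd|exact: measurable_fst].
have F0 z : (0 <= F z)%E by exact: Ke0.
pose H : set R := `[- h, h]%classic.
have mH : measurable H by exact: measurable_itv.
have mI : measurable I by exact: measurable_itv.
have cV := prim_continuous pV.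
have mV := continuous_measurable_fun cV.
have mS c : measurable_fun setT (fun y : R => V (y + c)) by exact: measurable_shiftf.
have mR : measurable_fun setT (fun y => \int[mu]_(r in H) F (r, y))%E.
  have mP : measurable_fun setT (fun z : R * R => (F \_ (H `*` setT)) (z.2, z.1)).
    have mP' : measurable_fun setT (F \_ (H `*` setT)).
      by apply/(measurable_restrictT _ (measurableX mH measurableT)); exact: measurable_funTS.
    by apply: (measurableT_comp mP'); exact: measurable_swap.
  have := measurable_fun_fubini_tonelli_F (m2 := mu) _ mP.
  have P0 (z : R * R) : (0 <= (F \_ (H `*` setT)) (z.2, z.1))%E by rewrite patchE; case: ifP.
  move=> /(_ P0); congr measurable_fun; apply/funext => y; rewrite /fubini_F [RHS]integral_mkcond.
  by apply: eq_integral => r _; rewrite !patchE in_setX/= in_setT andbT.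
have hh : 0 < (2 * h)^-1 by rewrite invr_gt0; lra.
have step1 y : ((((V (y + h) - V (y - h)) / (2 * h)) ^+ 2)%:E <=
    ((2 * h)^-1)%:E * \int[mu]_(r in H) F (r, y))%E.
  have lt : y - h < y + h by lra.
  have [iy ->] := pV (y - h) (y + h) (ltW lt).
  have := sq_Rintegral_le lt mk iy.
  have -> : (\int[mu]_(x in `[(y - h)%R, (y + h)%R]) (k x ^+ 2)%:E = \int[mu]_(r in H) F (r, y))%E.
    rewrite -(integral_mksub y (F := Ke))//.
    have -> : (fun x : R => x + y) @^-1` `[y - h, y + h]%classic = H.
      by apply/seteqP; split => x; rewrite /H /= !in_itv/=; lra.
    by apply: eq_integral => r _; rewrite /F /= addrC.
  have -> : y + h - (y - h) = 2 * h by ring.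
  move=> Hle.
  rewrite exprMn (_ : ((2 * h)^-1 ^+ 2) = (2 * h)^-1 * (2 * h)^-1)// mulrC -mulrA EFinM.
  apply: lee_wpmul2l; first by rewrite lee_fin ltW.
  by rewrite EFinM lee_pdivrMl//; lra.
apply: (@le_trans _ _ (\int[mu]_(y in I) (((2 * h)^-1)%:E * \int[mu]_(r in H) F (r, y)))%E).
  apply: ge0_le_integral => //.
  - by move=> y _; rewrite lee_fin sqr_ge0.
  - apply: measurable_funTS; apply/measurable_EFinP; apply: measurable_funX.
    by apply: measurable_funM => //; apply: measurable_funB; exact: mS.
  - by apply: measurable_funTS; apply: emeasurable_funM.
rewrite ge0_integralZl//; last 3 first.
- exact: measurable_funTS.
- by move=> y _; apply: integral_ge0 => r _; exact: F0.
- by rewrite lee_fin ltW.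
rewrite -(tonelli_AB mH mI mF F0).
rewrite (eq_integral (cst (\int[mu]_(y in I) (k y ^+ 2)%:E)%E)); last first.
  move=> r; rewrite inE /H /= in_itv/= => hr.
  rewrite -(ge0_integral_period_sym (c := r) (F := Ke))//; first by lra.
  by apply: aeS per => y e; rewrite /Ke e.
have eH : mu H = (2 * h)%:E.
  rewrite /H lebesgue_measure_itv/= lte_fin ifT; last by lra.
  by rewrite -EFinB; congr EFin; ring.
set c := (\int[mu]_(y in I) (k y ^+ 2)%:E)%E.
rewrite [X in (_ * X <= _)%E](_ : _ = c * (2 * h)%:E)%E; last first.
  by transitivity (c * mu H)%E; [exact: integral_cst|rewrite eH].
by rewrite muleCA -EFinM mulVf ?mule1// gt_eqF; lra.
Qed.

(* Replaces the derivative in [x2]: it is defined everywhere, and skew-adjoint over a period. *)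
Definition dq (h : R) f (x : R * R) : R := (f (tau h x) - f (tau (- h) x)) / (2 * h).

Lemma measurable_comp_tau h f : measurable_fun setT f -> measurable_fun setT (fun x => f (tau h x)).
Proof. by move=> mf; apply: (measurableT_comp mf); exact: measurable_tau. Qed.

Lemma measurable_dq h f : measurable_fun setT f -> measurable_fun setT (dq h f).
Proof.
by move=> mf; apply: measurable_funM => //; apply: measurable_funB; exact: measurable_comp_tau.
Qed.

Lemma dq_energy f fx fy U V h : strip f fx fy U V -> 0 < h -> h <= 1 ->
  mu2.-integrable Q (EFin \o (fun x => dq h f x ^+ 2)) /\
  \int[mu2]_(x in Q) (dq h f x ^+ 2) <= \int[mu2]_(x in Q) (fy x ^+ 2).
Proof.
move=> S h0 h1; have mf := strip_mf S; have my := strip_my S; have mV := strip_mV S.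
have m1 : measurable_fun setT (fun x => (dq h f x ^+ 2)%:E).
  by apply/measurable_EFinP; apply: measurable_funX; exact: measurable_dq.
have m2 : measurable_fun setT (fun x => (fy x ^+ 2)%:E).
  by apply/measurable_EFinP; exact: measurable_funX.
have le : (\int[mu2]_(x in Q) (dq h f x ^+ 2)%:E <= \int[mu2]_(x in Q) (fy x ^+ 2)%:E)%E.
  have [n1 ->] := tonelli_strip measurableT m1 (fun x => sqr_ge0 (dq h f x)).
  have [n2 ->] := tonelli_strip measurableT m2 (fun x => sqr_ge0 (fy x)).
  apply: ae_ge0_le_integral => //.
  - by move=> x _; apply: integral_ge0 => y _; rewrite lee_fin sqr_ge0.
  - by move=> x _; apply: integral_ge0 => y _; rewrite lee_fin sqr_ge0.
  apply: aeS (ae_and (ae_slices1 (strip_py S)) (strip_good S)) => t [py [pV fV _ _ _]] _.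
  have := jensen_line h0 h1 pV (measurable_slice2 t my) py; apply: le_trans.
  rewrite le_eqVlt; apply/orP; left; apply/eqP; apply: ae_eq_integral => //.
  - by apply: measurable_funTS; exact: (measurableT_comp m1 (pair1_measurable t)).
  - apply: measurable_funTS; apply/measurable_EFinP; apply: measurable_funX; apply: measurable_funM => //.
    have mVt := measurable_slice2 t mV.
    by apply: measurable_funB; exact: (measurable_shiftf _ mVt).
  - by apply: aeS (ae_and (ae_shift h fV) (ae_shift (- h) fV)) => y [e1 e2] _; rewrite /dq/= e1 e2.
have i2 := strip_y2 S.
have i1 : mu2.-integrable Q (EFin \o (fun x => dq h f x ^+ 2)).
  apply/integrableP; split; first exact: measurable_funTS.
  have /integrableP[_] := i2; apply: le_lt_trans; apply: le_trans (le_trans le _).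
    by rewrite le_eqVlt; apply/orP; left; apply/eqP; apply: eq_integral => x _ /=; rewrite ger0_norm// sqr_ge0.
  by rewrite le_eqVlt; apply/orP; left; apply/eqP; apply: eq_integral => x _ /=; rewrite ger0_norm// sqr_ge0.
split => //; rewrite /Rintegral; apply: fine_le => //.
- exact: (@integrable_fin_num _ _ _ mu2 _ (measurable_Q measurableT) _ i1).
- exact: (@integrable_fin_num _ _ _ mu2 _ (measurable_Q measurableT) _ i2).
Qed.

Lemma integrable_mulL2 d (T : measurableType d) (m : {measure set T -> \bar R}) (D : set T)
  (k l : T -> R) : measurable D -> measurable_fun D k -> measurable_fun D l ->
  m.-integrable D (EFin \o (fun x => k x ^+ 2)) ->
  m.-integrable D (EFin \o (fun x => l x ^+ 2)) ->
  m.-integrable D (EFin \o (fun x => k x * l x)).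
Proof.
move=> mD mk ml ik il.
apply: (@le_integrableR _ _ _ _ _ _ (fun x => k x ^+ 2 + l x ^+ 2)) => //.
- exact: measurable_funM.
- move=> x _; apply: le_trans (ler_norm _); rewrite ler_norml.
  by have := sqr_ge0 (k x - l x); have := sqr_ge0 (k x + l x); rewrite !expr2; nra.
- exact: integrableDR.
Qed.

Lemma ae_le_Rintegral d (T : measurableType d) (m : {measure set T -> \bar R}) (D : set T)
  (F G : T -> R) : measurable D -> m.-integrable D (EFin \o F) ->
  m.-integrable D (EFin \o G) -> {ae m, forall x, D x -> F x <= G x} ->
  \int[m]_(x in D) F x <= \int[m]_(x in D) G x.
Proof.
move=> mD iF iG h; rewrite -subr_ge0 -RintegralB//.
have mF : measurable_fun D F by have /integrableP[/measurable_EFinP] := iF.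
have mG : measurable_fun D G by have /integrableP[/measurable_EFinP] := iG.
rewrite (@Rintegral_ae_eqm _ _ _ m D _ (fun x => `|G x - F x|))//.
- by apply: Rintegral_ge0 => x _; exact: normr_ge0.
- exact: measurable_funB.
- by apply: measurableT_comp => //; exact: measurable_funB.
- by apply: aeS h => x hx Dx; rewrite ger0_norm// subr_ge0 hx.
Qed.

Lemma Rintegral_I_bound (Z : R -> R) (C : R) : measurable_fun setT Z ->
  {ae mu, forall y, I y -> `|Z y| <= C} -> `|\int[mu]_(y in I) Z y| <= C.
Proof.
move=> mZ h; have mI : measurable I by exact: measurable_itv.
have ic (c : R) : mu.-integrable I (EFin \o (fun=> c)).
  by apply: continuous_itv_integrable => x; exact: cvg_cst.
have iZ : mu.-integrable I (EFin \o Z).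
  apply: (@ae_le_integrable _ _ _ mu I Z (fun=> C)) => //; first exact: measurable_funTS.
  by apply: aeS h => y hy Iy; rewrite (le_trans (hy Iy))// ler_norm.
apply: le_trans (@le_normr_Rintegral _ _ _ mu I _ mI iZ) _.
rewrite -[leRHS]Rintegral_cstI; apply: (@ae_le_Rintegral _ _ mu) => //.
exact: integrable_norm iZ.
Qed.

Lemma tauDN (h : R) (x : R * R) : tau h (tau (- h) x) = x.
Proof. by case: x => a b; rewrite /tau/= subrK. Qed.

Lemma tauC (h k : R) (x : R * R) : tau h (tau k x) = tau k (tau h x).
Proof. by rewrite /tau/= addrAC. Qed.

Lemma integrable_sq_tau (s t h : R) k : -1 <= h <= 1 -> measurable_fun setT k -> yper k ->
  mu2.-integrable (`[s, t] `*` I) (EFin \o (fun x => k x ^+ 2)) ->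
  mu2.-integrable (`[s, t] `*` I) (EFin \o (fun x => k (tau h x) ^+ 2)).
Proof.
move=> hh mk pk ik.
apply: (integrable_tau_strip (f := fun x => k x ^+ 2) hh (measurable_itv _) _ _ ik).1.
- exact: measurable_funX.
- by apply: aeS pk => x ->.
Qed.

(** Over a period, a shift by [h] on one factor equals a shift by [- h] on the other; in the
    symmetric quotient the two terms are exchanged with opposite signs. *)
Lemma dq_parts k l (s t h : R) : 0 < h -> h <= 1 ->
  measurable_fun setT k -> measurable_fun setT l -> yper k -> yper l ->
  mu2.-integrable (`[s, t] `*` I) (EFin \o (fun x => k x ^+ 2)) ->
  mu2.-integrable (`[s, t] `*` I) (EFin \o (fun x => l x ^+ 2)) ->
  [/\ mu2.-integrable (`[s, t] `*` I) (EFin \o (fun x => k x * dq h l x)),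
   mu2.-integrable (`[s, t] `*` I) (EFin \o (fun x => l x * dq h k x)) &
  \int[mu2]_(x in `[s, t] `*` I) (k x * dq h l x) =
  - \int[mu2]_(x in `[s, t] `*` I) (l x * dq h k x)].
Proof.
move=> h0 h1 mk ml pk pl ik il; have mB := measurable_box s t.
have hh : -1 <= h <= 1 by lra.
have hN : -1 <= - h <= 1 by lra.
have iT (a b : R * R -> R) c : -1 <= c <= 1 -> measurable_fun setT a -> measurable_fun setT b -> yper b ->
    mu2.-integrable (`[s, t] `*` I) (EFin \o (fun x => a x ^+ 2)) ->
    mu2.-integrable (`[s, t] `*` I) (EFin \o (fun x => b x ^+ 2)) ->
    mu2.-integrable (`[s, t] `*` I) (EFin \o (fun x => a x * b (tau c x))).
  move=> hc ma mb pb ia ib; apply: integrable_mulL2 => //.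
  - exact: measurable_funTS.
  - by apply: measurable_funTS; exact: measurable_comp_tau.
  - exact: integrable_sq_tau.
have E (a b : R * R -> R) x : a x * dq h b x = (2 * h)^-1 * (a x * b (tau h x) - a x * b (tau (- h) x)).
  by rewrite /dq; ring.
have iE (a b : R * R -> R) : measurable_fun setT a -> measurable_fun setT b -> yper b ->
    mu2.-integrable (`[s, t] `*` I) (EFin \o (fun x => a x ^+ 2)) ->
    mu2.-integrable (`[s, t] `*` I) (EFin \o (fun x => b x ^+ 2)) ->
    mu2.-integrable (`[s, t] `*` I) (EFin \o (fun x => a x * dq h b x)) /\
    \int[mu2]_(x in `[s, t] `*` I) (a x * dq h b x) = (2 * h)^-1 *
      (\int[mu2]_(x in `[s, t] `*` I) (a x * b (tau h x)) - \int[mu2]_(x in `[s, t] `*` I) (a x * b (tau (- h) x))).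
  move=> ma mb pb ia ib.
  have i1 := iT a b h hh ma mb pb ia ib; have i2 := iT a b (- h) hN ma mb pb ia ib.
  have i3 := @integrableBR _ _ _ mu2 _ mB _ _ i1 i2.
  split.
    rewrite (_ : (fun x => _) = (fun x => (2 * h)^-1 * (a x * b (tau h x) - a x * b (tau (- h) x)))); last first.
      by apply/funext => x; exact: E.
    exact: integrableZR.
  under eq_Rintegral do rewrite E.
  by rewrite RintegralZl// RintegralB.
have sh (a b : R * R -> R) c : -1 <= c <= 1 -> measurable_fun setT a -> measurable_fun setT b -> yper a -> yper b ->
    mu2.-integrable (`[s, t] `*` I) (EFin \o (fun x => a x ^+ 2)) ->
    mu2.-integrable (`[s, t] `*` I) (EFin \o (fun x => b x ^+ 2)) ->
    \int[mu2]_(x in `[s, t] `*` I) (a x * b (tau c x)) = \int[mu2]_(x in `[s, t] `*` I) (b x * a (tau (- c) x)).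
  move=> hc ma mb pa pb ia ib.
  have i1 := iT a b c hc ma mb pb ia ib.
  have hc' : -1 <= - c <= 1 by lra.
  have [||_ <-] := integrable_tau_strip (f := fun x => a x * b (tau c x)) hc' (measurable_itv _) _ _ i1.
  - by apply: measurable_funM => //; exact: measurable_comp_tau.
  - by apply: aeS (ae_and pa (ae_tau c pb)) => x [e1 e2]; rewrite e1 tauC e2.
  - by apply: eq_Rintegral => x _; rewrite tauDN mulrC.
have [i1 ->] := iE k l mk ml pl ik il.
have [i2 ->] := iE l k ml mk pk il ik.
split => //.
rewrite (sh k l h)// (sh k l (- h))// opprK.
by rewrite -mulrN opprB.
Qed.

Lemma sub_box_Q (k : R * R -> R) (s t : R) : mu2.-integrable Q (EFin \o k) ->
  mu2.-integrable (`[s, t] `*` I) (EFin \o k).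
Proof.
move=> ik; apply: (@integrableS _ _ _ mu2 _ _ _ (measurable_Q measurableT) (measurable_box s t)) => //.
exact: subsetX.
Qed.

(** On a line where both traces are within [e] of their limits, the quotient of the second is at
    most [e / h] and the first is at most [|p| + e]. For fixed [h] the boundary term thus tends to
    zero with [e]. *)
Lemma dq_boundary_le f fy U V g gy U' V' (t h p q e : R) : 0 < h -> h <= 1 ->
  good f fy U V t -> good g gy U' V' t -> vclose V t p e -> vclose V' t q e ->
  {ae mu, forall y, I y -> `|U (t, y) * dq h U' (t, y)| <= (`|p| + e) * e / h}.
Proof.
move=> h0 h1 [_ fV fU _ _] [_ gV gU _ _] cf cg.
apply: aeS (ae_and (ae_and fV fU) (ae_and (ae_and (ae_shift h gV) (ae_shift (- h) gV))
  (ae_and (ae_shift h gU) (ae_shift (- h) gU)))) => y [[f1 f2] [[g1 g2] [g3 g4]]].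
rewrite /= in_itv/= => y01; rewrite /dq/= -f2 f1 -g3 g1 -g4 g2.
have a1 := cf y ltac:(lra); have a2 := cg (y + h) ltac:(lra); have a3 := cg (y - h) ltac:(lra).
rewrite normrM -mulrA; apply: ler_pM => //.
  by have := ler_normD (V (t, y) - p) p; rewrite subrK; lra.
rewrite normrM [`|(2 * h)^-1|]ger0_norm; last by rewrite invr_ge0; lra.
rewrite ler_pdivrMr; last by lra.
rewrite (_ : e / h * (2 * h) = e + e); last by field; rewrite gt_eqF.
have -> : V' (t, y + h) - V' (t, y - h) = (V' (t, y + h) - q) - (V' (t, y - h) - q) by ring.
by apply: le_trans (ler_normB _ _) _; exact: lerD.
Qed.

(** Skew-adjointness turns [- gx * dq h f] into [f * dq h gx]. As [dq h] commutes with the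
    horizontal derivative, the integrand becomes the horizontal derivative of [U * dq h U'], and
    only boundary terms of order [eta / h] remain. *)
Lemma det_dq f fx fy U V g gx gy U' V' (mf pf mg pg h : R) :
  strip f fx fy U V -> strip g gx gy U' V' -> tends f mf pf -> tends g mg pg ->
  0 < h -> h <= 1 ->
  mu2.-integrable Q (EFin \o (fun x => fx x * dq h g x - gx x * dq h f x)) /\
  \int[mu2]_(x in Q) (fx x * dq h g x - gx x * dq h f x) = 0.
Proof.
move=> S S' tf tg h0 h1; have mQ : measurable Q := measurable_Q measurableT.
have [i1 _] := dq_energy S h0 h1; have [i2 _] := dq_energy S' h0 h1.
have mfx := strip_mx S; have mgx := strip_mx S'.
have mdf := measurable_dq h (strip_mf S); have mdg := measurable_dq h (strip_mf S').
have j1 : mu2.-integrable Q (EFin \o (fun x => fx x * dq h g x)).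
  by apply: (@integrable_mulL2 _ _ mu2) => //; [exact: measurable_funTS..|exact: strip_x2 S].
have j2 : mu2.-integrable Q (EFin \o (fun x => gx x * dq h f x)).
  by apply: (@integrable_mulL2 _ _ mu2) => //; [exact: measurable_funTS..|exact: strip_x2 S'].
have ik := @integrableBR _ _ _ mu2 _ mQ _ _ j1 j2.
split => //; apply: cell_limit => // e T e0.
(* The two ends contribute at most [(|pf| + eta) * eta / h] and [(|mf| + eta) * eta / h]; with
   [eta <= 1] their sum is at most [C * eta / h]. *)
pose C := `|pf| + `|mf| + 2.
have C0 : 0 < C by rewrite /C; have := normr_ge0 pf; have := normr_ge0 mf; lra.
pose eta := Num.min 1 (e * h / C).
have eta0 : 0 < eta by rewrite lt_min ltr01 divr_gt0// mulr_gt0.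
have eta1 : eta <= 1 by rewrite ge_min lexx.
have etae : C * eta / h <= e.
  rewrite ler_pdivrMr// mulrC -ler_pdivlMr//; by rewrite ge_min lexx orbT.
have [t [Tt _ g1 g2 [c1 c2]]] := good_time_p (G := fun=> True) (Num.max T 0) S S' tf tg (aeT mu (fun=> Logic.I)) eta0.
have [s [sT _ g3 g4 [c3 c4]]] := good_time_m (G := fun=> True) (- Num.max T 0) S S' tf tg (aeT mu (fun=> Logic.I)) eta0.
have TM : T <= Num.max T 0 by rewrite le_max lexx.
have M0 : 0 <= Num.max T 0 by rewrite le_max lexx orbT.
exists s, t; split; [by clear -sT TM M0 Tt; lra|by clear -sT TM M0 Tt; lra|].
have st : s <= t by clear -sT TM M0 Tt; lra.
have mB := measurable_box s t.
have ifB : mu2.-integrable (`[s, t] `*` `[0, 1]) (EFin \o (fun x => f x ^+ 2)) by apply: L1loc2_box; exact: strip_L2 S.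
have igxB := sub_box_Q s t (strip_x2 S').
have pfS : yper f by apply: aeT; exact: strip_per S.
have [k1 k2 k3] := dq_parts h0 h1 mgx (strip_mf S) (strip_px S') pfS igxB ifB.
rewrite RintegralB//; last exact: sub_box_Q.
rewrite k3 opprK -RintegralD//; last exact: sub_box_Q.
pose Y (x : R * R) := U x * dq h U' x.
pose G (x : R * R) := U x * dq h gx x + dq h U' x * fx x.
have mU := strip_mU S; have mU' := strip_mU S'.
have mY : measurable_fun setT Y by apply: measurable_funM => //; exact: measurable_dq.
have mG : measurable_fun setT G.
  by apply: measurable_funD; apply: measurable_funM => //; exact: measurable_dq.
have iD := @integrableDR _ _ _ mu2 _ mB _ _ (sub_box_Q s t j1) k2.
have eG : {ae mu2, forall x, fx x * dq h g x + f x * dq h gx x = G x}.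
  apply: aeS (ae_and (strip_fU S) (ae_and (ae_tau h (strip_fU S')) (ae_tau (- h) (strip_fU S')))).
  by move=> x [e1 [e2 e3]]; rewrite /G /dq e1 e2 e3 addrC [fx x * _]mulrC.
have iG : mu2.-integrable (`[s, t] `*` I) (EFin \o G).
  apply: (@ae_le_integrable _ _ _ mu2 _ _ _ mB _ _ iD); first exact: measurable_funTS.
  by apply: aeS eG => x <-.
rewrite (@Rintegral_ae_eq _ _ _ mu2 _ _ G mB iD iG); last by apply: aeS eG => x.
rewrite (hflux (Y := Y))//; last first.
  have pU' := strip_primU S'.
  apply: aeS (ae_and (strip_primU S) (ae_and (ae_shift h pU') (ae_shift (- h) pU'))) => y [p1 [p2 p3]].
  apply: prim_ext (prim_mul p1 (primZ (2 * h)^-1 (primB p2 p3))) => x.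
    by rewrite /Y /dq/=; ring.
  by rewrite /G /dq/=; ring.
rewrite subr0.
have B1 := dq_boundary_le h0 h1 g1 g2 c1 c2; have B2 := dq_boundary_le h0 h1 g3 g4 c3 c4.
apply: le_trans etae; apply: Rintegral_I_bound.
  by apply: measurable_funB; exact: measurable_slice2.
apply: aeS (ae_and B1 B2) => y [b1 b2] Iy.
apply: le_trans (ler_normB _ _) _; apply: le_trans (lerD (b1 Iy) (b2 Iy)) _.
rewrite -mulrDl ler_pM2r ?invr_gt0// -mulrDl ler_pM2r// /C.
by clear -eta0 eta1; lra.
Qed.

(** Expanding the squares, the cross terms form [- 2] times the integral of [det_dq], which is zero,
    and the squared quotients do not exceed the energies of [fy] and [gy]. *)
Lemma det_dq_le f fx fy U V g gx gy U' V' (mf pf mg pg h : R) :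
  strip f fx fy U V -> strip g gx gy U' V' -> tends f mf pf -> tends g mg pg ->
  0 < h -> h <= 1 ->
  mu2.-integrable Q (EFin \o (fun x => (fx x - dq h g x) ^+ 2 + (gx x + dq h f x) ^+ 2)) /\
  \int[mu2]_(x in Q) ((fx x - dq h g x) ^+ 2 + (gx x + dq h f x) ^+ 2) <=
  \int[mu2]_(x in Q) (fx x ^+ 2 + fy x ^+ 2 + (gx x ^+ 2 + gy x ^+ 2)).
Proof.
move=> S S' tf tg h0 h1; have mQ : measurable Q := measurable_Q measurableT.
have [i1 l1] := dq_energy S h0 h1; have [i2 l2] := dq_energy S' h0 h1.
have [ik ek] := det_dq S S' tf tg h0 h1.
have x1 := strip_x2 S; have x2 := strip_x2 S'; have y1 := strip_y2 S; have y2 := strip_y2 S'.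
have iD := @integrableDR _ _ _ mu2 _ mQ.
have iA := iD _ _ (iD _ _ x1 i1) (iD _ _ x2 i2).
have i2k := @integrableZR _ _ _ mu2 _ mQ 2 _ ik.
have E x : (fx x - dq h g x) ^+ 2 + (gx x + dq h f x) ^+ 2 =
  (fx x ^+ 2 + dq h f x ^+ 2 + (gx x ^+ 2 + dq h g x ^+ 2)) - 2 * (fx x * dq h g x - gx x * dq h f x) by ring.
have -> : (fun x => (fx x - dq h g x) ^+ 2 + (gx x + dq h f x) ^+ 2) = _ := funext E.
split; first exact: (@integrableBR _ _ _ mu2 _ mQ).
rewrite RintegralB// RintegralZl// ek mulr0 subr0.
rewrite !RintegralD//; try exact: iD.
by clear -l1 l2; lra.
Qed.

Lemma measurable_limn_einf d (T : measurableType d) (f : (T -> \bar R)^nat) :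
  (forall n, measurable_fun setT (f n)) ->
  measurable_fun setT (fun x => limn_einf (fun n => f n x)).
Proof.
move=> mf; have h := @measurable_fun_limn_esup _ _ _ setT (fun n x => (- f n x)%E).
by apply: measurableT_comp => //; apply: h => n; exact: measurableT_comp.
Qed.

Lemma is_derive_sym_quotient (V : R -> R) (y l : R) : is_derive y (1 : R) V l ->
  (V (y + n.+1%:R^-1) - V (y - n.+1%:R^-1)) / (2 * n.+1%:R^-1) @[n --> \oo] --> l.
Proof.
move=> [dV lV]; have c : h^-1 *: (V (h *: 1 + y) - V y) @[h --> 0^'] --> l.
  by rewrite -lV; exact: dV.
have [H _] := cvgr_dnbhsP (fun h => h^-1 *: (V (h *: 1 + y) - V y)) 0 l.
have {}H := H c.
have c0 : (n.+1%:R^-1 : R) @[n --> \oo] --> (0 : R) by exact: cvg_harmonic.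
have nz n : n.+1%:R^-1 != 0 :> R by rewrite invr_eq0 pnatr_eq0.
have c1 := H (fun n => n.+1%:R^-1) (conj nz c0).
have c2 : (- n.+1%:R^-1 : R)^-1 *: (V (- n.+1%:R^-1 *: 1 + y) - V y) @[n --> \oo] --> l.
  apply: (H (fun n => - n.+1%:R^-1)); split; first by move=> n; rewrite oppr_eq0.
  by rewrite -oppr0; exact: cvgN.
have -> : l = 2^-1 * (l + l) by field.
have E n : (V (y + n.+1%:R^-1) - V (y - n.+1%:R^-1)) / (2 * n.+1%:R^-1) =
    2^-1 * ((n.+1%:R^-1 : R)^-1 *: (V (n.+1%:R^-1 *: 1 + y) - V y) +
    (- n.+1%:R^-1 : R)^-1 *: (V (- n.+1%:R^-1 *: 1 + y) - V y)).
  rewrite /GRing.scale/= !mulr1 ![_ + y]addrC.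
  have n0 : n.+1%:R != 0 :> R by rewrite pnatr_eq0.
  by field; rewrite ?n0 ?oppr_eq0 ?n0//.
rewrite (eq_cvg _ _ E); apply: cvgM; first exact: cvg_cst.
exact: cvgD c1 c2.
Qed.

(* The two sides differ by twice the integral of the Jacobian.  With difference quotients in
   place of [fy] and [gy] that integral is exactly zero, and Fatou's lemma gives the inequality. *)
Lemma det_le f fx fy U V g gx gy U' V' (mf pf mg pg : R) :
  strip f fx fy U V -> strip g gx gy U' V' -> tends f mf pf -> tends g mg pg ->
  mu2.-integrable Q (EFin \o (fun x => (fx x - gy x) ^+ 2 + (gx x + fy x) ^+ 2)) /\
  \int[mu2]_(x in Q) ((fx x - gy x) ^+ 2 + (gx x + fy x) ^+ 2) <=
  \int[mu2]_(x in Q) (fx x ^+ 2 + fy x ^+ 2 + (gx x ^+ 2 + gy x ^+ 2)).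
Proof.
move=> S S' tf tg; have mQ : measurable Q := measurable_Q measurableT.
have mfx := strip_mx S; have mgx := strip_mx S'; have mfy := strip_my S; have mgy := strip_my S'.
have iT : mu2.-integrable Q (EFin \o (fun x => (fx x - gy x) ^+ 2 + (gx x + fy x) ^+ 2)).
  apply: integrableDR => //.
    by apply: integrable_sqB => //; [exact: measurable_funTS..|exact: strip_x2 S|exact: strip_y2 S'].
  by apply: integrable_sqD => //; [exact: measurable_funTS..|exact: strip_x2 S'|exact: strip_y2 S].
split => //.
pose h n : R := n.+1%:R^-1.
have h0 n : 0 < h n by rewrite invr_gt0 ltr0n.
have h1 n : h n <= 1 by rewrite invf_le1 ?ler1n ?ltr0n.
pose F n x := (fx x - dq (h n) g x) ^+ 2 + (gx x + dq (h n) f x) ^+ 2.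
pose T x := (fx x - gy x) ^+ 2 + (gx x + fy x) ^+ 2.
have mF n : measurable_fun setT (fun x => (F n x)%:E).
  apply/measurable_EFinP; apply: measurable_funD; apply: measurable_funX.
    by apply: measurable_funB => //; apply: measurable_dq; exact: strip_mf S'.
  by apply: measurable_funD => //; apply: measurable_dq; exact: strip_mf S.
have mT : measurable_fun setT (fun x => (T x)%:E).
  by apply/measurable_EFinP; apply: measurable_funD; apply: measurable_funX;
    [exact: measurable_funB|exact: measurable_funD].
have F0 n x : (0 <= (F n x)%:E)%E by rewrite lee_fin addr_ge0// sqr_ge0.
have T0 x : (0 <= (T x)%:E)%E by rewrite lee_fin addr_ge0// sqr_ge0.
pose L x := limn_einf (fun n => (F n x)%:E).
have mL : measurable_fun setT L by exact: measurable_limn_einf.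
have L0 x : (0 <= L x)%E.
  rewrite /L limn_einf_lim; apply: lime_ge; first exact: is_cvg_einfs.
  by apply: nearW => n; apply: le_ereal_inf_tmp => _ [m /= nm <-].
set C := (X in _ <= X).
have fat : (\int[mu2]_(x in Q) L x <= C%:E)%E.
  apply: le_trans (@fatou _ _ _ mu2 Q mQ (fun n x => (F n x)%:E) _ _) _ => //.
    by move=> n; exact: measurable_funTS (mF n).
  rewrite limn_einf_lim; apply: lime_le; first exact: is_cvg_einfs.
  apply: nearW => n; apply: (@le_trans _ _ (\int[mu2]_(x in Q) (F n x)%:E)%E).
    by apply: ereal_inf_lbound; exists n => /=.
  have [iF leF] := det_dq_le S S' tf tg (h0 n) (h1 n).
  rewrite (_ : \int[mu2]_(x in Q) (F n x)%:E = (\int[mu2]_(x in Q) F n x)%:E)%E ?lee_fin//.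
  by rewrite /Rintegral fineK//; exact: (@integrable_fin_num _ _ _ mu2 _ mQ _ iF).
(* On almost every vertical line [V] and [V'] are differentiable almost everywhere, so the quotients
   converge to [fy] and [gy] and the lower limit is a genuine limit. *)
have e : (\int[mu2]_(x in Q) L x = \int[mu2]_(x in Q) (T x)%:E)%E.
  have [n1 ->] := tonelli_strip measurableT mL L0.
  have [n2 ->] := tonelli_strip measurableT mT T0.
  apply: ae_eq_integral => //.
  apply: aeS (ae_and (strip_good S) (strip_good S')) => t [[pV fV _ _ _] [pV' gV _ _ _]] _.
  have D := prim_derive_ae (measurable_slice2 t mfy) pV.
  have D' := prim_derive_ae (measurable_slice2 t mgy) pV'.
  have sh (k K : R * R -> R) : {ae mu, forall y, k (t, y) = K (t, y)} ->
      {ae mu, forall y, forall n, k (t, y + h n) = K (t, y + h n) /\ k (t, y - h n) = K (t, y - h n)}.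
    move=> kK; apply: ae_nat => n; exact: (ae_and (ae_shift (h n) kK) (ae_shift (- h n) kK)).
  apply: ae_eq_integral => //.
  - by apply: measurable_funTS; exact: (measurableT_comp mL (pair1_measurable t)).
  - by apply: measurable_funTS; exact: (measurableT_comp mT (pair1_measurable t)).
  apply: aeS (ae_and (ae_and D D') (ae_and (sh _ _ fV) (sh _ _ gV))) => y [[d d'] [s s']] _.
  have c : F n (t, y) @[n --> \oo] --> T (t, y).
    have c1 := is_derive_sym_quotient d; have c2 := is_derive_sym_quotient d'.
    have k1 : dq (h n) f (t, y) @[n --> \oo] --> fy (t, y).
      apply: cvg_trans c1; apply: near_eq_cvg; apply: nearW => n.
      by rewrite /dq/=; have [-> ->] := s n.
    have k2 : dq (h n) g (t, y) @[n --> \oo] --> gy (t, y).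
      apply: cvg_trans c2; apply: near_eq_cvg; apply: nearW => n.
      by rewrite /dq/=; have [-> ->] := s' n.
    have k3 : fx (t, y) - dq (h n) g (t, y) @[n --> \oo] --> fx (t, y) - gy (t, y).
      by apply: cvgB => //; exact: cvg_cst.
    have k4 : gx (t, y) + dq (h n) f (t, y) @[n --> \oo] --> gx (t, y) + fy (t, y).
      by apply: cvgD => //; exact: cvg_cst.
    by apply: cvgD; rewrite expr2; apply: cvgM.
  have ce : (F n (t, y))%:E @[n --> \oo] --> (T (t, y))%:E by apply: cvg_EFin => //; exact: nearW.
  by rewrite /L is_cvg_limn_einfE; [exact: cvg_lim ce|apply/cvg_ex; exists (T (t, y))%:E].
rewrite e in fat; rewrite -lee_fin; apply: le_trans fat.
rewrite /Rintegral fineK//; exact: (@integrable_fin_num _ _ _ mu2 _ mQ _ iT).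
Qed.

End determinant.

(** * D'Alembert's formula *)

Section dalembert.
Context {R : realType}.
Implicit Types (F w : R * R -> R) (x v a b : R * R).

Lemma is_derive_line F v (G : R * R -> R) x (s : R) : (forall x, is_derive x v F (G x)) ->
  is_derive s (1 : R) (fun s => F (s *: v + x)) (G (s *: v + x)).
Proof.
move=> H; have /is_derive_lineP h := H (s *: v + x).
have := @is_derive_affine _ (fun h : R => F (h *: v + (s *: v + x))) (G (s *: v + x)) 1 (- s) s.
rewrite mul1r subrr => /(_ h); rewrite mul1r.
have -> // : (fun r : R => F ((1 * r + - s) *: v + (s *: v + x))) = (fun r => F (r *: v + x)).
by apply/funext => r; rewrite mul1r scalerBl addrA subrK.
Qed.

Lemma continuous_plane F a b x (e : R) : {for x, continuous F} -> 0 < e ->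
  exists2 d : R, 0 < d & forall s t, `|s| <= d -> `|t| <= d -> `|F (s *: a + (t *: b + x)) - F x| <= e.
Proof.
move=> cF e0.
pose z (p : R * R) := p.1 *: a + (p.2 *: b + x).
have z0 : z (0, 0) = x by rewrite /z/= !scale0r !add0r.
have cz : {for (0, 0), continuous z}.
  apply: cvgD; last apply: cvgD; last exact: cvg_cst.
  - by apply: cvgZr_tmp; exact: cvg_fst.
  - by apply: cvgZr_tmp; exact: cvg_snd.
have cFz : {for (0, 0), continuous (F \o z)} by apply: continuous_comp => //; rewrite z0.
have /cvgrPdist_le/(_ _ e0) := cFz; rewrite /= z0 => /nbhs_ballP[d /= d0 h].
exists (d / 2); first by rewrite divr_gt0.
move=> s t hs ht; rewrite distrC; apply: (h (s, t)).
by split => /=; rewrite /ball/= sub0r normrN; lra.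
Qed.

(** The data are directional derivatives and their continuity, so additivity in the direction needs
    a proof: the increment along [d *: (a + b)] is compared with the path that first follows
    [d *: b] and then [d *: a]. *)
Lemma derive_add F v a b (Fv Fa Fb : R * R -> R) x : v = a + b ->
  (forall x, is_derive x v F (Fv x)) ->
  (forall x, is_derive x a F (Fa x)) -> (forall x, is_derive x b F (Fb x)) ->
  continuous Fv -> continuous Fa -> continuous Fb -> Fv x = Fa x + Fb x.
Proof.
move=> -> dv da db cv ca cb.
apply/eqP; rewrite -subr_eq0 -normr_le0; apply/ler_addgt0Pl => e e0; rewrite addr0.
have e3 : 0 < e / 3 by rewrite divr_gt0.
have [d1 d10 h1] := continuous_plane (a + b) 0 (cv x) e3.
have [d2 d20 h2] := continuous_plane a b (ca x) e3.
have [d3 d30 h3] := continuous_plane 0 b (cb x) e3.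
pose d := Num.min d1 (Num.min d2 d3).
have d0 : 0 < d by rewrite !lt_min d10 d20 d30.
have [dd1 dd2 dd3] : [/\ d <= d1, d <= d2 & d <= d3] by rewrite /d !ge_min !lexx ?orbT.
have bnd (t : R) : 0 <= t <= d -> `|t| <= d by move=> /andP[t0 td]; rewrite ger0_norm.
have H (G : R -> R) (g : R -> R) L : (forall s : R, is_derive s (1 : R) G (g s)) ->
    (forall s, 0 <= s <= d -> `|g s - L| <= e / 3) -> `|G d - G 0 - L * d| <= e / 3 * d.
  move=> dG hg; have := is_derive_le (k := L - e / 3) (l := L + e / 3) dG (ltW d0).
  rewrite subr0 => HH; have {}HH := HH ltac:(move=> s hs; move: (hg s hs); rewrite ler_norml; lra).
  by rewrite ler_norml; lra.
have hv s : 0 <= s <= d -> `|Fv (s *: (a + b) + x) - Fv x| <= e / 3.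
  by move=> hs; have := h1 s 0 (le_trans (bnd s hs) dd1); rewrite normr0 scaler0 add0r; apply; exact: ltW.
have ha s : 0 <= s <= d -> `|Fa (s *: a + (d *: b + x)) - Fa x| <= e / 3.
  by move=> hs; apply: h2; rewrite (le_trans (bnd _ _) dd2)// ltW//= lexx.
have hb s : 0 <= s <= d -> `|Fb (s *: b + x) - Fb x| <= e / 3.
  by move=> hs; have := h3 0 s; rewrite scaler0 add0r normr0; apply; [exact: ltW|exact: le_trans (bnd s hs) dd3].
have B1 := H _ _ (Fv x) (fun s => is_derive_line x s dv) hv.
have B2 := H _ _ (Fa x) (fun s => is_derive_line (d *: b + x) s da) ha.
have B3 := H _ _ (Fb x) (fun s => is_derive_line x s db) hb.
have eA : d *: a + d *: b + x = d *: a + (d *: b + x) by rewrite addrA.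
move: B1 B2 B3; rewrite !scale0r !add0r scalerDr eA.
set A := F (_ + (_ + _)); set B := F (_ + _); set C := F x => B1 B2 B3.
rewrite -(ler_pM2r d0) -[X in _ * X](ger0_norm (ltW d0)) -normrM.
have -> : (Fv x - (Fa x + Fb x)) * d =
  (A - B - Fa x * d) + (B - C - Fb x * d) - (A - C - Fv x * d) by ring.
have := ler_normB ((A - B - Fa x * d) + (B - C - Fb x * d)) (A - C - Fv x * d).
by have := ler_normD (A - B - Fa x * d) (B - C - Fb x * d); lra.
Qed.

Lemma double_difference F a b (Fa Fab : R * R -> R) x (L e d : R) : 0 < d ->
  (forall x, is_derive x a F (Fa x)) -> (forall x, is_derive x b Fa (Fab x)) ->
  (forall s t, 0 <= s <= d -> 0 <= t <= d -> `|Fab (t *: b + (s *: a + x)) - L| <= e) ->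
  `|F (d *: a + (d *: b + x)) - F (d *: b + x) - (F (d *: a + x) - F x) - L * d * d| <= e * d * d.
Proof.
move=> d0 da db h.
pose G s := F (s *: a + (d *: b + x)) - F (s *: a + x).
pose g s := Fa (s *: a + (d *: b + x)) - Fa (s *: a + x).
have dG (s : R) : is_derive s (1 : R) G (g s).
  exact: (is_deriveB (is_derive_line (d *: b + x) s da) (is_derive_line x s da)).
have hg s : 0 <= s <= d -> (L - e) * d <= g s <= (L + e) * d.
  move=> hs; have := is_derive_le (u := 0) (v := d) (k := L - e) (l := L + e)
    (fun t => is_derive_line (s *: a + x) t db) (ltW d0).
  rewrite scale0r add0r subr0 /g addrCA; apply.
  by move=> t ht; have := h s t hs ht; rewrite ler_norml; lra.
have := is_derive_le (u := 0) (v := d) dG (ltW d0) hg.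
by rewrite subr0 /G scale0r !add0r ler_norml; lra.
Qed.

(** Both mixed derivatives, multiplied by [d * d], approximate the same second difference over the
    parallelogram spanned by [d *: a] and [d *: b]. *)
Lemma schwarz F a b (Fa Fb Fab Fba : R * R -> R) x :
  (forall x, is_derive x a F (Fa x)) -> (forall x, is_derive x b Fa (Fab x)) ->
  (forall x, is_derive x b F (Fb x)) -> (forall x, is_derive x a Fb (Fba x)) ->
  continuous Fab -> continuous Fba -> Fab x = Fba x.
Proof.
move=> da dab db dba cab cba.
apply/eqP; rewrite -subr_eq0 -normr_le0; apply/ler_addgt0Pl => e e0; rewrite addr0.
have e2 : 0 < e / 2 by rewrite divr_gt0.
have [d1 d10 h1] := continuous_plane b a (cab x) e2.
have [d2 d20 h2] := continuous_plane a b (cba x) e2.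
pose d := Num.min d1 d2.
have d0 : 0 < d by rewrite !lt_min d10 d20.
have [dd1 dd2] : d <= d1 /\ d <= d2 by rewrite /d !ge_min !lexx ?orbT.
have bnd (t : R) : 0 <= t <= d -> `|t| <= d by move=> /andP[t0 td]; rewrite ger0_norm.
have B1 := double_difference (L := Fab x) d0 da dab ltac:(move=> s t hs ht; apply: h1; exact: le_trans (bnd _ _) dd1).
have B2 := double_difference (L := Fba x) d0 db dba ltac:(move=> s t hs ht; apply: h2; exact: le_trans (bnd _ _) dd2).
move: B1 B2; rewrite [in X in _ -> X -> _]addrCA.
set A := F _; set B := F (d *: b + x); set C := F (d *: a + x); set D := F x => B1 B2.
have dd0 : 0 < d * d by exact: mulr_gt0.
rewrite -(ler_pM2r dd0) -[X in _ * X](ger0_norm (ltW dd0)) -normrM.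
have -> : (Fab x - Fba x) * (d * d) = (A - C - (B - D) - Fba x * d * d) - (A - B - (C - D) - Fab x * d * d) by ring.
have := ler_normB (A - C - (B - D) - Fba x * d * d) (A - B - (C - D) - Fab x * d * d).
by rewrite mulrA; lra.
Qed.

(** The wave operator factors into the derivatives along [a + b] and [a - b]; the mixed terms cancel
    by [schwarz]. *)
Lemma cross_eq0 w a b (Wa Wb Wm Waa Wab Wba Wbb Wap Wbp Wmp : R * R -> R) x :
  (forall x, is_derive x a w (Wa x)) -> (forall x, is_derive x b w (Wb x)) ->
  (forall x, is_derive x (a - b) w (Wm x)) ->
  (forall x, is_derive x a Wa (Waa x)) -> (forall x, is_derive x b Wa (Wab x)) ->
  (forall x, is_derive x a Wb (Wba x)) -> (forall x, is_derive x b Wb (Wbb x)) ->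
  (forall x, is_derive x (a + b) Wa (Wap x)) -> (forall x, is_derive x (a + b) Wb (Wbp x)) ->
  (forall x, is_derive x (a + b) Wm (Wmp x)) ->
  continuous Wa -> continuous Wb -> continuous Wm ->
  continuous Waa -> continuous Wab -> continuous Wba -> continuous Wbb ->
  continuous Wap -> continuous Wbp -> Waa x = Wbb x -> Wmp x = 0.
Proof.
move=> da db dm daa dab dba dbb dap dbp dmp ca cb cm caa cab cba cbb cap cbp e.
have D y : Wm y = Wa y - Wb y.
  apply/eqP; rewrite eq_sym subr_eq; apply/eqP.
  by apply: (derive_add y _ da dm db ca cm cb); rewrite subrK.
have X : is_derive x (a + b) Wm (Wap x - Wbp x).
  by rewrite (_ : Wm = Wa \- Wb); [exact: is_deriveB|apply/funext].
have [_ Y] := X; have [_ Z] := dmp x; rewrite -Z Y.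
rewrite (derive_add x erefl dap daa dab cap caa cab) (derive_add x erefl dbp dba dbb cbp cba cbb) e.
by rewrite (schwarz x da dab db dba cab cba); ring.
Qed.

Lemma const_line (F G : R * R -> R) v x s : (forall x, is_derive x v F (G x)) ->
  (forall t, G (t *: v + x) = 0) -> F (s *: v + x) = F x.
Proof.
move=> dF G0; have dl t := is_derive_line x t dF.
have e (r r' : R) : r <= r' -> F (r' *: v + x) = F (r *: v + x).
  move=> rr; have := is_derive_le (k := 0) (l := 0) dl rr.
  rewrite mul0r => H; apply/eqP; rewrite eq_le -subr_le0 -[X in _ && X]subr_ge0 andbC.
  by apply: H => t; rewrite G0 lexx.
have e0 : F (0 *: v + x) = F x by rewrite scale0r add0r.
have [s0|s0] := leP 0 s; first by rewrite (e 0 s).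
by rewrite -(e s 0)// ltW.
Qed.

(** [Fb] is constant along [a], so the increment of [F] by [s *: a] has zero derivative along
    [b]. *)
Lemma double_difference0 (F Fb Fba : R * R -> R) (a b : R * R) (s t : R) :
  (forall x, is_derive x b F (Fb x)) -> (forall x, is_derive x a Fb (Fba x)) ->
  (forall x, Fba x = 0) ->
  F (s *: a + t *: b) - F (t *: b) = F (s *: a) - F 0.
Proof.
move=> dF dFb F0.
have Db x : Fb (s *: a + x) = Fb x by apply: (const_line (G := Fba)).
pose K y := F (s *: a + y) - F y.
have dK y : is_derive y b K (Fb (s *: a + y) - Fb y).
  have H : is_derive y b (fun y => F (s *: a + y)) (Fb (s *: a + y)).
    apply/is_derive_lineP; have /is_derive_lineP := dF (s *: a + y).
    rewrite (_ : (fun h : R => F (h *: b + (s *: a + y))) = (fun h => F (s *: a + (h *: b + y))))//.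
    by apply/funext => h; rewrite addrCA.
  exact: (is_deriveB H (dF y)).
have := @const_line K (fun y => Fb (s *: a + y) - Fb y) b 0 t dK.
by rewrite /K !addr0; apply => r; rewrite Db subrr.
Qed.

Section wave.
Variable w : R * R -> R.
Hypothesis C2w : C2 w.
Hypothesis wave : forall x, 'D_(@e1 R) ('D_(@e1 R) w) x = 'D_(@e2 R) ('D_(@e2 R) w) x.

Let d1 v x : is_derive x v w ('D_v w x).
Proof. by have [D _] := C2w; have := D [::] v x isT; exact: derive_is_derive. Qed.

Let d2 u v x : is_derive x v ('D_u w) ('D_v ('D_u w) x).
Proof. by have [D _] := C2w; have := D [:: u] v x isT; exact: derive_is_derive. Qed.

Let c1 v : continuous ('D_v w).
Proof. by have [_ D] := C2w; exact: (D [:: v] isT). Qed.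

Let c2 u v : continuous ('D_v ('D_u w)).
Proof. by have [_ D] := C2w; exact: (D [:: v; u] isT). Qed.

Lemma wave_cross x : 'D_(e1 R + e2 R) ('D_(e1 R - e2 R) w) x = 0.
Proof.
apply: (@cross_eq0 w (e1 R) (e2 R) ('D_(e1 R) w) ('D_(e2 R) w) ('D_(e1 R - e2 R) w)
  ('D_(e1 R) ('D_(e1 R) w)) ('D_(e2 R) ('D_(e1 R) w)) ('D_(e1 R) ('D_(e2 R) w))
  ('D_(e2 R) ('D_(e2 R) w)) ('D_(e1 R + e2 R) ('D_(e1 R) w)) ('D_(e1 R + e2 R) ('D_(e2 R) w))
  ('D_(e1 R + e2 R) ('D_(e1 R - e2 R) w)) x).
- exact: d1.
- exact: d1.
- exact: d1.
- exact: d2.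
- exact: d2.
- exact: d2.
- exact: d2.
- exact: d2.
- exact: d2.
- exact: d2.
- exact: c1.
- exact: c1.
- exact: c1.
- exact: c2.
- exact: c2.
- exact: c2.
- exact: c2.
- exact: c2.
- exact: c2.
- exact: wave.
Qed.

Lemma wave_double_difference (s t : R) :
  w (s *: (e1 R + e2 R) + t *: (e1 R - e2 R)) - w (t *: (e1 R - e2 R)) =
  w (s *: (e1 R + e2 R)) - w 0.
Proof.
apply: (@double_difference0 w ('D_(e1 R - e2 R) w) ('D_(e1 R + e2 R) ('D_(e1 R - e2 R) w)) (e1 R + e2 R) (e1 R - e2 R)).
- exact: d1.
- exact: d2.
- exact: wave_cross.
Qed.

(** The characteristic coordinates of [z] are [(z.1 + z.2) / 2] along [(1, 1)] and [(z.1 - z.2) / 2]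
    along [(1, -1)]; the value at the origin, counted in both profiles, is subtracted once. *)
Lemma dalembert z : w z = w ((z.1 + z.2) / 2, (z.1 + z.2) / 2) +
  (w ((z.1 - z.2) / 2, - ((z.1 - z.2) / 2)) - w (0, 0)).
Proof.
have sa (s : R) : s *: (e1 R + e2 R) = (s, s).
  have -> : s *: (e1 R + e2 R) = (s * (1 + 0), s * (0 + 1)) by [].
  by rewrite addr0 add0r mulr1.
have sb (s : R) : s *: (e1 R - e2 R) = (s, - s).
  have -> : s *: (e1 R - e2 R) = (s * (1 - 0), s * (0 - 1)) by [].
  by rewrite subr0 sub0r mulrN mulr1.
have := wave_double_difference ((z.1 + z.2) / 2) ((z.1 - z.2) / 2).
rewrite !sa !sb; move: (z.1) (z.2) (surjective_pairing z) => p q ->.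
have -> : (((p + q) / 2, (p + q) / 2) : R * R) + ((p - q) / 2, - ((p - q) / 2)) = (p, q).
  have -> : (((p + q) / 2, (p + q) / 2) : R * R) + ((p - q) / 2, - ((p - q) / 2)) =
    ((p + q) / 2 + (p - q) / 2, (p + q) / 2 - (p - q) / 2) by [].
  by congr pair; field.
have -> : (0 : R * R) = (0, 0) by [].
move=> h; apply/eqP; rewrite addrC -subr_eq0; apply/eqP; move: h.
move: (w _) (w _) (w _) (w _) => A B C D; lra.
Qed.

End wave.

End dalembert.

(** * The calibration inequality *)

Section calibration.
Context {R : realType}.
Notation mu := (@lebesgue_measure R).
Notation mu2 := (@mu2 R).
Notation I := (`[0%R, 1%R]%classic : set R).
Notation Q := (setT `*` I : set (R * R)).
Implicit Types f g : R * R -> R.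

Lemma bounded_lipschitz (F f0 : R -> R) (C x y : R) : (forall x : R, is_derive x (1 : R) F (f0 x)) ->
  (forall x, `|f0 x| <= C) -> `|F x - F y| <= C * `|x - y|.
Proof.
move=> dF bf; wlog yx : x y / y <= x.
  by move=> H; have [/H//|/ltW/H] := leP y x; rewrite distrC [`|y - x|]distrC.
have := is_derive_le (k := - C) (l := C) dF yx.
move=> /(_ _)/wrap[]; first by move=> z _; rewrite -ler_norml.
by rewrite [`|x - y|]ger0_norm ?subr_ge0// ler_norml => /andP[h1 h2]; apply/andP; split; lra.
Qed.

(** The coefficient [c] will be [1] or [-1], for the two characteristic directions. The vertical
    part has no flux by periodicity, and [Phi] is [C]-Lipschitz, so each end costs at most
    [C * eta]. *)
Lemma flux_one f fx fy U V (phi Phi : R -> R) (C c s t p m eta : R) : strip f fx fy U V ->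
  (forall x : R, is_derive x (1 : R) Phi (phi x)) -> continuous phi -> (forall x, `|phi x| <= C) ->
  s <= t -> good f fy U V s -> good f fy U V t -> vclose V t p eta -> vclose V s m eta ->
  mu2.-integrable (`[s, t] `*` I) (EFin \o (fun x => (fx x + c * fy x) * phi (f x))) /\
  `|\int[mu2]_(x in `[s, t] `*` I) ((fx x + c * fy x) * phi (f x)) - (Phi p - Phi m)| <= C * (2 * eta).
Proof.
move=> S dPhi cphi bphi st gs gt ct cs.
have [i1 k1] := flux_x S dPhi cphi bphi st gs gt.
have [i2 k2] := flux_y S dPhi cphi bphi st.
have mB := measurable_box s t.
have i3 := @integrableZR _ _ _ mu2 _ mB c _ i2.
have E : (fun x => (fx x + c * fy x) * phi (f x)) = (fun x => fx x * phi (f x) + c * (fy x * phi (f x))).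
  by apply/funext => x; ring.
rewrite E; split; first exact: (@integrableDR _ _ _ mu2).
rewrite RintegralD// RintegralZl// k2 mulr0 addr0 k1.
have [pt _ _ _ _] := gt; have [ps _ _ _ _] := gs.
have cPhi := is_derive_continuous dPhi.
have cont r : prim (fun y => V (r, y)) (fun y => fy (r, y)) -> continuous (fun y => Phi (V (r, y))).
  move=> pr y; apply: (@continuous_comp R R R (fun y => V (r, y)) Phi); last exact: cPhi.
  exact: (prim_continuous pr).
have cD : continuous (fun y => Phi (V (t, y)) - Phi (V (s, y))).
  by move=> y; apply: cvgB; exact: cont.
have iD := @continuous_itv_integrable _ _ 0 1 cD.
have ic : mu.-integrable I (EFin \o (fun=> Phi p - Phi m)).
  by apply: continuous_itv_integrable => x; exact: cvg_cst.
rewrite -[X in _ - X]Rintegral_cstI -RintegralB//.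
apply: Rintegral_I_bound.
  by apply: measurable_funB => //; exact: continuous_measurable_fun.
apply: aeT => y; rewrite /= in_itv/= => hy.
have a1 := bounded_lipschitz (V (t, y)) p dPhi bphi.
have a2 := bounded_lipschitz (V (s, y)) m dPhi bphi.
have hy' : -1 <= y <= 2 by clear -hy; lra.
have b1 := ct y hy'; have b2 := cs y hy'.
have C0 : 0 <= C by apply: le_trans (bphi 0).
have d1 := ler_wpM2l C0 b1; have d2 := ler_wpM2l C0 b2.
have -> : Phi (V (t, y)) - Phi (V (s, y)) - (Phi p - Phi m) =
  (Phi (V (t, y)) - Phi p) - (Phi (V (s, y)) - Phi m) by ring.
have := ler_normB (Phi (V (t, y)) - Phi p) (Phi (V (s, y)) - Phi m).
by move: a1 a2 d1 d2; clear; lra.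
Qed.

Lemma vcloseD (V V' : R * R -> R) (t p q e : R) : vclose V t p e -> vclose V' t q e ->
  vclose (fun x => V x + V' x) t (p + q) (2 * e) /\ vclose (fun x => V x - V' x) t (p - q) (2 * e).
Proof.
move=> h h'; split => y hy; have a := h y hy; have b := h' y hy.
- have -> : V (t, y) + V' (t, y) - (p + q) = (V (t, y) - p) + (V' (t, y) - q) by ring.
  by have := ler_normD (V (t, y) - p) (V' (t, y) - q); lra.
- have -> : V (t, y) - V' (t, y) - (p - q) = (V (t, y) - p) - (V' (t, y) - q) by ring.
  by have := ler_normB (V (t, y) - p) (V' (t, y) - q); lra.
Qed.

Lemma flux_total f fx fy U V g gx gy U' V' (mf pf mg pg : R) (phi psi Phi Psi : R -> R) (C : R) :
  strip f fx fy U V -> strip g gx gy U' V' -> tends f mf pf -> tends g mg pg ->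
  {ae mu2, forall x, fx x + gy x = 0} ->
  (forall x : R, is_derive x (1 : R) Phi (phi x)) -> (forall x : R, is_derive x (1 : R) Psi (psi x)) ->
  continuous phi -> continuous psi -> (forall x, `|phi x| <= C) -> (forall x, `|psi x| <= C) ->
  mu2.-integrable Q (EFin \o (fun x => (gx x + fy x) * (phi (f x + g x) + psi (f x - g x)))) ->
  \int[mu2]_(x in Q) ((gx x + fy x) * (phi (f x + g x) + psi (f x - g x))) =
  Phi (pf + pg) - Phi (mf + mg) - (Psi (pf - pg) - Psi (mf - mg)).
Proof.
move=> S S' tf tg dv dPhi dPsi cphi cpsi bphi bpsi ik.
have SP := stripD S S'; have SQ := stripB S S'.
apply: cell_limit => // e T e0.
have C0 : 0 <= C by apply: le_trans (bphi 0).
(* Sums and differences of the components are within [2 * eta] of their limits, hence each of the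
   two fluxes is off by at most [4 * C * eta]. The [+ 1] covers [C = 0]. *)
pose eta := e / (8 * (C + 1)).
have C1 : 0 < 8 * (C + 1) by lra.
have eta0 : 0 < eta by rewrite divr_gt0.
have etae : C * (8 * eta) <= e.
  have -> : e = (C + 1) * (8 * eta) by rewrite /eta; field; lra.
  by apply: ler_wpM2r; [lra|rewrite lerDl].
have aG := ae_and (strip_good SP) (strip_good SQ).
have [t [Tt [gP gQ] g1 g2 [c1 c2]]] := good_time_p (Num.max T 0) S S' tf tg aG eta0.
have [s [sT [gP' gQ'] g3 g4 [c3 c4]]] := good_time_m (- Num.max T 0) S S' tf tg aG eta0.
have TM : T <= Num.max T 0 by rewrite le_max lexx.
have M0 : 0 <= Num.max T 0 by rewrite le_max lexx orbT.
exists s, t; split; [by clear -sT TM M0 Tt; lra|by clear -sT TM M0 Tt; lra|].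
have st : s <= t by clear -sT TM M0 Tt; lra.
have mB := measurable_box s t.
have [v1 v2] := vcloseD c1 c2; have [v3 v4] := vcloseD c3 c4.
have [i1 k1] := flux_one 1 SP dPhi cphi bphi st gP' gP v1 v3.
have [i2 k2] := flux_one (- 1) SQ dPsi cpsi bpsi st gQ' gQ v2 v4.
set A := \int[mu2]_(x in _) _ in k1; set B := \int[mu2]_(x in _) _ in k2.
have -> : \int[mu2]_(x in `[s, t] `*` I) ((gx x + fy x) * (phi (f x + g x) + psi (f x - g x))) = A - B.
  rewrite /A /B -RintegralB//.
  apply: (@Rintegral_ae_eq _ _ _ mu2) => //; first exact: sub_box_Q.
    exact: (@integrableBR _ _ _ mu2).
  apply: aeS dv => x e1 _ /=.
  have -> : fx x = - gy x by clear -e1; lra.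
  by ring.
have -> : A - B - (Phi (pf + pg) - Phi (mf + mg) - (Psi (pf - pg) - Psi (mf - mg))) =
  (A - (Phi (pf + pg) - Phi (mf + mg))) - (B - (Psi (pf - pg) - Psi (mf - mg))) by ring.
have := ler_normB (A - (Phi (pf + pg) - Phi (mf + mg))) (B - (Psi (pf - pg) - Psi (mf - mg))).
by move: k1 k2 etae; clear; lra.
Qed.

Definition clamp (M x : R) : R := Num.max (- M) (Num.min M x).

Lemma clamp_norm M x : 0 <= M -> `|clamp M x| <= M.
Proof.
by move=> M0; rewrite ler_norml /clamp le_max lexx/= ge_max ge_min lexx andbT; lra.
Qed.

Lemma clamp_id M x : `|x| <= M -> clamp M x = x.
Proof.
by rewrite ler_norml => /andP[h1 h2]; rewrite /clamp min_r// max_r.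
Qed.

Lemma continuous_clamp M : continuous (clamp M).
Proof.
move=> x; apply: (@continuous_max _ _ (cst (- M)) (fun x => Num.min M x)); first exact: cvg_cst.
by apply: (@continuous_min _ _ (cst M) id); [exact: cvg_cst|exact: cvg_id].
Qed.

Lemma continuous_comp1 (F G : R -> R) : continuous F -> continuous G -> continuous (fun x => G (F x)).
Proof. by move=> cF cG x; apply: (@continuous_comp R R R F G); [exact: cF|exact: cG]. Qed.

Lemma clamp_bounded (F : R -> R) M : 0 <= M -> continuous F ->
  exists C, forall x, `|F (clamp M x)| <= C.
Proof.
move=> M0 cF; have [C [_ hC]] := @continuous_itv_bounded _ F (- M) M cF.
exists (C + 1) => x; apply: (hC (C + 1)); first by lra.
by rewrite /= in_itv/= -ler_norml clamp_norm.
Qed.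

Lemma continuous_line (w : R * R -> R) (F G : R -> R) : continuous w -> continuous F -> continuous G ->
  continuous (fun s => w (F s, G s)).
Proof.
move=> cw cF cG s; apply: (@continuous_comp R (R * R)%type R (fun s => (F s, G s)) w); last exact: cw.
exact: (cvg_pair (cF s) (cG s)).
Qed.

Section calibrated.
Variable w : R * R -> R.
Hypothesis C2w : C2 w.
Hypothesis wave : forall x, 'D_(@e1 R) ('D_(@e1 R) w) x = 'D_(@e2 R) ('D_(@e2 R) w) x.

(** The two d'Alembert profiles, as functions of [z.1 + z.2] and [z.1 - z.2]; the constant
    [w (0, 0)] is attributed to [wpsi]. *)
Definition wphi (s : R) : R := w (s / 2, s / 2).
Definition wpsi (t : R) : R := w (t / 2, - (t / 2)) - w (0, 0).

Lemma C2_continuous : continuous w.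
Proof. by have [_ D] := C2w; exact: (D [::] isT). Qed.

Lemma continuous_half : continuous (fun s : R => s / 2).
Proof. by move=> s; apply: cvgM; [exact: cvg_id|exact: cvg_cst]. Qed.

Lemma continuous_wphi : continuous wphi.
Proof. by apply: continuous_line; [exact: C2_continuous|exact: continuous_half..]. Qed.

Lemma continuous_wpsi : continuous wpsi.
Proof.
move=> s; apply: cvgB; last exact: cvg_cst.
apply: (continuous_line C2_continuous continuous_half); move=> t; apply: cvgN; exact: continuous_half.
Qed.

Lemma wsplit z : w z = wphi (z.1 + z.2) + wpsi (z.1 - z.2).
Proof. exact: (dalembert C2w wave). Qed.

(** Truncation acts on the characteristic variables and not on the value of [w], so that the result
    is still a sum of a function of [z.1 + z.2] and one of [z.1 - z.2] and its flux can still be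
    computed. *)
Definition wtrunc M (z : R * R) : R := wphi (clamp M (z.1 + z.2)) + wpsi (clamp M (z.1 - z.2)).

Lemma wtrunc_id M z : `|z.1 + z.2| <= M -> `|z.1 - z.2| <= M -> wtrunc M z = w z.
Proof. by move=> h1 h2; rewrite /wtrunc !clamp_id// -wsplit. Qed.

(** The truncated function is [w] at the point whose characteristic coordinates are clamped, so a
    growth bound on [w] bounds it too. *)
Lemma wtruncE M z : wtrunc M z = w ((clamp M (z.1 + z.2) + clamp M (z.1 - z.2)) / 2,
  (clamp M (z.1 + z.2) - clamp M (z.1 - z.2)) / 2).
Proof.
rewrite wsplit/= /wtrunc; by congr (wphi _ + wpsi _); field.
Qed.

Definition wint (a p q : R) : R := sint (fun s => w (a, s)) q - sint (fun s => w (a, s)) p.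

Lemma calib_value (a p q M : R) : 0 <= M -> `|a| + `|p| + `|q| <= M ->
  sint (fun s => wphi (clamp M s)) (a + q) - sint (fun s => wphi (clamp M s)) (a + p) -
  (sint (fun s => wpsi (clamp M s)) (a - q) - sint (fun s => wpsi (clamp M s)) (a - p)) = wint a p q.
Proof.
move=> M0 hM.
set Phi := sint (fun s => wphi _); set Psi := sint (fun s => wpsi _).
have dPhi := continuous_antiderivative (continuous_comp1 (@continuous_clamp M) continuous_wphi).
have dPsi := continuous_antiderivative (continuous_comp1 (@continuous_clamp M) continuous_wpsi).
have ck : continuous (fun s => w (a, s)).
  by apply: (continuous_line C2_continuous); [move=> x; exact: cvg_cst|move=> x; exact: cvg_id].
have dk := continuous_antiderivative ck.
(* As long as the clamps are inactive, [H] has derivative [wphi (a + s) + wpsi (a - s) - w (a, s) =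
   0]. The forms [1 * s + a] and [- 1 * s + a] fit [is_derive_affine]. *)
pose H s := Phi (1 * s + a) - Psi (- 1 * s + a) - sint (fun s => w (a, s)) s.
have dH (s : R) : is_derive s (1 : R) H
  (1 * wphi (clamp M (1 * s + a)) - (- 1 * wpsi (clamp M (- 1 * s + a))) - w (a, s)).
  have D1 := is_derive_affine (dPhi (1 * s + a)).
  have D2 := is_derive_affine (dPsi (- 1 * s + a)).
  exact: (is_deriveB (is_deriveB D1 D2) (dk s)).
have Hc u v : u <= v -> `|a| + `|u| <= M -> `|a| + `|v| <= M -> H v = H u.
  move=> uv hu hv; have := is_derive_le (k := 0) (l := 0) dH uv.
  rewrite mul0r => HH; apply/eqP; rewrite eq_le -subr_le0 -[X in _ && X]subr_ge0 andbC.
  apply: HH => s hs.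
  have [s1 s2] : `|1 * s + a| <= M /\ `|- 1 * s + a| <= M.
    by move: hu hv; rewrite !ler_norml; have := ler_norm a; have := ler_norm (- a); rewrite normrN;
     have := ler_norm v; have := ler_norm (- u); rewrite normrN; lra.
  rewrite !clamp_id// (_ : _ - _ = 0) ?lexx//.
  have := wsplit (a, s); rewrite /= (_ : 1 * s + a = a + s); last by ring.
  by rewrite (_ : - 1 * s + a = a - s); [lra|ring].
have Hpq : H q = H p.
  have n1 := normr_ge0 p; have n2 := normr_ge0 q.
  have [pq|qp] := leP p q; first by apply: Hc => //; lra.
  by apply/esym; apply: Hc; [exact: ltW|lra|lra].
have E (s : R) : H s = Phi (a + s) - Psi (a - s) - sint (fun s => w (a, s)) s.
  by rewrite /H mul1r mulN1r [s + a]addrC [- s + a]addrC.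
by move: Hpq; rewrite !E /wint; lra.
Qed.

(** The only property through which boundedness of [u] or growth of [w] enters: the truncation error
    is small in L2, at suitable levels as large as desired. *)
Definition tail_small (f g : R * R -> R) := forall e M0 : R, 0 < e -> exists M, [/\ M0 <= M,
  mu2.-integrable Q (EFin \o (fun x => (w (f x, g x) - wtrunc M (f x, g x)) ^+ 2)) &
  \int[mu2]_(x in Q) ((w (f x, g x) - wtrunc M (f x, g x)) ^+ 2) <= e].

Lemma measurable_pair_comp (k : R * R -> R) f g : continuous k -> measurable_fun setT f -> measurable_fun setT g ->
  measurable_fun setT (fun x => k (f x, g x)).
Proof.
move=> ck mf mg; apply: (measurableT_comp (continuous2_measurable ck)).
exact: measurable_fun_pair.
Qed.

Lemma measurable_wtrunc M f g : measurable_fun setT f -> measurable_fun setT g ->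
  measurable_fun setT (fun x => wtrunc M (f x, g x)).
Proof.
move=> mf mg; apply: measurable_funD.
- apply: (measurableT_comp (continuous_measurable_fun (continuous_comp1 (@continuous_clamp M) continuous_wphi))).
  exact: measurable_funD.
- apply: (measurableT_comp (continuous_measurable_fun (continuous_comp1 (@continuous_clamp M) continuous_wpsi))).
  exact: measurable_funB.
Qed.

(** Both factors are square integrable, so the integral exists; its value is known for the
    truncations, once the level exceeds the limits, and the error is the integral of an L2 function
    against a small one. *)
Lemma flux_w f fx fy U V g gx gy U' V' (a um up : R) :
  strip f fx fy U V -> strip g gx gy U' V' -> tends f a a -> tends g um up ->
  {ae mu2, forall x, fx x + gy x = 0} ->
  mu2.-integrable Q (EFin \o (fun x => w (f x, g x) ^+ 2)) -> tail_small f g ->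
  mu2.-integrable Q (EFin \o (fun x => (gx x + fy x) * w (f x, g x))) /\
  \int[mu2]_(x in Q) ((gx x + fy x) * w (f x, g x)) = wint a um up.
Proof.
move=> S S' tf tg dv iw tail.
have mQ : measurable Q := measurable_Q measurableT.
have mf := strip_mf S; have mg := strip_mf S'.
pose s x := gx x + fy x.
have ms : measurable_fun setT s by apply: measurable_funD; [exact: strip_mx S'|exact: strip_my S].
have is2 : mu2.-integrable Q (EFin \o (fun x => s x ^+ 2)).
  apply: integrable_sqD => //; [apply: measurable_funTS; exact: strip_mx S'|apply: measurable_funTS; exact: strip_my S|exact: strip_x2 S'|exact: strip_y2 S].
have mw : measurable_fun setT (fun x => w (f x, g x)) by apply: measurable_pair_comp => //; exact: C2_continuous.
have isw : mu2.-integrable Q (EFin \o (fun x => s x * w (f x, g x))).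
  by apply: (@integrable_mulL2 _ _ _ mu2) => //; exact: measurable_funTS.
split => //; apply/eqP; rewrite -subr_eq0 -normr_le0; apply/ler_addgt0Pl => e e0; rewrite addr0.
set K := \int[mu2]_(x in Q) (s x ^+ 2).
have K0 : 0 <= K by apply: Rintegral_ge0 => x _; exact: sqr_ge0.
(* The product [s * D] is split with weights [d] and [d^-1]: the choice gives [d * K <= e], and
   requesting an error of at most [d * e] from [tail] makes the other part at most [e]. *)
pose d := e / (K + 1).
have d0 : 0 < d by rewrite divr_gt0//; lra.
have dK : d * K <= e.
  by rewrite /d mulrAC ler_pdivrMr; [apply: ler_wpM2l; lra|lra].
have de0 : 0 < d * e by exact: mulr_gt0.
have [M [hM iD leD]] := tail _ (`|a| + `|um| + `|up|) de0.
have M0 : 0 <= M by apply: le_trans hM; rewrite !addr_ge0.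
pose D x := w (f x, g x) - wtrunc M (f x, g x).
have mD : measurable_fun setT D by apply: measurable_funB => //; exact: measurable_wtrunc.
have isD : mu2.-integrable Q (EFin \o (fun x => s x * D x)).
  by apply: (@integrable_mulL2 _ _ _ mu2) => //; exact: measurable_funTS.
have E x : s x * w (f x, g x) = s x * wtrunc M (f x, g x) + s x * D x by rewrite /D; ring.
have isM : mu2.-integrable Q (EFin \o (fun x => s x * wtrunc M (f x, g x))).
  have := @integrableBR _ _ _ mu2 _ mQ _ _ isw isD; congr (_.-integrable _ _).
  by apply/funext => x /=; rewrite E addrK.
have eM : \int[mu2]_(x in Q) (s x * wtrunc M (f x, g x)) = wint a um up.
  have c1 := continuous_comp1 (@continuous_clamp M) continuous_wphi.
  have c2 := continuous_comp1 (@continuous_clamp M) continuous_wpsi.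
  have [C1 b1] := clamp_bounded M0 continuous_wphi.
  have [C2 b2] := clamp_bounded M0 continuous_wpsi.
  rewrite -(calib_value M0 hM).
  apply: (flux_total (C := Num.max C1 C2) S S' tf tg dv
     (continuous_antiderivative c1) (continuous_antiderivative c2) c1 c2) => //.
  - by move=> x; rewrite le_max b1.
  - by move=> x; rewrite le_max b2 orbT.
rewrite (_ : (fun x => (gx x + fy x) * w (f x, g x)) = (fun x => s x * wtrunc M (f x, g x) + s x * D x)); last first.
  by apply/funext => x; exact: E.
rewrite RintegralD// eM addrAC subrr add0r.
have iB : mu2.-integrable Q (EFin \o (fun x => 2^-1 * (d * s x ^+ 2 + d^-1 * D x ^+ 2))).
  by apply: integrableZR => //; apply: integrableDR => //; exact: integrableZR.
apply: le_trans (@le_normr_Rintegral _ _ _ mu2 Q _ mQ isD) _.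
apply: (@le_trans _ _ (\int[mu2]_(x in Q) (2^-1 * (d * s x ^+ 2 + d^-1 * D x ^+ 2)))).
  apply: le_Rintegral => //; first exact: (integrable_norm isD).
  move=> x _; have d1 : 0 < 2^-1 * d^-1 by rewrite mulr_gt0 ?invr_gt0.
  have q1 : 0 <= (2^-1 * d^-1) * (d * s x + D x) ^+ 2 by rewrite mulr_ge0 ?sqr_ge0// ltW.
  have q2 : 0 <= (2^-1 * d^-1) * (d * s x - D x) ^+ 2 by rewrite mulr_ge0 ?sqr_ge0// ltW.
  have r1 : (2^-1 * d^-1) * (d * s x + D x) ^+ 2 = 2^-1 * (d * s x ^+ 2 + d^-1 * D x ^+ 2) + s x * D x.
    by field; rewrite gt_eqF.
  have r2 : (2^-1 * d^-1) * (d * s x - D x) ^+ 2 = 2^-1 * (d * s x ^+ 2 + d^-1 * D x ^+ 2) - s x * D x.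
    by field; rewrite gt_eqF.
  by clear -q1 q2 r1 r2; rewrite ler_norml; lra.
rewrite RintegralZl//; last by apply: integrableDR => //; exact: integrableZR.
rewrite RintegralD//; [|exact: integrableZR|exact: integrableZR].
rewrite RintegralZl// RintegralZl// -/K.
have : d^-1 * \int[mu2]_(x in Q) (D x ^+ 2) <= e by rewrite ler_pdivrMl.
by move: dK; clear; lra.
Qed.

Definition defect (W : R * R -> R) (f fx fy g gx gy : R * R -> R) (x : R * R) : R :=
  2^-1 * (gx x + fy x - w (f x, g x)) ^+ 2 + 2^-1 * (fx x - gy x) ^+ 2 +
  (W (f x, g x) - 2^-1 * w (f x, g x) ^+ 2).

(** Expanding the squares of [defect], the terms in [w ^+ 2] cancel. The cross term is evaluated by
    [flux_w] and the quadratic part is bounded by [det_le], which is the only source of the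
    inequality. *)
Lemma calibration (W : R * R -> R) f fx fy U V g gx gy U' V' (a um up : R) :
  continuous W -> (forall z, w z ^+ 2 / 2 <= W z) ->
  strip f fx fy U V -> strip g gx gy U' V' -> tends f a a -> tends g um up ->
  {ae mu2, forall x, fx x + gy x = 0} ->
  mu2.-integrable Q (EFin \o (fun x => W (f x, g x))) -> tail_small f g ->
  mu2.-integrable Q (EFin \o defect W f fx fy g gx gy) /\
  wint a um up + \int[mu2]_(x in Q) defect W f fx fy g gx gy x <=
  2^-1 * \int[mu2]_(x in Q) (fx x ^+ 2 + fy x ^+ 2 + (gx x ^+ 2 + gy x ^+ 2)) +
  \int[mu2]_(x in Q) W (f x, g x).
Proof.
move=> cW wW S S' tf tg dv iW tail.
have mQ : measurable Q := measurable_Q measurableT.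
have mf := strip_mf S; have mg := strip_mf S'.
have mw : measurable_fun setT (fun x => w (f x, g x)) by apply: measurable_pair_comp => //; exact: C2_continuous.
have iw : mu2.-integrable Q (EFin \o (fun x => w (f x, g x) ^+ 2)).
  apply: (@le_integrableR _ _ _ mu2 _ _ (fun x => 2 * W (f x, g x))) => //.
  - by apply: measurable_funTS; exact: measurable_funX.
  - move=> x _; rewrite ger0_norm ?sqr_ge0//; apply: le_trans (ler_norm _).
    by have := wW (f x, g x); lra.
  - exact: integrableZR.
have [iS eS] := flux_w S S' tf tg dv iw tail.
have [iD leD] := det_le S S' tf tg.
have E : defect W f fx fy g gx gy = (fun x =>
  2^-1 * ((fx x - gy x) ^+ 2 + (gx x + fy x) ^+ 2) - (gx x + fy x) * w (f x, g x) + W (f x, g x)).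
  by apply/funext => x; rewrite /defect; field.
have i1 := @integrableZR _ _ _ mu2 _ mQ 2^-1 _ iD.
have i2 := @integrableBR _ _ _ mu2 _ mQ _ _ i1 iS.
rewrite E; split; first exact: (@integrableDR _ _ _ mu2).
rewrite RintegralD// RintegralB// RintegralZl// eS.
by lra.
Qed.

End calibrated.

End calibration.

(** * Decay of the level sets *)

Section tail.
Context {R : realType}.
Notation mu := (@lebesgue_measure R).
Notation mu2 := (@mu2 R).
Notation I := (`[0%R, 1%R]%classic : set R).
Notation Q := (setT `*` I : set (R * R)).
Implicit Types f g : R * R -> R.

Lemma cauchy_schwarz d (T : measurableType d) (m : {measure set T -> \bar R}) (D : set T)
  (k l : T -> R) : measurable D -> measurable_fun D k -> measurable_fun D l ->
  m.-integrable D (EFin \o (fun x => k x ^+ 2)) ->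
  m.-integrable D (EFin \o (fun x => l x ^+ 2)) ->
  (\int[m]_(x in D) (k x * l x)) ^+ 2 <=
  \int[m]_(x in D) (k x ^+ 2) * \int[m]_(x in D) (l x ^+ 2).
Proof.
move=> mD mk ml ik il; have ikl := integrable_mulL2 mD mk ml ik il.
set A := \int[m]_(x in D) (k x ^+ 2); set C := \int[m]_(x in D) (l x ^+ 2).
set B := \int[m]_(x in D) (k x * l x).
have H t : 0 <= A - 2 * t * B + t ^+ 2 * C.
  have -> : A - 2 * t * B + t ^+ 2 * C = \int[m]_(x in D) (k x ^+ 2 - 2 * t * (k x * l x) + t ^+ 2 * l x ^+ 2).
    have i1 := integrableZR mD (2 * t) ikl; have i2 := integrableZR mD (t ^+ 2) il.
    by rewrite RintegralD//; [rewrite RintegralB// !RintegralZl//|exact: integrableBR].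
  apply: Rintegral_ge0 => x _; rewrite (_ : _ + _ = (k x - t * l x) ^+ 2) ?sqr_ge0//; ring.
have C0 : 0 <= C by apply: Rintegral_ge0 => x _; exact: sqr_ge0.
have A0 : 0 <= A by apply: Rintegral_ge0 => x _; exact: sqr_ge0.
move: C0; rewrite le_eqVlt => /predU1P[C0|C0].
  rewrite -C0 mulr0 le_eqVlt sqrf_eq0; apply/orP; left; apply/eqP.
  (* With [C = 0] the expression is affine in [t]; at this value of [t] it equals [- 1]. *)
  apply/eqP/negPn/negP => B0; have := H ((A + 1) / (2 * B)); rewrite -C0 mulr0 addr0.
  have -> : 2 * ((A + 1) / (2 * B)) * B = A + 1 by field.
  lra.
have := H (B / C).
have -> : A - 2 * (B / C) * B + (B / C) ^+ 2 * C = A - B ^+ 2 / C by field; rewrite gt_eqF.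
by rewrite subr_ge0 ler_pdivrMr.
Qed.

Lemma integrable_prod (k l : R -> R) : mu.-integrable setT (EFin \o k) ->
  mu.-integrable I (EFin \o l) -> measurable_fun setT l ->
  mu2.-integrable Q (EFin \o (fun x => k x.1 * l x.2)) /\
  \int[mu2]_(x in Q) (k x.1 * l x.2) = \int[mu]_t k t * \int[mu]_(y in I) l y.
Proof.
move=> ik il ml; have mI : measurable I by exact: measurable_itv.
have mk : measurable_fun setT k by have /integrableP[/measurable_EFinP] := ik.
have mkl : measurable_fun setT (fun x : R * R => k x.1 * l x.2).
  by apply: measurable_funM; [apply: (measurableT_comp mk); exact: measurable_fst|apply: (measurableT_comp ml); exact: measurable_snd].
have iQ : mu2.-integrable Q (EFin \o (fun x => k x.1 * l x.2)).
  apply/integrableP; split; first by apply: measurable_funTS; exact/measurable_EFinP.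
  have mN : measurable_fun setT (fun x : R * R => `|(k x.1 * l x.2)%:E|%E).
    by apply: measurableT_comp => //; exact/measurable_EFinP.
  have [_ ->] := tonelli_strip measurableT mN (fun x => abse_ge0 _).
  have /integrableP[_ fk] := ik; have /integrableP[_ fl] := il.
  have eI x : (\int[mu]_(y in I) `|(k x * l y)%:E| = `|(k x)%:E| * \int[mu]_(y in I) `|(l y)%:E|)%E.
    rewrite -ge0_integralZl//; first by apply: eq_integral => y _; rewrite EFinM abseM.
    by apply: measurable_funTS; apply: measurableT_comp => //; exact/measurable_EFinP.
  under eq_integral => x _ do rewrite /= eI.
  rewrite ge0_integralZr//; last first.
  - by apply: integral_ge0.
  - by apply: measurableT_comp => //; exact/measurable_EFinP.
  by apply: lte_mul_pinfty => //; [exact: integral_ge0|rewrite ge0_fin_numE//; exact: integral_ge0].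
split => //; have [_ _ ->] := RFubini measurableT mI iQ.
rewrite -RintegralZr//; apply: eq_Rintegral => x _.
exact: (@RintegralZl _ _ _ mu I l (k x) mI il).
Qed.

Lemma le_Rintegral_subset d (T : measurableType d) (m : {measure set T -> \bar R}) (A B : set T)
  (k : T -> R) : measurable A -> measurable B -> A `<=` B -> m.-integrable B (EFin \o k) ->
  (forall x, 0 <= k x) -> \int[m]_(x in A) k x <= \int[m]_(x in B) k x.
Proof.
move=> mA mB AB iB k0; have iA := integrableS mB mA AB iB.
rewrite /Rintegral; apply: fine_le.
- exact: (integrable_fin_num mA iA).
- exact: (integrable_fin_num mB iB).
apply: ge0_subset_integral => //; first by have /integrableP[] := iB.
by move=> x _; rewrite lee_fin.
Qed.

Lemma mean_mvt f fx fy U V t : strip f fx fy U V -> good f fy U V t ->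
  exists2 y, 0 <= y <= 1 & V (t, y) = mean f t.
Proof.
move=> S [pV fV _ _ _].
have cV := prim_continuous pV; have dV := continuous_antiderivative cV.
have cs : {within `[0, 1], continuous (sint (fun y => V (t, y)))}.
  by apply: continuous_subspaceT; exact: is_derive_continuous dV.
have [y] := @MVT R (sint (fun y => V (t, y))) (fun y => V (t, y)) 0 1 ltr01 (fun x _ => dV x) cs.
rewrite in_itv/= => /andP[y0 y1]; rewrite subr0 mulr1 => e.
exists y; first by lra.
have [_] := prim_is_derive dV cV ler01; rewrite e => ->.
rewrite /mean; apply: Rintegral_ae_eqm.
- exact: measurable_itv.
- apply: measurable_funTS; apply: measurable_slice2; exact: strip_mV S.
- apply: measurable_funTS; apply: measurable_slice2; exact: strip_mf S.
- by apply: aeS fV => z ->.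
Qed.

Lemma mean_increment f fx fy U V s t : strip f fx fy U V -> s <= t ->
  good f fy U V s -> good f fy U V t ->
  `|mean f t - mean f s| <= \int[mu2]_(x in `[s, t] `*` I) `|fx x|.
Proof.
move=> S st gs gt; have mB := measurable_box s t.
have ix : mu2.-integrable (`[s, t] `*` I) (EFin \o fx) by apply: L1loc2_box; exact: strip_Lx S.
have [i1 e1] := flux_x (F := id) (f0 := fun=> 1) (C := 1) S (fun x => is_derive_id x 1) (fun x => cvg_cst _) ltac:(by move=> x; rewrite normr1) st gs gt.
have mn r : good f fy U V r -> mean f r = \int[mu]_(y in I) V (r, y) /\ mu.-integrable I (EFin \o (fun y => V (r, y))).
  move=> [pV fV _ _ _]; split; last by apply: continuous_itv_integrable; exact: prim_continuous pV.
  rewrite /mean; apply: Rintegral_ae_eqm.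
  - exact: measurable_itv.
  - apply: measurable_funTS; apply: measurable_slice2; exact: strip_mf S.
  - apply: measurable_funTS; apply: measurable_slice2; exact: strip_mV S.
  - by apply: aeS fV => z ->.
have [-> is'] := mn s gs; have [-> it] := mn t gt.
rewrite -RintegralB// -e1.
have -> : (fun x => fx x * 1) = fx by apply/funext => x; rewrite mulr1.
exact: (@le_normr_Rintegral _ _ _ mu2 _ _ mB ix).
Qed.

(** Outside a bounded interval the limits control the mean. Inside, its increment up to a fixed good
    time [t] is at most the integral of [|fx|] over a box. *)
Lemma mean_bounded f fx fy U V (m p : R) : strip f fx fy U V -> tends f m p ->
  exists K, {ae mu, forall t, `|mean f t| <= K}.
Proof.
move=> S [ub [eub hp hm]].
have /cvgrPdist_le/(_ _ ltr01) [A [_ hA]] := hp.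
have /cvgrPdist_le/(_ _ ltr01) [B [_ hB]] := hm.
have [t [Dt gt _]] := small_time (k := fun=> 0) (measurable_itv `]Num.max A B, +oo[) (measure_itv_oy _)
   (integrable0 _ _) (strip_good S) ltr01.
have At : A < t by move: Dt; rewrite /= in_itv/= andbT gt_max => /andP[].
have Bt : B < t by move: Dt; rewrite /= in_itv/= andbT gt_max => /andP[].
exists (`|p| + `|m| + 1 + `|mean f t| + \int[mu2]_(x in `[B, t] `*` I) `|fx x|).
have i0 : 0 <= \int[mu2]_(x in `[B, t] `*` I) `|fx x| by exact: Rintegral_ge0.
have np := normr_ge0 p; have nm := normr_ge0 m; have nt := normr_ge0 (mean f t).
apply: aeS (ae_and (strip_good S) eub) => s [gs es].
have [As|sA] := ltP A s.
  have := hA s As; rewrite -es => h.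
  by have := ler_normB p (p - ub s); rewrite opprB addrC subrK; lra.
have [sB|Bs] := ltP s B.
  have := hB s sB; rewrite -es => h.
  by have := ler_normB m (m - ub s); rewrite opprB addrC subrK; lra.
have st : s <= t by lra.
have := mean_increment S st gs gt => h.
have h2 : \int[mu2]_(x in `[s, t] `*` I) `|fx x| <= \int[mu2]_(x in `[B, t] `*` I) `|fx x|.
  apply: le_Rintegral_subset => //.
  - exact: measurable_box.
  - exact: measurable_box.
  - by apply: subsetX => // z; rewrite /= !in_itv/=; lra.
  - by apply: integrable_norm; apply: L1loc2_box; exact: strip_Lx S.
have := ler_normB (mean f t) (mean f t - mean f s); rewrite opprB addrC subrK.
by move: (le_trans h h2); set c := Rintegral _ _ _; lra.
Qed.

Lemma ae_le_of_slices1 (k l : R * R -> R) : measurable_fun setT k -> measurable_fun setT l ->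
  {ae mu, forall t, {ae mu, forall y, k (t, y) <= l (t, y)}} -> {ae mu2, forall x, k x <= l x}.
Proof.
move=> mk ml h; have mx : measurable_fun setT (fun x => Num.max (k x) (l x)) by exact: measurable_maxr.
have H : {ae mu2, forall x, Num.max (k x) (l x) = l x}.
  by apply: ae_of_slices1 => //; apply: aeS h => t; apply: aeS => y kl; rewrite max_r.
by apply: aeS H => x <-; rewrite le_max lexx.
Qed.

Lemma ae_le_of_slices2 (k l : R * R -> R) : measurable_fun setT k -> measurable_fun setT l ->
  {ae mu, forall y, {ae mu, forall t, k (t, y) <= l (t, y)}} -> {ae mu2, forall x, k x <= l x}.
Proof.
move=> mk ml h.
have H := ae_le_of_slices1 (swap_measurable_fun mk) (swap_measurable_fun ml) h.
by apply: aeS (ae_swap H) => -[x y].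
Qed.

Definition level (r : R) f (x : R * R) : R := if r <= `|f x| then 1 else 0.

Lemma measurable_level r f : measurable_fun setT f -> measurable_fun setT (level r f).
Proof.
move=> mf; apply: measurable_fun_ifT => //; apply: measurable_fun_ler => //.
exact: measurableT_comp.
Qed.

Lemma level_ge0 r f x : 0 <= level r f x.
Proof. by rewrite /level; case: ifP. Qed.

Lemma level_le1 r f x : level r f x <= 1.
Proof. by rewrite /level; case: ifP. Qed.

(** A factor that turns statements valid on [Q] into statements on the whole plane, where the
    slicing lemmas apply. *)
Definition chiI (y : R) : R := if 0 <= y <= 1 then 1 else 0.

Lemma measurable_chiI : measurable_fun setT chiI.
Proof.
apply: measurable_fun_ifT => //; apply: measurable_and => //; exact: measurable_fun_ler.
Qed.

Lemma measurable_chiI2 : measurable_fun setT (fun x : R * R => chiI x.2).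
Proof. by apply: (measurableT_comp measurable_chiI); exact: measurable_snd. Qed.

Lemma chiI_Q x : Q x -> chiI x.2 = 1.
Proof. by move=> [_]; rewrite /= in_itv/= /chiI => ->. Qed.

(** Where [|f| >= K + 1] the distance to the mean is at least 1, so the variation along the vertical
    line is at least 1 and its energy too, by [Rintegral_abs_le] with weight 1. The level set is
    thus dominated by the vertical energy. *)
Lemma level_integrable f fx fy U V K r : strip f fx fy U V ->
  {ae mu, forall t, `|mean f t| <= K} -> K + 1 <= r ->
  mu2.-integrable Q (EFin \o level r f).
Proof.
move=> S hK Kr; have mf := strip_mf S.
have iE := strip_energy S.
set E := (fun t => \int[mu]_(y in I) _) in iE.
have mE : measurable_fun setT E by have /integrableP[/measurable_EFinP] := iE.
have ic : mu.-integrable I (EFin \o (fun=> 1)).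
  by apply: continuous_itv_integrable => x; exact: cvg_cst.
have [ip _] := integrable_prod iE ic (measurable_cst _).
have H : {ae mu2, forall x, level r f x * chiI x.2 <= E x.1}.
  apply: ae_le_of_slices1.
  - by apply: measurable_funM; [exact: measurable_level|exact: measurable_chiI2].
  - by apply: (measurableT_comp mE); exact: measurable_fst.
  apply: aeS (ae_and (strip_good S) hK) => t [gt mt].
  have E0 : 0 <= E t by apply: Rintegral_ge0 => y _; exact: sqr_ge0.
  have [_ fV _ _ i2] := gt.
  have [_ l1] := Rintegral_abs_le ltr01 (measurable_slice2 t (strip_my S)) i2.
  apply: aeS fV => y e; rewrite /level /chiI/=.
  case: ifP => h; last by rewrite mul0r.
  case: ifP => y01; last by rewrite mulr0.
  have Iy : I y by rewrite /= in_itv.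
  have h2 := good_mean S gt Iy; rewrite -e in h2.
  have := ler_normD (f (t, y) - mean f t) (mean f t); rewrite subrK mulr1 => h3.
  move: l1; rewrite invr1 mul1r -/(E t) => l1.
  move: h2; set c := Rintegral _ _ _ in l1 *; lra.
apply: (@ae_le_integrable _ _ _ mu2 Q _ (fun x => E x.1 * 1)) => //.
- exact: measurable_Q.
- by apply: measurable_funTS; exact: measurable_level.
- apply: aeS H => x h Qx; move: h; rewrite chiI_Q// !mulr1 => h.
  by rewrite ger0_norm ?level_ge0// (le_trans h)// ler_norm.
Qed.

Lemma shell_le_level r h f x : shell r h (f x) <= level r f x.
Proof. by rewrite /shell /level; case: ifP => [/andP[/ltW -> _]//|_]; case: ifP. Qed.

Lemma shell_ge0 (r h z : R) : 0 <= shell r h z.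
Proof. by rewrite /shell; case: ifP. Qed.

Lemma shell_sq (r h z : R) : shell r h z ^+ 2 = shell r h z.
Proof. by rewrite /shell; case: ifP; rewrite ?expr1n// expr0n. Qed.

Lemma shell_le1 (r h z : R) : shell r h z <= 1.
Proof. by rewrite /shell; case: ifP. Qed.

Lemma measurable_shellf r h f : measurable_fun setT f -> measurable_fun setT (fun x => shell r h (f x)).
Proof. by move=> mf; exact: (measurableT_comp (measurable_shell r h)). Qed.

(** The crossing starts at a height where [V] equals its mean, hence is at most [r] in absolute
    value; it ends at the point where the level [r + h] is reached. *)
Lemma vertical_crossing f fx fy U V K r h t : strip f fx fy U V -> good f fy U V t ->
  `|mean f t| <= K -> K <= r -> 0 <= r -> 0 < h ->
  {ae mu, forall y, level (r + h) f (t, y) * chiI y * (h / 4) <=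
    \int[mu]_(z in I) (`|fy (t, z)| * shell r h (f (t, z)))}.
Proof.
move=> S gt mt Kr r0 h0; have [pV fV _ _ i2] := gt.
have mI : measurable I by exact: measurable_itv.
have [y0 y01 e0] := mean_mvt S gt.
have mV := strip_mV S; have my := strip_my S; have mf := strip_mf S.
have eV : \int[mu]_(z in I) (`|fy (t, z)| * shell r h (f (t, z))) =
    \int[mu]_(z in I) (`|fy (t, z)| * shell r h (V (t, z))).
  have mm k : measurable_fun setT k -> measurable_fun I (fun z : R => `|fy (t, z)| * shell r h (k (t, z))).
    move=> mk; apply: measurable_funTS; apply: measurable_funM.
      by apply: measurableT_comp => //; exact: measurable_slice2.
    by apply: (measurableT_comp (measurable_shell r h)); exact: measurable_slice2.
  by apply: Rintegral_ae_eqm; [exact: measurable_itv|exact: mm|exact: mm|apply: aeS fV => z ->].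
have iI : mu.-integrable I (EFin \o (fun z => `|fy (t, z)| * shell r h (V (t, z)))).
  have [i1 _] := pV 0 1 ler01.
  apply: (@integrable_bounded_mul _ _ _ mu I (fun z => `|fy (t, z)|) (fun z => shell r h (V (t, z))) 1) => //.
  - by apply: measurable_funTS; apply: (measurableT_comp (measurable_shell r h)); exact: measurable_slice2.
  - by move=> z _; rewrite ger0_norm ?shell_ge0 ?shell_le1.
  - exact: integrable_norm.
have F0 z : 0 <= `|fy (t, z)| * shell r h (V (t, z)) by rewrite mulr_ge0 ?shell_ge0.
rewrite eV; apply: aeS fV => y e; rewrite /level /chiI e.
case: ifP => hy; last by rewrite !mul0r Rintegral_ge0.
case: ifP => y1; last by rewrite mulr0 mul0r Rintegral_ge0.
rewrite !mul1r.
have b0 : `|V (t, y0)| <= r by rewrite e0; lra.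
have sub a b : 0 <= a -> b <= 1 -> \int[mu]_(z in `[a, b]) (`|fy (t, z)| * shell r h (V (t, z))) <=
    \int[mu]_(z in I) (`|fy (t, z)| * shell r h (V (t, z))).
  move=> a0 b1; apply: (@le_Rintegral_subset _ _ mu) => //.
  by move=> z; rewrite /= !in_itv/=; lra.
have [yy|yy] := leP y0 y.
- apply: le_trans (sub y0 y _ _); [|by clear -y01 y1; lra|by clear -y01 y1; lra].
  by apply: prim_crossing => //; left.
- apply: le_trans (sub y y0 _ _); [|by clear -y01 y1; lra|by clear -y01 y1; lra].
  by apply: prim_crossing => //; [exact: ltW|right].
Qed.

Lemma Rintegral_ge0f (d : measure_display) (T : measurableType d) (m : {measure set T -> \bar R}) (D : set T) (k : T -> R) :
  (forall x, 0 <= k x) -> 0 <= \int[m]_(x in D) k x.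
Proof. by move=> k0; apply: Rintegral_ge0 => x _; exact: k0. Qed.

(** One good time [s], at which the trace is within 1 of its limit and so at most [|p| + 1 <= r],
    serves as starting point on almost every horizontal line. *)
Lemma horizontal_crossing f fx fy U V (m p r h : R) : strip f fx fy U V -> tends f m p ->
  `|p| + 1 <= r -> 0 < h ->
  mu2.-integrable Q (EFin \o (fun x => `|fx x| * shell r h (f x))) ->
  {ae mu, forall y, {ae mu, forall t, level (r + h) f (t, y) * chiI y * (h / 4) <=
    \int[mu]_z (`|fx (z, y)| * shell r h (f (z, y)))}}.
Proof.
move=> S tf pr h0 iQ.
have aT : {ae mu, forall t : R, True} by exact: aeT.
have [s [_ _ gs _ [cs _]]] := good_time_p 0 S S tf tf aT ltr01.
have mI : measurable I by exact: measurable_itv.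
have [i1 _ _] := RFubini' measurableT mI iQ.
have mU := strip_mU S; have mx := strip_mx S; have mf := strip_mf S.
have [_ sV sU _ _] := gs.
apply: aeS (ae_and (ae_and (strip_primU S) i1) (ae_and (ae_slices2 (strip_fU S)) (ae_and sV sU))).
move=> y [[pU iy] [fU [e1 e2]]].
have F0 (k : R -> R) : (forall z, 0 <= `|fx (z, y)| * shell r h (k z)).
  by move=> z; rewrite mulr_ge0 ?shell_ge0.
apply: aeS (fU) => t e; rewrite /level /chiI/=.
case: ifP => ht; last by rewrite !mul0r; apply: Rintegral_ge0f; exact: F0.
case: ifP => y01; last by rewrite mulr0 mul0r; apply: Rintegral_ge0f; exact: F0.
rewrite !mul1r.
have Iy : I y by rewrite /= in_itv.
have {}iy := iy Iy.
have eU : \int[mu]_z (`|fx (z, y)| * shell r h (f (z, y))) = \int[mu]_z (`|fx (z, y)| * shell r h (U (z, y))).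
  have mm k : measurable_fun setT k -> measurable_fun setT (fun z : R => `|fx (z, y)| * shell r h (k (z, y))).
    move=> mk; apply: measurable_funM.
      by apply: measurableT_comp => //; exact: measurable_slice1.
    by apply: (measurableT_comp (measurable_shell r h)); exact: measurable_slice1.
  by apply: Rintegral_ae_eqm => //; [exact: mm|exact: mm|apply: aeS fU => z ->].
have iU : mu.-integrable setT (EFin \o (fun z => `|fx (z, y)| * shell r h (U (z, y)))).
  apply: ae_eq_integrable iy.
    apply/measurable_EFinP; apply: measurable_funM.
      by apply: measurableT_comp => //; exact: measurable_slice1.
    by apply: (measurableT_comp (measurable_shell r h)); exact: measurable_slice1.
  by apply: aeS fU => z /= ->.
have b0 : `|U (s, y)| <= r.
  rewrite -e2 e1; have := cs y ltac:(lra) => hh.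
  by have := ler_normD (V (s, y) - p) p; rewrite subrK; lra.
rewrite eU; rewrite e in ht.
have sub a b : \int[mu]_(z in `[a, b]) (`|fx (z, y)| * shell r h (U (z, y))) <=
    \int[mu]_z (`|fx (z, y)| * shell r h (U (z, y))).
  by apply: (@le_Rintegral_subset _ _ mu) => //; exact: (F0 (fun z => U (z, y))).
have r0 : 0 <= r by have := normr_ge0 p; lra.
have [st|ts] := leP s t.
- by apply: le_trans (sub s t); apply: prim_crossing => //; left.
- by apply: le_trans (sub t s); apply: prim_crossing => //; [exact: ltW|right].
Qed.

(* At level at least [r + h] a function crosses the shell [r, r + h] along its vertical line,
   because its mean there is smaller than [r], and along its horizontal line, because of the
   limits at infinity.  Each crossing costs energy in the shell, and the product of the two costs
   bounds the measure. *)
Lemma level_step f fx fy U V (m p K r h : R) : strip f fx fy U V -> tends f m p ->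
  {ae mu, forall t, `|mean f t| <= K} -> K + 1 <= r -> `|p| + 1 <= r -> 0 < h ->
  \int[mu2]_(x in Q) level (r + h) f x <= 8 / h ^+ 2 *
    \int[mu2]_(x in Q) ((fx x ^+ 2 + fy x ^+ 2) * shell r h (f x)) * \int[mu2]_(x in Q) level r f x.
Proof.
move=> S tf hK Kr pr h0.
have fin (a b c d e k : R) : a <= b -> 2 * b <= c + d -> c <= e -> d <= k -> a <= (e + k) / 2 by lra.
have amgm (X Y : R) : 2 * (Y * X) <= X ^+ 2 + Y ^+ 2.
  by have := sqr_ge0 (X - Y); rewrite !expr2; lra.
have Kr' : K <= r by lra.
have r0 : 0 <= r by have := normr_ge0 p; lra.
have h40 : 0 < h / 4 by lra.
have Krh : K + 1 <= r + h by lra.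
have mQ : measurable Q := measurable_Q measurableT.
have mI : measurable I by exact: measurable_itv.
have mf := strip_mf S; have mx := strip_mx S; have my := strip_my S.
have il := level_integrable S hK Kr.
have il2 : mu2.-integrable Q (EFin \o level (r + h) f) by exact: (level_integrable S hK).
have msh := measurable_shellf r h mf.
have ish : mu2.-integrable Q (EFin \o (fun x => shell r h (f x))).
  apply: (@le_integrableR _ _ _ mu2 _ _ (level r f)) => //; first exact: measurable_funTS.
  by move=> x _; rewrite !ger0_norm ?shell_ge0 ?level_ge0// shell_le_level.
have ish2 : mu2.-integrable Q (EFin \o (fun x => shell r h (f x) ^+ 2)).
  by move: ish; congr (_.-integrable _ _); apply/funext => x /=; rewrite shell_sq.
have key (k : R * R -> R) : measurable_fun setT k -> mu2.-integrable Q (EFin \o (fun x => k x ^+ 2)) ->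
  [/\ mu2.-integrable Q (EFin \o (fun x => `|k x| * shell r h (f x))),
   mu2.-integrable Q (EFin \o (fun x => k x ^+ 2 * shell r h (f x))) &
   (\int[mu2]_(x in Q) (`|k x| * shell r h (f x))) ^+ 2 <=
   \int[mu2]_(x in Q) (k x ^+ 2 * shell r h (f x)) * \int[mu2]_(x in Q) shell r h (f x)].
  move=> mk ik.
  have mks : measurable_fun setT (fun x => `|k x| * shell r h (f x)).
    by apply: measurable_funM => //; exact: measurableT_comp.
  have i2 : mu2.-integrable Q (EFin \o (fun x => k x ^+ 2 * shell r h (f x))).
    apply: (@integrable_bounded_mul _ _ _ mu2 Q (fun x => k x ^+ 2) (fun x => shell r h (f x)) 1) => //.
    - exact: measurable_funTS.
    - by move=> z _; rewrite ger0_norm ?shell_ge0 ?shell_le1.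
  have e2 : (fun x => (`|k x| * shell r h (f x)) ^+ 2) = (fun x => k x ^+ 2 * shell r h (f x)).
    by apply/funext => x; rewrite exprMn shell_sq real_normK ?num_real.
  have i3 : mu2.-integrable Q (EFin \o (fun x => (`|k x| * shell r h (f x)) ^+ 2)).
    by move: i2; congr (_.-integrable _ _); rewrite e2.
  (* An indicator equals its square, so Cauchy-Schwarz keeps it in both factors: the energy inside
     the shell times the measure of the shell. *)
  have e1 : (fun x => `|k x| * shell r h (f x)) = (fun x => (`|k x| * shell r h (f x)) * shell r h (f x)).
    by apply/funext => x; rewrite -mulrA -expr2 shell_sq.
  have mQs : measurable_fun Q (fun x => shell r h (f x)) by exact: measurable_funTS.
  split => //.
    rewrite e1; apply: (@integrable_mulL2 _ _ _ mu2) => //; exact: measurable_funTS.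
  have := @cauchy_schwarz _ _ mu2 Q _ _ mQ (measurable_funTS mks) mQs i3 ish2.
  rewrite -e1 e2; under [X in _ * X]eq_Rintegral do rewrite shell_sq.
  by [].
have [ix ix2 cx] := key _ mx (strip_x2 S); have [iy iy2 cy] := key _ my (strip_y2 S).
have [_ j1 e1] := RFubini' measurableT mI ix.
have [_ j2 e2] := RFubini measurableT mI iy.
pose F1 y := \int[mu]_z (`|fx (z, y)| * shell r h (f (z, y))).
pose F2 t := \int[mu]_(z in I) (`|fy (t, z)| * shell r h (f (t, z))).
have mF2 : measurable_fun setT F2 by have /integrableP[/measurable_EFinP] := j2.
have mF1 : measurable_fun setT F1.
  apply: (@measurable_Rintegral_param _ _ _ (fun z : R * R => `|fx (z.2, z.1)| * shell r h (f (z.2, z.1)))).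
  apply: measurable_funM.
    by apply: measurableT_comp => //; apply: (measurableT_comp mx); exact: measurable_swap.
  by apply: (measurableT_comp msh); exact: measurable_swap.
have [i12 e12] := integrable_prod j2 j1 mF1.
have F10 y : 0 <= F1 y by apply: Rintegral_ge0f => z; rewrite mulr_ge0 ?shell_ge0.
have F20 y : 0 <= F2 y by apply: Rintegral_ge0f => z; rewrite mulr_ge0 ?shell_ge0.
have mL : measurable_fun setT (fun x => level (r + h) f x * chiI x.2 * (h / 4)).
  apply: measurable_funM => //; apply: measurable_funM; last exact: measurable_chiI2.
  exact: measurable_level.
have A : {ae mu2, forall x, level (r + h) f x * chiI x.2 * (h / 4) <= F2 x.1}.
  apply: ae_le_of_slices1 => //; first by apply: (measurableT_comp mF2); exact: measurable_fst.
  apply: aeS (ae_and (strip_good S) hK) => t [gt mt].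
  exact: (vertical_crossing S gt mt).
have B : {ae mu2, forall x, level (r + h) f x * chiI x.2 * (h / 4) <= F1 x.2}.
  apply: ae_le_of_slices2 => //; first by apply: (measurableT_comp mF1); exact: measurable_snd.
  exact: (horizontal_crossing S tf).
have h160 : 0 <= (h / 4) ^+ 2 by exact: sqr_ge0.
have le1 : \int[mu2]_(x in Q) ((h / 4) ^+ 2 * level (r + h) f x) <= \int[mu2]_(x in Q) (F2 x.1 * F1 x.2).
  apply: (@ae_le_Rintegral _ _ _ mu2) => //; first exact: integrableZR.
  apply: aeS (ae_and A B) => x [a b] Qx; move: a b; rewrite chiI_Q// mulr1.
  rewrite /level; case: ifP => _; last by rewrite mulr0 mulr_ge0.
  by rewrite mul1r mulr1 expr2 => a b; apply: ler_pM => //; exact: ltW.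
rewrite RintegralZl// e12 in le1.
rewrite -[\int[mu]_t _]e2 -[\int[mu]_(y in I) _]e1 in le1.
have les : \int[mu2]_(x in Q) shell r h (f x) <= \int[mu2]_(x in Q) level r f x.
  by apply: le_Rintegral => // x _; exact: shell_le_level.
have -> : \int[mu2]_(x in Q) ((fx x ^+ 2 + fy x ^+ 2) * shell r h (f x)) =
   \int[mu2]_(x in Q) (fx x ^+ 2 * shell r h (f x)) + \int[mu2]_(x in Q) (fy x ^+ 2 * shell r h (f x)).
  by rewrite -RintegralD//; apply: eq_Rintegral => x _; rewrite mulrDl.
have ex0 : 0 <= \int[mu2]_(x in Q) (fx x ^+ 2 * shell r h (f x)).
  by apply: Rintegral_ge0f => x; rewrite mulr_ge0 ?shell_ge0 ?sqr_ge0.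
have ey0 : 0 <= \int[mu2]_(x in Q) (fy x ^+ 2 * shell r h (f x)).
  by apply: Rintegral_ge0f => x; rewrite mulr_ge0 ?shell_ge0 ?sqr_ge0.
move: le1 les cx cy ex0 ey0.
set L2 := \int[mu2]_(x in Q) level (r + h) f x; set L1 := \int[mu2]_(x in Q) level r f x.
set Y := \int[mu2]_(x in Q) (`|fy x| * _); set X := \int[mu2]_(x in Q) (`|fx x| * _).
set ex := \int[mu2]_(x in Q) (fx x ^+ 2 * _); set ey := \int[mu2]_(x in Q) (fy x ^+ 2 * _).
set s := \int[mu2]_(x in Q) shell _ _ _ => le1 les cx cy ex0 ey0.
have c1 : X ^+ 2 <= ex * L1 by apply: le_trans cx _; exact: ler_wpM2l.
have c2 : Y ^+ 2 <= ey * L1 by apply: le_trans cy _; exact: ler_wpM2l.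
have c3 : 2 * (Y * X) <= X ^+ 2 + Y ^+ 2 by exact: amgm. 
have hh : 0 < h ^+ 2 by exact: exprn_gt0.
(* The 8 is 16 from [(h / 4) ^+ 2], halved by [Y * X <= (X ^+ 2 + Y ^+ 2) / 2]. *)
have -> : 8 / h ^+ 2 * (ex + ey) * L1 = (ex * L1 + ey * L1) / 2 / (h / 4) ^+ 2.
  by field; rewrite gt_eqF.
rewrite ler_pdivlMr; last exact: exprn_gt0.
by rewrite mulrC; exact: fin le1 c3 c1 c2.
Qed.

(** Closed below and open above, so that it is disjoint from the shell that follows it and the sum
    over successive shells telescopes. *)
Definition band (r l z : R) : R := if r <= `|z| < l then 1 else 0.

Lemma band_shell r h c z : r <= c -> 0 < h -> band r c z + shell c h z <= band r (c + h) z.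
Proof.
move=> rc h0; rewrite /band /shell.
case: ifPn => [/andP[a b]|]; case: ifPn => [/andP[a' b']|]; try lra.
- by move=> _; rewrite addr0 ifT//; apply/andP; split; lra.
- by move=> _; rewrite add0r ifT//; apply/andP; split; lra.
- by move=> _ _; rewrite addr0; case: ifP.
Qed.

Lemma band_ge0 r l z : 0 <= band r l z. Proof. by rewrite /band; case: ifP. Qed.
Lemma band_le1 r l z : band r l z <= 1. Proof. by rewrite /band; case: ifP. Qed.

Lemma measurable_bandf r l f : measurable_fun setT f -> measurable_fun setT (fun x => band r l (f x)).
Proof.
move=> mf; have mn : measurable_fun setT (fun x => `|f x|) by exact: measurableT_comp.
apply: measurable_fun_ifT => //; apply: measurable_and; first exact: measurable_fun_ler.
exact: measurable_fun_ltr.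
Qed.

Section one_strip.
Variables (f fx fy U V : R * R -> R).
Hypothesis S : strip f fx fy U V.

Let mf := strip_mf S.
Let mQ : measurable Q := measurable_Q measurableT.

Definition dens (x : R * R) : R := fx x ^+ 2 + fy x ^+ 2.

Lemma dens_ge0 x : 0 <= dens x. Proof. by rewrite addr_ge0 ?sqr_ge0. Qed.

Lemma dens_integrable : mu2.-integrable Q (EFin \o dens).
Proof. by apply: integrableDR => //; [exact: strip_x2 S|exact: strip_y2 S]. Qed.

Lemma dens_mul (k : R * R -> R) : measurable_fun setT k -> (forall x, 0 <= k x <= 1) ->
  mu2.-integrable Q (EFin \o (fun x => dens x * k x)).
Proof.
move=> mk hk; apply: (@integrable_bounded_mul _ _ _ mu2 Q dens k 1) => //.
- exact: measurable_funTS.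
- by move=> x _; rewrite ger0_norm; case/andP: (hk x).
- exact: dens_integrable.
Qed.

Lemma sum_shells r h N : 0 < h ->
  \sum_(k < N) \int[mu2]_(x in Q) (dens x * shell (r + k%:R * h) h (f x)) <=
  \int[mu2]_(x in Q) (dens x * level r f x).
Proof.
move=> h0.
have ib l : mu2.-integrable Q (EFin \o (fun x => dens x * band r l (f x))).
  by apply: dens_mul; [exact: measurable_bandf|move=> x; rewrite band_ge0 band_le1].
have is_ c : mu2.-integrable Q (EFin \o (fun x => dens x * shell c h (f x))).
  by apply: dens_mul; [exact: measurable_shellf|move=> x; rewrite shell_ge0 shell_le1].
apply: (@le_trans _ _ (\int[mu2]_(x in Q) (dens x * band r (r + N%:R * h) (f x)))); last first.
  apply: le_Rintegral => //.
    by apply: dens_mul; [exact: measurable_level|move=> x; rewrite level_ge0 level_le1].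
  move=> x _; apply: ler_wpM2l; first exact: dens_ge0.
  by rewrite /band /level; case: ifPn => [/andP[-> _]//|_]; case: ifP.
elim: N => [|N IH]; first by rewrite big_ord0; apply: Rintegral_ge0f => x; rewrite mulr_ge0 ?dens_ge0 ?band_ge0.
rewrite big_ord_recr/=; apply: le_trans (lerD IH (lexx _)) _.
rewrite -RintegralD//; apply: le_Rintegral => //.
  by apply: integrableDR.
move=> x _; rewrite -mulrDr; apply: ler_wpM2l; first exact: dens_ge0.
rewrite (_ : r + N.+1%:R * h = r + N%:R * h + h); last by rewrite -natr1; ring.
by apply: band_shell => //; rewrite lerDl mulr_ge0// ltW.
Qed.

Lemma tail_energy (e : R) : 0 < e ->
  exists K, forall r, K <= r -> \int[mu2]_(x in Q) (dens x * level r f x) <= e.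
Proof.
move=> e0.
have il r : mu2.-integrable Q (EFin \o (fun x => dens x * level r f x)).
  by apply: dens_mul; [exact: measurable_level|move=> x; rewrite level_ge0 level_le1].
have md : measurable_fun setT dens.
  by apply: measurable_funD; apply: measurable_funX; [exact: strip_mx S|exact: strip_my S].
have c0 x : Q x -> dens x * level n%:R f x @[n --> \oo] --> (0 : R).
  move=> _; apply: cvg_near_cst; exists (Num.truncn `|f x|).+1 => // n /= hn.
  rewrite /level ifF ?mulr0//; apply/negbTE; rewrite -ltNge.
  have := truncnS_gt `|f x|; have : (Num.truncn `|f x|).+1%:R <= n%:R :> R by rewrite ler_nat.
  by move=> h1 h2; exact: lt_le_trans h2 h1.
have b0 n x : Q x -> `|dens x * level n%:R f x| <= dens x.
  by move=> _; rewrite ger0_norm ?mulr_ge0 ?dens_ge0 ?level_ge0// ler_piMr ?dens_ge0 ?level_le1.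
have mn n : measurable_fun Q (fun x => dens x * level n%:R f x).
  by apply: measurable_funTS; apply: measurable_funM => //; exact: measurable_level.
have [_] := @Rdominated_cvg _ _ _ mu2 Q (fun n x => dens x * level n%:R f x) (fun=> 0) dens mQ
  mn (measurable_cst _) c0 dens_integrable b0.
rewrite (_ : \int[mu2]_(x in Q) (0 : R) = 0); last by rewrite /Rintegral integral0.
move=> /cvgrPdist_le/(_ _ e0)[n _ /(_ _ (leqnn n))] /=; rewrite sub0r normrN => hn.
exists n%:R => r nr; apply: le_trans (le_trans _ (ler_norm _)) hn.
apply: le_Rintegral => // x _; apply: ler_wpM2l; first exact: dens_ge0.
by rewrite /level; case: ifPn => [h|_]; [rewrite (le_trans nr h)|case: ifP].
Qed.

Lemma level_iter (m p K r h : R) N : tends f m p ->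
  {ae mu, forall t, `|mean f t| <= K} -> K + 1 <= r -> `|p| + 1 <= r -> 0 < h ->
  \int[mu2]_(x in Q) level (r + N%:R * h) f x <=
  (\prod_(k < N) (8 / h ^+ 2 * \int[mu2]_(x in Q) (dens x * shell (r + k%:R * h) h (f x)))) *
  \int[mu2]_(x in Q) level r f x.
Proof.
move=> tf hK Kr pr h0; elim: N => [|N IH]; first by rewrite big_ord0 mul0r addr0 mul1r.
have ge c : 0 <= 8 / h ^+ 2 * \int[mu2]_(x in Q) (dens x * shell c h (f x)).
  apply: mulr_ge0; first by rewrite divr_ge0 ?sqr_ge0.
  by apply: Rintegral_ge0f => x; rewrite mulr_ge0 ?dens_ge0 ?shell_ge0.
have Nh : 0 <= N%:R * h by rewrite mulr_ge0// ltW.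
have := level_step (r := r + N%:R * h) S tf hK (le_trans Kr _) (le_trans pr _) h0.
rewrite lerDl => /(_ Nh Nh).
rewrite (_ : r + N.+1%:R * h = r + N%:R * h + h); last by rewrite -natr1; ring.
move=> H; apply: le_trans H (le_trans (ler_wpM2l (ge _) IH) _).
by rewrite big_ord_recr/= le_eqVlt; apply/orP; left; apply/eqP; ring.
Qed.

(* Iterate [level_step] over N shells of width sqrt(kap / N).  The energies in the shells have a
   small sum, so by AM-GM the product of the N factors is at most exp(- N). *)
Lemma tail_measure (m p kap : R) : tends f m p -> 0 < kap ->
  exists K A, [/\ 0 <= K, 0 <= A, (forall r, K <= r -> mu2.-integrable Q (EFin \o level r f)) &
    forall N, (0 < N)%N ->
    \int[mu2]_(x in Q) level (K + Num.sqrt (kap * N%:R)) f x <= A * expR (- N%:R)].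
Proof.
move=> tf kap0; have [K0 hK0] := mean_bounded S tf.
(* With [h ^+ 2 = kap / N], this makes the mean of the [N] factors, [8 / h ^+ 2 * th / N], equal to
   [expR (-1)]. *)
pose th := kap / 8 * expR (-1).
have th0 : 0 < th by rewrite mulr_gt0 ?divr_gt0 ?expR_gt0.
have [K1 hK1] := tail_energy th0.
(* [K0 + 1] and [|p| + 1] are the thresholds of [level_step]; above [K1] the remaining energy is at
   most [th]. *)
pose K := Num.max (Num.max (K0 + 1) (`|p| + 1)) (Num.max K1 0).
have [k1 k2 k3 k4] : [/\ K0 + 1 <= K, `|p| + 1 <= K, K1 <= K & 0 <= K].
  by split; rewrite /K !le_max lexx ?orbT.
exists K, (\int[mu2]_(x in Q) level K f x); split => //.
- by apply: Rintegral_ge0f => x; exact: level_ge0.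
- by move=> r Kr; apply: (level_integrable S hK0); exact: le_trans Kr.
move=> N N0; have N0' : 0 < N%:R :> R by rewrite ltr0n.
pose L := Num.sqrt (kap * N%:R).
have L0 : 0 < L by rewrite sqrtr_gt0 mulr_gt0.
have L2 : L ^+ 2 = kap * N%:R by rewrite sqr_sqrtr// mulr_ge0// ltW.
pose h := L / N%:R; have h0 : 0 < h by rewrite divr_gt0.
have := @level_iter m p K0 K h N tf hK0 k1 k2 h0.
have -> : K + N%:R * h = K + L by rewrite /h; congr (_ + _); field; rewrite gt_eqF.
move=> H; apply: le_trans H _; rewrite mulrC; apply: ler_wpM2l.
  by apply: Rintegral_ge0f => x; exact: level_ge0.
pose e (k : 'I_N) := \int[mu2]_(x in Q) (dens x * shell (K + k%:R * h) h (f x)).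
have e0 k : 0 <= e k by apply: Rintegral_ge0f => x; rewrite mulr_ge0 ?dens_ge0 ?shell_ge0.
have he : 0 <= 8 / h ^+ 2 by rewrite divr_ge0 ?sqr_ge0.
have := (leif_AGM (A := predT) (E := fun k : 'I_N => 8 / h ^+ 2 * e k) (fun k _ => mulr_ge0 he (e0 k))).1.
rewrite card_ord => AG; apply: le_trans AG _.
have -> : - N%:R = (-1) * N%:R :> R by rewrite mulN1r.
rewrite expRM_natr; apply: lerXn2r; rewrite ?nnegrE.
- by apply: divr_ge0 => //; apply: sumr_ge0 => k _; exact: mulr_ge0.
- exact: expR_ge0.
rewrite -mulr_sumr ler_pdivrMr//.
have sE : \sum_(i in 'I_N) e i <= th.
  apply: le_trans (hK1 K k3); have := sum_shells K N h0; apply: le_trans.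
  by rewrite le_eqVlt; apply/orP; left; apply/eqP; apply: eq_bigl.
apply: le_trans (ler_wpM2l he sE) _.
have -> : h ^+ 2 = kap / N%:R.
  by rewrite /h exprMn L2; field; rewrite gt_eqF.
by rewrite /th le_eqVlt; apply/orP; left; apply/eqP; field; rewrite !gt_eqF.
Qed.

End one_strip.

Lemma good_mean_V f fx fy U V t : strip f fx fy U V -> good f fy U V t ->
  mean f t = \int[mu]_(y in I) V (t, y) /\ mu.-integrable I (EFin \o (fun y => V (t, y))).
Proof.
move=> S [pV fV _ _ _]; split; last by apply: continuous_itv_integrable; exact: prim_continuous pV.
rewrite /mean; apply: Rintegral_ae_eqm.
- exact: measurable_itv.
- apply: measurable_funTS; apply: measurable_slice2; exact: strip_mf S.
- apply: measurable_funTS; apply: measurable_slice2; exact: strip_mV S.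
- by apply: aeS fV => z ->.
Qed.

Lemma tendsD f fx fy U V g gx gy U' V' (mf pf mg pg : R) :
  strip f fx fy U V -> strip g gx gy U' V' -> tends f mf pf -> tends g mg pg ->
  tends (fun x => f x + g x) (mf + mg) (pf + pg).
Proof.
move=> S S' [ub [e1 p1 m1]] [vb [e2 p2 m2]].
exists (fun t => ub t + vb t); split; [|exact: cvgD|exact: cvgD].
have g1 := strip_good S; have g2 := strip_good S'; have g3 := strip_good (stripD S S').
apply: aeS (ae_and (ae_and e1 e2) (ae_and g1 (ae_and g2 g3))) => t [[-> ->] [k1 [k2 k3]]].
have [-> i1] := good_mean_V S k1; have [-> i2] := good_mean_V S' k2.
by have [-> _] := good_mean_V (stripD S S') k3; rewrite RintegralD.
Qed.

Lemma tendsB f fx fy U V g gx gy U' V' (mf pf mg pg : R) :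
  strip f fx fy U V -> strip g gx gy U' V' -> tends f mf pf -> tends g mg pg ->
  tends (fun x => f x - g x) (mf - mg) (pf - pg).
Proof.
move=> S S' [ub [e1 p1 m1]] [vb [e2 p2 m2]].
exists (fun t => ub t - vb t); split; [|exact: cvgB|exact: cvgB].
have g1 := strip_good S; have g2 := strip_good S'; have g3 := strip_good (stripB S S').
apply: aeS (ae_and (ae_and e1 e2) (ae_and g1 (ae_and g2 g3))) => t [[-> ->] [k1 [k2 k3]]].
have [-> i1] := good_mean_V S k1; have [-> i2] := good_mean_V S' k2.
by have [-> _] := good_mean_V (stripB S S') k3; rewrite RintegralB.
Qed.

Lemma sqrt_large (kap B : R) (N : nat) : 0 < kap -> (Num.truncn (B ^+ 2 / kap) < N)%N ->
  `|B| < Num.sqrt (kap * N%:R).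
Proof.
move=> k0 hN; rewrite -sqrtr_sqr ltr_sqrt; last first.
  by rewrite mulr_gt0// ltr0n; exact: leq_ltn_trans hN.
rewrite -ltr_pdivrMl// mulrC; have := truncnS_gt (B ^+ 2 / kap) => h.
by apply: lt_le_trans h _; rewrite ler_nat.
Qed.

Lemma level_mono r r' f x : r <= r' -> level r' f x <= level r f x.
Proof.
by move=> h; rewrite /level; case: ifPn => [h'|_]; [rewrite (le_trans h h')|case: ifP].
Qed.

Section growth.
Variable w : R * R -> R.
Hypothesis C2w : C2 w.
Hypothesis wave : forall x, 'D_(@e1 R) ('D_(@e1 R) w) x = 'D_(@e2 R) ('D_(@e2 R) w) x.
Variables (C beta : R).
Hypothesis beta0 : 0 < beta.
Hypothesis growth : forall z, `|w z| <= C * expR (beta * sq2 z).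

(** If [p] and [q] are the clamped sum and difference of the coordinates, the point at which [w] is
    evaluated has squared norm [(p ^+ 2 + q ^+ 2) / 2 <= M ^+ 2]. *)
Lemma wtrunc_le M z : 0 <= M -> `|wtrunc w M z| <= C * expR (beta * M ^+ 2).
Proof.
move=> M0; rewrite wtruncE//.
have C0 : 0 <= C.
  have := le_trans (normr_ge0 _) (growth (0, 0)).
  by rewrite pmulr_lge0// expR_gt0.
apply: le_trans (growth _) _; apply: ler_wpM2l => //; rewrite ler_expR; apply: ler_wpM2l; first exact: ltW.
have := clamp_norm (z.1 + z.2) M0; have := clamp_norm (z.1 - z.2) M0.
rewrite /sq2/=; move: (clamp M _) (clamp M _) => p q hp hq.
have sq (c : R) : `|c| <= M -> c ^+ 2 <= M ^+ 2.
  by move=> h; rewrite -[c ^+ 2]real_normK ?num_real// lerXn2r ?nnegrE.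
have := sq _ hp; have := sq _ hq => h1 h2.
rewrite (_ : _ + _ = (p ^+ 2 + q ^+ 2) / 2); last by field.
lra.
Qed.

Lemma expR_decay (B e : R) : 0 <= B -> 0 < e -> forall N : nat, 2 * B / e < N%:R ->
  B * expR (- (N%:R / 2)) <= e.
Proof.
move=> B0 e0 N hN.
have N0 : 0 < N%:R :> R by apply: le_lt_trans hN; rewrite divr_ge0 ?mulr_ge0// ltW.
rewrite expRN ler_pdivrMr ?expR_gt0//.
have h1 : 1 + N%:R / 2 <= expR (N%:R / 2) :> R by exact: expR_ge1Dx.
apply: le_trans (ler_wpM2l (ltW e0) h1).
move: hN; rewrite ltr_pdivrMr//; nra.
Qed.

(** The truncation acts only where [|f + g|] or [|f - g|] reaches the level [M N]. There the part
    due to [w] tends to zero by dominated convergence, [w (f, g)] being square integrable, and the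
    truncated part is at most a constant times [expR (N / 2)] in square, against a measure of order
    [expR (- N)]. *)
Lemma tail_small_growth f fx fy U V g gx gy U' V' (mf pf mg pg : R) :
  strip f fx fy U V -> strip g gx gy U' V' -> tends f mf pf -> tends g mg pg ->
  mu2.-integrable Q (EFin \o (fun x => w (f x, g x) ^+ 2)) -> tail_small w f g.
Proof.
move=> S S' tf tg iw e M0 e0.
have e2 : 0 < e / 2 by lra.
have mQ : measurable Q := measurable_Q measurableT.
pose P x := f x + g x; pose D x := f x - g x.
(* As [M N ^+ 2 <= 2 * K ^+ 2 + 2 * kap * N], the squared growth bound has exponent at most
   [4 * beta * K ^+ 2 + 4 * beta * kap * N]; this [kap] turns the last term into [N / 2], half of
   the decay rate. *)
have kap0 : 0 < (8 * beta)^-1 by rewrite invr_gt0 mulr_gt0.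
set kap := (8 * beta)^-1 in kap0.
have [K1 [A1 [K10 A10 i1 h1]]] := tail_measure (stripD S S') (tendsD S S' tf tg) kap0.
have [K2 [A2 [K20 A20 i2 h2]]] := tail_measure (stripB S S') (tendsB S S' tf tg) kap0.
have mP : measurable_fun setT P by exact: strip_mf (stripD S S').
have mD : measurable_fun setT D by exact: strip_mf (stripB S S').
pose K := Num.max K1 K2.
have [K1K K2K] : K1 <= K /\ K2 <= K by rewrite /K !le_max !lexx orbT.
have K0 : 0 <= K by exact: le_trans K1K.
pose M N := K + Num.sqrt (kap * N%:R).
have s0 N : 0 <= Num.sqrt (kap * N%:R) by exact: sqrtr_ge0.
have M0' N : 0 <= M N by exact: addr_ge0.
pose bad N x := level (M N) P x + level (M N) D x.
have mbad N : measurable_fun setT (bad N) by apply: measurable_funD; exact: measurable_level.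
have bad0 N x : 0 <= bad N x by rewrite addr_ge0 ?level_ge0.
have bad2 N x : bad N x <= 2 by have := level_le1 (M N) P x; have := level_le1 (M N) D x; rewrite /bad; lra.
have ibad N : (0 < N)%N -> mu2.-integrable Q (EFin \o bad N) /\
    \int[mu2]_(x in Q) bad N x <= (A1 + A2) * expR (- N%:R).
  move=> N0.
  have j1 : mu2.-integrable Q (EFin \o level (M N) P).
    by apply: i1; rewrite /M; have := s0 N; clear -K1K C2w wave beta0 growth; lra.
  have j2 : mu2.-integrable Q (EFin \o level (M N) D).
    by apply: i2; rewrite /M; have := s0 N; clear -K2K C2w wave beta0 growth; lra.
  split; first exact: integrableDR.
  rewrite RintegralD// mulrDl; apply: lerD.
  - apply: le_trans (h1 N N0); apply: le_Rintegral => //; first by apply: i1; rewrite lerDl.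
    by move=> x _; apply: level_mono; rewrite lerD2r.
  - apply: le_trans (h2 N N0); apply: le_Rintegral => //; first by apply: i2; rewrite lerDl.
    by move=> x _; apply: level_mono; rewrite lerD2r.
have mw : measurable_fun setT (fun x => w (f x, g x)).
  by apply: measurable_pair_comp; [exact: C2_continuous|exact: strip_mf S|exact: strip_mf S'].
have mw2 : measurable_fun setT (fun x => w (f x, g x) ^+ 2) by exact: measurable_funX.
have iwb N : mu2.-integrable Q (EFin \o (fun x => w (f x, g x) ^+ 2 * bad N x)).
  apply: (@integrable_bounded_mul _ _ _ mu2 Q _ (bad N) 2) => //; first exact: measurable_funTS (mbad N).
  by move=> x _; rewrite ger0_norm.
have cw0 x : Q x -> w (f x, g x) ^+ 2 * bad N x @[N --> \oo] --> (0 : R).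
  move=> _; apply: cvg_near_cst.
  exists (maxn (Num.truncn (P x ^+ 2 / kap)) (Num.truncn (D x ^+ 2 / kap))).+1 => // N /=.
  rewrite gtn_max => /andP[n1 n2].
  have b1 := sqrt_large kap0 n1; have b2 := sqrt_large kap0 n2.
  by rewrite /bad /level !ifF ?addr0 ?mulr0//; apply/negbTE; rewrite -ltNge /M; clear -b1 b2 K0 C2w wave beta0 growth; lra.
have bw0 N x : Q x -> `|w (f x, g x) ^+ 2 * bad N x| <= 2 * w (f x, g x) ^+ 2.
  move=> _; rewrite mulrC ger0_norm; first by apply: ler_wpM2r => //; exact: sqr_ge0.
  by apply: mulr_ge0 => //; exact: sqr_ge0.
have [_] := @Rdominated_cvg _ _ _ mu2 Q (fun N x => w (f x, g x) ^+ 2 * bad N x) (fun=> 0)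
  (fun x => 2 * w (f x, g x) ^+ 2) mQ (fun N => measurable_funTS (measurable_funM mw2 (mbad N)))
  (measurable_cst _) cw0 (@integrableZR _ _ _ mu2 _ mQ 2 _ iw) bw0.
rewrite (_ : \int[mu2]_(x in Q) (0 : R) = 0); last by rewrite /Rintegral integral0.
have e4 : 0 < e / 4 by lra.
move=> /cvgrPdist_le/(_ _ e4)[n1 _ hn1].
pose B := 2 * C ^+ 2 * expR (4 * beta * K ^+ 2) * (A1 + A2).
have A120 : 0 <= A1 + A2 by exact: addr_ge0.
have B0 : 0 <= B.
  rewrite /B; apply: mulr_ge0 => //; apply: mulr_ge0; last exact: expR_ge0.
  by apply: mulr_ge0 => //; exact: sqr_ge0.
pose N := (maxn n1 (maxn (Num.truncn (2 * B / (e / 2))) (Num.truncn (M0 ^+ 2 / kap)))).+1.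
have N0 : (0 < N)%N by [].
have Nn1 : (n1 <= N)%N by rewrite ltnW// ltnS leq_maxl.
have NB : 2 * B / (e / 2) < N%:R.
  apply: lt_le_trans (truncnS_gt _) _; rewrite ler_nat ltnS.
  by rewrite !leq_max leqnn orbT.
have NM : M0 <= M N.
  apply: le_trans (ler_norm _) _; apply: (@le_trans _ _ (Num.sqrt (kap * N%:R))); last by rewrite lerDr.
  by apply/ltW/sqrt_large => //; rewrite ltnS !leq_max leqnn !orbT.
have [jb lb] := ibad N N0.
have wtl x : `|wtrunc w (M N) (f x, g x)| <= C * expR (beta * M N ^+ 2) by apply: wtrunc_le.
set cM := C * expR (beta * M N ^+ 2) in wtl.
have dom x : (w (f x, g x) - wtrunc w (M N) (f x, g x)) ^+ 2 <=
    2 * (w (f x, g x) ^+ 2 * bad N x) + 2 * cM ^+ 2 * bad N x.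
  have big : 1 <= bad N x -> (w (f x, g x) - wtrunc w (M N) (f x, g x)) ^+ 2 <=
      2 * (w (f x, g x) ^+ 2 * bad N x) + 2 * cM ^+ 2 * bad N x.
    move=> b1; have sq2c : wtrunc w (M N) (f x, g x) ^+ 2 <= cM ^+ 2.
      rewrite -[wtrunc _ _ _ ^+ 2]real_normK ?num_real// lerXn2r ?nnegrE//.
      exact: le_trans (wtl x).
    have := sqr_ge0 (w (f x, g x) + wtrunc w (M N) (f x, g x)) => h3.
    have h4 : (w (f x, g x) - wtrunc w (M N) (f x, g x)) ^+ 2 <=
      (2 * w (f x, g x) ^+ 2 + 2 * cM ^+ 2) * 1 by move: h3 sq2c; rewrite !expr2; clear -C2w wave beta0 growth; lra.
    apply: le_trans h4 _; rewrite mulrA -mulrDl; apply: ler_wpM2l => //.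
    by rewrite addr_ge0// mulr_ge0// sqr_ge0.
  have [p1|p1] := leP (M N) `|P x|.
    by apply: big; rewrite /bad {1}/level p1 lerDl level_ge0.
  have [d1|d1] := leP (M N) `|D x|.
    by apply: big; rewrite /bad {2}/level d1 lerDr level_ge0.
  rewrite wtrunc_id ?subrr ?expr0n/=; [|exact: C2w|exact: wave|exact: ltW|exact: ltW].
  by apply: addr_ge0; apply: mulr_ge0 => //; apply: mulr_ge0 => //; exact: sqr_ge0.
have mt := measurable_wtrunc C2w (M N) (strip_mf S) (strip_mf S').
have idom : mu2.-integrable Q (EFin \o (fun x => 2 * (w (f x, g x) ^+ 2 * bad N x) + 2 * cM ^+ 2 * bad N x)).
  by apply: integrableDR => //; exact: integrableZR.
have iD : mu2.-integrable Q (EFin \o (fun x => (w (f x, g x) - wtrunc w (M N) (f x, g x)) ^+ 2)).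
  apply: (@le_integrableR _ _ _ mu2 Q _ _ mQ _ _ idom).
    by apply: measurable_funTS; apply: measurable_funX; exact: measurable_funB.
  by move=> x _; rewrite ger0_norm ?sqr_ge0//; apply: le_trans (dom x) (ler_norm _).
exists (M N); split => //.
apply: le_trans (@le_Rintegral _ _ _ mu2 Q _ _ mQ iD idom (fun x _ => dom x)) _.
rewrite RintegralD//; [|exact: integrableZR|exact: integrableZR].
rewrite !RintegralZl//.
have b1 := hn1 N Nn1; rewrite sub0r normrN in b1.
have {}b1 := le_trans (ler_norm _) b1.
have sqM : M N ^+ 2 <= 2 * K ^+ 2 + 2 * kap * N%:R.
  have := sqr_ge0 (K - Num.sqrt (kap * N%:R)); rewrite sqrrB /M sqrrD sqr_sqrtr; first by clear -C2w wave beta0 growth; lra.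
  by rewrite mulr_ge0// ltW.
have cM2 : cM ^+ 2 <= C ^+ 2 * (expR (4 * beta * K ^+ 2) * expR (N%:R / 2)).
  rewrite /cM exprMn -expRM_natl -expRD; apply: ler_wpM2l; first exact: sqr_ge0.
  rewrite ler_expR.
  have kb : kap * (8 * beta) = 1 by rewrite /kap mulVf// gt_eqF// mulr_gt0.
  have := ler_wpM2l (ltW beta0) sqM.
  have -> : beta * (2 * K ^+ 2 + 2 * kap * N%:R) = 2 * beta * K ^+ 2 + kap * (8 * beta) * N%:R / 4 by field.
  by rewrite kb; clear -C2w wave beta0 growth; lra.
have last : 2 * cM ^+ 2 * \int[mu2]_(x in Q) bad N x <= e / 2.
  apply: le_trans (expR_decay B0 e2 NB).
  have c0 : 0 <= 2 * cM ^+ 2 by apply: mulr_ge0 => //; exact: sqr_ge0.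
  apply: le_trans (ler_wpM2l c0 lb) _.
  have a0 : 0 <= 2 * ((A1 + A2) * expR (- N%:R)).
    by apply: mulr_ge0 => //; apply: mulr_ge0 => //; exact: expR_ge0.
  have := ler_wpM2l a0 cM2.
  have -> : expR (- N%:R) = expR (- (N%:R / 2)) * expR (- (N%:R / 2)) :> R.
    by rewrite -expRD; congr expR; field.
  have en : expR (N%:R / 2) * expR (- (N%:R / 2)) = 1 :> R by rewrite -expRD subrr expR0.
  move=> h3; apply: le_trans (le_trans _ h3) _; first by rewrite le_eqVlt; apply/orP; left; apply/eqP; ring.
  rewrite le_eqVlt; apply/orP; left; apply/eqP.
  move: en; rewrite /B; move: (expR (N%:R / 2)) (expR (- (N%:R / 2))) (expR (4 * _ * _)) => E1 E2 E3 en.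
  transitivity (2 * C ^+ 2 * E3 * (A1 + A2) * E2 * (E1 * E2)); first by ring.
  by rewrite en mulr1.
by move: b1 last; set a := Rintegral _ _ _; set b := _ * Rintegral _ _ _; clear -C2w wave beta0 growth; lra.
Qed.

End growth.

End tail.

(** * From the statement to the strip *)

Section bridge.
Context {R : realType}.
Notation mu := (@lebesgue_measure R).
Notation mu2 := (@mu2 R).
Notation I := (`[0%R, 1%R]%classic : set R).
Notation Q := (setT `*` I : set (R * R)).
Implicit Types f g : R * R -> R.

Lemma strip_of_weak f fx fy : (forall x, f (tau 1 x) = f x) -> L1loc2 (fun x => f x ^+ 2) ->
  weak_partial2 (@e1 R) f fx -> weak_partial2 (@e2 R) f fy ->
  mu2.-integrable Q (EFin \o (fun x => fx x ^+ 2)) ->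
  mu2.-integrable Q (EFin \o (fun x => fy x ^+ 2)) ->
  exists U V, strip f fx fy U V.
Proof.
move=> per L2 w1 w2 i1 i2.
have [U [mU fU pU]] := weak_line1 (weak_tensor1_of w1).
have [V [mV fV pV]] := weak_line2 w2.
have [Lf [Lx _]] := w1; have [_ [Ly _]] := w2.
exists U, V; split => //.
- exact: measurable_L1loc2.
- exact: periodic_partial1 w1 per.
- exact: periodic_partial2 w2 per.
Qed.

Lemma integrable_cell_le f (F : R * R -> R) : measurable_fun setT f -> measurable_fun setT F ->
  (forall x, 0 <= f x <= F x) -> (\int[mu2]_(x in @cell R) (F x)%:E < +oo)%E ->
  mu2.-integrable Q (EFin \o f).
Proof.
move=> mf mF h; have mF' : measurable_fun setT (fun x => (F x)%:E) by exact/measurable_EFinP.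
rewrite integral_cell// => fin.
apply/integrableP; split; first by apply: measurable_funTS; exact/measurable_EFinP.
apply: le_lt_trans fin; apply: ge0_le_integral => //.
- exact: measurable_Q.
- by apply: measurable_funTS; apply: measurableT_comp => //; exact/measurable_EFinP.
- exact: measurable_funTS.
- by move=> x _; rewrite lee_fin; case/andP: (h x) => h0 h1; rewrite ger0_norm.
Qed.

Lemma sq2_ge0 (p : R * R) : 0 <= sq2 p. Proof. by rewrite addr_ge0 ?sqr_ge0. Qed.

Lemma measurable_sq2 (v : R * R -> R * R) : measurable_fun setT (fun x => (v x).1) ->
  measurable_fun setT (fun x => (v x).2) -> measurable_fun setT (fun x => sq2 (v x)).
Proof. by move=> m1 m2; apply: measurable_funD; exact: measurable_funX. Qed.

Lemma Hdiv_measurable (u du1 du2 : R * R -> R * R) : Hdiv u du1 du2 ->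
  [/\ measurable_fun setT (fun x => (u x).1), measurable_fun setT (fun x => (u x).2),
   measurable_fun setT (fun x => sq2 (du1 x)) & measurable_fun setT (fun x => sq2 (du2 x))].
Proof.
move=> [_ [_ [_ [[a1 [a2 _]] [[b1 [b2 _]] [[_ [c2 _]] [[_ [d2 _]] _]]]]]]].
by split; try exact: measurable_L1loc2; apply: measurable_sq2; exact: measurable_L1loc2.
Qed.

Lemma Hdiv_strips (u du1 du2 : R * R -> R * R) : Hdiv u du1 du2 ->
  exists U V U' V', strip (fun x => (u x).1) (fun x => (du1 x).1) (fun x => (du2 x).1) U V /\
    strip (fun x => (u x).2) (fun x => (du1 x).2) (fun x => (du2 x).2) U' V'.
Proof.
move=> H; have [mu1 mu2' ms1 ms2] := Hdiv_measurable H.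
have [per [L1 [L2 [w1 [w2 [w3 [w4 [fin _]]]]]]]] := H.
have per' x : u (tau 1 x) = u x by case: x => a b; exact: per.
have mm (v : R * R) (k l : R * R -> R) : weak_partial2 v k l -> measurable_fun setT l.
  by move=> [_ [L _]]; exact: measurable_L1loc2.
have iQ (l : R * R -> R) : measurable_fun setT l -> (forall x, l x ^+ 2 <= sq2 (du1 x) + sq2 (du2 x)) ->
    mu2.-integrable Q (EFin \o (fun x => l x ^+ 2)).
  move=> ml hl; apply: (@integrable_cell_le _ (fun x => sq2 (du1 x) + sq2 (du2 x))) => //.
  - exact: measurable_funX.
  - exact: measurable_funD.
  - by move=> x; rewrite sqr_ge0 hl.
have s0 (p : R * R) : [/\ p.1 ^+ 2 <= sq2 p, p.2 ^+ 2 <= sq2 p & 0 <= sq2 p].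
  by split; rewrite /sq2; [rewrite lerDl sqr_ge0|rewrite lerDr sqr_ge0|rewrite addr_ge0 ?sqr_ge0].
have [U [V S]] : exists U V, strip (fun x => (u x).1) (fun x => (du1 x).1) (fun x => (du2 x).1) U V.
  apply: strip_of_weak => //; first by move=> x; rewrite per'.
  - by apply: iQ => [|x]; [exact: mm w1|have [a b c] := s0 (du1 x); have [a' b' c'] := s0 (du2 x); lra].
  - by apply: iQ => [|x]; [exact: mm w3|have [a b c] := s0 (du1 x); have [a' b' c'] := s0 (du2 x); lra].
have [U' [V' S']] : exists U V, strip (fun x => (u x).2) (fun x => (du1 x).2) (fun x => (du2 x).2) U V.
  apply: strip_of_weak => //; first by move=> x; rewrite per'.
  - by apply: iQ => [|x]; [exact: mm w2|have [a b c] := s0 (du1 x); have [a' b' c'] := s0 (du2 x); lra].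
  - by apply: iQ => [|x]; [exact: mm w4|have [a b c] := s0 (du1 x); have [a' b' c'] := s0 (du2 x); lra].
by exists U, V, U', V'.
Qed.

Lemma bc_tends (u : R * R -> R * R) (um up : R * R) : bc u um up ->
  tends (fun x => (u x).1) um.1 up.1 /\ tends (fun x => (u x).2) um.2 up.2.
Proof.
move=> [ub [e [p m]]]; split.
- exists (fun t => (ub t).1); split.
  + by apply: aeS e => t ->.
  + by apply: (cvg_comp _ _ p); exact: cvg_fst.
  + by apply: (cvg_comp _ _ m); exact: cvg_fst.
- exists (fun t => (ub t).2); split.
  + by apply: aeS e => t ->.
  + by apply: (cvg_comp _ _ p); exact: cvg_snd.
  + by apply: (cvg_comp _ _ m); exact: cvg_snd.
Qed.

Lemma energy_real (W : R * R -> R) (u du1 du2 : R * R -> R * R) : continuous W -> (forall z, 0 <= W z) ->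
  Hdiv u du1 du2 -> (energy W u du1 du2 < +oo)%E ->
  mu2.-integrable Q (EFin \o (fun x => W ((u x).1, (u x).2))) /\
  energy W u du1 du2 = (2^-1 * \int[mu2]_(x in Q) ((du1 x).1 ^+ 2 + (du2 x).1 ^+ 2 +
    ((du1 x).2 ^+ 2 + (du2 x).2 ^+ 2)) + \int[mu2]_(x in Q) W ((u x).1, (u x).2))%:E.
Proof.
move=> cW W0 H fin; have [mu1 mu2' ms1 ms2] := Hdiv_measurable H.
have [U [V [U' [V' [S S']]]]] := Hdiv_strips H.
have mQ : measurable Q := measurable_Q measurableT.
have mW : measurable_fun setT (fun x => W ((u x).1, (u x).2)) by exact: measurable_pair_comp.
have eu x : W (u x) = W ((u x).1, (u x).2) by rewrite -surjective_pairing.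
have mF : measurable_fun setT (fun x => (sq2 (du1 x) + sq2 (du2 x)) / 2 + W ((u x).1, (u x).2)).
  by apply: measurable_funD => //; apply: measurable_funM => //; exact: measurable_funD.
have eE : energy W u du1 du2 = (\int[mu2]_(x in @cell R) ((sq2 (du1 x) + sq2 (du2 x)) / 2 + W ((u x).1, (u x).2))%:E)%E.
  by apply: eq_integral => x _; rewrite eu.
have iW : mu2.-integrable Q (EFin \o (fun x => W ((u x).1, (u x).2))).
  apply: (@integrable_cell_le _ (fun x => (sq2 (du1 x) + sq2 (du2 x)) / 2 + W ((u x).1, (u x).2))) => //.
  - by move=> x; rewrite W0 lerDr divr_ge0// addr_ge0// sq2_ge0.
  - by rewrite -eE.
split => //; rewrite eE integral_cell//; last exact/measurable_EFinP.
have iG := @integrableDR _ _ _ mu2 _ mQ _ _ (@integrableDR _ _ _ mu2 _ mQ _ _ (strip_x2 S) (strip_y2 S))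
  (@integrableDR _ _ _ mu2 _ mQ _ _ (strip_x2 S') (strip_y2 S')).
have iG2 := @integrableZR _ _ _ mu2 _ mQ 2^-1 _ iG.
rewrite -RintegralZl// -RintegralD// /Rintegral fineK; last first.
  exact: (@integrable_fin_num _ _ _ mu2 _ mQ _ (@integrableDR _ _ _ mu2 _ mQ _ _ iG2 iW)).
by apply: eq_integral => x _; congr EFin; rewrite /sq2; congr (_ + _); field.
Qed.

Section one_dim.

Lemma Rintegral_EFin d (T : measurableType d) (m : {measure set T -> \bar R}) (D : set T) (k : T -> R) :
  measurable D -> m.-integrable D (EFin \o k) -> (\int[m]_(x in D) (k x)%:E = (\int[m]_(x in D) k x)%:E)%E.
Proof. by move=> mD ik; rewrite /Rintegral fineK//; exact: (integrable_fin_num mD ik). Qed.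

Lemma L1loc1_itv (k : R -> R) (s t : R) : L1loc1 k -> mu.-integrable `[s, t] (EFin \o k).
Proof.
move=> Lk; have [n [ns tn]] := itv_nat s t.
exact: (integrable_subitv ns tn (Lk n%:R)).
Qed.

Lemma L1loc1_continuous (k : R -> R) : continuous k -> L1loc1 k.
Proof. by move=> ck M; exact: continuous_itv_integrable. Qed.

Lemma prim_weak_deriv1 (y k : R -> R) : prim y k -> weak_deriv1 y k.
Proof.
move=> p; split; first by apply: L1loc1_continuous; exact: prim_continuous p.
split.
  move=> M; have [M0|M0] := leP 0 M.
    by have [] := p (- M) M; first by lra.
  rewrite set_itv_ge; first exact: integrable_set0.
  by rewrite bnd_simp -ltNge; lra.
move=> phi tphi; have [i1 i2 e] := prim_ibp p tphi.
by rewrite (Rintegral_EFin measurableT i1) (Rintegral_EFin measurableT i2) -EFinN e.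
Qed.

Lemma L1loc2_snd (k : R -> R) : L1loc1 k -> L1loc2 (fun x : R * R => k x.2).
Proof. by move=> L; apply: L1loc2P => M; apply: integrable_snd; exact: L1loc1_itv. Qed.

Lemma L1loc2_fst (k : R -> R) : L1loc1 k -> L1loc2 (fun x : R * R => k x.1).
Proof. by move=> L; have := L1loc2_swap (L1loc2_snd L). Qed.

Lemma measurable_L1loc1 (k : R -> R) : L1loc1 k -> measurable_fun setT k.
Proof. by move=> L; have := measurable_slice1 0 (measurable_L1loc2 (L1loc2_fst L)). Qed.

Lemma testfun2_L1loc f (p : R * R -> R) : L1loc2 f -> continuous p ->
  (exists M : R, forall x : R * R, M < `|x.1| \/ M < `|x.2| -> p x = 0) ->
  mu2.-integrable setT (EFin \o (fun x => f x * p x)).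
Proof.
move=> Lf cp [M hM].
have mp := continuous2_measurable cp.
have mB := @measurable_itvX R (- M) M (- M) M.
have [C hC] : exists C : R, forall x, (`[- M, M]%classic `*` `[- M, M]%classic) x -> `|p x| <= C.
  have K : compact ((`[- M, M]%classic `*` `[- M, M]%classic) : set (R * R)).
    by apply: compact_setX; exact: segment_compact.
  have K' : compact (p @` (`[- M, M]%classic `*` `[- M, M]%classic)).
    by apply: continuous_compact => //; exact: continuous_subspaceT.
  have [C [_ hC]] := compact_bounded K'; exists (C + 1) => x Bx.
  by apply: (hC (C + 1)); [lra|exists x].
have iB : mu2.-integrable (`[- M, M]%classic `*` `[- M, M]%classic) (EFin \o (fun x => f x * p x)).
  apply: (@integrable_bounded_mul _ _ _ mu2 _ f p C) => //; first exact: measurable_funTS.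
  exact: L1loc2_box.
have := (@integrable_patch _ _ _ mu2 _ (fun x => f x * p x) mB).1 iB.
congr (_.-integrable _ _); apply/funext => x /=; rewrite patchE; case: ifPn => // h.
rewrite hM ?mulr0//; move: h; rewrite in_setX !mem_setE !in_itv/= -!ler_norml negb_and -!ltNge.
by case/orP; [left|right].
Qed.

Lemma testfun2_supp_derive (p : R * R -> R) (M : R) : testfun2 p ->
  (forall x : R * R, M < `|x.1| \/ M < `|x.2| -> p x = 0) ->
  forall x : R * R, M < `|x.1| \/ M < `|x.2| -> 'D_(@e1 R) p x = 0.
Proof.
move=> tp hM [t y] h; have [tq <-] := testfun2_slice y tp.
case: h => /= h.
- by apply: (derive1_supp (M := M)) => // s hs; apply: hM; left.
- have -> : (fun s => p (s, y)) = cst 0 by apply/funext => s; apply: hM; right.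
  by rewrite derive1_cst.
Qed.

(** At fixed second coordinate a test function of the plane is one of a single variable, so the weak
    identity holds on every horizontal line and Fubini integrates it. *)
Lemma weak_ext1 (y k : R -> R) : weak_deriv1 y k ->
  weak_partial2 (@e1 R) (fun x => y x.1) (fun x => k x.1).
Proof.
move=> [Ly [Lk H]]; have Ly2 := L1loc2_fst Ly; have Lk2 := L1loc2_fst Lk.
split => //; split => // p tp; have [_ [cp [M hM]]] := tp.
have cd : continuous ('D_(@e1 R) p) by exact: (cp [:: @e1 R]).
have c0 : continuous p by exact: (cp [::]).
have i1 := testfun2_L1loc Ly2 cd (ex_intro _ M (testfun2_supp_derive tp hM)).
have i2 := testfun2_L1loc Lk2 c0 (ex_intro _ M hM).
rewrite (Rintegral_EFin measurableT i1) (Rintegral_EFin measurableT i2) -EFinN; congr EFin.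
have e (z : R * R -> R) : mu2.-integrable setT (EFin \o z) ->
    \int[mu2]_x z x = \int[mu]_t \int[mu]_s z (s, t).
  move=> iz; have XT : [set: R * R] = setT `*` setT by rewrite setXTT.
  by rewrite XT in iz *; have [_ _ ->] := RFubini' measurableT measurableT iz.
rewrite e// e// -[RHS]mulN1r.
have iI : mu.-integrable setT (EFin \o (fun t => \int[mu]_s (k s * p (s, t)))).
  have XT : [set: R * R] = setT `*` setT by rewrite setXTT.
  by rewrite XT in i2; have [_ +  _] := RFubini' measurableT measurableT i2.
rewrite -RintegralZl//; apply: eq_Rintegral => t _ /=; rewrite mulN1r.
have [tq dq] := testfun2_slice t tp.
have h : \int[mu]_s (y s * (fun s => p (s, t))^`()%classic s) = - \int[mu]_s (k s * p (s, t)).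
  exact: (etrans (congr1 fine (H _ tq)) (fineN _)).
rewrite -[RHS]h; apply: eq_Rintegral => s _.
exact: (congr1 (fun z => y s * z) (esym (dq s))).
Qed.

(** On each vertical line [y x.1] is a constant factor and the derivative of a compactly supported
    function has integral zero. *)
Lemma weak_ext2 (y : R -> R) : L1loc1 y ->
  weak_partial2 (@e2 R) (fun x => y x.1) (fun=> 0).
Proof.
move=> Ly; have Ly2 := L1loc2_fst Ly.
split => //; split; first by apply: (@L1loc2_fst (fun=> 0)); apply: L1loc1_continuous => x; exact: cvg_cst.
move=> p tp; have [_ [cp [M hM]]] := tp.
have ts := testfun2_swap tp.
have dE x : 'D_(@e2 R) p x = 'D_(@e1 R) (p \o @swap R R) (swap x).
  have := derive_is_derive (tp.1 [::] (@e2 R) x).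
  move=> h; have := (is_derive_swap p (swap x) (@e1 R) ('D_(@e2 R) p x)).2.
  case: x h => a b h /(_ h) [_ ->] //.
have cd : continuous ('D_(@e2 R) p) by exact: (cp [:: @e2 R]).
have hd x : M < `|x.1| \/ M < `|x.2| -> 'D_(@e2 R) p x = 0.
  move=> h; rewrite dE; apply: (testfun2_supp_derive ts (M := M)).
    by move=> z hz; apply: hM; case: hz => /=; [right|left].
  by case: x h => a b /= [h|h]; [right|left].
have i1 := testfun2_L1loc Ly2 cd (ex_intro _ M hd).
under [X in (- X)%E]eq_integral do rewrite mul0r.
rewrite integral0 oppe0 (Rintegral_EFin measurableT i1); congr EFin.
have [_ _ ->] := RFubiniT i1.
rewrite (_ : (fun x => _) = (fun=> 0)); first by rewrite /Rintegral integral0.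
apply/funext => s /=.
have [tq dq] := testfun2_slice s ts.
have [j1 j2 je] := prim_ibp (prim_cst 1) tq.
have i3 : mu.-integrable setT (EFin \o (fun z => p (s, z))^`()%classic).
  by move: j1; congr (_.-integrable _ _); apply/funext => z /=; rewrite mul1r.
have e0 : \int[mu]_z (fun z => p (s, z))^`()%classic z = 0.
  move: je; under eq_Rintegral do rewrite mul1r.
  by under [X in - X]eq_Rintegral do rewrite mul0r; rewrite {2}/Rintegral integral0 oppr0.
transitivity (\int[mu]_z (y s * (fun z => p (s, z))^`()%classic z)).
  by apply: eq_Rintegral => z _; congr (_ * _); rewrite dE -dq.
by rewrite RintegralZl// e0 mulr0.
Qed.

Lemma cell_fst (F : R -> \bar R) : measurable_fun setT F -> (forall t, 0 <= F t)%E ->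
  (\int[mu2]_(x in @cell R) F x.1 = \int[mu]_t F t)%E.
Proof.
move=> mF F0; have mF1 : measurable_fun setT (fun x : R * R => F x.1).
  by apply: (measurableT_comp mF); exact: measurable_fst.
rewrite integral_cell//; have [_ ->] := tonelli_strip measurableT mF1 (fun x => F0 _).
have mI : mu I = 1%:E by rewrite lebesgue_measure_itv/= lte_fin ltr01 oppr0 adde0.
apply: eq_integral => t _; transitivity (F t * mu I)%E; last by rewrite mI mule1.
have mI' : measurable I by exact: measurable_itv.
transitivity (\int[mu]_(y in I) (cst (F t)) y)%E => //; exact: integral_cst.
Qed.

(** The pair is extended to the plane so that [weak_line1] applies; on a suitable slice the
    absolutely continuous representative is the constant [a]. *)
Lemma weak_deriv1_cst (a : R) (k : R -> R) : weak_deriv1 (fun=> a) k -> {ae mu, forall t, k t = 0}.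
Proof.
move=> w; have mk := measurable_L1loc1 w.2.1.
have [U [mU aU pU]] := weak_line1 (weak_tensor1_of (weak_ext1 w)).
have [y [pr e]] : exists y, prim (fun t => U (t, y)) k /\ {ae mu, forall t, a = U (t, y)}.
  have [y [_ [h1 h2] _]] := small_time (k := cst 0) (measurable_itv `]0, +oo[) (measure_itv_oy 0)
    (integrable0 _ _) (ae_and pU (ae_slices2 aU)) ltr01.
  by exists y; split => //; apply: aeS h2.
apply: (@prim_cst_ae0 _ a) => //; apply: (prim_ext _ _ pr) => // t.
apply/esym; apply: (@continuous_ae_eq _ (fun=> a) (fun t => U (t, y))) => //.
- by move=> x; exact: cvg_cst.
- exact: prim_continuous pr.
Qed.

Lemma continuous_fst_comp (gam : R -> R * R) : continuous gam ->
  continuous (fun t => (gam t).1) /\ continuous (fun t => (gam t).2).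
Proof.
move=> c; split => t; apply: (@continuous_comp R (R * R)%type R gam); try exact: c.
- exact: cvg_fst.
- exact: cvg_snd.
Qed.

Lemma sq20 : sq2 ((0, 0) : R * R) = 0.
Proof. by rewrite /sq2/= expr0n addr0. Qed.

Lemma ext_admissible (a : R) (um up : R * R) (gam dgam : R -> R * R) :
  admissible1 a um up gam dgam ->
  admissible um up (fun x => gam x.1) (fun x => dgam x.1) (fun=> (0, 0)).
Proof.
move=> [[cg [ga [w1 [w2 fin]]]] [p m]]; have [c1 c2] := continuous_fst_comp cg.
have sqc (k : R -> R) : continuous k -> continuous (fun t => k t ^+ 2).
  by move=> ck t; apply: cvgM; exact: ck.
have md1 := measurable_L1loc1 w1.2.1; have md2 := measurable_L1loc1 w2.2.1.
have ms : measurable_fun setT (fun t => sq2 (dgam t)).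
  by apply: measurable_funD; exact: measurable_funX.
split; last first.
  exists gam; split => //; apply: aeT => t; rewrite /ubar.
  by rewrite [gam t]surjective_pairing; congr pair; rewrite /= [RHS]Rintegral_cstI.
split; first by [].
split; first by apply: (@L1loc2_fst (fun t => (gam t).1 ^+ 2)); apply: L1loc1_continuous; exact: sqc.
split; first by apply: (@L1loc2_fst (fun t => (gam t).2 ^+ 2)); apply: L1loc1_continuous; exact: sqc.
split; first exact: (weak_ext1 w1).
split; first exact: (weak_ext1 w2).
split; first exact: (weak_ext2 (L1loc1_continuous c1)).
split; first exact: (weak_ext2 (L1loc1_continuous c2)).
split.
  rewrite sq20; under eq_integral do rewrite addr0.
  rewrite (cell_fst (F := fun t => (sq2 (dgam t))%:E))//; first exact/measurable_EFinP.
  by move=> t; rewrite lee_fin sq2_ge0.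
(* The divergence of the extension is the derivative of the first component, which vanishes because
   the curve stays in the line of first coordinate [a]. *)
have e1 : (fun t => (gam t).1) = (fun=> a) by apply/funext => t; exact: ga.
rewrite e1 in w1; have := ae_fst (weak_deriv1_cst w1).
by apply: aeS => x /= ->; rewrite addr0.
Qed.

Lemma ext_energy (W : R * R -> R) (gam dgam : R -> R * R) : continuous W -> (forall z, 0 <= W z) ->
  continuous gam -> weak_deriv1 (fun t => (gam t).1) (fun t => (dgam t).1) ->
  weak_deriv1 (fun t => (gam t).2) (fun t => (dgam t).2) ->
  energy W (fun x => gam x.1) (fun x => dgam x.1) (fun=> (0, 0)) = energy1 W gam dgam.
Proof.
move=> cW W0 cg w1 w2.
have md1 := measurable_L1loc1 w1.2.1; have md2 := measurable_L1loc1 w2.2.1.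
have ms : measurable_fun setT (fun t => sq2 (dgam t)).
  by apply: measurable_funD; exact: measurable_funX.
have cWg : continuous (fun t => W (gam t)).
  by move=> t; apply: (@continuous_comp R (R * R)%type R gam W); [exact: cg|exact: cW].
rewrite /energy /energy1.
rewrite sq20; under eq_integral do rewrite addr0.
rewrite (cell_fst (F := fun t => (sq2 (dgam t) / 2 + W (gam t))%:E))//.
  apply/measurable_EFinP; apply: measurable_funD; first exact: measurable_funM.
  exact: continuous_measurable_fun.
by move=> t; rewrite lee_fin addr_ge0// divr_ge0// sq2_ge0.
Qed.

End one_dim.

End bridge.

(** * Equality in the calibration *)

Section rigidity.
Context {R : realType}.
Notation mu := (@lebesgue_measure R).
Notation mu2 := (@mu2 R).
Notation I := (`[0%R, 1%R]%classic : set R).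
Notation Q := (setT `*` I : set (R * R)).
Implicit Types f g : R * R -> R.

Lemma Rintegral0_ae d (T : measurableType d) (m : {measure set T -> \bar R}) (D : set T) (k : T -> R) :
  measurable D -> m.-integrable D (EFin \o k) -> (forall x, 0 <= k x) ->
  \int[m]_(x in D) k x <= 0 -> {ae m, forall x, D x -> k x = 0}.
Proof.
move=> mD ik k0 le0.
have mk : measurable_fun setT (k \_ D).
  by apply/(measurable_patch _ mD); have /integrableP[/measurable_EFinP] := ik.
have h : {ae m, forall x, ((k \_ D) x)%:E = 0%E}.
  apply: ae_integral_eq0; first exact/measurable_EFinP.
    by move=> x; rewrite lee_fin patchE; case: ifP.
  have e : (\int[m]_(x in D) (k x)%:E = \int[m]_x ((k \_ D) x)%:E)%E.
    rewrite integral_mkcond; apply: eq_integral => x _.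
    by rewrite !patchE; case: ifP.
  rewrite -e Rintegral_EFin//; congr EFin; apply/eqP.
  by rewrite eq_le le0 Rintegral_ge0.
by apply: aeS h => x + Dx; rewrite patchE mem_set// => -[].
Qed.

Lemma ae_exists_I (P : R -> Prop) : {ae mu, forall y, P y} -> exists2 y, I y & P y.
Proof.
move=> [N [mN N0 hN]]; apply: contrapT => H.
have IN : I `<=` N by move=> y Iy; apply: hN => /= Py; apply: H; exists y.
have mI : mu I = 1%:E by rewrite lebesgue_measure_itv/= lte_fin ltr01 oppr0 adde0.
have : (mu I <= mu N)%E by apply: le_measure => //; rewrite inE//; exact: measurable_itv.
by rewrite mI [mu N]N0 lee_fin ler10.
Qed.

Lemma tau_int (k : R * R -> R) (n : int) : (forall x, k (tau 1 x) = k x) ->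
  forall x, k (tau n%:~R x) = k x.
Proof.
move=> per.
have nat_case (j : nat) x : k (tau j%:R x) = k x.
  elim: j x => [|j IH] x; first by case: x => a b; rewrite /tau/= addr0.
  by rewrite -[RHS]per -(IH (tau 1 x)); congr k; rewrite /tau/= -natr1 [j%:R + 1]addrC addrA.
move=> x; case: n => j; first exact: nat_case.
rewrite NegzE mulrNz -[LHS](nat_case j.+1); congr k.
by case: x => a b; rewrite /tau/= pmulrn subrK.
Qed.

(** The exceptional set is a countable union of integer translates of a null set; translating by the
    floor of the second coordinate brings a point into [Q]. *)
Lemma ae_extend (k : R * R -> R) : (forall x, k (tau 1 x) = k x) ->
  {ae mu2, forall x, Q x -> k x = 0} -> {ae mu2, forall x, k x = 0}.
Proof.
move=> per h.
have H := @ae_count _ int _ _ mu2 (fun n x => Q (tau n%:~R x) -> k (tau n%:~R x) = 0) (fun n => ae_tau n%:~R h).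
apply: aeS H => x hx; have := hx (- Num.floor x.2); rewrite tau_int//; apply.
split => //=; rewrite in_itv/= mulrNz.
have /andP[h1 h2] := floor_itv x.2.
by rewrite intrD in h2; apply/andP; split; lra.
Qed.

Lemma prim_const (y k : R -> R) : prim y k -> {ae mu, forall x, k x = 0} -> forall s t, y s = y t.
Proof.
move=> p k0.
have H s t : s <= t -> y t = y s.
  move=> st; have [i e] := p _ _ st; apply/eqP; rewrite -subr_eq0 e; apply/eqP.
  rewrite (@Rintegral_ae_eqm _ _ _ mu _ _ (fun=> 0)) ?measurable_itv//.
  - by rewrite /Rintegral integral0.
  - by have /integrableP[/measurable_EFinP] := i.
  - by apply: aeS k0 => x ->.
by move=> s t; have [st|/ltW ts] := leP s t; [rewrite (H _ _ st)|exact: H].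
Qed.

Lemma prim_is_derive_continuous (y h : R -> R) : prim y h -> continuous h ->
  forall t : R, is_derive t (1 : R) y (h t).
Proof.
move=> p ch; have ps : prim (sint h) h by apply: prim_sint => s t; exact: continuous_itv_integrable.
have e t : y t = y 0 - sint h 0 + sint h t.
  have [t0|/ltW t0] := leP 0 t.
  - by have [_ a] := p _ _ t0; have [_ b] := ps _ _ t0; lra.
  - by have [_ a] := p _ _ t0; have [_ b] := ps _ _ t0; lra.
move=> t; rewrite (_ : y = cst (y 0 - sint h 0) + sint h); last by apply/funext => s; rewrite e.
by rewrite -[h t]add0r; apply: is_deriveD; exact: continuous_antiderivative.
Qed.

Lemma prim_ae (y k h : R -> R) : prim y k -> continuous h -> {ae mu, forall t, k t = h t} -> prim y h.
Proof.
move=> p ch e s t st; have [i ee] := p s t st; have i' := continuous_itv_integrable s t ch.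
by split => //; rewrite ee; apply: Rintegral_ae_eq => //; apply: aeS e => x ->.
Qed.

Lemma measurable_mean f : measurable_fun setT f -> measurable_fun setT (mean f).
Proof.
move=> mf.
have -> : mean f = (fun t => \int[mu]_y (f (t, y) * chiI y)).
  apply/funext => t; rewrite /mean Rintegral_mkcond; apply: eq_Rintegral => y _.
  by rewrite patchE /chiI mem_setE in_itv/=; case: ifP; rewrite ?mulr1 ?mulr0.
apply: (@measurable_Rintegral_param _ _ _ (fun x : R * R => f x * chiI x.2)).
by apply: measurable_funM => //; exact: measurable_chiI2.
Qed.

(** Every time has times arbitrarily close to it, taken on the right so as to stay beyond the
    threshold, at which [ub] and [Y] agree; continuity of [Y] does the rest. *)
Lemma cvg_ae_continuous_p (Y ub : R -> R) (p : R) : continuous Y -> {ae mu, forall t, ub t = Y t} ->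
  ub t @[t --> +oo] --> p -> Y t @[t --> +oo] --> p.
Proof.
move=> cY e /cvgrPdist_le cu; apply/cvgrPdist_le => eps eps0.
have [A [_ hA]] := cu _ eps0; exists A; split => //= t At.
apply/ler_addgt0Pr => d d0.
have /cvgrPdist_lt/(_ _ d0) := cY t; move=> /nbhs_ballP[r /= r0 hr].
pose D : set R := `]t, t + r[%classic.
have [s [Ds es _]] : exists s, [/\ D s, ub s = Y s & True].
  move: e => [N [mN N0 hN]]; apply: contrapT => H.
  have IN : D `<=` N.
    by move=> s Is; apply: hN => /= es; apply: H; exists s.
  have : (mu D <= mu N)%E by apply: le_measure => //; rewrite inE//; exact: measurable_itv.
  by rewrite [mu N]N0 lebesgue_measure_itv/= lte_fin ltrDl r0 -EFinB lee_fin; lra.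
move: Ds; rewrite /D /= in_itv/= => /andP[s1 s2].
have h1 := hA s (lt_trans At s1); have h2 := hr s ltac:(by rewrite /ball/= ltr_norml; lra).
rewrite es in h1.
have -> : p - Y t = (p - Y s) - (Y t - Y s) by ring.
by have := ler_normB (p - Y s) (Y t - Y s); lra.
Qed.

Lemma cvg_ae_continuous_m (Y ub : R -> R) (p : R) : continuous Y -> {ae mu, forall t, ub t = Y t} ->
  ub t @[t --> -oo] --> p -> Y t @[t --> -oo] --> p.
Proof.
move=> cY e /cvgrPdist_le cu; apply/cvgrPdist_le => eps eps0.
have [A [_ hA]] := cu _ eps0; exists A; split => //= t At.
apply/ler_addgt0Pr => d d0.
have /cvgrPdist_lt/(_ _ d0) := cY t; move=> /nbhs_ballP[r /= r0 hr].
pose D : set R := `]t - r, t[%classic.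
have [s [Ds es _]] : exists s, [/\ D s, ub s = Y s & True].
  move: e => [N [mN N0 hN]]; apply: contrapT => H.
  have IN : D `<=` N.
    by move=> s Is; apply: hN => /= es; apply: H; exists s.
  have : (mu D <= mu N)%E by apply: le_measure => //; rewrite inE//; exact: measurable_itv.
  rewrite [mu N]N0 lebesgue_measure_itv/= lte_fin ifT; last by lra.
  by rewrite -EFinB lee_fin; lra.
move: Ds; rewrite /D /= in_itv/= => /andP[s1 s2].
have h1 := hA s (lt_trans s2 At); have h2 := hr s ltac:(by rewrite /ball/= ltr_norml; lra).
rewrite es in h1.
have -> : p - Y t = (p - Y s) - (Y t - Y s) by ring.
by have := ler_normB (p - Y s) (Y t - Y s); lra.
Qed.

(** At a level above [B] the truncation changes nothing, so the error is zero. *)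
Lemma tail_small_bounded (w : R * R -> R) f g (B : R) : C2 w ->
  (forall x, 'D_(@e1 R) ('D_(@e1 R) w) x = 'D_(@e2 R) ('D_(@e2 R) w) x) ->
  measurable_fun setT f -> measurable_fun setT g ->
  {ae mu2, forall x, `|f x + g x| <= B /\ `|f x - g x| <= B} -> tail_small w f g.
Proof.
move=> C2w wave mf mg hB e M0 e0; exists (Num.max M0 B).
have mQ : measurable Q := measurable_Q measurableT.
have MB : B <= Num.max M0 B by rewrite le_max lexx orbT.
have mw : measurable_fun setT (fun x => w (f x, g x)) by apply: measurable_pair_comp => //; exact: C2_continuous.
have mD : measurable_fun setT (fun x => (w (f x, g x) - wtrunc w (Num.max M0 B) (f x, g x)) ^+ 2).
  by apply: measurable_funX; apply: measurable_funB => //; exact: measurable_wtrunc.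
have z : {ae mu2, forall x, (w (f x, g x) - wtrunc w (Num.max M0 B) (f x, g x)) ^+ 2 = 0}.
  apply: aeS hB => x [h1 h2]; rewrite wtrunc_id//= ?subrr ?expr0n//; exact: le_trans MB.
have i0 : mu2.-integrable Q (EFin \o (fun=> 0 : R)) by exact: integrable0.
have iD : mu2.-integrable Q (EFin \o (fun x => (w (f x, g x) - wtrunc w (Num.max M0 B) (f x, g x)) ^+ 2)).
  apply: (@ae_le_integrable _ _ _ mu2 _ _ (fun=> 0) mQ) => //; first exact: measurable_funTS.
  by apply: aeS z => x ->; rewrite normr0.
split => //; first by rewrite le_max lexx.
rewrite (@Rintegral_ae_eq _ _ _ mu2 _ _ (fun=> 0) mQ iD i0); last by apply: aeS z => x ->.
by rewrite /Rintegral integral0/= ltW.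
Qed.


Lemma ae_eq_Q1 (k l : R * R -> R) : measurable_fun setT k -> measurable_fun setT l ->
  {ae mu, forall t, {ae mu, forall y, I y -> k (t, y) = l (t, y)}} ->
  {ae mu2, forall x, Q x -> k x = l x}.
Proof.
move=> mk ml h.
have H : {ae mu2, forall x, `|k x - l x| * chiI x.2 <= 0}.
  apply: (@ae_le_of_slices1 _ (fun x => `|k x - l x| * chiI x.2) (fun=> 0)) => //.
    apply: measurable_funM; last exact: measurable_chiI2.
    by apply: measurableT_comp => //; exact: measurable_funB.
  apply: aeS h => t h; apply: aeS h => y /= h.
  rewrite /chiI; case: ifP; last by rewrite mulr0.
  by move=> yI; rewrite h ?subrr ?normr0 ?mul0r//=; rewrite in_itv.
apply: aeS H => -[t y] /= + [_ Iy]; rewrite /chiI.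
by move: Iy; rewrite /= in_itv/= => ->; rewrite mulr1 normr_le0 subr_eq0 => /eqP.
Qed.

Lemma ae_eq_Q2 (k l : R * R -> R) : measurable_fun setT k -> measurable_fun setT l ->
  {ae mu, forall y, I y -> {ae mu, forall t, k (t, y) = l (t, y)}} ->
  {ae mu2, forall x, Q x -> k x = l x}.
Proof.
move=> mk ml h.
have H : {ae mu2, forall x, `|k x - l x| * chiI x.2 <= 0}.
  apply: (@ae_le_of_slices2 _ (fun x => `|k x - l x| * chiI x.2) (fun=> 0)) => //.
    apply: measurable_funM; last exact: measurable_chiI2.
    by apply: measurableT_comp => //; exact: measurable_funB.
  apply: aeS h => y h; rewrite /chiI /=.
  have [yI|yI] := boolP (0 <= y <= 1).
    by apply: aeS (h _) => [t ->|]; rewrite ?subrr ?normr0 ?mul0r//=; rewrite in_itv.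
  by apply: aeT => t; rewrite mulr0.
apply: aeS H => -[t y] /= + [_ Iy]; rewrite /chiI.
by move: Iy; rewrite /= in_itv/= => ->; rewrite mulr1 normr_le0 subr_eq0 => /eqP.
Qed.

(** On almost every horizontal line [f] is constant. The constant is [a], because the line meets
    countably many good vertical lines on which [V] is uniformly within [n.+1%:R^-1] of [a];
    countability lets [U] and [V] agree at all these crossings for almost every height. *)
Lemma rigid_first f fx fy U V g gx gy U' V' (a mg pg : R) :
  strip f fx fy U V -> strip g gx gy U' V' -> tends f a a -> tends g mg pg ->
  {ae mu2, forall x, Q x -> fx x = 0} -> {ae mu2, forall x, f x = a}.
Proof.
move=> S S' tf tg h0.
have mf := strip_mf S.
have aT : {ae mu, forall t : R, True} by exact: aeT.
have ex (n : nat) : exists t, {ae mu, forall y, V (t, y) = U (t, y)} /\ vclose V t a (n.+1%:R^-1).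
  have e0 : 0 < (n.+1%:R^-1 : R) by rewrite invr_gt0 ltr0n.
  have [t [_ _ [_ v u _ _] _ [c _]]] := good_time_p 0 S S' tf tg aT e0.
  by exists t; split => //; apply: aeS (ae_and v u) => y [<- <-].
have [t ht] := choice ex.
have hu := ae_nat (fun n => (ht n).1).
have hy : {ae mu, forall y, I y -> {ae mu, forall s, f (s, y) = a}}.
  apply: aeS (ae_and (ae_and hu (strip_primU S)) (ae_and (ae_slices2 h0) (ae_slices2 (strip_fU S)))).
  move=> y [[hV pU] [f0 fU]] Iy.
  have c : {ae mu, forall s, fx (s, y) = 0} by apply: aeS f0 => s; apply; split.
  have ca := prim_const pU c.
  have e : U (0, y) = a.
    apply/eqP; rewrite -subr_eq0 -normr_le0; apply/ler_gtP => e e0.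
    have [n _ hn] : exists2 n : nat, true & n.+1%:R^-1 < e.
      exists (Num.truncn e^-1) => //; rewrite invf_plt ?posrE ?ltr0n//.
      exact: truncnS_gt.
    apply: le_trans (ltW hn); have [_ /(_ y)] := ht n.
    rewrite hV (ca _ 0); apply; move: Iy; rewrite /= in_itv/=; lra.
  by apply: aeS fU => s ->; rewrite (ca _ 0).
have hQ : {ae mu2, forall x, Q x -> f x = a} by apply: ae_eq_Q2.
have H : {ae mu2, forall x, f x - a = 0}.
  apply: ae_extend => [x|]; first by rewrite (strip_per S).
  by apply: aeS hQ => x h Qx; rewrite h// subrr.
by apply: aeS H => x /eqP; rewrite subr_eq0 => /eqP.
Qed.

Lemma rigid_first_y f fx fy U V (a : R) : strip f fx fy U V -> measurable_fun setT fy ->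
  {ae mu2, forall x, f x = a} -> {ae mu2, forall x, Q x -> fy x = 0}.
Proof.
move=> S mfy fa; apply: ae_eq_Q1 => //.
apply: aeS (ae_and (strip_good S) (ae_slices1 fa)) => t [[p v _ _ _] h].
have e : (fun y => V (t, y)) = (fun=> a).
  apply/funext; apply: continuous_ae_eq; first exact: prim_continuous p.
    by move=> y; exact: cvg_cst.
  by apply: aeS (ae_and v h) => y [<- ->].
rewrite e in p.
by apply: aeS (prim_cst_ae0 (measurable_slice2 t mfy) p).
Qed.

Lemma rigid_mean g gx gy U' V' : strip g gx gy U' V' ->
  {ae mu2, forall x, Q x -> gy x = 0} -> {ae mu2, forall x, Q x -> g x = mean g x.1}.
Proof.
move=> S h0; have mg := strip_mf S.
have mm : measurable_fun setT (fun x : R * R => mean g x.1).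
  by apply: (measurableT_comp (measurable_mean mg)); exact: measurable_fst.
apply: (@ae_eq_Q1 g (fun x => mean g x.1)) => //.
apply: aeS (ae_and (strip_good S) (ae_slices1 h0)) => t [G h].
have z : \int[mu]_(z in I) `|gy (t, z)| = 0.
  have -> : \int[mu]_(z in I) `|gy (t, z)| = \int[mu]_(z in I) (fun=> 0 : R) z.
    rewrite /Rintegral; congr fine; apply: ae_eq_integral => //.
    - apply: measurable_funTS; apply/measurable_EFinP; apply: measurableT_comp => //.
      by apply: measurable_slice2; exact: strip_my S.
    - by apply: aeS h => y hy Iy; rewrite hy// normr0.
  by rewrite /Rintegral integral0.
have [_ v _ _ _] := G.
apply: aeS v => y e Iy; have := good_mean S G Iy.
by rewrite z normr_le0 subr_eq0 -e => /eqP.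
Qed.

Lemma rigid_core (w : R * R -> R) f fx fy U V g gx gy U' V' (a um up : R) : continuous w ->
  strip f fx fy U V -> strip g gx gy U' V' -> tends f a a -> tends g um up ->
  {ae mu2, forall x, fx x + gy x = 0} ->
  {ae mu2, forall x, Q x -> fx x = gy x /\ gx x + fy x = w (f x, g x)} ->
  exists Y : R -> R, [/\ forall t : R, is_derive t (1 : R) Y (w (a, Y t)),
    {ae mu2, forall x, f x = a /\ g x = Y x.1},
    Y t @[t --> +oo] --> up, Y t @[t --> -oo] --> um &
    {ae mu2, forall x, Q x -> [/\ fx x = 0, fy x = 0, gx x = w (a, Y x.1) & gy x = 0]}].
Proof.
move=> cw S S' tf tg dv H.
have mg := strip_mf S'.
have H0 : {ae mu2, forall x, Q x -> fx x = 0 /\ gy x = 0}.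
  (* [fx + gy = 0] and [fx = gy] force both to vanish. *)
  by apply: aeS (ae_and dv H) => x [d h] Qx; have [h1 _] := h Qx; split; lra.
have fa : {ae mu2, forall x, f x = a}.
  by apply: rigid_first S S' tf tg _; apply: aeS H0 => x h Qx; have [] := h Qx.
have fy0 := rigid_first_y S (strip_my S) fa.
have gm : {ae mu2, forall x, Q x -> g x = mean g x.1}.
  by apply: rigid_mean S' _; apply: aeS H0 => x h Qx; have [] := h Qx.
have gw : {ae mu2, forall x, Q x -> gx x = w (a, g x)}.
  apply: aeS (ae_and (ae_and H fy0) fa) => x [[h1 h2] <-] Qx.
  by have [_ <-] := h1 Qx; rewrite h2// addr0.
(* All almost-everywhere information is collected on a single horizontal line, where the absolutely
   continuous [U'] serves as profile. The other lines inherit it because [g] equals its vertical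
   mean. *)
have [y0 Iy0 [[p eU] [em ew]]] := ae_exists_I (ae_and (ae_and (strip_primU S') (ae_slices2 (strip_fU S')))
   (ae_and (ae_slices2 gm) (ae_slices2 gw))).
pose Y t := U' (t, y0).
have Q0 t : Q (t, y0) by split.
have cY : continuous Y := prim_continuous p.
have cwY : continuous (fun t => w (a, Y t)).
  move=> t; apply: (@continuous_comp R (R * R)%type R (fun t => (a, Y t)) w); last exact: cw.
  by apply: (@cvg_pair _ _ _ _ (nbhs a) (nbhs (Y t))); [exact: cvg_cst|exact: cY].
have pY : prim Y (fun t => w (a, Y t)).
  by apply: (prim_ae p cwY); apply: aeS (ae_and ew eU) => t [h e]; rewrite (h (Q0 t)) /Y -e.
have mY : {ae mu, forall t, mean g t = Y t}.
  by apply: aeS (ae_and em eU) => t [h e]; rewrite -(h (Q0 t))/= /Y -e.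
have gY : {ae mu2, forall x, g x - Y x.1 = 0}.
  apply: (ae_extend (k := fun x => g x - Y x.1)) => [x|]; first by rewrite (strip_per S').
  by apply: aeS (ae_and gm (ae_fst mY)) => x [h e] Qx; rewrite h// e subrr.
have gY' : {ae mu2, forall x, g x = Y x.1} by apply: aeS gY => x /eqP; rewrite subr_eq0 => /eqP.
exists Y; split.
- exact: prim_is_derive_continuous pY cwY.
- exact: ae_and fa gY'.
- have [ub [e p1 _]] := tg; apply: (cvg_ae_continuous_p cY _ p1).
  by apply: aeS (ae_and e mY) => t [-> ->].
- have [ub [e _ p1]] := tg; apply: (cvg_ae_continuous_m cY _ p1).
  by apply: aeS (ae_and e mY) => t [-> ->].
- apply: aeS (ae_and (ae_and H0 fy0) (ae_and gw gY')) => x [[h1 h2] [h3 e]] Qx.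
  by have [a1 a2] := h1 Qx; split => //; [exact: h2|rewrite h3// e].
Qed.

(** The energy bound leaves an integral of [defect] that is at most zero, while each of its three
    terms is nonnegative. The statement is about any admissible map, since it is applied both to the
    minimizer on the strip and to extended one-dimensional minimizers. *)
Lemma rigidity (W w : R * R -> R) (a um up : R) (v dv1 dv2 : R * R -> R * R) :
  continuous W -> (forall z, 0 <= W z) -> C2 w ->
  (forall x, 'D_(@e1 R) ('D_(@e1 R) w) x = 'D_(@e2 R) ('D_(@e2 R) w) x) ->
  (forall z, w z ^+ 2 / 2 <= W z) -> admissible (a, um) (a, up) v dv1 dv2 ->
  tail_small w (fun x => (v x).1) (fun x => (v x).2) ->
  (energy W v dv1 dv2 <= (wint w a um up)%:E)%E ->
  exists Y : R -> R, [/\ forall t : R, is_derive t (1 : R) Y (w (a, Y t)),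
    {ae mu2, forall x, v x = (a, Y x.1)},
    Y t @[t --> +oo] --> up, Y t @[t --> -oo] --> um &
    energy W v dv1 dv2 = energy1 W (fun t => (a, Y t)) (fun t => (0, w (a, Y t)))].
Proof.
move=> cW W0 C2w wave wW [Hv bv] tail le.
have mQ : measurable Q := measurable_Q measurableT.
have fin : (energy W v dv1 dv2 < +oo)%E by apply: le_lt_trans le _; rewrite ltry.
have [iW eE] := energy_real cW W0 Hv fin.
have [U [V [U' [V' [S S']]]]] := Hdiv_strips Hv.
have [tf tg] := bc_tends bv.
have dv : {ae mu2, forall x, (dv1 x).1 + (dv2 x).2 = 0} by move: Hv => [_ [_ [_ [_ [_ [_ [_ [_ ]]]]]]]].
have [iD hD] := calibration C2w wave cW wW S S' tf tg dv iW tail.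
have cw : continuous w := C2_continuous C2w.
have D0 x : 0 <= defect w W (fun x => (v x).1) (fun x => (dv1 x).1) (fun x => (dv2 x).1)
    (fun x => (v x).2) (fun x => (dv1 x).2) (fun x => (dv2 x).2) x.
  rewrite /defect; have := wW ((v x).1, (v x).2).
  set s := (_ + _ - w _); set d := (_ - _ : R); have := sqr_ge0 s.
  move: (s ^+ 2) => s2; have := sqr_ge0 ((dv1 x).1 - (dv2 x).2).
  move: (((dv1 x).1 - (dv2 x).2) ^+ 2) => d2; rewrite /d; lra.
have z : {ae mu2, forall x, Q x -> defect w W (fun x => (v x).1) (fun x => (dv1 x).1) (fun x => (dv2 x).1)
    (fun x => (v x).2) (fun x => (dv1 x).2) (fun x => (dv2 x).2) x = 0}.
  apply: (@Rintegral0_ae _ _ mu2 _ _ mQ iD D0); move: le hD; rewrite eE lee_fin => le hD.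
  have := le_trans hD le; rewrite gerDl; exact.
have H : {ae mu2, forall x, Q x -> (dv1 x).1 = (dv2 x).2 /\
    (dv1 x).2 + (dv2 x).1 = w ((v x).1, (v x).2)}.
  apply: aeS z => x hz Qx; have := hz Qx; rewrite /defect.
  have := wW ((v x).1, (v x).2); set s := (_ + _ - w _).
  have := sqr_ge0 s; have := sqr_ge0 ((dv1 x).1 - (dv2 x).2).
  move=> h1 h2 h3 h4; split.
    have /eqP : ((dv1 x).1 - (dv2 x).2) ^+ 2 = 0 by lra.
    by rewrite sqrf_eq0 subr_eq0 => /eqP.
  have /eqP : s ^+ 2 = 0 by lra.
  by rewrite sqrf_eq0 subr_eq0 => /eqP.
have [Y [dY e cp cm eQ]] := rigid_core cw S S' tf tg dv H.
exists Y; split => //.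
  by apply: aeS (e) => x [e1 e2]; rewrite [v x]surjective_pairing e1 e2.
have cY : continuous Y by move=> t; apply: differentiable_continuous; apply/derivable1_diffP; have [] := dY t.
have mY : measurable_fun setT Y by exact: continuous_measurable_fun.
have cwY : continuous (fun t => w (a, Y t)).
  move=> t; apply: (@continuous_comp R (R * R)%type R (fun t => (a, Y t)) w); last exact: cw.
  by apply: (@cvg_pair _ _ _ _ (nbhs a) (nbhs (Y t))); [exact: cvg_cst|exact: cY].
have cWY : continuous (fun t => W (a, Y t)).
  move=> t; apply: (@continuous_comp R (R * R)%type R (fun t => (a, Y t)) W); last exact: cW.
  by apply: (@cvg_pair _ _ _ _ (nbhs a) (nbhs (Y t))); [exact: cvg_cst|exact: cY].
pose F (t : R) : R := sq2 (0, w (a, Y t)) / 2 + W (a, Y t).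
have mF : measurable_fun setT F.
  apply: measurable_funD; last exact: continuous_measurable_fun.
  apply: measurable_funM => //; rewrite /sq2/=; apply: measurable_funD => //.
  by apply: measurable_funX; exact: continuous_measurable_fun.
rewrite /energy1 /energy -(@cell_fst _ (EFin \o F)); last 2 first.
- exact/measurable_EFinP.
- by move=> t; rewrite lee_fin addr_ge0// divr_ge0// sq2_ge0.
have [m1 m2 ms1 ms2] := Hdiv_measurable Hv.
apply: ae_eq_integral => //.
- exact: measurable_cell.
- apply: measurable_funTS; apply/measurable_EFinP; apply: measurable_funD.
    by apply: measurable_funM => //; exact: measurable_funD.
  rewrite (_ : (fun x => W (v x)) = (fun x => W ((v x).1, (v x).2))); first exact: measurable_pair_comp.
  by apply/funext => x; rewrite -surjective_pairing.
- apply: measurable_funTS; apply/measurable_EFinP.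
  by apply: (measurableT_comp mF); exact: measurable_fst.
- apply: aeS (ae_and e eQ) => x [[e1 e2] h] /= cx.
  have [|b1 b2 b3 b4] := h.
    by move: cx; rewrite /cell /= => /andP[c1 c2]; split => //=; rewrite in_itv/= c1 ltW.
  rewrite /F; congr EFin; congr (_ / 2 + _); first by rewrite /sq2/= b1 b2 b3 b4 !expr0n/= !add0r !addr0.
  by rewrite [v x]surjective_pairing e1 e2.
Qed.

End rigidity.

(** * One-dimensional profiles *)

Section profiles.
Context {R : realType}.
Notation mu := (@lebesgue_measure R).
Notation mu2 := (@mu2 R).
Notation I := (`[0%R, 1%R]%classic : set R).
Notation Q := (setT `*` I : set (R * R)).

Lemma surjective_of_growth (G : R -> R) (k : R) : continuous G -> 0 < k ->
  (forall u v, u <= v -> k * (v - u) <= G v - G u) -> forall t, exists s, G s = t.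
Proof.
move=> cG k0 gr t; pose d := `|t - G 0| / k.
have d0 : 0 <= d by rewrite divr_ge0// ltW.
have kd : k * d = `|t - G 0| by rewrite /d mulrC divfK// gt_eqF.
have h1 := gr 0 d d0; rewrite subr0 kd in h1.
have nd : - d <= 0 by lra.
have h2 := gr (- d) 0 nd; rewrite sub0r opprK kd in h2.
have ab : - d <= d by lra.
have := ler_norm (t - G 0); have := ler_norm (- (t - G 0)); rewrite normrN => n1 n2.
have [|c _ e] := IVT (v := t) ab (continuous_subspaceT cG); last by exists c.
by rewrite ge_min le_max; apply/andP; split; apply/orP; [left|right]; lra.
Qed.

(** Separation of variables: the solution is the inverse of the primitive [G] of the reciprocal of
    [h]. The upper bound on [h] makes [G] injective and onto, so the flow exists for all times, and
    the positive lower bound keeps the reciprocal continuous. *)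
Lemma autonomous_flow (h : R -> R) (l L : R) : continuous h -> 0 < l ->
  (forall s, l <= h s <= L) ->
  exists (th : R -> R) (t0 t1 : R), [/\ forall t : R, is_derive t (1 : R) th (h (th t)),
    t0 <= t1, th t0 = 0 & th t1 = 1].
Proof.
move=> ch l0 hl.
have h0 s : 0 < h s by have := hl s; lra.
have L0 : 0 < L by have := hl 0; lra.
pose k s := (h s)^-1.
have ck : continuous k by move=> s; apply: cvgV; [rewrite gt_eqF|exact: ch].
have dG := continuous_antiderivative ck; move: dG; set G := sint k => dG.
have cG : continuous G := is_derive_continuous dG.
have kb s : L^-1 <= k s <= l^-1.
  by have /andP[h1 h2] := hl s; rewrite /k !lef_pV2 ?posrE// h1 h2.
have gr u v : u <= v -> L^-1 * (v - u) <= G v - G u.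
  by move=> uv; have /andP[] := is_derive_le (k := L^-1) (l := l^-1) dG uv (fun x _ => kb x).
have Li : 0 < L^-1 by rewrite invr_gt0.
have [th hth] := choice (surjective_of_growth cG Li gr).
have inj u v : G u = G v -> u = v.
  have H x y : x <= y -> G x = G y -> x = y.
    move=> xy e; have := gr _ _ xy; rewrite e subrr pmulr_rle0// => ?.
    by apply/eqP; rewrite eq_le xy; lra.
  by move=> e; have [uv|/ltW vu] := leP u v; [exact: H|apply/esym; exact: H].
have thK s : th (G s) = s by apply: inj; rewrite hth.
exists th, (G 0), (G 1); split => //.
- move=> t; have := @is_derive_inverse R G th (k (th t)) (th t).
  rewrite hth /k invrK; apply; last by rewrite gt_eqF// invr_gt0.
  + by near=> z; exact: thK.
  + by near=> z; exact: cG.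
- by have := gr 0 1 ler01; rewrite subr0 mulr1; lra.
Unshelve. all: by end_near.
Qed.

Definition tcl (t0 t1 t : R) : R := Num.max t0 (Num.min t1 t).
Definition chi (t0 t1 t : R) : R := if t0 <= t <= t1 then 1 else 0.

Lemma tcl_in (t0 t1 t : R) : t0 <= t1 -> t0 <= tcl t0 t1 t <= t1.
Proof. by move=> h; rewrite /tcl le_max lexx/= ge_max h ge_min lexx. Qed.

Lemma tcl_ge (t0 t1 t : R) : t0 <= t1 -> t1 <= t -> tcl t0 t1 t = t1.
Proof. by move=> h h1; rewrite /tcl min_l// max_r. Qed.

Lemma tcl_le (t0 t1 t : R) : t0 <= t1 -> t <= t0 -> tcl t0 t1 t = t0.
Proof. by move=> h h1; rewrite /tcl min_r ?max_l//; lra. Qed.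

Lemma tcl_id (t0 t1 t : R) : t0 <= t <= t1 -> tcl t0 t1 t = t.
Proof. by move=> /andP[h h1]; rewrite /tcl min_r// max_r. Qed.

(** Stops a curve before [t0] and after [t1]; the density is cut off accordingly and nothing is lost
    at the two corners. *)
Lemma prim_tcl (y k : R -> R) (t0 t1 : R) : t0 <= t1 -> prim y k ->
  prim (fun t => y (tcl t0 t1 t)) (fun t => k t * chi t0 t1 t).
Proof.
move=> t01 p s t st.
have e : (fun t => k t * chi t0 t1 t) = (k \_ `[t0, t1]%classic).
  apply/funext => x; rewrite patchE /chi mem_setE in_itv/=.
  by case: ifP; rewrite ?mulr1 ?mulr0.
rewrite e; have [i _] := p _ _ st.
have mst : measurable (`[s, t]%classic : set R) by exact: measurable_itv.
have m01 : measurable (`[t0, t1]%classic : set R) by exact: measurable_itv.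
have iI : mu.-integrable (`[s, t]%classic `&` `[t0, t1]%classic) (EFin \o k).
  by apply: integrableS i => //; exact: measurableI.
split; first by rewrite -restrict_EFin; apply: (iffLR (@integrable_restrict _ _ _ mu _ m01 _ mst _)).
rewrite -Rintegral_mkcondr.
have [h|h] := leP (Num.max s t0) (Num.min t t1).
  have [_ E] := p _ _ h.
  move: h; rewrite ge_max !le_min => /andP[/andP[h1 h2] /andP[h3 h4]].
  have e1 : tcl t0 t1 s = Num.max s t0 by rewrite /tcl min_r// maxC.
  have e2 : tcl t0 t1 t = Num.min t t1 by rewrite /tcl max_r ?le_min ?t01 ?h3// minC.
  rewrite e1 e2 E; congr (Rintegral _ _ _); apply/seteqP; split => x /=; rewrite !in_itv/= ge_max le_min.
    by move=> /andP[/andP[-> ->] /andP[-> ->]].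
  by move=> [/andP[-> ->] /andP[-> ->]].
have -> : `[s, t]%classic `&` `[t0, t1]%classic = set0.
  apply/seteqP; split => x //=; rewrite !in_itv/= => -[/andP[a1 a2] /andP[a3 a4]].
  have /andP[b1 b2] : (Num.max s t0 <= x) && (x <= Num.min t t1) by rewrite ge_max le_min a1 a2 a3 a4.
  by move: (le_trans b1 b2); rewrite leNgt h.
rewrite Rintegral_set0; move: h; rewrite lt_max !gt_min !ltNge st t01/= orbF => /orP[] h.
  by rewrite !tcl_ge ?subrr//; move: h; rewrite -ltNge; lra.
by rewrite !tcl_le ?subrr//; move: h; rewrite -ltNge; lra.
Qed.

Lemma integral_supported_le (F K : R -> R) (t0 t1 : R) : t0 <= t1 -> measurable_fun setT F -> continuous K ->
  (forall t, 0 <= F t) -> (forall t, t0 <= t <= t1 -> F t <= K t) ->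
  (forall t, ~~ (t0 <= t <= t1) -> F t = 0) ->
  (\int[mu]_t (F t)%:E <= (\int[mu]_(t in `[t0, t1]) K t)%:E)%E.
Proof.
move=> t01 mF cK F0 FK Fz.
have m01 : measurable (`[t0, t1]%classic : set R) by exact: measurable_itv.
have iK := continuous_itv_integrable t0 t1 cK.
rewrite -(@Rintegral_EFin _ _ _ mu _ _ m01 iK).
have -> : (\int[mu]_t (F t)%:E = \int[mu]_(t in `[t0, t1]) (F t)%:E)%E.
  rewrite [RHS]integral_mkcond; apply: eq_integral => t _; rewrite patchE mem_setE in_itv/=.
  by case: ifPn => // h; rewrite Fz.
apply: ge0_le_integral => //.
- by move=> t _; rewrite lee_fin.
- by apply: measurable_funTS; exact/measurable_EFinP.
- by have /integrableP[] := iK.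
Qed.

Lemma bounded_of_limits (y : R -> R) (p m : R) : continuous y ->
  y t @[t --> +oo] --> p -> y t @[t --> -oo] --> m -> exists B, forall t, `|y t| <= B.
Proof.
move=> cy cp cm.
have [A [_ hA]] := (cvgrPdist_le _ _).1 cp _ ltr01.
have [A' [_ hA']] := (cvgrPdist_le _ _).1 cm _ ltr01.
have [C [_ hC]] := continuous_itv_bounded (A' - 1) (A + 1) cy.
exists (Num.max (C + 1) (Num.max (`|p| + 1) (`|m| + 1))) => t; rewrite !le_max.
have tri (u v : R) : `|v - u| <= 1 -> `|u| <= `|v| + 1.
  by move=> h; have := ler_normB v (v - u); rewrite (_ : v - (v - u) = u); [lra|ring].
have [h|h] := ltP A t; first by rewrite (tri _ _ (hA _ h)) !orbT.
have [h'|h'] := ltP t A'; first by rewrite (tri _ _ (hA' _ h')) !orbT.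
apply/orP; left; apply: (hC (C + 1)); first by lra.
by rewrite /= in_itv/=; lra.
Qed.

(** The squared distance changes at a relative rate of at most [2 * L], so with the weight
    [expR (- (2 * L) * s)] it does not increase forwards from [s0], and with [expR (2 * L * s)] it
    does not increase backwards. *)
Lemma gronwall_zero (y z phi : R -> R) (L s0 : R) :
  (forall t : R, is_derive t (1 : R) y (phi (y t))) ->
  (forall t : R, is_derive t (1 : R) z (phi (z t))) ->
  (forall t, `|phi (y t) - phi (z t)| <= L * `|y t - z t|) -> y s0 = z s0 -> y =1 z.
Proof.
move=> dy dz lip e0 t.
pose F (c s : R) := (y s - z s) * (y s - z s) * expR (c * s).
pose f (c s : R) := expR (c * s) * (2 * (y s - z s) * (phi (y s) - phi (z s)) + c * ((y s - z s) * (y s - z s))).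
have dF c (s : R) : is_derive s (1 : R) (F c) (f c s).
  have d1 := is_deriveB (dy s) (dz s).
  have d2 := is_deriveM d1 d1.
  have d3 : is_derive s (1 : R) (cst c * @id R) c.
    by apply: is_derive_eq (is_deriveM (is_derive_cst c s (1 : R)) (is_derive_id s (1 : R))) _; rewrite /GRing.scale/=; ring.
  have d4 := is_derive1_comp (is_derive_expR (c * s)) d3.
  have d5 := is_deriveM d2 d4.
  apply: is_derive_eq d5 _.
  change ((y s - z s) * (y s - z s) * (expR (c * s) * c) + expR (c * s) *
    ((y s - z s) * (phi (y s) - phi (z s)) + (y s - z s) * (phi (y s) - phi (z s))) = f c s).
  by rewrite /f; ring.
have MV c u v : u < v -> exists2 x, u <= x <= v & F c v - F c u = f c x * (v - u).
  move=> uv; have cFw : {within `[u, v], continuous (F c)}.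
    by apply: continuous_subspaceT; exact: is_derive_continuous (dF c).
  by have [x xuv ->] := MVT_segment (ltW uv) (fun x _ => dF c x) cFw; exists x.
have key s : `|2 * (y s - z s) * (phi (y s) - phi (z s))| <= 2 * L * ((y s - z s) * (y s - z s)).
  rewrite !normrM (ger0_norm (ler0n R 2)) -mulrA -[leRHS]mulrA ler_wpM2l//.
  have := lip s; have -> : (y s - z s) * (y s - z s) = `|y s - z s| * `|y s - z s|.
    by rewrite -normrM ger0_norm// -expr2 sqr_ge0.
  by move=> h; have := ler_wpM2l (normr_ge0 (y s - z s)) h; rewrite mulrCA.
have F0 c : F c s0 = 0 by rewrite /F e0 subrr !mul0r.
have done c : F c t <= 0 -> y t = z t.
  rewrite /F pmulr_lle0 ?expR_gt0// -expr2 => h; apply/eqP; rewrite -subr_eq0 -sqrf_eq0.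
  by rewrite eq_le h sqr_ge0.
have [h|h|<-//] := ltgtP s0 t.
- apply: (done (- (2 * L))); have [x _ e] := MV (- (2 * L)) _ _ h; rewrite F0 subr0 in e.
  rewrite e pmulr_lle0 ?subr_gt0// pmulr_rle0 ?expR_gt0//.
  by have := ler_norm (2 * (y x - z x) * (phi (y x) - phi (z x))); have := key x; lra.
- apply: (done (2 * L)); have [x _ e] := MV (2 * L) _ _ h; rewrite F0 sub0r in e.
  rewrite -oppr_ge0 e pmulr_lge0 ?subr_gt0// pmulr_rge0 ?expR_gt0//.
  by have := ler_norm (- (2 * (y x - z x) * (phi (y x) - phi (z x)))); rewrite normrN; have := key x; lra.
Qed.

Lemma attains_between (y : R -> R) (m p c : R) : continuous y ->
  y t @[t --> +oo] --> p -> y t @[t --> -oo] --> m -> (m < c < p \/ p < c < m) -> exists t, y t = c.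
Proof.
move=> cy cp cm hc.
have near_p e : 0 < e -> exists2 A, True & forall t, A < t -> `|p - y t| <= e.
  by move=> e0; have [A [_ hA]] := (cvgrPdist_le _ _).1 cp _ e0; exists A.
have near_m e : 0 < e -> exists2 A, True & forall t, t < A -> `|m - y t| <= e.
  by move=> e0; have [A [_ hA]] := (cvgrPdist_le _ _).1 cm _ e0; exists A.
suff [s1 [s2 [s12 hs]]] : exists s1 s2, s1 <= s2 /\ Num.min (y s1) (y s2) <= c <= Num.max (y s1) (y s2).
  by have [t _ e] := IVT s12 (continuous_subspaceT cy) hs; exists t.
have e1 : 0 < `|p - c| / 2 by rewrite divr_gt0// normr_gt0 subr_eq0; case: hc => /andP[h1 h2]; [rewrite gt_eqF|rewrite lt_eqF].
have e2 : 0 < `|c - m| / 2 by rewrite divr_gt0// normr_gt0 subr_eq0; case: hc => /andP[h1 h2]; [rewrite gt_eqF|rewrite lt_eqF].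
have [A _ hA] := near_p _ e1; have [A' _ hA'] := near_m _ e2.
exists (Num.min A A' - 1), (Num.max A A' + 1).
have a1 : Num.min A A' <= A' by rewrite ge_min lexx orbT.
have a2 : Num.min A A' <= A by rewrite ge_min lexx.
have a3 : A <= Num.max A A' by rewrite le_max lexx.
split; first by lra.
have := hA' (Num.min A A' - 1) ltac:(clear -a1; lra); have := hA (Num.max A A' + 1) ltac:(clear -a3; lra).
move: (y _) (y _) => u v; rewrite ge_min le_max !ler_norml.
case: hc => /andP[c1 c2].
- rewrite (gtr0_norm (x := p - c)) ?(gtr0_norm (x := c - m)); [|lra..].
  by move=> /andP[h1 h2] /andP[h3 h4]; apply/andP; split; apply/orP; [left|right]; lra.
- rewrite (ltr0_norm (x := p - c)) ?(ltr0_norm (x := c - m)); [|lra..].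
  by move=> /andP[h1 h2] /andP[h3 h4]; apply/andP; split; apply/orP; [right|left]; lra.
Qed.

(** Both solutions take the value midway between the limits, and a translation makes them meet
    there. [phi] is only locally Lipschitz, but the two solutions stay in a bounded interval, on
    which its derivative is bounded. *)
Lemma heteroclinic_unique (phi dphi y z : R -> R) (m p : R) : m != p ->
  (forall s : R, is_derive s (1 : R) phi (dphi s)) -> continuous dphi ->
  (forall t : R, is_derive t (1 : R) y (phi (y t))) ->
  (forall t : R, is_derive t (1 : R) z (phi (z t))) ->
  y t @[t --> +oo] --> p -> y t @[t --> -oo] --> m ->
  z t @[t --> +oo] --> p -> z t @[t --> -oo] --> m ->
  exists c, forall t, y t = z (t + c).
Proof.
move=> mp dphi' cd dy dz yp ym zp zm.
have cy := is_derive_continuous dy; have cz := is_derive_continuous dz.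
have hc : m < (m + p) / 2 < p \/ p < (m + p) / 2 < m.
  by move: mp; rewrite neq_lt => /orP[] h; [left|right]; apply/andP; split; lra.
have [s1 e1] := attains_between cy yp ym hc; have [s2 e2] := attains_between cz zp zm hc.
pose c := s2 - s1; exists c.
have [By hBy] := bounded_of_limits cy yp ym; have [Bz hBz] := bounded_of_limits cz zp zm.
pose B := Num.max By Bz.
have [C [_ hC]] := continuous_itv_bounded (- B) B cd.
have hC' s : - B <= s <= B -> - (C + 1) <= dphi s <= C + 1.
  move=> hs; rewrite -ler_norml; apply: (hC (C + 1)); first by lra.
  by rewrite /= in_itv.
have lip u v : `|u| <= B -> `|v| <= B -> u <= v -> `|phi v - phi u| <= (C + 1) * `|v - u|.
  rewrite !ler_norml => /andP[u1 u2] /andP[v1 v2] uv.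
  have := @is_derive_le _ phi dphi (- (C + 1)) (C + 1) u v dphi' uv => H.
  have {}H := H (fun x hx => hC' x ltac:(move: hx => /andP[]; lra)).
  by rewrite ger0_norm ?subr_ge0// -mulNr.
apply: (@gronwall_zero y (fun t => z (t + c)) phi (C + 1) s1) => //.
- move=> t; have d1 : is_derive t (1 : R) (fun t : R => t + c) 1.
    by have := is_deriveD (is_derive_id t (1 : R)) (is_derive_cst c t (1 : R)); rewrite addr0.
  by have := @is_derive1_comp R z (fun t => t + c) t _ _ (dz (t + c)) d1; rewrite mulr1.
- move=> t; have b1 : `|y t| <= B by rewrite /B le_max hBy.
  have b2 : `|z (t + c)| <= B by rewrite /B le_max hBz orbT.
  have [h|/ltW h] := leP (y t) (z (t + c)); last exact: lip.
  by rewrite distrC [`|y t - _|]distrC; exact: lip.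
- by rewrite /c addrC subrK e1 e2.
Qed.

(* The segment is run through with speed [Num.max psi d], in finite time. *)
Lemma competitor (W : R * R -> R) (psi Psi : R -> R) (a um up d : R) :
  continuous W -> (forall z, 0 <= W z) -> um != up -> W (a, um) = 0 -> W (a, up) = 0 ->
  continuous psi -> (forall s : R, is_derive s (1 : R) Psi (psi s)) ->
  (forall s, 0 <= s <= 1 -> 0 <= psi s /\ W (a, um + s * (up - um)) <= psi s ^+ 2 / 2) -> 0 < d ->
  exists gam dgam, admissible1 a (a, um) (a, up) gam dgam /\
    (energy1 W gam dgam <= (`|up - um| * (Psi 1 - Psi 0 + d))%:E)%E.
Proof.
move=> cW W0 neq Wm Wp cpsi dPsi hpsi d0.
set c := `|up - um|; have c0 : 0 < c by rewrite normr_gt0 subr_eq0 eq_sym.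
(* [h] is the speed of the parameter in [[0, 1]], so the curve itself moves at speed [c * h].
   Clamping the parameter keeps [h] bounded on all of the line, as the flow requires. *)
pose h s := Num.max (psi (tcl 0 1 s)) d / c.
have ctcl (t0 t1 : R) : continuous (tcl t0 t1).
  move=> x; apply: (@continuous_max _ _ (cst t0) (fun x => Num.min t1 x)); first exact: cvg_cst.
  by apply: (@continuous_min _ _ (cst t1) id); [exact: cvg_cst|exact: cvg_id].
have ch : continuous h.
  move=> x; apply: cvgM; last exact: cvg_cst.
  apply: (@continuous_max _ _ (psi \o tcl 0 1) (cst d)); last exact: cvg_cst.
  by apply: continuous_comp1; [exact: ctcl|exact: cpsi].
have [C [_ hC]] := continuous_itv_bounded 0 1 cpsi.
have hb s : d / c <= h s <= Num.max (C + 1) d / c.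
  rewrite !ler_pM2r ?invr_gt0// le_max lexx orbT/= ge_max !le_max lexx orbT andbT.
  apply/orP; left; have : `|psi (tcl 0 1 s)| <= C + 1.
    by apply: (hC (C + 1)); [lra|rewrite /= in_itv/= tcl_in].
  exact: le_trans (ler_norm _).
have dc0 : 0 < d / c by rewrite divr_gt0.
have [th [t0 [t1 [dth t01 e0 e1]]]] := autonomous_flow ch dc0 hb.
have cth := is_derive_continuous dth.
have chth : continuous (fun t => h (th t)) by exact: continuous_comp1.
have mono u v : u <= v -> th u <= th v.
  move=> uv; have /andP[H _] := is_derive_le (k := 0) (l := Num.max (C + 1) d / c) dth uv
    (fun x _ => ltac:(have /andP[h1 h2] := hb (th x); apply/andP; split => //; lra)).
  by move: H; rewrite mul0r subr_ge0.
have th01 t : t0 <= t <= t1 -> 0 <= th t <= 1.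
  by move=> /andP[h1 h2]; rewrite -e0 -e1 !mono.
pose y t := um + (up - um) * th (tcl t0 t1 t).
pose k t := (up - um) * (h (th t) * chi t0 t1 t).
have py : prim y k.
  have := primD (prim_cst um) (primZ (up - um) (prim_tcl t01 (prim_is_derive dth chth))).
  by apply: prim_ext => t //; rewrite /k add0r.
have cy := prim_continuous py.
have mchi : measurable_fun setT (chi t0 t1).
  by apply: measurable_fun_ifT => //; apply: measurable_and; apply: measurable_fun_ler.
have mk : measurable_fun setT k.
  apply: measurable_funM => //; apply: measurable_funM => //; exact: continuous_measurable_fun.
pose gam t := (a, y t); pose dgam t : R * R := (0, k t).
have cgam : continuous gam.
  by move=> t; apply: (@cvg_pair _ _ _ _ (nbhs a) (nbhs (y t))); [exact: cvg_cst|exact: cy].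
have cWg : continuous (fun t => W (gam t)).
  by move=> t; apply: (@continuous_comp R (R * R)%type R gam W); [exact: cgam|exact: cW].
pose F t := sq2 (dgam t) / 2 + W (gam t).
have sq0 t : 0 <= sq2 (dgam t) by exact: sq2_ge0.
have ms : measurable_fun setT (fun t => sq2 (dgam t)).
  by apply: measurable_funD => //; exact: measurable_funX.
have mF : measurable_fun setT F.
  by apply: measurable_funD; [exact: measurable_funM|exact: continuous_measurable_fun].
(* With [m] the floored speed, [m ^+ 2 / 2 + psi ^+ 2 / 2 <= (psi + d) * m], and the right side is
   [K]. As an exact derivative along [th] it integrates to a value that does not depend on the
   duration. *)
pose K t := c * (psi (th t) + d) * h (th t).
have cpth : continuous (fun t => c * (psi (th t) + d)).
  move=> t; apply: cvgM; first exact: cvg_cst.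
  by apply: cvgD; [apply: (continuous_comp1 cth cpsi)|exact: cvg_cst].
have cK : continuous K by move=> t; apply: cvgM; [exact: cpth|exact: chth].
have F0 t : 0 <= F t by rewrite addr_ge0// divr_ge0.
have FK t : t0 <= t <= t1 -> F t <= K t.
  move=> ht; have h01 := th01 _ ht; have [p0 hW] := hpsi _ h01.
  have eF : F t = ((up - um) * h (th t)) ^+ 2 / 2 + W (a, um + th t * (up - um)).
    by rewrite /F /sq2 /dgam /gam /k /y /= tcl_id// /chi ht mulr1 expr0n/= add0r [th t * _]mulrC.
  rewrite eF; apply: le_trans (_ : ((up - um) * h (th t)) ^+ 2 / 2 + psi (th t) ^+ 2 / 2 <= _); first by rewrite lerD2l.
  rewrite exprMn -[(up - um) ^+ 2]real_normK ?num_real// -/c /K /h (tcl_id h01).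
  set m := Num.max _ _; have m1 : psi (th t) <= m by rewrite le_max lexx.
  have m2 : d <= m by rewrite le_max lexx orbT.
  have m3 : m <= psi (th t) + d by rewrite ge_max; lra.
  have -> : c ^+ 2 * (m / c) ^+ 2 = m ^+ 2 by field; rewrite gt_eqF.
  have -> : c * (psi (th t) + d) * (m / c) = (psi (th t) + d) * m by field; rewrite gt_eqF.
  move: (psi (th t)) p0 m1 m3 => p p0 m1 m3; nra.
have Fz t : ~~ (t0 <= t <= t1) -> F t = 0.
  move=> ht; rewrite /F /sq2 /dgam /gam /k /= /chi (negbTE ht) !mulr0 expr0n/= addr0 mul0r add0r.
  move: ht; rewrite negb_and -!ltNge => /orP[] h'; rewrite /y.
    by rewrite tcl_le ?(ltW h')// e0 mulr0 addr0.
  by rewrite tcl_ge ?(ltW h')// e1 mulr1 addrC subrK.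
have iK : \int[mu]_(t in `[t0, t1]) K t = c * (Psi 1 - Psi 0 + d).
  have dP (s : R) : is_derive s (1 : R) (fun s => c * (Psi s + d * s)) (c * (psi s + d)).
    have d1 := is_deriveM (is_derive_cst d s (1 : R)) (is_derive_id s (1 : R)).
    have d2 := is_deriveM (is_derive_cst c s (1 : R)) (is_deriveD (dPsi s) d1).
    apply: is_derive_eq d2 _.
    change (c * (psi s + (d * 1 + s * 0)) + (Psi s + d * s) * 0 = c * (psi s + d)); ring.
  have cP : continuous (fun s => c * (psi s + d)).
    by move=> s; apply: cvgM; [exact: cvg_cst|apply: cvgD; [exact: cpsi|exact: cvg_cst]].
  have [_ <-] := prim_comp (prim_is_derive dth chth) dP cP t01.
  by rewrite e0 e1; ring.
exists gam, dgam; split; last by rewrite -iK; exact: integral_supported_le.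
split; last split.
- split; [exact: cgam|split => //; split; [|split]].
  + exact: prim_weak_deriv1 (prim_cst a).
  + exact: prim_weak_deriv1 py.
  + have cK2 : continuous (fun t => 2 * K t) by move=> t; apply: cvgM; [exact: cvg_cst|exact: cK].
    apply: le_lt_trans (integral_supported_le t01 ms cK2 sq0 _ _) _; last exact: ltry.
    * by move=> t /FK; have := W0 (gam t); rewrite /F; lra.
    * by move=> t /Fz; have := W0 (gam t); have := sq0 t; rewrite /F; lra.
- apply: cvg_near_cst; exists t1; split => //= t h1.
  by rewrite /gam /y tcl_ge ?(ltW h1)// e1 mulr1 addrC subrK.
- apply: cvg_near_cst; exists t0; split => //= t h1.
  by rewrite /gam /y tcl_le ?(ltW h1)// e0 mulr0 addr0.
Qed.

Lemma derive_scale (w : R * R -> R) (sg : R) : C2 w -> forall s, (size s <= 2)%N ->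
  Dseq s (fun z => sg * w z) = (fun z => sg * Dseq s w z).
Proof.
move=> [dw _]; elim => [//|v s IH] hs; apply/funext => x /=.
rewrite IH; last exact: ltnW hs.
by have := @deriveZ _ _ _ (Dseq s w) sg x v (dw s v x hs).
Qed.

Lemma C2_scale (w : R * R -> R) (sg : R) : C2 w -> C2 (fun z => sg * w z).
Proof.
move=> C2w; split.
  move=> s v x hs; rewrite derive_scale//; last exact: leq_trans hs _.
  exact: derivableZ (C2w.1 s v x hs).
by move=> s hs; rewrite derive_scale// => x; apply: cvgM; [exact: cvg_cst|exact: C2w.2].
Qed.

Lemma wave_scale (w : R * R -> R) (sg : R) : C2 w ->
  (forall x, 'D_(@e1 R) ('D_(@e1 R) w) x = 'D_(@e2 R) ('D_(@e2 R) w) x) ->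
  forall x, 'D_(@e1 R) ('D_(@e1 R) (fun z => sg * w z)) x = 'D_(@e2 R) ('D_(@e2 R) (fun z => sg * w z)) x.
Proof.
move=> C2w wave x; have h v := congr1 (fun F => F x) (derive_scale sg C2w (s := [:: v; v]) erefl).
exact: etrans (h (@e1 R)) (etrans (congr1 (fun r => sg * r) (wave x)) (esym (h (@e2 R)))).
Qed.

Lemma C2_derive_section (w : R * R -> R) (a : R) : C2 w -> exists dphi : R -> R,
  continuous dphi /\ forall s : R, is_derive s (1 : R) (fun s => w (a, s)) (dphi s).
Proof.
move=> C2w; exists (fun s => 'D_(@e2 R) w (a, s)); split.
  move=> s; apply: (@continuous_comp R (R * R)%type R (fun s => (a, s)) ('D_(@e2 R) w)).
    by apply: (@cvg_pair _ _ _ _ (nbhs a) (nbhs s)); [exact: cvg_cst|exact: cvg_id].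
  exact: (C2w.2 [:: @e2 R]).
move=> s; have H x : is_derive x (@e2 R) w ('D_(@e2 R) w x).
  by apply/derivableP; exact: (C2w.1 [::]).
have := is_derive_line (a, 0) s H.
have E (t : R) : t *: @e2 R + (a, 0) = (a, t) 
  by change ((t * 0 + a, t * 1 + 0) = (a, t)); rewrite mulr0 mulr1 add0r addr0.
by rewrite E; congr (is_derive _ _ _ _); apply/funext => t; rewrite E.
Qed.

Lemma ext_tail_small (w : R * R -> R) (a : R) (um up : R * R) (gam dgam : R -> R * R) : C2 w ->
  (forall x, 'D_(@e1 R) ('D_(@e1 R) w) x = 'D_(@e2 R) ('D_(@e2 R) w) x) ->
  admissible1 a um up gam dgam ->
  tail_small w (fun x => (gam x.1).1) (fun x => (gam x.1).2).
Proof.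
move=> C2w wave [[cg _] [p m]]; have [c1 c2] := continuous_fst_comp cg.
have p1 : (gam t).1 @[t --> +oo] --> up.1 by apply: (cvg_comp _ _ p); exact: cvg_fst.
have m1 : (gam t).1 @[t --> -oo] --> um.1 by apply: (cvg_comp _ _ m); exact: cvg_fst.
have p2 : (gam t).2 @[t --> +oo] --> up.2 by apply: (cvg_comp _ _ p); exact: cvg_snd.
have m2 : (gam t).2 @[t --> -oo] --> um.2 by apply: (cvg_comp _ _ m); exact: cvg_snd.
have [B1 h1] := bounded_of_limits c1 p1 m1; have [B2 h2] := bounded_of_limits c2 p2 m2.
have mc (k : R -> R) : continuous k -> measurable_fun setT (fun x : R * R => k x.1).
  by move=> ck; apply: (measurableT_comp (continuous_measurable_fun ck)); exact: measurable_fst.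
apply: (@tail_small_bounded _ w _ _ (B1 + B2) C2w wave (mc _ c1) (mc _ c2)).
apply: aeT => x; have := h1 x.1; have := h2 x.1 => k2 k1; split.
  by apply: le_trans (ler_normD _ _) _; exact: lerD.
by apply: le_trans (ler_normB _ _) _; exact: lerD.
Qed.

Lemma bounded_tail_small (w : R * R -> R) (u : R * R -> R * R) (M : R) : C2 w ->
  (forall x, 'D_(@e1 R) ('D_(@e1 R) w) x = 'D_(@e2 R) ('D_(@e2 R) w) x) ->
  measurable_fun setT (fun x => (u x).1) -> measurable_fun setT (fun x => (u x).2) ->
  {ae mu2, forall x, sq2 (u x) <= M} -> tail_small w (fun x => (u x).1) (fun x => (u x).2).
Proof.
move=> C2w wave m1 m2 hM.
have sq (x : R) : `|x| <= (1 + x ^+ 2) / 2.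
  by have := sqr_ge0 (`|x| - 1); rewrite sqrrB real_normK ?num_real// mulr1 expr1n; lra.
apply: (@tail_small_bounded _ w _ _ ((1 + 2 * M) / 2) C2w wave m1 m2).
apply: aeS hM => x; rewrite /sq2; move: (u x).1 (u x).2 => p q h.
have := sqr_ge0 (p - q); have := sqr_ge0 (p + q); rewrite sqrrD sqrrB => k1 k2.
by split; apply: le_trans (sq _) _; rewrite ?sqrrD ?sqrrB; lra.
Qed.

Lemma growth_tail_small (W w : R * R -> R) (u du1 du2 : R * R -> R * R) (um up : R * R) (C beta : R) :
  continuous W -> (forall z, 0 <= W z) -> C2 w ->
  (forall x, 'D_(@e1 R) ('D_(@e1 R) w) x = 'D_(@e2 R) ('D_(@e2 R) w) x) ->
  (forall z, w z ^+ 2 / 2 <= W z) -> 0 < beta ->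
  (forall z, `|w z| <= C * expR (beta * sq2 z)) ->
  admissible um up u du1 du2 -> (energy W u du1 du2 < +oo)%E ->
  tail_small w (fun x => (u x).1) (fun x => (u x).2).
Proof.
move=> cW W0 C2w wave wW b0 gr [Hu bu] fin.
have mQ : measurable Q := measurable_Q measurableT.
have [iW _] := energy_real cW W0 Hu fin.
have [U [V [U' [V' [S S']]]]] := Hdiv_strips Hu.
have [tf tg] := bc_tends bu.
have mw : measurable_fun setT (fun x => w ((u x).1, (u x).2)).
  by apply: measurable_pair_comp; [exact: C2_continuous|exact: strip_mf S|exact: strip_mf S'].
apply: (tail_small_growth C2w wave b0 gr S S' tf tg).
apply: (@le_integrableR _ _ _ mu2 _ _ (fun x => 2 * W ((u x).1, (u x).2))) => //.
- by apply: measurable_funTS; exact: measurable_funX.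
- move=> x _; rewrite ger0_norm ?sqr_ge0// ger0_norm ?mulr_ge0//.
  by have := wW ((u x).1, (u x).2); lra.
- exact: (@integrableZR _ _ _ mu2 _ mQ 2 _ iW).
Qed.

Lemma ode_curve_admissible (W w : R * R -> R) (a um up : R) (Y : R -> R) :
  continuous W -> continuous w -> (forall z, w z ^+ 2 / 2 <= W z) ->
  (forall t : R, is_derive t (1 : R) Y (w (a, Y t))) ->
  Y t @[t --> +oo] --> up -> Y t @[t --> -oo] --> um ->
  (energy1 W (fun t => (a, Y t)) (fun t => (0%R, w (a, Y t))) < +oo)%E ->
  admissible1 a (a, um) (a, up) (fun t => (a, Y t)) (fun t => (0, w (a, Y t))).
Proof.
move=> cW cw wW dY Yp Ym fin.
have cY := is_derive_continuous dY.
have cg : continuous (fun t => (a, Y t)).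
  by move=> t; apply: (@cvg_pair _ _ _ _ (nbhs a) (nbhs (Y t))); [exact: cvg_cst|exact: cY].
have cwY : continuous (fun t => w (a, Y t)).
  by move=> t; apply: (@continuous_comp R (R * R)%type R (fun t => (a, Y t)) w); [exact: cg|exact: cw].
have cWY : continuous (fun t => W (a, Y t)).
  by move=> t; apply: (@continuous_comp R (R * R)%type R (fun t => (a, Y t)) W); [exact: cg|exact: cW].
have ms : measurable_fun setT (fun t => sq2 (0, w (a, Y t))).
  by rewrite /sq2/=; apply: measurable_funD => //; apply: measurable_funX; exact: continuous_measurable_fun.
have lim (F : set_system R) (p : R) : Filter F -> Y t @[t --> F] --> p -> (a, Y t) @[t --> F] --> (a, p).
  by move=> FF h; apply: (@cvg_pair _ _ _ _ (nbhs a) (nbhs p)); [exact: cvg_cst|exact: h].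
split; last by split; [exact: lim|exact: lim].
split => //; split => //; split; first exact: prim_weak_deriv1 (prim_cst a).
split; first exact: prim_weak_deriv1 (prim_is_derive dY cwY).
apply: le_lt_trans fin; apply: ge0_le_integral => //.
- by move=> t _; rewrite lee_fin sq2_ge0.
- exact/measurable_EFinP.
- apply/measurable_EFinP; apply: measurable_funD; last exact: continuous_measurable_fun.
  exact: measurable_funM.
- move=> t _; rewrite lee_fin /sq2/= expr0n/= add0r.
  by have := wW (a, Y t); lra.
Qed.

(** Minimality compares [u] with the extension of a competitor that runs through the segment with
    excess [e]. The sign [sg] orients the integral of [w] from [um] to [up], which makes it
    positive. *)
Lemma energy_le_wint (W w : R * R -> R) (a um up sg : R) (u du1 du2 : R * R -> R * R) :
  continuous W -> (forall z, 0 <= W z) -> um != up -> W (a, um) = 0 -> W (a, up) = 0 -> continuous w ->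
  (forall z, w z ^+ 2 / 2 <= W z) -> sg * (up - um) = `|up - um| ->
  (forall t : R, 0 < t < 1 ->
     W (a, (1 - t) * um + t * up) = w (a, (1 - t) * um + t * up) ^+ 2 / 2 /\
     0 < w (a, (1 - t) * um + t * up)) ->
  global_min W (a, um) (a, up) u du1 du2 ->
  (energy W u du1 du2 <= (wint (fun z => (sg * w z)%R) a um up)%:E)%E.
Proof.
move=> cW W0 neq Wm Wp cw wW sgE seg gm; apply/lee_addgt0Pr => e e0.
set c := `|up - um|; have c0 : 0 < c by rewrite normr_gt0 subr_eq0 eq_sym.
pose line s := um + s * (up - um).
have dline (s : R) : is_derive s (1 : R) line (up - um).
  have d1 := is_deriveM (is_derive_id s (1 : R)) (is_derive_cst (up - um) s (1 : R)).
  apply: is_derive_eq (is_deriveD (is_derive_cst um s (1 : R)) d1) _.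
  by change (0 + (s * 0 + (up - um) * 1) = up - um); ring.
have cs : continuous (fun s => w (a, s)).
  move=> s; apply: (@continuous_comp R (R * R)%type R (fun s => (a, s)) w); last exact: cw.
  by apply: (@cvg_pair _ _ _ _ (nbhs a) (nbhs s)); [exact: cvg_cst|exact: cvg_id].
have cs' : continuous (fun s => sg * w (a, s)) by move=> s; apply: cvgM; [exact: cvg_cst|exact: cs].
pose psi s := w (a, line s).
have cpsi : continuous psi by exact: (continuous_comp1 (is_derive_continuous dline) cs).
(* [line] has velocity [up - um] and [sg * (up - um) = c]; the factor [c^-1] makes [psi] the
   derivative of [Psi], and the length [c] in the competitor bound restores [wint]. *)
pose Psi s := c^-1 * sint (fun s => sg * w (a, s)) (line s).
have dPsi (s : R) : is_derive s (1 : R) Psi (psi s).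
  have d1 := is_derive1_comp (continuous_antiderivative cs' (line s)) (dline s).
  apply: is_derive_eq (is_deriveM (is_derive_cst c^-1 s (1 : R)) d1) _.
  change (c^-1 * (sg * w (a, line s) * (up - um)) + sint (fun s => sg * w (a, s)) (line s) * 0 = psi s).
  by rewrite mulr0 addr0 mulrAC sgE -/c mulrA mulVf ?gt_eqF// mul1r.
(* The segment hypothesis covers the open segment only; at its ends [w] vanishes because
   [w ^+ 2 / 2 <= W = 0]. *)
have w0 s : W (a, s) = 0 -> w (a, s) = 0.
  move=> h; have := wW (a, s); rewrite h => h'; apply/eqP; rewrite -sqrf_eq0.
  by rewrite eq_le sqr_ge0 andbT; lra.
have hpsi s : 0 <= s <= 1 -> 0 <= psi s /\ W (a, um + s * (up - um)) <= psi s ^+ 2 / 2.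
  move=> /andP[s0 s1]; rewrite /psi /line.
  have [->|sn0] := eqVneq s 0; first by rewrite mul0r addr0 Wm w0// expr0n/= mul0r.
  have [->|sn1] := eqVneq s 1.
    by rewrite mul1r addrC subrK Wp w0// expr0n/= mul0r.
  have [] := seg s; first by rewrite lt_neqAle eq_sym sn0 s0 lt_neqAle sn1.
  have -> : (1 - s) * um + s * up = um + s * (up - um) by ring.
  by move=> -> h; split => //; exact: ltW.
(* The excess in the competitor bound is [c] times the floor on the speed, so the floor [e / c]
   costs exactly [e]. *)
have ec0 : 0 < e / c by rewrite divr_gt0.
have [gam [dgam [adm le]]] := competitor cW W0 neq Wm Wp cpsi dPsi hpsi ec0.
have := gm.2 _ _ _ (ext_admissible adm).
have [[cg [_ [w1 [w2 _]]]] _] := adm.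
rewrite ext_energy// => h; apply: le_trans h (le_trans le _).
rewrite -EFinD lee_fin /Psi /line mul0r mul1r addr0 [um + _]addrC subrK /wint -/c.
set A := sint _ up; set B := sint _ um.
by rewrite (_ : c * _ = A - B + e)//; field; rewrite gt_eqF.
Qed.

End profiles.

Theorem theorem4p21 (R : realType) (W w : R * R -> R) (a um2 up2 : R)
    (u du1 du2 : R * R -> R * R) :
  continuous W -> (forall z, 0 <= W z) ->
  um2 != up2 -> W (a, um2) = 0 -> W (a, up2) = 0 ->
  C2 w -> (forall x, 'D_(@e1 R) ('D_(@e1 R) w) x = 'D_(@e2 R) ('D_(@e2 R) w) x) ->
  (forall z, w z ^+ 2 / 2 <= W z) ->
  (forall t : R, 0 < t < 1 ->
     W (a, (1 - t) * um2 + t * up2) = w (a, (1 - t) * um2 + t * up2) ^+ 2 / 2 /\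
     0 < w (a, (1 - t) * um2 + t * up2)) ->
  global_min W (a, um2) (a, up2) u du1 du2 ->
  ((exists M : R, {ae @mu2 R, forall x, sq2 (u x) <= M}) \/
   (exists C beta : R, 0 < C /\ 0 < beta /\
      forall z, `|w z| <= C * expR (beta * sq2 z))) ->
  exists g dg : R -> R * R,
    min1 W a (a, um2) (a, up2) g dg /\
    (forall gam dgam, min1 W a (a, um2) (a, up2) gam dgam ->
       exists tau : R, forall t, gam t = g (t + tau)) /\
    {ae @mu2 R, forall x, u x = g x.1}.
Proof.
move=> cW W0 neq Wm Wp C2w wave wW seg gm hyp.
(* [sg] orients the segment: the profile solves Y' = sg w(a, Y). *)
pose sg : R := if um2 < up2 then 1 else -1.
have sgsq : sg ^+ 2 = 1 by rewrite /sg; case: ifP => _; rewrite ?sqrrN expr1n.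
have sgE : sg * (up2 - um2) = `|up2 - um2|.
  rewrite /sg; case: ltP => h; first by rewrite mul1r ger0_norm// subr_ge0 ltW.
  by rewrite mulN1r ler0_norm// subr_le0.
pose v z := sg * w z.
have C2v : C2 v := C2_scale sg C2w.
have wavev := wave_scale sg C2w wave : forall x, 'D_(@e1 R) ('D_(@e1 R) v) x = 'D_(@e2 R) ('D_(@e2 R) v) x.
have vW z : v z ^+ 2 / 2 <= W z by rewrite /v exprMn sgsq mul1r.
have cv := C2_continuous C2v.
have Em := energy_le_wint cW W0 neq Wm Wp (C2_continuous C2w) wW sgE seg gm.
have fin : (energy W u du1 du2 < +oo)%E by apply: le_lt_trans Em _; exact: ltry.
have tail : tail_small v (fun x => (u x).1) (fun x => (u x).2).
  case: hyp => [[M hM]|[C [beta [C0 [b0 gr]]]]].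
    have [U [V [U' [V' [S S']]]]] := Hdiv_strips gm.1.1.
    exact: bounded_tail_small C2v wavev (strip_mf S) (strip_mf S') hM.
  apply: growth_tail_small cW W0 C2v wavev vW b0 _ gm.1 fin => z.
  rewrite /v normrM; suff -> : `|sg| = 1 by rewrite mul1r; exact: gr.
  by rewrite /sg; case: ifP => _; rewrite ?normrN normr1.
have [Y [dY uY Yp Ym eE]] := rigidity cW W0 C2v wavev vW gm.1 tail Em.
pose g t := (a, Y t); pose dg t : R * R := (0, v (a, Y t)).
have adm : admissible1 a (a, um2) (a, up2) g dg.
  by apply: (ode_curve_admissible cW cv vW dY Yp Ym); rewrite -eE.
have min_g gam dgam : admissible1 a (a, um2) (a, up2) gam dgam ->
    (energy1 W g dg <= energy1 W gam dgam)%E.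
  move=> h; rewrite -eE; have [[cg [_ [w1 [w2 _]]]] _] := h.
  by rewrite -(ext_energy cW W0 cg w1 w2); exact: gm.2 _ _ _ (ext_admissible h).
exists g, dg; split; [by split|split => //] => gam dgam [hg mg].
have [[cg [ga [w1 [w2 _]]]] [gp gmm]] := hg.
have le : (energy W (fun x => gam x.1) (fun x => dgam x.1) (fun=> (0%R, 0%R)) <= (wint v a um2 up2)%:E)%E.
  by rewrite (ext_energy cW W0 cg w1 w2); apply: le_trans (mg _ _ adm) _; rewrite -eE.
have [Z [dZ eZ Zp Zm _]] := rigidity cW W0 C2v wavev vW (ext_admissible hg) (ext_tail_small C2v wavev hg) le.
(* The equality on the strip holds almost everywhere; on one horizontal line, continuity of both
   curves makes it hold at all times. *)
have gZ t : gam t = (a, Z t).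
  have [y _ hy] := ae_exists_I (ae_slices2 eZ).
  have [c1 c2] := continuous_fst_comp cg.
  rewrite [gam t]surjective_pairing ga; congr pair.
  apply: (continuous_ae_eq c2 (is_derive_continuous dZ)).
  by apply: aeS hy => s /= ->.
have [dphi [cd dphi']] := C2_derive_section a C2v.
have [c hc] := heteroclinic_unique neq dphi' cd dZ dY Zp Zm Yp Ym.
by exists c => t; rewrite gZ hc.
Qed.
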